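(* Let $N\ge 3$, let $k\ge1$ be an integer, and let $V\in C^1(\mathbb{R}^N,\mathbb{R})$ satisfy the following two conditions. $(V_1)$ $V\in L^\infty(\mathbb{R}^N)$ and $0<\inf_{\mathbb{R}^N}V\le \sup_{\mathbb{R}^N}V<\infty$. $(V_2)$ There are $k$ distinct points $\xi_1,\dots,\xi_k\in\mathbb{R}^N$ such that, for every $j=1,\dots,k$, $\nabla V(\xi_j)=0$ and the Hessian matrix of $V$ at $\xi_j$ (assumed to exist) has nonzero determinant. If $u_\varepsilon^{(1)}$ and $u_\varepsilon^{(2)}$ are two families of positive solutions of $$-\varepsilon^2\Delta u+V(x)u=u\log u^2,\qquad u>0,\qquad\text{in }\mathbb{R}^N,$$ both being $k$-peak solutions concentrated at $\xi_1,\dots,\xi_k$, then $u_\varepsilon^{(1)}\equiv u_\varepsilon^{(2)}$ for all sufficiently small $\varepsilon>0$.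
   Context: Solution: $u\in H^1(\mathbb{R}^N)$ is a (weak) solution if $\varepsilon^2\int_{\mathbb{R}^N}\nabla u\cdot\nabla\psi+\int_{\mathbb{R}^N}V(x)u\psi=\int_{\mathbb{R}^N}u\psi\log u^2$ for all $\psi\in H^1(\mathbb{R}^N)$; solutions are required to be positive. $k$-peak solution: a family of solutions $u_\varepsilon\in H^1(\mathbb{R}^N)$ (indexed by small $\varepsilon>0$) is called a $k$-peak solution concentrated at $\xi_1,\dots,\xi_k$ if (i) $u_\varepsilon$ has $k$ local maximum points $y_{\varepsilon,j}\in\mathbb{R}^N$, $j=1,\dots,k$, with $y_{\varepsilon,j}\to\xi_j$ as $\varepsilon\to0$; (ii) for any given $\tau>0$ there exists $R\gg1$ such that $|u_\varepsilon(x)|\le\tau$ for $x\in\mathbb{R}^N\setminus\bigcup_{j=1}^kB_{R\varepsilon}(y_{\varepsilon,j})$; (iii) there exists $C>0$ (independent of $\varepsilon$) such that $\int_{\mathbb{R}^N}(\varepsilon^2|\nabla u_\varepsilon|^2+u_\varepsilon^2)\le C\varepsilon^N$. *)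

(* Defs.v *)
From HB Require Import structures.
From mathcomp Require Import all_boot all_order all_algebra.
From mathcomp Require Import all_classical all_reals all_analysis.

Set Implicit Arguments.
Unset Strict Implicit.
Unset Printing Implicit Defensive.

Import Order.TTheory GRing.Theory Num.Theory.
Import numFieldNormedType.Exports.

Local Open Scope classical_set_scope.
Local Open Scope ring_scope.

Definition measure_row_display : measure_display -> measure_display.
Proof. exact. Qed.

Section measurable_row.
Context {R : realType} {n : nat}.

Let coors : 'I_n -> 'rV[R]_n -> measurableTypeR R := fun i x => x ord0 i.

Let row_set0 : g_sigma_preimage coors set0.
Proof. exact: sigma_algebra0. Qed.

Let row_setC A : g_sigma_preimage coors A -> g_sigma_preimage coors (~` A).
Proof. exact: sigma_algebraC. Qed.

Let row_bigcup (F : _^nat) : (forall i, g_sigma_preimage coors (F i)) ->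
  g_sigma_preimage coors (\bigcup_i (F i)).
Proof. exact: sigma_algebra_bigcup. Qed.

(* The product sigma-algebra, as the library does for tuples. As R is second
   countable, it coincides with the Borel sigma-algebra of 'rV[R]_n. *)
HB.instance Definition _ :=
  @isMeasurable.Build (measure_row_display default_measure_display)
    'rV[R]_n (g_sigma_preimage coors) row_set0 row_setC row_bigcup.

Lemma measurable_row_coord (i : 'I_n) :
  measurable_fun setT (fun x : 'rV[R]_n => x ord0 i : measurableTypeR R).
Proof.
move=> _ Y mY; rewrite setTI; apply: sub_sigma_algebra => /=.
rewrite -bigcup_seq/=; exists i => /=; first by rewrite mem_index_enum.
by exists Y => //; rewrite setTI.
Qed.

Lemma measurable_fun_rowP d (T : measurableType d) (f : T -> 'rV[R]_n) :
  measurable_fun setT f <->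
  forall i, measurable_fun setT (fun t => f t ord0 i : measurableTypeR R).
Proof.
split=> [mf i|mf].
  exact: (measurableT_comp (measurable_row_coord i) mf).
move=> _ A mA; rewrite setTI.
pose G : set (set 'rV[R]_n) := [set B | measurable (f @^-1` B)].
suff : measurable `<=` G by exact.
apply: smallest_sub.
  split=> [|B GB|F GF].
  - by rewrite /G/= preimage_set0; exact: measurable0.
  - by rewrite /G/= setTD preimage_setC; exact: measurableC.
  - by rewrite /G/= preimage_bigcup; exact: bigcupT_measurable.
rewrite -bigcup_seq => B [i _ [Y mY <-]]; rewrite /G/= setTI.
by have := mf i measurableT Y mY; rewrite setTI.
Qed.

End measurable_row.

Section row_cons.
Context {R : realType} {n : nat}.

Definition row_cons (p : measurableTypeR R * 'rV[R]_n) : 'rV[R]_n.+1 :=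
  row_mx (p.1%:M : 'rV[R]_1) p.2.

Definition row_uncons (x : 'rV[R]_n.+1) : measurableTypeR R * 'rV[R]_n :=
  (x ord0 ord0, \row_j x ord0 (lift ord0 j)).

Lemma row_cons0 p : row_cons p ord0 ord0 = p.1.
Proof.
rewrite /row_cons mxE; case: splitP => [j _|j]; first by rewrite mxE !ord1 eqxx.
by [].
Qed.

Lemma row_consS p (j : 'I_n) : row_cons p ord0 (lift ord0 j) = p.2 ord0 j.
Proof.
rewrite /row_cons mxE; case: splitP => [k|k] /=; first by rewrite ord1.
by rewrite /bump/= !add1n => -[jk]; congr (p.2 _ _); exact/val_inj.
Qed.

Lemma row_consK : cancel row_cons row_uncons.
Proof.
move=> [a x]; rewrite /row_uncons row_cons0; congr (_, _).
by apply/rowP => j; rewrite mxE row_consS.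
Qed.

Lemma row_unconsK : cancel row_uncons row_cons.
Proof.
move=> x; apply/rowP => i; case: (unliftP ord0 i) => [j ->|->].
  by rewrite row_consS mxE.
by rewrite row_cons0.
Qed.

Lemma measurable_row_cons : measurable_fun setT row_cons.
Proof.
apply/measurable_fun_rowP => i; case: (unliftP ord0 i) => [j ->|->].
  under eq_fun do rewrite row_consS.
  exact: (measurableT_comp (measurable_row_coord j) measurable_snd).
under eq_fun do rewrite row_cons0.
exact: measurable_fst.
Qed.

Lemma measurable_row_uncons : measurable_fun setT row_uncons.
Proof.
apply: measurable_fun_pair; first exact: measurable_row_coord.
apply/measurable_fun_rowP => i; under eq_fun do rewrite mxE.
exact: measurable_row_coord.
Qed.

End row_cons.

Section lebesgue_row_step.
Context {R : realType} {n : nat}.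
Variable mu : {sigma_finite_measure set 'rV[R]_n -> \bar R}.

Definition lebesgue_row_step : set 'rV[R]_n.+1 -> \bar R :=
  pushforward (@lebesgue_measure R \x mu)%E row_cons.

Let step0 : lebesgue_row_step set0 = 0%E.
Proof. by rewrite /lebesgue_row_step /pushforward preimage_set0 measure0. Qed.

Let step_ge0 A : (0 <= lebesgue_row_step A)%E.
Proof. by rewrite /lebesgue_row_step /pushforward; exact: measure_ge0. Qed.

Let step_sigma_additive : semi_sigma_additive lebesgue_row_step.
Proof. apply: measure_semi_sigma_additive; exact: measurable_row_cons. Qed.

HB.instance Definition _ := isMeasure.Build _ _ _ lebesgue_row_step
  step0 step_ge0 step_sigma_additive.

Lemma lebesgue_row_stepE (A : set (measurableTypeR R)) (B : set 'rV[R]_n) :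
  measurable A -> measurable B ->
  lebesgue_row_step (row_uncons @^-1` (A `*` B)) = (lebesgue_measure A * mu B)%E.
Proof.
move=> mA mB; rewrite -product_measure1E// /lebesgue_row_step /pushforward.
rewrite -comp_preimage (_ : _ \o _ = id) ?preimage_id//.
by apply/funext/row_consK.
Qed.

(* The library proves this for products too, but its instance on [\x] of
   sigma-finite measures is shadowed by the one on subprobabilities. *)
Let step_sigma_finite : sigma_finite setT lebesgue_row_step.
Proof.
have /sigma_finiteP[F [TF ndF Foo]] := sigma_finiteT (@lebesgue_measure R).
have /sigma_finiteP[G [TG ndG Goo]] := sigma_finiteT mu.
exists (fun i => row_uncons @^-1` (F i `*` G i)).
  rewrite -preimage_bigcup (_ : \bigcup_i _ = setT) ?preimage_setT//.
  apply/seteqP; split=> // -[x y] _.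
  have [a _ Fx] : (\bigcup_i F i) x by rewrite -TF.
  have [b _ Gy] : (\bigcup_i G i) y by rewrite -TG.
  exists (maxn a b) => //; split=> /=.
    by move: x Fx; exact/subsetPset/ndF/leq_maxl.
  by move: y Gy; exact/subsetPset/ndG/leq_maxr.
move=> i; have [mF Fi] := Foo i; have [mG Gi] := Goo i; split.
  rewrite -[X in measurable X]setTI; apply: measurable_row_uncons => //.
  exact: measurableX.
by rewrite lebesgue_row_stepE// lte_mul_pinfty// ge0_fin_numE.
Qed.

HB.instance Definition _ := Measure_isSigmaFinite.Build _ _ _
  lebesgue_row_step step_sigma_finite.

End lebesgue_row_step.

Fixpoint lebesgue_row (R : realType) (n : nat) :
    {sigma_finite_measure set 'rV[R]_n -> \bar R} :=
  match n with
  | 0 => \d_(0 : 'rV[R]_0)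
  | n'.+1 => lebesgue_row_step (lebesgue_row R n')
  end.

Lemma lebesgue_row_box (R : realType) (n : nat) (A : 'I_n -> set R) :
  (forall i, measurable (A i : set (measurableTypeR R))) ->
  lebesgue_row R n [set x | forall i, A i (x ord0 i)] =
  (\prod_(i < n) lebesgue_measure (A i))%E.
Proof.
elim: n A => [|n IH] A mA.
  by rewrite big_ord0/= diracE mem_set// => -[].
pose B := [set x : 'rV[R]_n | forall i, A (lift ord0 i) (x ord0 i)].
have mB : measurable B.
  have -> : B = \bigcap_(i in [set: 'I_n])
      ((fun x : 'rV[R]_n => x ord0 i : measurableTypeR R) @^-1` A (lift ord0 i)).
    by apply/seteqP; split=> [x Bx i _|x Bx i]; exact: Bx.
  apply: fin_bigcap_measurable => // i _.
  by rewrite -[X in measurable X]setTI; exact: measurable_row_coord.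
rewrite big_ord_recl -IH// -lebesgue_row_stepE//=; congr lebesgue_row_step.
apply/seteqP; split=> [x Ax|x [Ax Bx] i] /=.
  by split=> [|i]; rewrite /= ?mxE; exact: Ax.
by case: (unliftP ord0 i) => [j ->|-> //]; have := Bx j; rewrite mxE.
Qed.

Section calculus.
Context {R : realType} {N : nat}.
Implicit Types (f : 'rV[R]_N -> R) (x y : 'rV[R]_N).

(* The library norm on 'rV[R]_N is the sup norm, hence [enorm]. *)
Definition dot x y : R := \sum_i x ord0 i * y ord0 i.

Definition enorm x : R := Num.sqrt (dot x x).

Definition partial (i : 'I_N) f x : R := 'D_(delta_mx ord0 i) f x.

Definition grad f x : 'rV[R]_N := \row_i partial i f x.

(* All partial derivatives of order at most m exist everywhere and are
   continuous. *)
Fixpoint class_C (m : nat) f : Prop :=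
  continuous f /\
  if m is m'.+1 then
    forall i, (forall x, derivable f x (delta_mx ord0 i)) /\
              class_C m' (partial i f)
  else True.

Definition hessian f x : 'M[R]_N := jacobian (grad f) x.

Definition local_max f y : Prop := \forall z \near y, f z <= f y.

Definition test_function f : Prop :=
  (forall m, class_C m f) /\ compact (closure [set x | f x != 0]).

End calculus.

Section sobolev.
Context {R : realType} {N : nat}.
Implicit Types (u v : 'rV[R]_N -> R) (g : 'rV[R]_N -> 'rV[R]_N).

Local Notation mu := (lebesgue_row R N).

Definition is_weak_gradient u g : Prop := forall i : 'I_N,
  (fun x => g x ord0 i) \in Lfun mu 2%:E /\
  forall phi, test_function phi ->
    \int[mu]_x (u x * partial i phi x) = - \int[mu]_x (g x ord0 i * phi x).

Definition H1 u : Prop :=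
  u \in Lfun mu 2%:E /\ exists g, is_weak_gradient u g.

(* Weak gradients are unique up to null sets; this picks one of them. *)
Definition weak_gradient u : 'rV[R]_N -> 'rV[R]_N :=
  xget (cst 0) [set g | is_weak_gradient u g].

End sobolev.

Section logarithmic_equation.
Context {R : realType} {N : nat}.
Implicit Types (V u : 'rV[R]_N -> R) (eps : R).

Local Notation mu := (lebesgue_row R N).

(* For u in H^1 the integrand on the right need not be integrable: that the
   right-hand side makes sense is part of the definition, as [Rintegral] is
   total. The other integrals converge when V is bounded. *)
Definition weak_solution V eps u : Prop :=
  H1 u /\
  forall psi, H1 psi ->
    mu.-integrable setT (EFin \o (fun x => u x * psi x * ln (u x ^+ 2))) /\
    eps ^+ 2 * \int[mu]_x dot (weak_gradient u x) (weak_gradient psi x)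
      + \int[mu]_x (V x * u x * psi x)
    = \int[mu]_x (u x * psi x * ln (u x ^+ 2)).

(* A weak solution is an a.e. class with a continuous representative, by
   elliptic regularity; pointwise notions (positivity, local maxima, uniform
   bounds, identity of solutions) refer to that representative. *)
Definition positive_solution V eps u : Prop :=
  [/\ continuous u, forall x, 0 < u x & weak_solution V eps u].

Definition peak_solution V (k : nat) (xi : 'I_k -> 'rV[R]_N)
    (u : R -> 'rV[R]_N -> R) : Prop :=
  exists2 eps0 : R, 0 < eps0 &
  [/\ forall eps, 0 < eps < eps0 -> positive_solution V eps (u eps),
      exists y : 'I_k -> R -> 'rV[R]_N,
        [/\ forall j eps, 0 < eps < eps0 -> local_max (u eps) (y j eps),
            forall j, y j eps @[eps --> 0^'+] --> xi j &
            forall tau : R, 0 < tau -> exists2 r : R, 1 < r &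
              forall eps (x : 'rV[R]_N), 0 < eps < eps0 ->
                (forall j, r * eps <= enorm (x - y j eps)) ->
                `|u eps x| <= tau] &
      exists2 C : R, 0 < C &
        forall eps, 0 < eps < eps0 ->
          \int[mu]_x (eps ^+ 2 * enorm (weak_gradient (u eps) x) ^+ 2
                      + u eps x ^+ 2) <= C * eps ^+ N].

Definition cond_V1 V : Prop :=
  [/\ V \in Lfun mu +oo%E,
      (0 < ereal_inf (range (EFin \o V)))%E,
      (ereal_inf (range (EFin \o V)) <= ereal_sup (range (EFin \o V)))%E &
      (ereal_sup (range (EFin \o V)) < +oo)%E].

(* The Hessian exists at xi_j in the sense that the gradient is differentiable
   there, not merely that the second-order partial derivatives exist. *)
Definition cond_V2 V (k : nat) (xi : 'I_k -> 'rV[R]_N) : Prop :=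
  injective xi /\
  forall j, [/\ grad V (xi j) = 0,
                differentiable (grad V) (xi j) &
                \det (hessian V (xi j)) != 0].

End logarithmic_equation.

(* Main.v *)
(** Idea. If the two families differed for arbitrarily small parameters, fix an
ultrafilter of such parameters: bounded quantities converge along it. Near a
peak the rescaled solutions converge to exp ((V(xi) + N - |x|^2) / 2), up to
translation the only positive solution of the limit equation that vanishes at
infinity; a local Pohozaev identity and the nondegeneracy of the Hessian force
the peaks to lie within o(eps) of the concentration points. Let S be the
maximum of |u1 - u2|. Far from the peaks both solutions are below e^-2, where
s |-> (V - ln s^2) s is strictly increasing, so by the maximum principle S is
attained within O(eps) of some peak. There (u1 - u2) / S, rescaled, converges
to a nonzero solution of the linearised equation, that is
(b . x) exp (- |x|^2 / 2) with b <> 0. Applying the Pohozaev identity to the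
difference of the two solutions shows that the integral of
(b . x)^2 exp (- |x|^2) vanishes, a contradiction.

Regularity is elementary: testing the equation against the translates and
dilates of one radial bump yields mean value inequalities, hence the maximum
principle, Lipschitz and C^2 regularity, and stability under locally uniform
limits. *)

Require Import Defs.
From mathcomp Require Import all_boot all_order all_algebra.
From mathcomp Require Import all_classical all_reals all_analysis.
From mathcomp Require Import ring lra measurable_realfun.

Import Order.TTheory GRing.Theory Num.Theory.
Import numFieldNormedType.Exports.

Local Open Scope classical_set_scope.
Local Open Scope ring_scope.

Set Implicit Arguments.
Unset Strict Implicit.
Unset Printing Implicit Defensive.

(* [lra] reifies the whole context, which is slow in long proofs. *)
Ltac keep_comparisons := repeat match goal with H : ?P |- _ =>
  lazymatch type of P with Prop =>
    lazymatch P with is_true _ => fail | _ = _ => fail | _ => clear H end end end.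
Ltac clra := keep_comparisons; lra.
Ltac cnra := keep_comparisons; nra.

(** The obstacle is the logarithm: the nonlinearity is not Lipschitz at 0, and the linearised
    potential $V-\ln u^2-2$ is unbounded, since $u$ vanishes at infinity. Two pointwise bounds with
    constants independent of $\varepsilon$ control it: a Gaussian from below makes $\ln u^2$ grow at
    most quadratically, and an exponential from above absorbs such polynomials. The exponential
    bound holds only up to distance $c/\varepsilon$ from a peak in rescaled variables, since other
    peaks lie beyond; hence every integral identity carries a cutoff at scale $\rho/\varepsilon$.
    The rescaled potential has gradient of order $\varepsilon^2$ near a critical point of $V$, so
    the Pohozaev identity is divided by $\varepsilon^2$ and its cutoff error must be smaller; it is
    made $O(\varepsilon^4)$. Second-order information on $V$ is available at the points $\xi_j$
    only. Both families are therefore finally rescaled about $\xi_j$ itself, not about their own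
    maxima: they then solve the same equation, and the expansion of the gradient of $V$ applies to
    their difference. *)

Lemma normrv_leP (R : realType) (n : nat) (x : 'rV[R]_n) (c : R) : 0 <= c ->
  `|x| <= c <-> (forall i, `|x ord0 i| <= c).
Proof.
move=> c0; rewrite [`|x|]/Num.norm/= mx_normrE; split.
  by move=> /bigmax_leP[_ h] i; exact: (h (ord0, i)).
by move=> h; apply/bigmax_leP; split=> // -[i j] _ /=; rewrite ord1.
Qed.

Lemma normrv_ltP (R : realType) (n : nat) (x : 'rV[R]_n) (c : R) : 0 < c ->
  `|x| < c <-> (forall i, `|x ord0 i| < c).
Proof.
move=> c0; rewrite [`|x|]/Num.norm/= mx_normrE; split.
  by move=> /bigmax_ltP[_ h] i; exact: (h (ord0, i)).
by move=> h; apply/bigmax_ltP; split=> // -[i j] _ /=; rewrite ord1.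
Qed.

Lemma coord_le_norm (R : realType) (n : nat) (x : 'rV[R]_n) i :
  `|x ord0 i| <= `|x|.
Proof. by apply: (normrv_leP _ _).1. Qed.

(** * Lebesgue measure and integration on row vectors *)

Section row_measure.
Context {R : realType} {n : nat}.
Implicit Types (A : 'I_n -> set (measurableTypeR R)).

Definition row_box A : set 'rV[R]_n := [set x | forall i, A i (x ord0 i)].

Lemma measurable_row_box A : (forall i, measurable (A i)) ->
  measurable (row_box A).
Proof.
move=> mA.
have -> : row_box A = \bigcap_(i in [set: 'I_n])
    ((fun x : 'rV[R]_n => x ord0 i : measurableTypeR R) @^-1` A i).
  by apply/seteqP; split=> [x Bx i _|x Bx i]; exact: Bx.
apply: fin_bigcap_measurable => // i _.
by rewrite -[X in measurable X]setTI; exact: measurable_row_coord.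
Qed.

Definition row_boxes : set (set 'rV[R]_n) :=
  [set B | exists2 A, (forall i, measurable (A i)) & B = row_box A].

Lemma measurable_row_boxes : @measurable _ 'rV[R]_n = <<s row_boxes >>.
Proof.
apply/seteqP; split; last first.
  apply: smallest_sub; first exact: sigma_algebra_measurable.
  by move=> _ [A mA ->]; exact: measurable_row_box.
apply: smallest_sub; first exact: smallest_sigma_algebra.
rewrite -bigcup_seq => B [i _ [Y mY <-]]; rewrite setTI.
apply: sub_sigma_algebra.
exists (fun j => if j == i then Y else setT).
  by move=> j; case: ifP => // _; exact: measurableT.
apply/seteqP; split=> [x Yx j|x /(_ i)]; last by rewrite eqxx.
by case: eqP => // ->.
Qed.

Lemma setI_closed_row_boxes : setI_closed row_boxes.
Proof.
move=> _ _ [A mA ->] [B mB ->]; exists (fun i => A i `&` B i).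
  by move=> i; exact: measurableI.
apply/seteqP; split=> [x [Ax Bx] i|x ABx]; first by split.
by split=> i; have [] := ABx i.
Qed.

Definition cube (k : R) : set 'rV[R]_n := [set x | `|x| <= k].

Lemma cubeE (k : R) : 0 <= k -> cube k = row_box (fun=> `[- k, k]%classic).
Proof.
move=> k0; apply/seteqP; split=> x /=.
  by move=> /(normrv_leP _ k0) h i; rewrite /= in_itv/= -ler_norml.
by move=> h; apply/(normrv_leP _ k0) => i; have := h i;
   rewrite /= in_itv/= -ler_norml.
Qed.

Lemma measurable_cube (k : R) : measurable (cube k).
Proof.
have [k0|k0] := leP 0 k; first by rewrite cubeE//; apply: measurable_row_box.
rewrite (_ : cube k = set0)//; apply/seteqP; split => // x /= h.
by have := le_lt_trans (le_trans (normr_ge0 _) h) k0; rewrite ltxx.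
Qed.

Lemma bigcup_cube : \bigcup_(k : nat) cube k%:R = setT.
Proof.
apply/seteqP; split=> // x _; exists (Num.truncn `|x|).+1 => //.
by rewrite /cube/= ltW// truncnS_gt.
Qed.

Lemma row_measure_unique (m1 m2 : {measure set 'rV[R]_n -> \bar R}) :
  (forall A, (forall i, measurable (A i)) ->
     m1 (row_box A) = m2 (row_box A)) ->
  (forall k : nat, (m1 (cube k%:R) < +oo)%E) ->
  forall B, measurable B -> m1 B = m2 B.
Proof.
move=> m12 m1oo; apply: (measure_unique row_boxes (fun k : nat => cube k%:R)) => //.
- exact: measurable_row_boxes.
- exact: setI_closed_row_boxes.
- move=> k; exists (fun=> `[- k%:R, k%:R]%classic) => //; exact: cubeE.
- exact: bigcup_cube.
- by move=> _ [A mA ->]; exact: m12.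
Qed.

End row_measure.

Section lebesgue_row_theory.
Context {R : realType} {n : nat}.
Local Notation mu := (lebesgue_row R n).

Lemma lebesgue_row_cube (k : R) : 0 <= k -> mu (cube k) = ((k *+ 2) ^+ n)%:E.
Proof.
move=> k0.
have E : lebesgue_measure (`[- k, k]%classic : set R) = (k *+ 2)%:E.
  rewrite lebesgue_measure_itv/= lte_fin; case: ltP => [_|kk].
    by rewrite -EFinB opprK -mulr2n.
  have -> : k = 0; last by rewrite mul0rn.
  by apply/eqP; rewrite eq_le k0 andbT; clra.
rewrite cubeE// (lebesgue_row_box (A := fun=> `[- k, k]%classic))//.
by under eq_bigr do rewrite E; rewrite prodEFin prodr_const card_ord.
Qed.

Lemma lebesgue_row_cube_fin (k : R) : (mu (cube k) < +oo)%E.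
Proof.
have [k0|k0] := leP 0 k; first by rewrite lebesgue_row_cube// ltry.
rewrite (_ : cube k = set0) ?measure0//; apply/seteqP; split => // x /= h.
by have := le_lt_trans (le_trans (normr_ge0 _) h) k0; rewrite ltxx.
Qed.

Definition rowmap (f : 'I_n -> R -> R) (x : 'rV[R]_n) : 'rV[R]_n :=
  \row_i f i (x ord0 i).

Lemma measurable_rowmap (f : 'I_n -> R -> R) :
  (forall i, measurable_fun setT (f i : measurableTypeR R -> measurableTypeR R)) ->
  measurable_fun setT (rowmap f).
Proof.
move=> mf; apply/measurable_fun_rowP => i.
under eq_fun do rewrite mxE.
exact: (measurableT_comp (mf i) (measurable_row_coord i)).
Qed.

(** The two measures are compared on boxes, where they are products. One factor [c] per coordinate
    covers dilations followed by translations and, with [c = 1], the reflection. *)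
Lemma lebesgue_row_rowmap (f : 'I_n -> R -> R) (c : R) : 0 < c ->
  (forall i, measurable_fun setT (f i : measurableTypeR R -> measurableTypeR R)) ->
  (forall i (A : set (measurableTypeR R)), measurable A ->
    lebesgue_measure (f i @^-1` A) = (c%:E * lebesgue_measure A)%E) ->
  forall B, measurable B -> mu (rowmap f @^-1` B) = ((c ^+ n)%:E * mu B)%E.
Proof.
move=> c0 mf fE.
have mF := measurable_rowmap mf.
have c0' : 0 <= c ^+ n by rewrite exprn_ge0// ltW.
pose m1 : {measure set 'rV[R]_n -> \bar R} := mscale (NngNum c0') mu.
pose m2 : {measure set 'rV[R]_n -> \bar R} := pushforward mu (rowmap f).
move=> B mB; apply/esym; apply: (@row_measure_unique _ _ m1 (m2 mF)) => //.
- move=> A mA; rewrite /m1 /m2 /mscale/= /pushforward.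
  transitivity ((c ^+ n)%:E * mu (row_box A))%E; first by [].
  rewrite (lebesgue_row_box mA)//.
  rewrite (_ : _ @^-1` _ = [set x : 'rV[R]_n | forall i, (f i @^-1` A i) (x ord0 i)]).
    rewrite (lebesgue_row_box (A := fun i => f i @^-1` A i)); last first.
      by move=> i; rewrite -[X in measurable X]setTI; exact: mf.
    transitivity (\prod_(i < n) (c%:E * lebesgue_measure (A i)))%E; last first.
      by apply: eq_bigr => i _; exact/esym/fE.
    rewrite big_split/=; congr (_ * _)%E.
    by rewrite prodEFin prodr_const card_ord.
  by apply/seteqP; split=> x /= h i; have := h i; rewrite mxE.
- move=> k; rewrite /m1 /mscale/= lte_mul_pinfty// ?lee_fin//.
  exact: lebesgue_row_cube_fin.
Qed.

Lemma lebesgue_affine (a b : R) : 0 < a ->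
  forall A : set (measurableTypeR R), measurable A ->
  lebesgue_measure ((fun x => a * x + b) @^-1` A) = (a^-1%:E * lebesgue_measure A)%E.
Proof.
move=> a0 A mA.
have mf : measurable_fun setT
    ((fun x : R => a * x + b) : measurableTypeR R -> measurableTypeR R).
  by apply: measurable_funD => //; exact: measurable_funM.
pose m2 : {measure set (measurableTypeR R) -> \bar R} :=
  mscale (NngNum (ltW a0)) (pushforward (@lebesgue_measure R) ((fun x : R => a * x + b) : measurableTypeR R -> measurableTypeR R)).
have -> : lebesgue_measure A = m2 mf A.
  apply: lebesgue_measure_unique => //= _ [[c d]] _ <-.
  rewrite /m2 /mscale/= /pushforward.
  rewrite (_ : _ @^-1` _ = `](c - b) / a, (d - b) / a]%classic); last first.
    apply/seteqP; split=> x /=; rewrite !in_itv/=;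
    by rewrite ltr_pdivrMr// ler_pdivlMr// ltrBlDr lerBrDr mulrC.
  rewrite !lebesgue_measure_itv/= !lte_fin ltr_pM2r ?invr_gt0// ltrD2r.
  case: ifP => _; last by rewrite mule0.
  by rewrite -!EFinB -EFinM -mulrBl mulrCA divff ?gt_eqF// mulr1 opprB addrA subrK.
by rewrite /m2 /mscale/= /pushforward muleA -EFinM mulVf ?gt_eqF// mul1e.
Qed.

(* [r] is positive: reflections are treated apart. *)
Lemma lebesgue_row_affine (r : R) (b : 'rV[R]_n) : 0 < r ->
  forall B, measurable B ->
  mu ((fun x => b + r *: x) @^-1` B) = ((r^-1 ^+ n)%:E * mu B)%E.
Proof.
move=> r0 B mB.
rewrite (_ : (fun x => _) = rowmap (fun i x => r * x + b ord0 i)).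
  apply: lebesgue_row_rowmap => //; first by rewrite invr_gt0.
  - by move=> i; apply: measurable_funD => //; exact: measurable_funM.
  - by move=> i A mA; exact: lebesgue_affine.
by apply/funext => x; apply/rowP => i; rewrite !mxE addrC.
Qed.

Lemma lebesgue_rowN (B : set 'rV[R]_n) : measurable B -> mu ((fun x => - x) @^-1` B) = mu B.
Proof.
move=> mB.
rewrite (_ : (fun x => _) = rowmap (fun i x => - x)); last first.
  by apply/funext => x; apply/rowP => i; rewrite !mxE.
rewrite (lebesgue_row_rowmap (ltr01))//.
- by rewrite expr1n mul1e.
- by move=> i; exact: measurable_funN.
- by move=> i A mA; rewrite -(lebesgue_measureN mA) mul1e.
Qed.

End lebesgue_row_theory.

Section change_of_variables.
Context {R : realType} {n : nat}.
Local Notation mu := (lebesgue_row R n).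
Variables (T : 'rV[R]_n -> 'rV[R]_n) (c : R).
Hypotheses (mT : measurable_fun setT T) (c0 : 0 < c).
Hypothesis muT : forall B, measurable B -> mu (T @^-1` B) = (c%:E * mu B)%E.

Let integral_image (f : 'rV[R]_n -> \bar R) :
  (\int[pushforward mu T]_x f x = \int[mscale (NngNum (ltW c0)) mu]_x f x)%E.
Proof. by apply: eq_measure_integral => A mA _; exact: muT. Qed.

Lemma integrable_image (f : 'rV[R]_n -> R) :
  mu.-integrable setT (EFin \o f) -> mu.-integrable setT (EFin \o (f \o T)).
Proof.
move=> /integrableP[mf foo]; apply/integrableP; split.
  exact: measurableT_comp mf mT.
have mf' : measurable_fun setT (fun x => `|(f x)%:E|%E) by exact: measurableT_comp.
rewrite (_ : \int[mu]_x _ = \int[mu]_(x in T @^-1` setT) ((fun x => `|(f x)%:E|%E) \o T) x)%E//.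
rewrite -ge0_integral_pushforward// integral_image ge0_integral_mscale//.
by rewrite lte_mul_pinfty// lee_fin ltW.
Qed.

Lemma Rintegral_image (f : 'rV[R]_n -> R) :
  mu.-integrable setT (EFin \o f) ->
  \int[mu]_x f (T x) = c * \int[mu]_x f x.
Proof.
move=> fi; have fTi := integrable_image fi; rewrite /Rintegral.
have mf : measurable_fun setT (EFin \o f) by case/integrableP: fi.
rewrite -[X in _ = X * _]/(fine c%:E) -fineM//; last first.
  exact: integrable_fin_num.
congr fine; transitivity (\int[mu]_(x in T @^-1` setT) ((EFin \o f) \o T) x)%E.
  by [].
rewrite -integral_pushforward// integral_image.
have mp := measurable_funepos mf; have mn := measurable_funeneg mf.
have pos g : measurable_fun setT g -> (forall x, 0 <= g x)%E ->
    (\int[mscale (NngNum (ltW c0)) mu]_x g x = c%:E * \int[mu]_x g x)%E.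
  by move=> mg g0; rewrite ge0_integral_mscale.
pose m := mscale (NngNum (ltW c0)) mu.
transitivity (\int[m]_x (EFin \o f)^\+ x - \int[m]_x (EFin \o f)^\- x)%E.
  by rewrite [LHS]integralE.
transitivity (c%:E * (\int[mu]_x (EFin \o f)^\+ x - \int[mu]_x (EFin \o f)^\- x))%E.
  rewrite muleBr//; first by congr (_ - _)%E; exact: pos.
  apply: fin_num_adde_defl; rewrite fin_numN.
  exact: integrable_neg_fin_num.
by congr (_ * _)%E; rewrite [RHS]integralE.
Qed.

End change_of_variables.

Section continuous_row.
Context {R : realType} {n : nat}.
Local Notation mu := (lebesgue_row R n).
Implicit Types (f g : 'rV[R]_n -> R).

(** The sigma-algebra is generated by the coordinates, so an open set has to be written as a
    countable union of boxes: those with rational centre and half-width [m.+1%:R^-1] that it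
    contains, enumerated by [unpickle]. *)
Lemma open_measurable_row (U : set 'rV[R]_n) : open U -> measurable U.
Proof.
move=> oU.
pose B (p : 'rV[rat]_n * nat) : set 'rV[R]_n :=
  row_box (fun i => `]ratr (p.1 ord0 i) - p.2.+1%:R^-1,
                     ratr (p.1 ord0 i) + p.2.+1%:R^-1[%classic).
have mB p : measurable (B p) by exact: measurable_row_box.
pose F (k : nat) := if unpickle k is Some p then
  (if `[< B p `<=` U >] then B p else set0) else set0.
suff -> : U = \bigcup_k F k.
  apply: bigcupT_measurable => k; rewrite /F; case: unpickle => // p.
  by case: ifP => // _.
apply/seteqP; split=> x; last first.
  move=> [k _]; rewrite /F; case: unpickle => // p.
  by case: ifPn => // /asboolP; apply.
move=> Ux; have /nbhs_ballP[e /= e0 xeU] := open_nbhs_nbhs (conj oU Ux).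
have [m me] : exists m : nat, m.+1%:R^-1 < e / 2 :> R.
  exists (Num.truncn (e / 2)^-1); rewrite -ltf_pV2 ?posrE ?invr_gt0 ?invrK ?divr_gt0//.
  exact: truncnS_gt.
have qP (i : 'I_n) : exists q : rat,
    x ord0 i - m.+1%:R^-1 < ratr q < x ord0 i + m.+1%:R^-1.
  have [|q] := @rat_in_itvoo R (x ord0 i - m.+1%:R^-1) (x ord0 i + m.+1%:R^-1).
    by rewrite ltrD2l gtrN// invr_gt0.
  by rewrite in_itv/=; exists q.
pose q : 'rV[rat]_n := \row_i xget 0 [set q | x ord0 i - m.+1%:R^-1 < ratr q < x ord0 i + m.+1%:R^-1].
have qE i : x ord0 i - m.+1%:R^-1 < ratr (q ord0 i) < x ord0 i + m.+1%:R^-1.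
  by rewrite mxE; case: xgetP => // h; have [r] := qP i; move: (h r).
have Bx : B (q, m) x.
  by move=> i /=; rewrite in_itv/=; case/andP: (qE i) => h1 h2; rewrite ltrBlDr h2 /= -ltrBlDr.
exists (pickle (q, m)) => //; rewrite /F pickleK ifT//.
apply/asboolP => y By; apply: xeU => /=.
rewrite mx_norm_ball /ball_/=; apply/(normrv_ltP _ e0) => i; rewrite !mxE.
have /= := By i; rewrite in_itv/= => /andP[p p0].
case/andP: (qE i) => h1 h2.
move: (ratr (q ord0 i)) (m.+1%:R^-1) (x ord0 i) (y ord0 i) me h1 h2 p p0 => *.
rewrite ltr_norml; apply/andP; split; clra.
Qed.

Lemma continuous_measurable_row f : continuous f -> measurable_fun setT f.
Proof.
move=> cf; apply: (measurability _ (RGenOpens.measurableE R)).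
move=> _ [_ [a [b ->] <-]]; rewrite setTI; apply: open_measurable_row.
by move/continuousP : cf; apply; exact: interval_open.
Qed.

Lemma cube_compact (k : R) : compact (cube k : set 'rV[R]_n).
Proof.
have [k0|k0] := leP 0 k.
  rewrite cubeE//; apply: (rV_compact (A := fun=> `[- k, k]%classic)) => i.
  exact: segment_compact.
rewrite (_ : cube k = set0); first exact: compact0.
apply/seteqP; split => // x /= h.
by have := le_lt_trans (le_trans (normr_ge0 _) h) k0; rewrite ltxx.
Qed.

Lemma continuous_cube_bounded f (k : R) : continuous f ->
  exists2 M, 0 <= M & forall x, `|x| <= k -> `|f x| <= M.
Proof.
move=> cf; have /compact_bounded[M [_ Mf]] : compact (f @` cube k).
  by apply: continuous_compact; [exact: continuous_subspaceT|exact: cube_compact].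
exists (`|M| + 1); first by rewrite addr_ge0.
by move=> x xk; apply: Mf; [rewrite ltr_pwDr// ler_norm|exists x].
Qed.

Lemma integrable_cube_supported f (k C : R) : measurable_fun setT f ->
  (forall x, `|f x| <= C) -> (forall x, k < `|x| -> f x = 0) ->
  mu.-integrable setT (EFin \o f).
Proof.
move=> mf fC fk.
have <- : (EFin \o f) \_ (cube k) = EFin \o f.
  apply/funext => x; rewrite patchE; case: ifPn => //.
  by rewrite notin_setE /cube/= => /negP; rewrite -ltNge => /fk ->.
rewrite -integrable_mkcond; last exact: measurable_cube.
apply: measurable_bounded_integrable.
- exact: measurable_cube.
- exact: lebesgue_row_cube_fin.
- exact: measurable_funTS.
- by exists C; split; [exact: num_real|move=> y Cy x _ /=; exact: le_trans (ltW Cy)].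
Qed.

Lemma integrable_continuous_supported f (k : R) : continuous f ->
  (forall x, k < `|x| -> f x = 0) -> mu.-integrable setT (EFin \o f).
Proof.
move=> cf fk; have [M M0 fM] := continuous_cube_bounded k cf.
apply: (@integrable_cube_supported _ k M) => //.
  exact: continuous_measurable_row.
move=> x; have [xk|/fk ->] := leP `|x| k; [exact: fM|by rewrite normr0].
Qed.

End continuous_row.

Section affine_integral.
Context {R : realType} {n : nat}.
Local Notation mu := (lebesgue_row R n).
Implicit Types (f g : 'rV[R]_n -> R).

Lemma Rintegral_affine f (r : R) (b : 'rV[R]_n) : 0 < r ->
  mu.-integrable setT (EFin \o f) ->
  mu.-integrable setT (EFin \o (fun x => f (b + r *: x))) /\
  \int[mu]_x f (b + r *: x) = r^-1 ^+ n * \int[mu]_x f x.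
Proof.
move=> r0 fi.
have cT : measurable_fun setT (fun x : 'rV[R]_n => b + r *: x).
  apply/measurable_fun_rowP => i; under eq_fun do rewrite !mxE.
  apply: measurable_funD => //; apply: measurable_funM => //.
  exact: measurable_row_coord.
have r0' : 0 < r^-1 ^+ n by rewrite exprn_gt0// invr_gt0.
split; first exact: (integrable_image cT r0' (lebesgue_row_affine b r0) fi).
exact: (Rintegral_image cT r0' (lebesgue_row_affine b r0) fi).
Qed.

Lemma Rintegral_shift f (b : 'rV[R]_n) :
  mu.-integrable setT (EFin \o f) ->
  mu.-integrable setT (EFin \o (fun x => f (b + x))) /\
  \int[mu]_x f (b + x) = \int[mu]_x f x.
Proof.
move=> fi; have := Rintegral_affine b ltr01 fi.
by under eq_fun do rewrite scale1r; rewrite invr1 expr1n mul1r.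
Qed.

Lemma RintegralN_arg f : mu.-integrable setT (EFin \o f) ->
  \int[mu]_x f (- x) = \int[mu]_x f x.
Proof.
move=> fi; rewrite (@Rintegral_image _ _ (fun x => - x) 1) ?mul1r//.
  apply/measurable_fun_rowP => i; under eq_fun do rewrite !mxE.
  by apply: measurable_funN; exact: measurable_row_coord.
by move=> B mB; rewrite mul1e; exact: lebesgue_rowN.
Qed.

End affine_integral.

(** * Differential calculus, smooth functions and integration by parts *)

Lemma cvg_is_derive (R : numFieldType) (V W : normedModType R) (f : V -> W)
    (a v : V) (d : W) :
  h^-1 *: (f (h *: v + a) - f a) @[h --> 0^'] --> d -> is_derive a v f d.
Proof. by move=> fd; apply: DeriveDef; [exact: cvgP fd|exact: cvg_lim fd]. Qed.

Lemma is_derive_cvg (R : numFieldType) (V W : normedModType R) (f : V -> W)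
    (a v : V) (d : W) :
  is_derive a v f d -> h^-1 *: (f (h *: v + a) - f a) @[h --> 0^'] --> d.
Proof. by case=> df <-; exact: df. Qed.

Lemma is_derive_line (R : numFieldType) (V W : normedModType R) (f : V -> W)
    (a v : V) (t : R) (d : W) :
  is_derive (a + t *: v) v f d <-> is_derive t 1 (fun s => f (a + s *: v)) d.
Proof.
have E : (fun h : R => h^-1 *: (f (h *: v + (a + t *: v)) - f (a + t *: v))) =
    (fun h : R => h^-1 *: (f (a + (h *: (1 : R) + t) *: v) - f (a + t *: v))).
  by apply/funext => h; rewrite scalerDl [h *: (1 : R)]mulr1 addrCA.
by split=> /is_derive_cvg fd; apply: cvg_is_derive; move: fd; rewrite E.
Qed.

Lemma is_derive_comp_dir (R : realType) (V : normedModType R) (f : R -> R)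
    (g : V -> R) (x v : V) (df dg : R) :
  is_derive (g x) 1 f df -> is_derive x v g dg ->
  is_derive x v (fun y => f (g y)) (df * dg).
Proof.
move=> fd gd.
have g0 : is_derive (0 : R) 1 (fun s : R => g (x + s *: v)) dg.
  by apply/is_derive_line; rewrite scale0r addr0.
have := @is_derive1_comp _ f (fun s : R => g (x + s *: v)) 0 df dg.
rewrite scale0r addr0 => /(_ fd g0) h.
by have := (is_derive_line (fun y => f (g y)) x v 0 (df * dg)).2 h; rewrite scale0r addr0.
Qed.

Lemma is_derive_mul (R : realType) (V : normedModType R) (f g : V -> R)
    (x v : V) (df dg : R) : is_derive x v f df -> is_derive x v g dg ->
  is_derive x v (fun y => f y * g y) (df * g x + f x * dg).
Proof.
move=> fd gd; apply: (@is_derive_eq _ _ _ (f * g)).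
by rewrite addrC [df * _]mulrC.
Qed.

Lemma is_derive_add (R : realType) (V : normedModType R) (f g : V -> R)
    (x v : V) (df dg : R) : is_derive x v f df -> is_derive x v g dg ->
  is_derive x v (fun y => f y + g y) (df + dg).
Proof. by move=> fd gd; exact: is_deriveD. Qed.

Lemma is_derive_sub (R : realType) (V : normedModType R) (f g : V -> R)
    (x v : V) (df dg : R) : is_derive x v f df -> is_derive x v g dg ->
  is_derive x v (fun y => f y - g y) (df - dg).
Proof. by move=> fd gd; exact: is_deriveB. Qed.

Lemma is_derive_expn (R : realType) (V : normedModType R) (f : V -> R) (n : nat)
    (x v : V) (df : R) : is_derive x v f df ->
  is_derive x v (fun y => f y ^+ n) (n%:R * f x ^+ n.-1 * df).
Proof.
move=> fd; elim: n => [|n IH]; first by rewrite !mul0r; exact: is_derive_cst.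
rewrite (_ : (fun y => _) = (fun y => f y * f y ^+ n)); last first.
  by apply/funext => y; rewrite exprS.
apply: (is_derive_eq (is_derive_mul fd IH)) => /=.
by case: n {IH} => [|n] /=; rewrite ?expr0 -?[in X in _ = X]natr1 ?exprS; ring.
Qed.

Lemma near_gt0 (R : realType) (t : R) : 0 < t -> \forall s \near t, 0 < s.
Proof. by move=> t0; exists t => //= s; rewrite /= ltr_norml => /andP[]; clra. Qed.

Section flat_exponential.
Context {R : realType}.
Implicit Types (p : {poly R}) (t : R).

(** Coefficient by coefficient, from $y^i \le i!\,e^y$. *)
Lemma horner_le_expR p : exists2 C, 0 <= C &
  forall y, 0 <= y -> `|p.[y]| <= C * expR y.
Proof.
elim/poly_ind: p => [|p c _].
  by exists 0 => // y _; rewrite horner0 normr0 mul0r.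
suff : forall q : {poly R}, exists2 C, 0 <= C &
  forall y, 0 <= y -> `|q.[y]| <= C * expR y by apply.
move=> {p c} q.
exists (\sum_(i < size q) `|q`_i| * (i`!%:R)); first by apply: sumr_ge0 => i _; rewrite mulr_ge0.
move=> y y0; rewrite horner_coef (le_trans (ler_norm_sum _ _ _))// mulr_suml.
apply: ler_sum => i _; rewrite normrM -mulrA ler_wpM2l//.
rewrite ger0_norm ?exprn_ge0//.
case: (i : nat) => [|k]; first by rewrite expr0 fact0 mul1r (le_trans _ (expR_ge1Dx _))// lerDl.
have := expR_ge1Dxn k y0; rewrite -ler_pdivrMl ?ltr0n ?fact_gt0// => h.
by rewrite mulrC (le_trans _ h)// lerDr.
Qed.

(** The functions $p(1/t)e^{-1/t}$, extended by 0, are closed under differentiation, the polynomial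
    becoming [dflatexp p]. Smoothness of every bump below thus reduces to iterating a map on
    polynomials. *)
Definition flatexp p t : R := if 0 < t then p.[t^-1] * expR (- t^-1) else 0.

Definition dflatexp p : {poly R} := 'X^2 * (p - p^`()).

Lemma flatexp_le0 p t : t <= 0 -> flatexp p t = 0.
Proof. by move=> t0; rewrite /flatexp ltNge t0. Qed.

Lemma is_derive_flatexp p t : is_derive t 1 (flatexp p) (flatexp (dflatexp p) t).
Proof.
have [t0|t0|->] := ltgtP t 0.
- rewrite (flatexp_le0 _ (ltW t0)).
  apply: (@near_eq_is_derive _ _ _ (cst 0)).
  by near=> s; rewrite flatexp_le0// ltW//; near: s; exact: lt_nbhsl t0.
- rewrite {2}/flatexp t0.
  apply: (@near_eq_is_derive R R R (fun s => p.[s^-1] * expR (- s^-1)) (flatexp p) t 1).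
    near=> s; rewrite /flatexp ifT//; near: s; exact: near_gt0.
  have dV : is_derive t 1 (fun s : R => s^-1) (- t ^- 2).
    have := @is_deriveV R id t 1 1 (lt0r_neq0 t0) (is_derive_id _ _).
    by rewrite /= scaler1.
  have dp : is_derive t 1 (fun s : R => p.[s^-1]) (p^`().[t^-1] * (- t ^- 2)).
    exact: (is_derive_comp_dir (is_derive_poly _ _)).
  have de : is_derive t 1 (fun s : R => expR (- s^-1)) (expR (- t^-1) * (t ^- 2)).
    apply: (is_derive_comp_dir (is_derive_expR _)).
    by rewrite -[X in is_derive _ _ _ X]opprK; exact: is_deriveN.
  apply: (is_derive_eq (is_derive_mul dp de)).
  rewrite /dflatexp hornerM hornerXn hornerD hornerN exprVn.
  by ring.
- rewrite (flatexp_le0 _ (lexx 0)); apply: cvg_is_derive.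
  (* The extra factor ['X^2] improves boundedness to $|f(s)| \le C s^2$, so the difference quotient
     at 0 tends to 0. *)
  have [C C0 pC] := horner_le_expR ('X^2 * p).
  have bnd s : 0 < s -> `|flatexp p s| <= C * s ^+ 2.
    move=> s0; have := pC s^-1; rewrite invr_ge0 => /(_ (ltW s0)).
    rewrite hornerM hornerXn /flatexp s0.
    have s2 : 0 <= s^-1 ^+ 2 by rewrite exprn_ge0// invr_ge0 ltW.
    rewrite (normrM (s^-1 ^+ 2)) (ger0_norm s2) exprVn => h.
    rewrite normrM (ger0_norm (expR_ge0 _)).
    rewrite expRN ler_pdivrMr ?expR_gt0// mulrAC -ler_pdivrMr ?exprn_gt0//.
    by rewrite mulrC.
  apply/cvgr0Pnorm_le => e e0; near=> h.
  have h0 : h != 0 by near: h; exact: nbhs_dnbhs_neq.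
  rewrite [_ *: 1]mulr1 addr0 (flatexp_le0 _ (lexx 0)) subr0.
  have [hp|hn] := ltP 0 h; last by rewrite flatexp_le0// scaler0 normr0 ltW.
  rewrite normrZ normfV (gtr0_norm hp) mulrC ler_pdivrMr//.
  apply: le_trans (bnd _ hp) _; rewrite expr2 mulrA ler_wpM2r ?ltW//.
  have : `|h| < e / (C + 1) by near: h; apply: dnbhs0_lt; rewrite divr_gt0//; clra.
  by rewrite gtr0_norm// ltr_pdivlMr; [cnra|clra].
Unshelve. all: by end_near. Qed.

End flat_exponential.

Lemma continuous_add (R : realType) (T : topologicalType) (f g : T -> R) :
  continuous f -> continuous g -> continuous (fun x => f x + g x).
Proof. by move=> cf cg x; exact: (cvgD (cf x) (cg x)). Qed.

Lemma continuous_sub (R : realType) (T : topologicalType) (f g : T -> R) :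
  continuous f -> continuous g -> continuous (fun x => f x - g x).
Proof. by move=> cf cg x; exact: (cvgB (cf x) (cg x)). Qed.

Lemma continuous_mul (R : realType) (T : topologicalType) (f g : T -> R) :
  continuous f -> continuous g -> continuous (fun x => f x * g x).
Proof. by move=> cf cg x; exact: (cvgM (cf x) (cg x)). Qed.

(** The uniform bound and the common support of the derivatives provide the dominating function
    [M * \1_(cube k)]. *)
Lemma is_derive_under_Rintegral (R : realType) (N : nat)
    (F dF : R -> 'rV[R]_N -> R) (a u v k M : R) : u < a < v ->
  (forall t, u < t < v -> (lebesgue_row R N).-integrable setT (EFin \o F t)) ->
  (forall t x, u < t < v -> is_derive t 1 (F^~ x) (dF t x)) ->
  (forall t x, u < t < v -> `|dF t x| <= M) ->
  (forall t x, u < t < v -> k < `|x| -> dF t x = 0) ->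
  is_derive a 1 (fun t => \int[lebesgue_row R N]_x F t x)
    (\int[lebesgue_row R N]_x dF a x).
Proof.
move=> auv Fi Fd dM dk.
have M0 : 0 <= M by exact: le_trans (dM a 0 auv).
pose G (x : 'rV[R]_N) := M * \1_(cube k) x.
have mG : measurable_fun setT G.
  apply: measurable_funM => //; apply: measurable_indic; exact: measurable_cube.
have Gi : (lebesgue_row R N).-integrable setT (EFin \o G).
  apply: (@integrable_cube_supported _ _ _ k M) => // x.
    by rewrite /G indicE; case: (_ \in _); rewrite ?mulr1 ?mulr0 ?normr0// ger0_norm.
  by move=> xk; rewrite /G indicE memNset ?mulr0// /cube/=; apply/negP; rewrite -ltNge.
have I t : t \in `]u, v[ -> u < t < v by rewrite in_itv.
have dE t x : u < t < v -> partial1of2 F t x = dF t x.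
  by move=> tuv; rewrite /partial1of2 derive1E; have := Fd t x tuv => ?; rewrite derive_val.
have := @cvg_differentiation_under_integral R _ _ (lebesgue_row R N) F setT
  measurableT a u v _ _ _ G _ Gi _.
have -> : \int[lebesgue_row R N]_y (partial1of2 F ^~ y) a = \int[lebesgue_row R N]_x dF a x.
  by apply: eq_Rintegral => x _; exact: dE.
move=> h; apply: cvg_is_derive.
have E : (fun h : R => h^-1 *: (\int[lebesgue_row R N]_x F (h *: (1 : R) + a) x -
    \int[lebesgue_row R N]_x F a x)) = (fun h : R => h^-1 *: (\int[lebesgue_row R N]_x F (h + a) x -
    \int[lebesgue_row R N]_x F a x)).
  by apply/funext => s; rewrite [_ *: (1 : R)]mulr1.
rewrite E; apply: h.
- by rewrite /= in_itv.
- by move=> t /= /I; exact: Fi.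
- by move=> t x /= /I tuv _; case: (Fd t x tuv).
- by move=> x; rewrite /G mulr_ge0// indicE.
- move=> t x /= /I tuv _; rewrite dE// /G indicE.
  have [xk|xk] := leP `|x| k; first by rewrite mem_set// mulr1 dM.
  by rewrite dk// normr0 mulr_ge0.
Qed.

Section class_C_theory.
Context {R : realType} {N : nat}.
Implicit Types (f g : 'rV[R]_N -> R) (m : nat) (i : 'I_N).
Local Notation e_ i := (delta_mx ord0 i : 'rV[R]_N).

Lemma class_C_continuous m f : class_C m f -> continuous f.
Proof. by case: m => [|m] []. Qed.

Lemma class_C_is_derive m f i x : class_C m.+1 f ->
  is_derive x (e_ i) f (partial i f x).
Proof. by move=> [_ /(_ i)[fi _]]; apply: DeriveDef. Qed.

Lemma class_C_partial m f i : class_C m.+1 f -> class_C m (partial i f).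
Proof. by move=> [_ /(_ i)[]]. Qed.

Lemma partialE f i x d : is_derive x (e_ i) f d -> partial i f x = d.
Proof. by move=> fd; rewrite /partial derive_val. Qed.

Lemma class_CS m f (df : 'I_N -> 'rV[R]_N -> R) : continuous f ->
  (forall i x, is_derive x (e_ i) f (df i x)) ->
  (forall i, class_C m (df i)) -> class_C m.+1 f.
Proof.
move=> cf fd fm; split => // i; split=> [x|]; first by case: (fd i x).
by rewrite (_ : partial i f = df i)//; apply/funext => x; exact: partialE.
Qed.

Lemma class_CW m f : class_C m.+1 f -> class_C m f.
Proof.
elim: m f => [|m IH] f [cf fi]; first by split.
by split=> // i; have [fd /IH] := fi i.
Qed.

Lemma class_C_cst m (c : R) : class_C m (fun _ : 'rV[R]_N => c).
Proof.
elim: m c => [|m IH] c; first by split => //; exact: cst_continuous.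
apply: (@class_CS _ _ (fun _ _ => 0)) => //; first exact: cst_continuous.
Qed.

Lemma is_derive_coord i j (x : 'rV[R]_N) :
  is_derive x (e_ j) (fun y : 'rV[R]_N => y ord0 i) (j == i)%:R.
Proof.
apply: cvg_is_derive; apply: (@cvg_near_cst _ _ _ _ (0 : R)^').
near=> h; have h0 : h != 0 by near: h; exact: nbhs_dnbhs_neq.
by rewrite !mxE addrK eqxx/= eq_sym [_ *: _]mulKf.
Unshelve. all: by end_near. Qed.

Lemma class_C_coord m i : class_C m (fun y : 'rV[R]_N => y ord0 i).
Proof.
case: m => [|m]; first by split => //; exact: coord_continuous.
apply: (@class_CS _ _ (fun j _ => (j == i)%:R)).
- exact: coord_continuous.
- by move=> j x; exact: is_derive_coord.
- by move=> j; exact: class_C_cst.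
Qed.

Lemma class_C_add m f g : class_C m f -> class_C m g ->
  class_C m (fun x => f x + g x).
Proof.
elim: m f g => [|m IH] f g fm gm.
  by split=> //; apply: continuous_add; [exact: (class_C_continuous fm)|exact: (class_C_continuous gm)].
apply: (@class_CS _ _ (fun i x => partial i f x + partial i g x)).
- by apply: continuous_add; [exact: (class_C_continuous fm)|exact: (class_C_continuous gm)].
- by move=> i x; exact: (is_derive_add (class_C_is_derive i x fm) (class_C_is_derive i x gm)).
- by move=> i; apply: IH; apply: class_C_partial.
Qed.

Lemma class_C_mul m f g : class_C m f -> class_C m g ->
  class_C m (fun x => f x * g x).
Proof.
elim: m f g => [|m IH] f g fm gm.
  by split=> //; apply: continuous_mul; [exact: (class_C_continuous fm)|exact: (class_C_continuous gm)].
apply: (@class_CS _ _ (fun i x => partial i f x * g x + f x * partial i g x)).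
- by apply: continuous_mul; [exact: (class_C_continuous fm)|exact: (class_C_continuous gm)].
- by move=> i x; exact: (is_derive_mul (class_C_is_derive i x fm) (class_C_is_derive i x gm)).
- move=> i; apply: class_C_add; apply: IH => //; try exact: class_C_partial;
  exact: class_CW.
Qed.

Lemma class_C_sum m (I : Type) (s : seq I) (F : I -> 'rV[R]_N -> R) :
  (forall j : I, class_C m (F j)) -> class_C m (fun x => \sum_(j <- s) F j x).
Proof.
move=> Fm; elim: s => [|i s IH].
  rewrite (_ : (fun x => _) = fun=> 0); first exact: class_C_cst.
  by apply/funext => x; rewrite big_nil.
rewrite (_ : (fun x => _) = fun x => F i x + \sum_(j <- s) F j x).
  exact: class_C_add.
by apply/funext => x; rewrite big_cons.
Qed.

Lemma class_C_prod m (I : Type) (s : seq I) (F : I -> 'rV[R]_N -> R) :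
  (forall j : I, class_C m (F j)) -> class_C m (fun x => \prod_(j <- s) F j x).
Proof.
move=> Fm; elim: s => [|i s IH].
  rewrite (_ : (fun x => _) = fun=> 1); first exact: class_C_cst.
  by apply/funext => x; rewrite big_nil.
rewrite (_ : (fun x => _) = fun x => F i x * \prod_(j <- s) F j x).
  exact: class_C_mul.
by apply/funext => x; rewrite big_cons.
Qed.

(* [h k] is the k-th derivative of a smooth function of one variable. *)
Lemma class_C_comp m (h : nat -> R -> R) g :
  (forall k (t : R), is_derive t (1 : R) (h k) (h k.+1 t)) -> class_C m g ->
  forall k, class_C m (fun x => h k (g x)).
Proof.
move=> hd.
have ch k : continuous (h k).
  by move=> t; apply: differentiable_continuous; apply/derivable1_diffP; case: (hd k t).
elim: m g => [|m IH] g gm k.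
  split=> // x; apply: (@continuous_comp _ _ _ g (h k)); last exact: ch.
  exact: class_C_continuous gm x.
apply: (@class_CS _ _ (fun i x => h k.+1 (g x) * partial i g x)).
- move=> x; apply: (@continuous_comp _ _ _ g (h k)); last exact: ch.
  exact: class_C_continuous gm x.
- by move=> i x; exact: (is_derive_comp_dir (hd k (g x)) (class_C_is_derive i x gm)).
- move=> i; apply: class_C_mul; last exact: class_C_partial.
  by apply: IH; exact: class_CW.
Qed.

Lemma class_C_flatexp m (p : {poly R}) g : class_C m g ->
  class_C m (fun x => flatexp p (g x)).
Proof.
move=> gm; apply: (@class_C_comp _ (fun k => flatexp (iter k dflatexp p)) g _ _ 0) => //.
by move=> k t; exact: is_derive_flatexp.
Qed.

Lemma class_C_expR m g : class_C m g -> class_C m (fun x => expR (g x)).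
Proof.
by move=> gm; apply: (@class_C_comp _ (fun=> expR) g _ _ 0) => // k t; exact: is_derive_expR.
Qed.

Lemma test_functionP f (k : R) : (forall m, class_C m f) ->
  (forall x, k < `|x| -> f x = 0) -> test_function f.
Proof.
move=> fm fk; split => //.
apply: (subclosed_compact _ (@cube_compact _ _ k)); first exact: closed_closure.
have cl : closed (cube k : set 'rV[R]_N).
  by apply: compact_closed; [exact: norm_hausdorff|exact: cube_compact].
rewrite ((closure_id _).1 cl); apply: closure_subset => x /= fx.
rewrite /cube/= leNgt; apply/negP => /fk fx0.
by rewrite fx0 eqxx in fx.
Qed.

Lemma test_function_supp f : test_function f ->
  exists2 k : R, 0 < k & forall x, k < `|x| -> f x = 0.
Proof.
move=> [_ /compact_bounded[M [_ Mf]]]; exists (`|M| + 1); first by rewrite ltr_wpDl.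
move=> x xM; apply: contraTeq xM => fx0; rewrite -leNgt.
apply: Mf; first by rewrite ltr_pwDr// ler_norm.
exact: subset_closure.
Qed.

Lemma is_derive_eq0 f i x (k : R) : (forall x, k < `|x| -> f x = 0) ->
  k < `|x| -> 'D_(e_ i) f x = 0.
Proof.
move=> fk xk; have -> : 'D_(e_ i) f x = 'D_(e_ i) (cst 0) x; last exact: derive_cst.
apply: near_eq_derive; near=> y; rewrite fk//; near: y.
apply: (cvgr_gt (`|x|)) => //; exact: norm_continuous.
Unshelve. all: by end_near. Qed.

Lemma test_function_partial f i : test_function f -> test_function (partial i f).
Proof.
move=> ft; have [k k0 fk] := test_function_supp ft.
apply: (@test_functionP _ k) => [m|x xk]; first exact: (class_C_partial _ (ft.1 m.+1)).
exact: is_derive_eq0 xk.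
Qed.

(** The integral of [f] translated along a basis vector does not depend on the translation, and its
    derivative at 0 is the integral of the partial derivative. This avoids iterated integrals. *)
Lemma Rintegral_partial0 f i (k : R) : class_C 1 f ->
  (forall x, k < `|x| -> f x = 0) -> \int[lebesgue_row R N]_x partial i f x = 0.
Proof.
move=> f1 fk.
have cf := class_C_continuous f1.
have cdf := class_C_continuous (class_C_partial i f1).
have fi := integrable_continuous_supported cf fk.
have [M M0 dfM] := continuous_cube_bounded k cdf.
have dfM' x : `|partial i f x| <= M.
  have [/dfM//|xk] := leP `|x| k.
  by rewrite /partial (is_derive_eq0 _ fk)// normr0.
pose F (t : R) x := f (t *: e_ i + x).
have Fd (t : R) x : is_derive t (1 : R) (F^~ x) (partial i f (t *: e_ i + x)).
  have := class_C_is_derive i (x + t *: e_ i) f1.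
  move/is_derive_line.
  by rewrite addrC (_ : (fun s => _) = F^~ x)//; apply/funext => s; rewrite /F addrC.
have Fi (t : R) : (lebesgue_row R N).-integrable setT (EFin \o F t).
  exact: (Rintegral_shift _ fi).1.
have E1 : forall x : 'rV[R]_N, `|0 *: (e_ i) + x| = `|x| by move=> x; rewrite scale0r add0r.
(* For translations of length less than 1, all supports stay in the cube of radius [|k| + 1]. *)
have := @is_derive_under_Rintegral R N F
  (fun t x => partial i f (t *: e_ i + x)) 0 (-1) 1 (`|k| + 1) M _ (fun t _ => Fi t)
  (fun t x _ => Fd t x) (fun t x _ => dfM' _) _.
have -> : (fun t => \int[lebesgue_row R N]_x F t x) =
    cst (\int[lebesgue_row R N]_x f x).
  by apply/funext => t; exact: (Rintegral_shift _ fi).2.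
have -> : \int[lebesgue_row R N]_x partial i f (0 *: e_ i + x) =
    \int[lebesgue_row R N]_x partial i f x.
  by apply: eq_Rintegral => x _; rewrite scale0r add0r.
move=> h; have [||_ <-] := h; last exact: derive_cst.
  by rewrite ltrN10 ltr01.
move=> t x /andP[t1 t2] xk; apply: (is_derive_eq0 _ fk).
have : `|t *: e_ i| <= 1.
  rewrite normrZ -[leRHS]mulr1 ler_pM//; first by rewrite ler_norml !ltW.
  apply/(normrv_leP _ ler01) => j; rewrite mxE eqxx /=.
  by case: (j == i); rewrite ?normr1 ?normr0.
have := ler_normD (t *: e_ i + x) (- (t *: e_ i)); rewrite addrAC subrr add0r normrN.
have := ler_norm k; clra.
Qed.

Lemma Rintegral_by_parts f g i (k : R) : class_C 1 f -> class_C 1 g ->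
  (forall x, k < `|x| -> g x = 0) ->
  \int[lebesgue_row R N]_x (f x * partial i g x) =
  - \int[lebesgue_row R N]_x (partial i f x * g x).
Proof.
move=> f1 g1 gk.
have fg1 := class_C_mul f1 g1.
have dg x : k < `|x| -> partial i g x = 0 by move=> xk; exact: is_derive_eq0 xk.
have := @Rintegral_partial0 (fun x => f x * g x) i k fg1.
have -> : partial i (fun x => f x * g x) =
    (fun x => partial i f x * g x + f x * partial i g x).
  apply/funext => x; apply: partialE.
  exact: (is_derive_mul (class_C_is_derive i x f1) (class_C_is_derive i x g1)).
rewrite RintegralD//.
- by move=> h; apply/eqP; rewrite -addr_eq0 addrC; apply/eqP/h => x xk; rewrite gk ?mulr0.
- apply: (@integrable_continuous_supported _ _ _ k).
    apply: continuous_mul; last exact: class_C_continuous g1.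
    exact: (class_C_continuous (class_C_partial i f1)).
  by move=> x xk; rewrite gk// mulr0.
- apply: (@integrable_continuous_supported _ _ _ k).
    apply: continuous_mul; first exact: class_C_continuous f1.
    exact: (class_C_continuous (class_C_partial i g1)).
  by move=> x xk; rewrite dg// mulr0.
Qed.

End class_C_theory.

(** * The fundamental lemma of the calculus of variations *)

Section fundamental_lemma.
Context {R : realType} {n : nat}.
Local Notation mu := (lebesgue_row R n).
Implicit Types (f g h : 'rV[R]_n -> R).

Lemma Lfun2P f : measurable_fun setT f ->
  mu.-integrable setT (EFin \o (fun x => f x ^+ 2)) -> f \in Lfun mu 2%:E.
Proof.
move=> mf fi; rewrite inE; apply/andP; split; first by rewrite inE.
rewrite inE/= /finite_norm unlock poweR_lty//.
case/integrableP: fi => _; apply: le_lt_trans.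
apply: ge0_le_integral => //.
- by move=> x _; exact: poweR_ge0.
- apply/measurable_EFinP.
  apply/(@measurableT_comp _ _ _ _ _ _ (fun x : R => x `^ 2)%R) => //.
  exact/measurableT_comp.
- by do 2 apply: measurableT_comp => //; apply: measurable_funX.
- by move=> x _ /=; rewrite lee_fin powR_mulrn ?normr_ge0// -normrX.
Qed.

Lemma Lfun2_measurable f : f \in Lfun mu 2%:E -> measurable_fun setT f.
Proof. by rewrite inE => /andP[]; rewrite inE. Qed.

Lemma Lfun2_mul_integrable f g : f \in Lfun mu 2%:E -> g \in Lfun mu 2%:E ->
  mu.-integrable setT (EFin \o (fun x => f x * g x)).
Proof. by move=> f2 g2; apply/Lfun1_integrable; exact: Lfun2_mul_Lfun1. Qed.

Lemma Lfun2_cube_supported f (k C : R) : measurable_fun setT f ->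
  (forall x, `|f x| <= C) -> (forall x, k < `|x| -> f x = 0) ->
  f \in Lfun mu 2%:E.
Proof.
move=> mf fC fk; apply: Lfun2P => //.
apply: (@integrable_cube_supported _ _ _ k (C ^+ 2)).
- exact: measurable_funX.
- by move=> x; rewrite normrX lerXn2r// nnegrE ?normr_ge0// (le_trans _ (fC x)).
- by move=> x /fk ->; rewrite expr0n.
Qed.

Lemma Lfun2_test f : test_function f -> f \in Lfun mu 2%:E.
Proof.
move=> ft; have [k _ fk] := test_function_supp ft.
have cf := class_C_continuous (ft.1 0).
have [M M0 fM] := continuous_cube_bounded k cf.
apply: (@Lfun2_cube_supported _ k M) => //; first exact: continuous_measurable_row.
by move=> x; have [/fM//|/fk ->] := leP `|x| k; rewrite normr0.
Qed.

Definition obox (a b : 'I_n -> R) : set 'rV[R]_n :=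
  row_box (fun i => `]a i, b i[%classic).

Definition oboxes : set (set 'rV[R]_n) := [set B | exists a b, B = obox a b].

Lemma measurable_obox a b : measurable (obox a b).
Proof. exact: measurable_row_box. Qed.

Lemma measurable_oboxes : @measurable _ 'rV[R]_n = <<s oboxes >>.
Proof.
apply/seteqP; split; last first.
  apply: smallest_sub; first exact: sigma_algebra_measurable.
  by move=> _ [a [b ->]]; exact: measurable_obox.
apply: smallest_sub; first exact: smallest_sigma_algebra.
rewrite -bigcup_seq => B [i _ [Y mY <-]]; rewrite setTI.
pose c (x : 'rV[R]_n) := x ord0 i.
pose G := [set Z : set R | <<s oboxes >> (c @^-1` Z)].
suff : G Y by [].
have [s0 sC sU] := smallest_sigma_algebra setT oboxes.
move: Y mY; rewrite RGenOpens.measurableE; apply: smallest_sub.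
  split=> [|A GA|F GF].
  - by rewrite /G/= preimage_set0.
  - exact: (sC _ GA).
  - by rewrite /G/= preimage_bigcup; exact: sU.
move=> _ [a [b ->]]; rewrite /G/=.
have -> : c @^-1` `]a, b[ = \bigcup_(k : nat)
    obox (fun j => if j == i then a else - k%:R) (fun j => if j == i then b else k%:R).
  apply/seteqP; split=> [x cx|x [k _ /(_ i)]]; last by rewrite /= eqxx.
  exists (Num.truncn `|x|).+1 => // j /=; case: eqP => [->//|_].
  rewrite in_itv/= -ltr_norml; apply: le_lt_trans (coord_le_norm _ _) _.
  exact: truncnS_gt.
by apply: sU => k; apply: sub_sigma_algebra; exists (fun j => if j == i then a else - k%:R);
  exists (fun j => if j == i then b else k%:R).
Qed.

Lemma oboxI a b a' b' : obox a b `&` obox a' b' =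
  obox (fun i => Num.max (a i) (a' i)) (fun i => Num.min (b i) (b' i)).
Proof.
apply/seteqP; split=> [x [h h'] i|x h].
  have := h i; have := h' i; rewrite /= !in_itv/= gt_max lt_min.
  by move=> /andP[-> ->] /andP[-> ->].
by split=> i; have := h i; rewrite /= !in_itv/= gt_max lt_min;
  by move=> /andP[/andP[? ?] /andP[? ?]]; apply/andP.
Qed.

Lemma setI_closed_oboxes : setI_closed oboxes.
Proof. by move=> _ _ [a [b ->]] [a' [b' ->]]; rewrite oboxI; eexists; eexists. Qed.

Lemma obox_bounded a b : exists k, forall x, obox a b x -> `|x| <= k.
Proof.
exists (\sum_i (`|a i| + `|b i|)) => x abx.
have k0 : 0 <= \sum_i (`|a i| + `|b i|) by apply: sumr_ge0 => i _; rewrite addr_ge0.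
apply/(normrv_leP _ k0) => i; rewrite (bigD1 i)//=.
apply: (@le_trans _ _ (`|a i| + `|b i|)); last first.
  by rewrite lerDl sumr_ge0// => j _; rewrite addr_ge0.
have := abx i; rewrite /= in_itv/= => /andP[ax xb].
rewrite ler_norml; apply/andP; split.
  by have := ler_norm (- a i); rewrite normrN; have := normr_ge0 (b i); clra.
by have := ler_norm (b i); have := normr_ge0 (a i); clra.
Qed.

(** Test functions converging to the indicator of the open box as [k] grows. The factor
    [*+ (a i < b i)] handles degenerate boxes: $(x-a)(b-x)$ is also positive when $b<x<a$, although
    the box is then empty. *)
Let bump (a b : 'I_n -> R) (k : nat) (x : 'rV[R]_n) : R :=
  \prod_i flatexp 1 (k.+1%:R * ((x ord0 i - a i) * (b i - x ord0 i)) *+ (a i < b i)%R).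

Let flat1_itv (t : R) : 0 <= flatexp 1 t <= 1.
Proof.
rewrite /flatexp; case: ltP => [t0|_]; last by rewrite lexx ler01.
by rewrite hornerC mul1r expR_ge0 -expR0 ler_expR oppr_le0 invr_ge0 ltW.
Qed.

Let bump_itv a b k x : 0 <= bump a b k x <= 1.
Proof.
rewrite /bump; elim/big_ind : _ => [|y z|i _]; last exact: flat1_itv.
  by rewrite ler01 lexx.
by move=> /andP[y0 y1] /andP[z0 z1]; rewrite mulr_ge0//= mulr_ile1.
Qed.

Let bump_out a b k x : ~ obox a b x -> bump a b k x = 0.
Proof.
move=> /existsNP[i xi]; rewrite /bump (bigD1 i)//= flatexp_le0 ?mul0r//.
have [ab|_] := ltP (a i) (b i); last by rewrite mulr0n.
rewrite mulr1n pmulr_rle0//; move: xi => /=; rewrite in_itv/= => xi.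
have [xa|ax] := leP (x ord0 i) (a i); first by cnra.
have [bx|xb] := leP (b i) (x ord0 i); first by cnra.
by exfalso; apply: xi; rewrite ax xb.
Qed.

Let bump_in a b x : obox a b x -> bump a b ^~ x @ \oo --> (1 : R).
Proof.
move=> abx.
have fac i : (fun k : nat => flatexp 1
    (k.+1%:R * ((x ord0 i - a i) * (b i - x ord0 i)) *+ (a i < b i)%R)) @ \oo --> (1 : R).
  have := abx i; rewrite /= in_itv/= => /andP[ax xb].
  have c0 : 0 < (x ord0 i - a i) * (b i - x ord0 i) by rewrite mulr_gt0// subr_gt0.
  have -> : (fun k : nat => flatexp 1
      (k.+1%:R * ((x ord0 i - a i) * (b i - x ord0 i)) *+ (a i < b i)%R)) =
      (fun k : nat => expR (- (((x ord0 i - a i) * (b i - x ord0 i))^-1 * k.+1%:R^-1))).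
    apply/funext => k; rewrite (lt_trans ax xb) mulr1n /flatexp ifT; last by rewrite pmulr_rgt0// ltr0n.
    by rewrite hornerC mul1r invfM mulrC.
  rewrite -[X in _ --> X](@expR0 R); apply: (@continuous_cvg _ _ _ _ _ _ _ 0); first exact: continuous_expR.
  rewrite -[X in _ --> X]oppr0; apply: cvgN.
  rewrite -[X in _ --> X](mulr0 ((x ord0 i - a i) * (b i - x ord0 i))^-1).
  by apply: cvgM; [exact: cvg_cst|exact: cvg_harmonic].
rewrite /bump; elim: (index_enum _) => [|i s IH].
  rewrite (_ : (fun k => _) = cst 1); first exact: cvg_cst.
  by apply/funext => k; rewrite big_nil.
rewrite (_ : (fun k => _) = (fun k : nat => flatexp 1
    (k.+1%:R * ((x ord0 i - a i) * (b i - x ord0 i)) *+ (a i < b i)%R) *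
    \prod_(j <- s) flatexp 1
    (k.+1%:R * ((x ord0 j - a j) * (b j - x ord0 j)) *+ (a j < b j)%R))).
  by rewrite -[X in _ --> X](mulr1 1); apply: cvgM; [exact: fac|exact: IH].
by apply/funext => k; rewrite big_cons.
Qed.

Let test_bump a b k : test_function (bump a b k).
Proof.
have [K abK] := obox_bounded a b.
apply: (@test_functionP _ _ _ K) => [m|x xK]; last first.
  by apply: bump_out => /abK; rewrite leNgt xK.
apply: class_C_prod => i; apply: class_C_flatexp.
have [ab|ab] := ltP (a i) (b i); last exact: class_C_cst.
apply: class_C_mul; first exact: class_C_cst.
apply: class_C_mul; apply: class_C_add; try exact: class_C_coord; try exact: class_C_cst.
rewrite (_ : (fun x => _) = fun x : 'rV[R]_n => -1 * x ord0 i).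
  by apply: class_C_mul; [exact: class_C_cst|exact: class_C_coord].
by apply/funext => x; rewrite mulN1r.
Qed.

Let integral_obox h a b : h \in Lfun mu 2%:E ->
  (forall phi, test_function phi -> \int[mu]_x (h x * phi x) = 0) ->
  (\int[mu]_(x in obox a b) (h x)%:E = 0)%E.
Proof.
move=> h2 h0; have mh := Lfun2_measurable h2.
have [K abK] := obox_bounded a b.
have ind2 : (\1_(obox a b) : _ -> R) \in Lfun mu 2%:E.
  apply: (@Lfun2_cube_supported _ K 1).
  - by apply: measurable_indic; exact: measurable_obox.
  - by move=> x; rewrite indicE; case: (_ \in _); rewrite ?normr1 ?normr0.
  - by move=> x xK; rewrite indicE memNset// => /abK; rewrite leNgt xK.
have mb k : measurable_fun setT (bump a b k).
  by apply: continuous_measurable_row; exact: (class_C_continuous ((test_bump a b k).1 0)).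
have bh k : mu.-integrable setT (EFin \o (fun x => h x * bump a b k x)).
  by apply: Lfun2_mul_integrable => //; exact: Lfun2_test.
have ih : mu.-integrable setT (EFin \o (fun x => h x * \1_(obox a b) x)).
  exact: Lfun2_mul_integrable.
have ihn := integrable_norm ih.
have cv x : (fun k => (h x * bump a b k x)%:E) @ \oo --> (h x * \1_(obox a b) x)%:E.
  apply: cvg_EFin; first exact: nearW.
  rewrite /comp/=; apply: cvgM; first exact: cvg_cst.
  rewrite indicE; have [xab|xab] := pselect (obox a b x).
    by rewrite mem_set//; exact: bump_in.
  rewrite memNset//= (_ : (fun k => _) = cst 0); first exact: cvg_cst.
  by apply/funext => k; rewrite bump_out.
have bd x k : (`|(h x * bump a b k x)%:E| <= `|h x * \1_(obox a b) x|%:E)%E.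
  rewrite lee_fin !normrM ler_wpM2l// indicE.
  have [xab|xab] := pselect (obox a b x); last first.
    by rewrite bump_out// normr0 normr_ge0.
  rewrite mem_set// normr1 ger0_norm.
    by case/andP: (bump_itv a b k x).
  by case/andP: (bump_itv a b k x).
have [_ _] := @dominated_convergence _ _ _ mu setT measurableT
  (fun k x => (h x * bump a b k x)%:E) (fun x => (h x * \1_(obox a b) x)%:E)
  (fun x => `|h x * \1_(obox a b) x|%:E)
  (fun k => measurable_int _ (bh k)) (measurable_int _ ih) (aeW _ (fun x _ => cv x))
  ihn (aeW _ (fun x k _ => bd x k)).
have -> : (fun k => (\int[mu]_x (h x * bump a b k x)%:E)%E) = cst 0%E.
  apply/funext => k; rewrite -[LHS]fineK; last exact: (integrable_fin_num measurableT (bh k)).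
  by rewrite [fine _]h0//; exact: test_bump.
move=> cvn; have := cvg_unique (@ereal_hausdorff R) cvn (cvg_cst 0%E).
move=> /= E0; rewrite -[RHS]E0 [LHS]integral_mkcond; apply: eq_integral => x _.
by rewrite patchE indicE; case: (_ \in _); rewrite ?mulr1 ?mulr0.
Qed.

(** Smooth bumps give a vanishing integral on open boxes, and Dynkin induction extends this to all
    measurable sets. The induction runs inside a bounded box [Q], on which the square-integrable [h]
    is integrable; the exceptional sets of countably many such boxes are then united. *)
Lemma Lfun2_orthogonal_test h : h \in Lfun mu 2%:E ->
  (forall phi, test_function phi -> \int[mu]_x (h x * phi x) = 0) ->
  ae_eq mu setT (EFin \o h) (cst 0%E).
Proof.
move=> h2 h0; have mh := Lfun2_measurable h2.
have boxint k : mu.-integrable (cube k) (EFin \o h).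
  apply/(integrable_mkcond _ (measurable_cube k)).
  rewrite (_ : _ \_ _ = EFin \o (fun x => h x * \1_(cube k) x)).
    apply: Lfun2_mul_integrable => //; apply: (@Lfun2_cube_supported _ k 1).
    - by apply: measurable_indic; exact: measurable_cube.
    - by move=> x; rewrite indicE; case: (_ \in _); rewrite ?normr1 ?normr0.
    - by move=> x xK; rewrite indicE memNset// /cube/= leNgt xK.
  by apply/funext => x; rewrite patchE /= indicE; case: (_ \in _); rewrite ?mulr1 ?mulr0.
have key (k : nat) : ae_eq mu (obox (fun=> - k%:R) (fun=> k%:R)) (EFin \o h) (cst 0%E).
  set Q := obox _ _.
  have mQ : measurable Q by exact: measurable_obox.
  have Qk : Q `<=` cube k%:R.
    move=> x Qx; rewrite /cube/=; apply/normrv_leP => // i.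
    by have := Qx i; rewrite /= in_itv/= -ltr_norml => /ltW.
  have hQ : mu.-integrable Q (EFin \o h).
    by apply: integrableS (boxint k%:R) => //; exact: measurable_cube.
  have P A : measurable A -> (\int[mu]_(x in A `&` Q) (h x)%:E = 0)%E.
    rewrite measurable_oboxes => sA.
    apply: (@dynkin_induction _ _ oboxes (fun A => \int[mu]_(x in A `&` Q) (h x)%:E = 0)%E
      measurable_oboxes setI_closed_oboxes) => //.
    - by rewrite setTI; exact: integral_obox.
    - by move=> _ [a [b ->]]; rewrite /Q oboxI; exact: integral_obox.
    - move=> S mS S0.
      have : (\int[mu]_(x in (S `&` Q) `|` (~` S `&` Q)) (h x)%:E = 0)%E.
        by rewrite -setIUl setUv setTI; exact: integral_obox.
      rewrite integral_setU.
      + by rewrite S0 add0e.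
      + exact: measurableI.
      + by apply: measurableI => //; exact: measurableC.
      + by apply: measurable_funTS; exact/measurable_EFinP.
      + by apply/disj_set2P; rewrite setIACA setICr set0I.
    - move=> F mF tF F0; rewrite setI_bigcupl integral_bigcup.
      + by apply: eseries0 => k' _ _; exact: F0.
      + exact: trivIset_setIr.
      + by move=> k'; apply: measurableI.
      + apply: integrableS hQ => //; first by apply: bigcup_measurable => k' _; exact: measurableI.
        by move=> x [k' _ []].
    apply: integral_ae_eq => // E EQ mE.
    by have := P _ mE; rewrite (setIidl EQ) integral0 => ->.
pose Z k := ~` [set x | obox (fun=> - k%:R) (fun=> k%:R) x -> (h x)%:E = 0%E].
have : mu.-negligible (\bigcup_k Z k) by apply: negligible_bigcup => k; exact: key.
apply: negligibleS => x /= hx; exists (Num.truncn `|x|).+1 => //= hq.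
apply: hx => _; apply: hq => i; rewrite /= in_itv/= -ltr_norml.
by apply: le_lt_trans (coord_le_norm _ _) _; exact: truncnS_gt.
Qed.

End fundamental_lemma.

Lemma continuousT_comp (U V W : topologicalType) (f : U -> V) (g : V -> W) :
  continuous f -> continuous g -> continuous (fun x => g (f x)).
Proof. by move=> cf cg x; exact: (continuous_comp (cf x) (cg (f x))). Qed.

Section integrable_pointwise.
Context {R : realType} {N : nat}.
Local Notation mu := (lebesgue_row R N).
Implicit Types (f g : 'rV[R]_N -> R).

Lemma integrable_add f g : mu.-integrable setT (EFin \o f) ->
  mu.-integrable setT (EFin \o g) ->
  mu.-integrable setT (EFin \o (fun x => f x + g x)).
Proof. by move=> fi gi; exact: (integrableD measurableT fi gi). Qed.

Lemma integrable_sub f g : mu.-integrable setT (EFin \o f) ->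
  mu.-integrable setT (EFin \o g) ->
  mu.-integrable setT (EFin \o (fun x => f x - g x)).
Proof. by move=> fi gi; exact: (integrableB measurableT fi gi). Qed.

Lemma integrable_scale (c : R) f : mu.-integrable setT (EFin \o f) ->
  mu.-integrable setT (EFin \o (fun x => c * f x)).
Proof. by move=> fi; exact: (integrableZl measurableT c fi). Qed.

End integrable_pointwise.

Section affine_class_C.
Context {R : realType} {N : nat}.
Implicit Types (f : 'rV[R]_N -> R) (m : nat) (i : 'I_N).

Lemma is_derive_affine f (a d : R) (b x v : 'rV[R]_N) :
  is_derive (a *: (x - b)) v f d ->
  is_derive x v (fun z => f (a *: (z - b))) (a * d).
Proof.
move=> fd.
pose G (t : R) := f (a *: (x - b) + t *: v).
have G0 : is_derive (a * 0) (1 : R) G d.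
  by apply/is_derive_line; rewrite mulr0 scale0r addr0.
have a0 : is_derive (0 : R) (1 : R) (fun s : R => a * s) a.
  have := is_derive_mul (is_derive_cst a (0 : R) (1 : R)) (is_derive_id (0 : R) (1 : R)).
  by rewrite mul0r add0r mulr1.
have := is_derive_comp_dir G0 a0.
rewrite (_ : (fun s => _) = (fun s : R => f (a *: (x + s *: v - b)))); last first.
  by apply/funext => s; rewrite /G -scalerA -scalerDr addrAC.
move/(is_derive_line (fun z => f (a *: (z - b)))).
by rewrite scale0r addr0 [d * a]mulrC.
Qed.

Lemma partial_affine f (a : R) (b : 'rV[R]_N) i : class_C 1 f ->
  partial i (fun z => f (a *: (z - b))) = (fun z => a * partial i f (a *: (z - b))).
Proof.
move=> f1; apply/funext => x; apply: partialE; apply: is_derive_affine.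
exact: class_C_is_derive f1.
Qed.

Lemma continuous_affine (a : R) (b : 'rV[R]_N) :
  continuous (fun z : 'rV[R]_N => a *: (z - b)).
Proof.
have c1 : continuous (fun z : 'rV[R]_N => z - b).
  by move=> z; apply: continuousB; [move=> A|exact: cst_continuous].
move=> x; apply: (@continuous_comp 'rV[R]_N 'rV[R]_N 'rV[R]_N (fun z => z - b) (fun z => a *: z)).
  exact: c1.
exact: scaler_continuous.
Qed.

Lemma class_C_affine m f (a : R) (b : 'rV[R]_N) : class_C m f ->
  class_C m (fun z => f (a *: (z - b))).
Proof.
elim: m f => [|m IH] f fm.
  split => //; apply: (continuousT_comp (@continuous_affine a b)).
  exact: (class_C_continuous fm).
apply: (@class_CS _ _ _ _ (fun i x => a * partial i f (a *: (x - b)))).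
- apply: (continuousT_comp (@continuous_affine a b)).
  exact: (class_C_continuous fm).
- by move=> i x; apply: is_derive_affine; exact: class_C_is_derive fm.
- move=> i; apply: class_C_mul; first exact: class_C_cst.
  by apply: (IH (partial i f)); exact: class_C_partial.
Qed.

End affine_class_C.

Section dot_norm.
Context {R : realType} {N : nat}.
Implicit Types (x y : 'rV[R]_N).

Lemma dot_ge0 x : 0 <= dot x x.
Proof. by apply: sumr_ge0 => i _; rewrite -expr2 sqr_ge0. Qed.

Lemma sqr_coord_le_dot x i : x ord0 i ^+ 2 <= dot x x.
Proof.
rewrite /dot (bigD1 i)//= expr2 lerDl; apply: sumr_ge0 => j _.
by rewrite -expr2 sqr_ge0.
Qed.

Lemma sqr_norm_le_dot x : `|x| ^+ 2 <= dot x x.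
Proof.
have s0 : 0 <= Num.sqrt (dot x x) by exact: sqrtr_ge0.
suff : `|x| <= Num.sqrt (dot x x).
  by move=> h; rewrite -[leRHS]sqr_sqrtr ?dot_ge0// ler_sqr ?nnegrE.
apply/(normrv_leP _ s0) => i.
by rewrite -sqrtr_sqr ler_wsqrtr// sqr_coord_le_dot.
Qed.

Lemma dot_le_sqr_norm x : dot x x <= N%:R * `|x| ^+ 2.
Proof.
have -> : N%:R * `|x| ^+ 2 = \sum_(i < N) `|x| ^+ 2.
  by rewrite sumr_const card_ord mulr_natl.
apply: ler_sum => i _.
rewrite -expr2 -real_normK ?num_real// lerXn2r ?nnegrE//.
exact: coord_le_norm.
Qed.

Lemma class_C_dot m : class_C m (fun x : 'rV[R]_N => dot x x).
Proof.
by apply: class_C_sum => i; apply: class_C_mul; exact: class_C_coord.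
Qed.

Lemma partial_dot i x : is_derive x (delta_mx ord0 i) (fun x : 'rV[R]_N => dot x x)
  (2 * x ord0 i).
Proof.
have h (j : 'I_N) : is_derive x (delta_mx ord0 i)
    (fun y : 'rV[R]_N => y ord0 j * y ord0 j) ((i == j)%:R * x ord0 j + x ord0 j * (i == j)%:R).
  by apply: is_derive_mul; exact: is_derive_coord.
have := @is_derive_sum _ _ _ _ _ x (delta_mx ord0 i) _ h.
rewrite (_ : \sum_(j < N) _ = fun x => dot x x); last first.
  by apply/funext => y; rewrite fct_sumE.
move=> H; apply: (is_derive_eq H); rewrite (bigD1 i)//= eqxx mul1r mulr1 big1 ?addr0.
  by rewrite mulr_natl.
by move=> j ji; rewrite eq_sym (negbTE ji) mul0r mulr0 addr0.
Qed.

End dot_norm.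

(** * The radial bump, and the Laplacian tested against it *)

Section kernels.
Context {R : realType} {N : nat}.
Local Notation mu := (lebesgue_row R N).
Implicit Types (x y z : 'rV[R]_N) (u w g f h : 'rV[R]_N -> R).

(* [grad psi y = - phi y *: y] and [lpsi] is the Laplacian of [psi]. *)
Definition psi y : R := flatexp 1 (1 - dot y y).
Definition phi y : R := 2 * flatexp (dflatexp 1) (1 - dot y y).
Definition lpsi y : R :=
  4 * dot y y * flatexp (dflatexp (dflatexp 1)) (1 - dot y y) - N%:R * phi y.

Definition laplacian f y : R := \sum_i partial i (partial i f) y.

Lemma class_C_flatdot m (p : {poly R}) :
  class_C m (fun y : 'rV[R]_N => flatexp p (1 - dot y y)).
Proof.
apply: class_C_flatexp; apply: class_C_add; first exact: class_C_cst.
rewrite (_ : (fun x => _) = fun x : 'rV[R]_N => -1 * dot x x).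
  by apply: class_C_mul; [exact: class_C_cst|exact: class_C_dot].
by apply/funext => x; rewrite mulN1r.
Qed.

Lemma partial_flatdot (p : {poly R}) i :
  partial i (fun y : 'rV[R]_N => flatexp p (1 - dot y y)) =
  (fun y => -2 * y ord0 i * flatexp (dflatexp p) (1 - dot y y)).
Proof.
apply/funext => y; apply: partialE.
have h : is_derive y (delta_mx ord0 i) (fun y : 'rV[R]_N => 1 - dot y y)
    (0 - 2 * y ord0 i).
  by apply: is_derive_sub; exact: partial_dot.
have h' := is_derive_comp_dir (g := fun z : 'rV[R]_N => 1 - dot z z) (is_derive_flatexp p (1 - dot y y)) h.
apply: (is_derive_eq h').
by rewrite sub0r mulrC mulNr.
Qed.

Lemma flatdot_supp (p : {poly R}) y : 1 < `|y| -> flatexp p (1 - dot y y) = 0.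
Proof.
move=> y1; apply: flatexp_le0; rewrite subr_le0.
by apply: le_trans (sqr_norm_le_dot y); rewrite -[leLHS](expr1n _ 2) lerXn2r ?nnegrE// ltW.
Qed.

Lemma psi_supp y : 1 < `|y| -> psi y = 0. Proof. exact: flatdot_supp. Qed.

Lemma phi_supp y : 1 < `|y| -> phi y = 0.
Proof. by move=> y1; rewrite /phi flatdot_supp// mulr0. Qed.

Lemma lpsi_supp y : 1 < `|y| -> lpsi y = 0.
Proof. by move=> y1; rewrite /lpsi phi_supp// flatdot_supp// !mulr0 subr0. Qed.

Lemma psi_ge0 y : 0 <= psi y.
Proof.
by rewrite /psi /flatexp; case: ifP => // _; rewrite hornerC mul1r expR_ge0.
Qed.

Lemma dflatexp1 : dflatexp 1 = 'X^2 :> {poly R}.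
Proof. by rewrite /dflatexp derivC subr0 mulr1. Qed.

Lemma phi_ge0 y : 0 <= phi y.
Proof.
rewrite /phi mulr_ge0// /flatexp dflatexp1; case: ifP => // y0.
by rewrite hornerXn mulr_ge0 ?expR_ge0 ?sqr_ge0.
Qed.

Lemma class_C_psi m : class_C m psi. Proof. exact: class_C_flatdot. Qed.

Lemma continuous_psi : continuous psi.
Proof. exact: (class_C_continuous (class_C_psi 0)). Qed.

Lemma continuous_phi : continuous phi.
Proof.
apply: continuous_mul; first exact: cst_continuous.
exact: (class_C_continuous (class_C_flatdot 0 _)).
Qed.

Lemma continuous_lpsi : continuous lpsi.
Proof.
apply: continuous_sub; apply: continuous_mul; try exact: cst_continuous.
- apply: continuous_mul; first exact: cst_continuous.
  exact: (class_C_continuous (class_C_dot 0)).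
- exact: (class_C_continuous (class_C_flatdot 0 _)).
- exact: continuous_phi.
Qed.

Lemma laplacian_psi : laplacian psi = lpsi.
Proof.
apply/funext => y; rewrite /laplacian.
have E i : partial i (partial i psi) y = -2 * flatexp (dflatexp 1) (1 - dot y y) +
    4 * (y ord0 i * y ord0 i) * flatexp (dflatexp (dflatexp 1)) (1 - dot y y).
  rewrite {1}/psi partial_flatdot; apply: partialE.
  have h1 : is_derive y (delta_mx ord0 i) (fun y : 'rV[R]_N => -2 * y ord0 i) (0 * y ord0 i + -2 * (i == i)%:R).
    by apply: is_derive_mul; exact: is_derive_coord.
  have h2 := class_C_is_derive i y (class_C_flatdot 1 (dflatexp 1)).
  apply: (is_derive_eq (is_derive_mul h1 h2)).
  rewrite partial_flatdot eqxx /=.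
  move: (flatexp _ _) (flatexp _ _) => c d; rewrite mulr1n; ring.
under eq_bigr do rewrite E.
rewrite big_split/= sumr_const card_ord /lpsi /phi -mulr_suml -mulr_sumr.
rewrite -[\sum_i _]/(dot y y) -mulr_natl; ring.
Qed.

(* The Laplacian of [w] is [g], tested against the dilated translates of [psi] only. *)
Definition DLap w g := forall x (r : R), 0 < r ->
  \int[mu]_y (w (x + r *: y) * lpsi y) = r ^+ 2 * \int[mu]_y (g (x + r *: y) * psi y).

Lemma H1_test f : test_function f -> H1 f /\ is_weak_gradient f (grad f).
Proof.
move=> ft; suff wg : is_weak_gradient f (grad f).
  by split => //; split; [exact: Lfun2_test|exists (grad f)].
move=> i; split.
  rewrite (_ : (fun x => _) = partial i f); last by apply/funext => x; rewrite mxE.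
  exact/Lfun2_test/test_function_partial.
move=> h ht; have [k k0 hk] := test_function_supp ht.
rewrite (Rintegral_by_parts _ (ft.1 1%N) (ht.1 1%N) hk); congr (- _).
by apply: eq_Rintegral => x _; rewrite mxE.
Qed.

Lemma weak_gradientP u : H1 u -> is_weak_gradient u (weak_gradient u).
Proof.
move=> [_ [g ug]]; rewrite /weak_gradient; case: xgetP => // h.
by have := h g.
Qed.

Lemma Lfun2_sub f g : f \in Lfun mu 2%:E -> g \in Lfun mu 2%:E ->
  (fun x => f x - g x) \in Lfun mu 2%:E.
Proof.
move=> f2 g2; have p1 : (1 <= 2%:E :> \bar R)%E by rewrite lee_fin ler1n.
have [_ h] := @Lfun_addr_closed _ _ R mu 2%:E p1.
exact: (h _ _ f2 (@Lfun_oppr_closed _ _ R mu 2%:E g g2)).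
Qed.

Lemma Rintegral_sum (I : Type) (s : seq I) (F : I -> 'rV[R]_N -> R) :
  (forall i, mu.-integrable setT (EFin \o F i)) ->
  mu.-integrable setT (EFin \o (fun x => \sum_(i <- s) F i x)) /\
  \int[mu]_x (\sum_(i <- s) F i x) = \sum_(i <- s) \int[mu]_x F i x.
Proof.
move=> Fi; elim: s => [|i s [IH1 IH2]].
  rewrite (_ : (fun x => _) = cst 0); last by apply/funext => x; rewrite big_nil.
  split; first exact: integrable0.
  by rewrite big_nil Rintegral_cst// mul0r.
rewrite (_ : (fun x => _) = (fun x => F i x + \sum_(j <- s) F j x)); last first.
  by apply/funext => x; rewrite big_cons.
split; last by rewrite big_cons -IH2 RintegralD.
exact: integrable_add.
Qed.

(** [weak_gradient f] is an arbitrary choice, so it is first identified almost everywhere with the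
    classical gradient. The definition of the weak gradient of [u] then applies with [partial i f]
    as test function. *)
Lemma weak_gradient_pairing u f : H1 u -> test_function f ->
  \int[mu]_x dot (weak_gradient u x) (weak_gradient f x) =
  - \int[mu]_x (u x * laplacian f x).
Proof.
move=> u1 ft; have ug := weak_gradientP u1; have [f1 fg] := H1_test ft.
have fw := weak_gradientP f1.
have ip i : mu.-integrable setT (EFin \o (fun x => weak_gradient u x ord0 i * weak_gradient f x ord0 i)).
  by apply: Lfun2_mul_integrable; [case: (ug i)|case: (fw i)].
have iq i : mu.-integrable setT (EFin \o (fun x => u x * partial i (partial i f) x)).
  apply: Lfun2_mul_integrable; first by case: u1.
  exact/Lfun2_test/test_function_partial/test_function_partial.
have -> : \int[mu]_x (u x * laplacian f x) = \int[mu]_x \sum_i u x * partial i (partial i f) x.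
  by apply: eq_Rintegral => x _; rewrite /laplacian mulr_sumr.
rewrite (Rintegral_sum _ ip).2 (Rintegral_sum _ iq).2 -sumrN; apply: eq_bigr => i _.
have [g2 gE] := ug i; have [w2 wE] := fw i.
have df := test_function_partial i ft.
rewrite (gE _ df) opprK.
have d2 := Lfun2_test df.
have : ae_eq mu setT (EFin \o (fun x => weak_gradient f x ord0 i - partial i f x)) (cst 0%E).
  apply: Lfun2_orthogonal_test; first exact: Lfun2_sub.
  move=> h ht; have h2 := Lfun2_test ht.
  rewrite (_ : (fun x => _) = (fun x => weak_gradient f x ord0 i * h x - partial i f x * h x)); last first.
    by apply/funext => x; rewrite mulrBl.
  rewrite RintegralB//; try exact: Lfun2_mul_integrable.
  have := wE _ ht; have [_ fE] := fg i; have := fE _ ht.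
  have -> : \int[mu]_x (grad f x ord0 i * h x) = \int[mu]_x (partial i f x * h x).
    by apply: eq_Rintegral => x _; rewrite mxE.
  by move=> -> /eqP; rewrite eqr_opp => /eqP ->; rewrite subrr.
move=> ae0; rewrite /Rintegral; congr fine; apply: ae_eq_integral => //.
- by apply/measurable_EFinP; apply: measurable_funM; apply: Lfun2_measurable.
- by apply/measurable_EFinP; apply: measurable_funM; apply: Lfun2_measurable.
- apply: filterS ae0 => x /= h _; congr EFin; congr (_ * _).
  by have := h I; move=> [] /eqP; rewrite subr_eq0 => /eqP.
Qed.

End kernels.

Section weak_solution_DLap.
Context {R : realType} {N : nat}.
Local Notation mu := (lebesgue_row R N).
Implicit Types (V u : 'rV[R]_N -> R).

Lemma continuous_ln_sqr u : continuous u -> (forall x, 0 < u x) ->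
  continuous (fun x => ln (u x ^+ 2)).
Proof.
move=> cu u0 x; apply: (@continuous_comp 'rV[R]_N R R (fun x => u x ^+ 2) (@ln R)).
  by apply: (@continuous_comp 'rV[R]_N R R u (fun y => y ^+ 2)); [exact: cu|exact: exprn_continuous].
by apply: continuous_ln; rewrite exprn_gt0.
Qed.

Lemma weak_solution_test V (eps : R) u f : 0 < eps -> continuous V ->
  positive_solution V eps u -> test_function f ->
  \int[mu]_x (u x * laplacian f x) =
  \int[mu]_x ((V x - ln (u x ^+ 2)) * u x / eps ^+ 2 * f x).
Proof.
move=> e0 cV [cu u0 [u1 uw]] ft.
have [f1 _] := H1_test ft; have [iu E] := uw _ f1.
have [k k0 fk] := test_function_supp ft.
have cf := class_C_continuous (ft.1 0).
have cl := continuous_ln_sqr cu u0.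
have i1 : mu.-integrable setT (EFin \o (fun x => V x * u x * f x)).
  apply: (@integrable_continuous_supported _ _ _ k) => [|x /fk ->]; last by rewrite mulr0.
  by apply: continuous_mul => //; exact: continuous_mul.
move: E; rewrite weak_gradient_pairing// => E.
have E' : \int[mu]_x (u x * laplacian f x) =
    (\int[mu]_x (V x * u x * f x) - \int[mu]_x (u x * f x * ln (u x ^+ 2))) / eps ^+ 2.
  have e2 : eps ^+ 2 != 0 by rewrite gt_eqF// exprn_gt0.
  by rewrite -E; field; rewrite gt_eqF.
rewrite E' -RintegralB// -RintegralZr//.
  by apply: eq_Rintegral => x _; ring.
exact: integrable_sub.
Qed.

(** The equation is tested with [psi] dilated by [r] about [x]. Its Laplacian carries $r^{-2}$, and
    the change of variables gives the same factor $r^{-N}$ on both sides. *)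
Lemma weak_solution_DLap V (eps : R) u : 0 < eps -> continuous V ->
  positive_solution V eps u ->
  DLap u (fun x => (V x - ln (u x ^+ 2)) * u x / eps ^+ 2).
Proof.
move=> e0 cV su x r r0.
have r0' : r != 0 by rewrite gt_eqF.
pose f (z : 'rV[R]_N) := psi (r^-1 *: (z - x)).
have fE y : f (x + r *: y) = psi y by rewrite /f addrAC subrr add0r scalerA mulVf// scale1r.
have fs z : r + `|x| < `|z| -> 1 < `|r^-1 *: (z - x)|.
  move=> zr; rewrite normrZ gtr0_norm ?invr_gt0// mulrC ltr_pdivlMr// mul1r.
  by have := ler_normD (z - x) x; rewrite subrK; clra.
have ft : test_function f.
  apply: (@test_functionP _ _ _ (r + `|x|)) => [m|z /fs]; last exact: psi_supp.
  by apply: class_C_affine; exact: class_C_psi.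
have lf z : laplacian f z = r^-1 ^+ 2 * lpsi (r^-1 *: (z - x)).
  rewrite -laplacian_psi /laplacian mulr_sumr; apply: eq_bigr => i _.
  rewrite /f partial_affine; last exact: class_C_psi.
  rewrite [X in X z = _](_ : _ = fun z => r^-1 * (r^-1 * partial i (partial i psi) (r^-1 *: (z - x)))).
    by rewrite mulrA -expr2.
  apply/funext => y; apply: partialE.
  have dp := class_C_is_derive i (r^-1 *: (y - x)) (class_C_partial i (class_C_psi 2)).
  have h := is_derive_mul (is_derive_cst r^-1 y (delta_mx ord0 i)) (is_derive_affine dp).
  by apply: (is_derive_eq h); rewrite mul0r add0r.
have := weak_solution_test e0 cV su ft.
have [cu u0 _] := su.
have cl := continuous_ln_sqr cu u0.
have cf := class_C_continuous (ft.1 0).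
have i1 : mu.-integrable setT (EFin \o (fun z => u z * laplacian f z)).
  apply: (@integrable_continuous_supported _ _ _ (r + `|x|)).
    apply: continuous_mul => //; rewrite (funext lf).
    apply: continuous_mul; first exact: cst_continuous.
    exact: (continuousT_comp (@continuous_affine _ _ r^-1 x) continuous_lpsi).
  by move=> z /fs zs; rewrite lf lpsi_supp// !mulr0.
have i2 : mu.-integrable setT (EFin \o (fun z => (V z - ln (u z ^+ 2)) * u z / eps ^+ 2 * f z)).
  apply: (@integrable_continuous_supported _ _ _ (r + `|x|)).
    apply: continuous_mul => //; apply: continuous_mul; last exact: cst_continuous.
    by apply: continuous_mul => //; exact: continuous_sub.
  by move=> z /fs zs; rewrite /f psi_supp// mulr0.
have [_ a1] := Rintegral_affine x r0 i1; have [_ a2] := Rintegral_affine x r0 i2.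
move=> E; move: a2; rewrite -E => {E} a2; move: a1; rewrite -a2.
have -> : \int[mu]_y (u (x + r *: y) * laplacian f (x + r *: y)) =
    r^-1 ^+ 2 * \int[mu]_y (u (x + r *: y) * lpsi y).
  rewrite -RintegralZl//.
    apply: eq_Rintegral => y _; rewrite lf addrAC subrr add0r scalerA mulVf// scale1r.
    by rewrite mulrCA.
  apply: (@integrable_continuous_supported _ _ _ 1) => [|y /lpsi_supp ->]; last by rewrite mulr0.
  apply: continuous_mul; last exact: continuous_lpsi.
  apply: (@continuousT_comp 'rV[R]_N 'rV[R]_N R (fun y => x + r *: y) u) => //.
  move=> y; apply: continuousD; first exact: cst_continuous.
  exact: scaler_continuous.
under [X in _ = X -> _]eq_Rintegral do rewrite fE.
move=> <-; rewrite mulrA -exprMn mulfV// expr1n mul1r.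
by apply: eq_Rintegral.
Qed.

End weak_solution_DLap.

Section kernel_integrals.
Context {R : realType} {N : nat}.
Local Notation mu := (lebesgue_row R N).
Implicit Types (x y z : 'rV[R]_N) (k w g : 'rV[R]_N -> R).

Lemma continuous_line x (r : R) : continuous (fun y : 'rV[R]_N => x + r *: y).
Proof.
by move=> y; apply: continuousD; [exact: cst_continuous|exact: scaler_continuous].
Qed.

Lemma continuous_comp_line w x (r : R) : continuous w ->
  continuous (fun y => w (x + r *: y)).
Proof. by move=> cw; exact: (continuousT_comp (@continuous_line x r) cw). Qed.

Definition kernel1 k := continuous k /\ forall y, 1 < `|y| -> k y = 0.

Lemma kernel_psi : kernel1 (@psi R N).
Proof. by split; [exact: continuous_psi|exact: psi_supp]. Qed.

Lemma kernel_phi : kernel1 (@phi R N).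
Proof. by split; [exact: continuous_phi|exact: phi_supp]. Qed.

Lemma kernel_lpsi : kernel1 (@lpsi R N).
Proof. by split; [exact: continuous_lpsi|exact: lpsi_supp]. Qed.

Lemma kernel_bounded k : kernel1 k -> exists2 M, 0 <= M & forall y, `|k y| <= M.
Proof.
move=> [ck ks]; have [M M0 kM] := continuous_cube_bounded 1 ck.
by exists M => // y; have [/kM//|/ks ->] := leP `|y| 1; rewrite normr0.
Qed.

Lemma kernel_integrable k : kernel1 k -> mu.-integrable setT (EFin \o k).
Proof. by move=> [ck ks]; exact: (integrable_continuous_supported ck ks). Qed.

Lemma kernel_mul_integrable k w x (r : R) : kernel1 k -> continuous w ->
  mu.-integrable setT (EFin \o (fun y => w (x + r *: y) * k y)).
Proof.
move=> [ck ks] cw; apply: (@integrable_continuous_supported _ _ _ 1).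
  by apply: continuous_mul => //; exact: continuous_comp_line.
by move=> y /ks ->; rewrite mulr0.
Qed.

Lemma kernel_scale k w (c : R) x (r : R) : kernel1 k -> continuous w ->
  \int[mu]_y (c * w (x + r *: y) * k y) = c * \int[mu]_y (w (x + r *: y) * k y).
Proof.
move=> hk cw; rewrite -(RintegralZl _ measurableT (kernel_mul_integrable x r hk cw)).
by apply: eq_Rintegral => y _; rewrite mulrA.
Qed.

Lemma kernel_add k w g x (r : R) : kernel1 k -> continuous w -> continuous g ->
  \int[mu]_y ((w (x + r *: y) + g (x + r *: y)) * k y) =
  \int[mu]_y (w (x + r *: y) * k y) + \int[mu]_y (g (x + r *: y) * k y).
Proof.
move=> hk cw cg; rewrite -(RintegralD measurableT (kernel_mul_integrable x r hk cw)
  (kernel_mul_integrable x r hk cg)).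
by apply: eq_Rintegral => y _; rewrite mulrDl.
Qed.

Lemma kernel_le k w (C : R) x (r : R) : kernel1 k -> (forall y, 0 <= k y) ->
  continuous w -> (forall y, `|y| <= 1 -> w (x + r *: y) <= C) ->
  \int[mu]_y (w (x + r *: y) * k y) <= C * \int[mu]_y k y.
Proof.
move=> hk k0 cw wC; rewrite -RintegralZl//; last exact: kernel_integrable.
apply: le_Rintegral => //.
- exact: kernel_mul_integrable.
- by apply: integrable_scale; exact: kernel_integrable.
- move=> y _; have [y1|y1] := leP `|y| 1; first by rewrite ler_wpM2r// wC.
  by case: hk => _ ->//; rewrite !mulr0.
Qed.

Lemma kernel_norm_le k w (C : R) x (r : R) : kernel1 k ->
  continuous w -> (forall y, `|y| <= 1 -> `|w (x + r *: y)| <= C) ->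
  `|\int[mu]_y (w (x + r *: y) * k y)| <= C * \int[mu]_y `|k y|.
Proof.
move=> hk cw wC; rewrite -RintegralZl//; last first.
  by apply: (integrable_norm (kernel_integrable hk)).
apply: (le_trans (le_normr_Rintegral measurableT (kernel_mul_integrable x r hk cw))).
apply: le_Rintegral => //.
- exact: (integrable_norm (kernel_mul_integrable x r hk cw)).
- by apply: integrable_scale; exact: (integrable_norm (kernel_integrable hk)).
- move=> y _; have [y1|y1] := leP `|y| 1; first by rewrite normrM ler_wpM2r// wC.
  by case: hk => _ ->//; rewrite !(mulr0, normr0).
Qed.

Lemma Rintegral_gt0 k (a d : R) : kernel1 k -> (forall y, 0 <= k y) -> 0 < a ->
  0 < d -> (forall y, `|y| <= a -> d <= k y) -> 0 < \int[mu]_y k y.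
Proof.
move=> hk k0 a0 d0 dk.
pose f (y : 'rV[R]_N) : R := d * \1_(cube a) y.
have fi : mu.-integrable setT (EFin \o (\1_(cube a) : 'rV[R]_N -> R)).
  apply: (@integrable_cube_supported _ _ _ a 1).
  - by apply: measurable_indic; exact: measurable_cube.
  - by move=> y; rewrite indicE; case: (_ \in _); rewrite ?normr1 ?normr0.
  - by move=> y ya; rewrite indicE memNset// /cube/= leNgt ya.
apply: (@lt_le_trans _ _ (\int[mu]_y f y)); last first.
  apply: le_Rintegral => //; [exact: integrable_scale|exact: kernel_integrable|].
  move=> y _; rewrite /f indicE; have [ya|ya] := leP `|y| a.
    by rewrite mem_set// mulr1 dk.
  by rewrite memNset ?mulr0// /cube/= leNgt ya.
rewrite /f RintegralZl// mulr_gt0// /Rintegral integral_indic//; last exact: measurable_cube.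
rewrite (_ : _ `&` _ = cube a) ?setIT//.
have E := @lebesgue_row_cube R N a (ltW a0).
by rewrite (_ : fine _ = (a *+ 2) ^+ N); [rewrite exprn_gt0// pmulrn_lgt0|exact: (congr1 fine E)].
Qed.

(** On this cube $1-|y|^2 \ge 1/2$, so [psi] and [phi] are bounded below there; this is how [cpsi]
    and [cphi] are seen to be positive. *)
Let rad : {a : R | 0 < a & forall y : 'rV[R]_N, `|y| <= a -> dot y y <= 2^-1}.
Proof.
exists (2 * (N%:R + 1))^-1; first by rewrite invr_gt0 mulr_gt0// ltr_wpDl.
move=> y ya; apply: le_trans (dot_le_sqr_norm y) _.
set b := (2 * (N%:R + 1))^-1 in ya *.
have b1 : N%:R * b <= 2^-1 :> R.
  rewrite /b invfM mulrCA ler_piMr ?invr_ge0// ler_pdivrMr ?ltr_wpDl// mul1r.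
  by rewrite lerDl.
have b2 : b <= 1.
  rewrite /b invf_le1 ?mulr_gt0 ?ltr_wpDl//.
  have : 0 <= N%:R :> R by []; clra.
have : `|y| ^+ 2 <= b.
  rewrite expr2 (le_trans (ler_pM _ _ ya ya))//.
  by rewrite ler_piMr// (le_trans _ ya).
have : 0 <= N%:R :> R by [].
cnra.
Qed.

Definition cphi : R := \int[mu]_y phi y.
Definition cpsi : R := \int[mu]_y psi y.

Let flat_lb (t : R) : 2^-1 <= t -> t <= 1 -> expR (- 2) <= expR (- t^-1) /\ 1 <= t^-1 ^+ 2.
Proof.
move=> t2 t1; have t0 : 0 < t by clra.
split; first by rewrite ler_expR lerN2 -[leRHS]invrK lef_pV2 ?posrE ?invr_gt0.
by rewrite exprn_ege1// invf_ge1.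
Qed.

Lemma cpsi_gt0 : 0 < cpsi.
Proof.
have [a a0 da] := rad.
apply: (@Rintegral_gt0 _ a (expR (- 2)) kernel_psi) => //.
- exact: psi_ge0.
- move=> y /da y2; have y0 := dot_ge0 y.
  have [||h _] := @flat_lb (1 - dot y y); [clra|clra|].
  by rewrite /psi /flatexp ifT ?hornerC ?mul1r//; clra.
Qed.

Lemma cphi_gt0 : 0 < cphi.
Proof.
have [a a0 da] := rad.
apply: (@Rintegral_gt0 _ a (expR (- 2)) kernel_phi) => //.
- exact: phi_ge0.
- move=> y /da y2; have y0 := dot_ge0 y.
  have [||h h'] := @flat_lb (1 - dot y y); [clra|clra|].
  rewrite /phi /flatexp ifT; last by clra.
  rewrite dflatexp1 hornerXn; have := expR_gt0 (- 2 : R).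
  move: h h'; move: (expR _) (expR _) (_ ^+ 2) => p q s; cnra.
Qed.

End kernel_integrals.
Arguments cphi : clear implicits.
Arguments cpsi : clear implicits.

(** * Mean value inequalities and the maximum principle *)

Section mean_value.
Context {R : realType} {N : nat}.
Local Notation mu := (lebesgue_row R N).
Implicit Types (x y z : 'rV[R]_N) (w g : 'rV[R]_N -> R).

Definition avg w x (r : R) : R := \int[mu]_y (w (x + r *: y) * phi y).

(** The change of variables moves the radius from [w], which is merely continuous, to the smooth
    kernel; the average can then be differentiated under the integral. *)
Let scaled w x (s : R) z := w z * (s^-1 ^+ N * phi (s^-1 *: (z - x))).

Let supp_scaled (r s : R) x z : 0 < s -> s <= r -> r + `|x| < `|z| -> 1 < `|s^-1 *: (z - x)|.
Proof.
move=> s0 sr zr; rewrite normrZ gtr0_norm ?invr_gt0// mulrC ltr_pdivlMr// mul1r.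
by have := ler_normD (z - x) x; rewrite subrK; clra.
Qed.

Let continuous_scaled (p : 'rV[R]_N -> R) (s : R) x : continuous p ->
  continuous (fun z => p (s^-1 *: (z - x))).
Proof. by move=> cp; exact: (continuousT_comp (@continuous_affine _ _ s^-1 x) cp). Qed.

Let scaled_integrable w x (s : R) : continuous w -> 0 < s ->
  mu.-integrable setT (EFin \o scaled w x s).
Proof.
move=> cw s0; apply: (@integrable_continuous_supported _ _ _ (s + `|x|)).
  apply: continuous_mul => //; apply: continuous_mul; first exact: cst_continuous.
  exact: (continuous_scaled continuous_phi).
by move=> z zs; rewrite /scaled phi_supp ?mulr0//; exact: (supp_scaled s0 (lexx s)).
Qed.

Let avg_scaled w x (s : R) : continuous w -> 0 < s -> avg w x s = \int[mu]_z scaled w x s z.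
Proof.
move=> cw s0; have [_ E] := Rintegral_affine x s0 (scaled_integrable x cw s0).
have s0' : s^-1 ^+ N != 0 by rewrite gt_eqF// exprn_gt0// invr_gt0.
suff H : s^-1 ^+ N * avg w x s = s^-1 ^+ N * \int[mu]_z scaled w x s z.
  exact: (mulfI s0' H).
have i1 := kernel_mul_integrable x s kernel_phi cw.
rewrite -E /avg -(RintegralZl _ measurableT i1).
apply: eq_Rintegral => y _; rewrite /scaled addrAC subrr add0r scalerA mulVf ?gt_eqF// scale1r.
by rewrite mulrCA.
Qed.

(** Since $\nabla\psi(y)=-\phi(y)y$, one has $\Delta\psi=-N\phi-y\cdot\nabla\phi$, and this is what
    differentiating $s^{-N}\phi((z-x)/s)$ in $s$ produces, up to the factor $s^{-N-1}$. *)
Lemma is_derive_avg w x (r : R) : continuous w -> 0 < r ->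
  is_derive r 1 (avg w x) (r^-1 * \int[mu]_y (w (x + r *: y) * lpsi y)).
Proof.
move=> cw r0.
pose dF (s : R) z := w z * (s^-1 * (s^-1 ^+ N * lpsi (s^-1 *: (z - x)))).
have [Ml Ml0 hl] := kernel_bounded (@kernel_lpsi R N).
have [Mw Mw0 hw] := continuous_cube_bounded (2 * r + `|x|) cw.
have key : is_derive r 1 (fun s => \int[mu]_z scaled w x s z) (\int[mu]_z dF r z).
  apply: (@is_derive_under_Rintegral _ _ _ _ r (r / 2) (2 * r) (2 * r + `|x|)
     (Mw * ((2 / r) * ((2 / r) ^+ N * Ml)))).
  - by apply/andP; split; clra.
  - by move=> s /andP[s1 s2]; apply: scaled_integrable => //; clra.
  - move=> s z /andP[s1 s2]; have s0 : 0 < s by clra.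
    have s0' : s != 0 by rewrite gt_eqF.
    have dV : is_derive s (1 : R) (fun s : R => s^-1) (- s ^- 2).
      have := @is_deriveV R id s 1 1 s0' (is_derive_id _ _).
      by rewrite /= scaler1.
    have dVN : is_derive s (1 : R) (fun s : R => s^-1 ^+ N) (- (N%:R * s^-1 ^+ N * s^-1)).
      apply: (is_derive_eq (is_derive_expn N dV)).
      rewrite mulrN; congr (- _); rewrite expr2 invfM mulrA; congr (_ * _).
      by case: (N) => [|n]; rewrite ?mul0r//= -mulrA -exprSr.
    have dQ : is_derive s (1 : R) (fun s : R => 1 - dot (s^-1 *: (z - x)) (s^-1 *: (z - x)))
        (2 * s^-1 * dot (s^-1 *: (z - x)) (s^-1 *: (z - x))).
      have E t : dot (t^-1 *: (z - x)) (t^-1 *: (z - x)) = t^-1 * t^-1 * dot (z - x) (z - x).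
        rewrite /dot mulr_sumr; apply: eq_bigr => i _; rewrite mxE; ring.
      rewrite (_ : (fun s => _) = (fun s : R => 1 - s^-1 * s^-1 * dot (z - x) (z - x))); last first.
        by apply/funext => t; rewrite E.
      have h := is_derive_sub (is_derive_cst (1 : R) s (1 : R))
        (is_derive_mul (is_derive_mul dV dV) (is_derive_cst (dot (z - x) (z - x)) s (1 : R))).
      by apply: (is_derive_eq h); rewrite E /=; field.
    have h := is_derive_mul (is_derive_cst (w z) s (1 : R)) (is_derive_mul dVN
      (is_derive_mul (is_derive_cst (2 : R) s (1 : R)) (is_derive_comp_dir (g := (fun s : R => 1 - dot (s^-1 *: (z - x)) (s^-1 *: (z - x)))) (is_derive_flatexp _ _) dQ))).
    apply: (is_derive_eq (h _)); rewrite /dF /lpsi /phi /=.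
    set c := dot _ _; set a := flatexp (dflatexp 1) _; set b := flatexp (dflatexp _) _.
    by clearbody a b c; move: (s^-1) => q; ring.
  - move=> s z /andP[s1 s2]; have s0 : 0 < s by clra.
    have qr : 0 <= 2 / r by rewrite divr_ge0// ltW.
    have [zs|zs] := leP `|z| (2 * r + `|x|); last first.
      rewrite /dF lpsi_supp ?mulr0 ?normr0.
        by rewrite mulr_ge0// mulr_ge0// mulr_ge0// exprn_ge0.
      by apply: (supp_scaled s0 _ zs); exact: ltW.
    have sV : `|s^-1| <= 2 / r.
      by rewrite gtr0_norm ?invr_gt0// -[leRHS]invrK lef_pV2 ?posrE ?invr_gt0 ?divr_gt0// invf_div ltW.
    rewrite /dF !normrM normrX.
    have H1 : `|s^-1| ^+ N * `|lpsi (s^-1 *: (z - x))| <= (2 / r) ^+ N * Ml.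
      by apply: ler_pM; [exact: exprn_ge0|exact: normr_ge0|rewrite lerXn2r|exact: hl].
    have H2 : 0 <= `|s^-1| ^+ N * `|lpsi (s^-1 *: (z - x))| by rewrite mulr_ge0// exprn_ge0.
    have H3 := ler_pM (normr_ge0 _) H2 sV H1.
    exact: (ler_pM (normr_ge0 _) (mulr_ge0 (normr_ge0 _) H2) (hw _ zs) H3).
  - move=> s z /andP[s1 s2] zs; rewrite /dF lpsi_supp ?mulr0//.
    by apply: (supp_scaled _ _ zs); [clra|exact: ltW].
have ri : mu.-integrable setT (EFin \o (fun y => w (x + r *: y) * lpsi y)).
  by apply: kernel_mul_integrable => //; exact: kernel_lpsi.
have dFE : \int[mu]_z dF r z = r^-1 * \int[mu]_y (w (x + r *: y) * lpsi y).
  have di : mu.-integrable setT (EFin \o dF r).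
    apply: (@integrable_continuous_supported _ _ _ (r + `|x|)).
      apply: continuous_mul => //; apply: continuous_mul; first exact: cst_continuous.
      apply: continuous_mul; first exact: cst_continuous.
      exact: (continuous_scaled continuous_lpsi).
    by move=> z zs; rewrite /dF lpsi_supp ?mulr0//; exact: (supp_scaled r0 (lexx r)).
  have [_ E] := Rintegral_affine x r0 di.
  have rN : r^-1 ^+ N != 0 by rewrite gt_eqF// exprn_gt0// invr_gt0.
  suff H : r^-1 ^+ N * \int[mu]_z dF r z =
      r^-1 ^+ N * (r^-1 * \int[mu]_y (w (x + r *: y) * lpsi y)) by exact: (mulfI rN H).
  rewrite -E -(RintegralZl _ measurableT ri).
  rewrite -(RintegralZl _ measurableT (integrable_scale _ ri)).
  apply: eq_Rintegral => y _; rewrite /dF addrAC subrr add0r scalerA mulVf ?gt_eqF// scale1r.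
  by move: (w _) (lpsi _) (r^-1) => a b c; ring.
rewrite -dFE; apply: near_eq_is_derive key; near=> s.
by rewrite avg_scaled//; near: s; exact: near_gt0.
Unshelve. all: by end_near. Qed.

Lemma avg0 w x : avg w x 0 = w x * cphi R N.
Proof.
rewrite /avg /cphi -RintegralZl//; last exact: (kernel_integrable kernel_phi).
by apply: eq_Rintegral => y _; rewrite scale0r addr0.
Qed.

Lemma avg_sub w x (r c : R) : continuous w ->
  avg w x r - c * cphi R N = \int[mu]_y ((w (x + r *: y) - c) * phi y).
Proof.
move=> cw; rewrite /avg /cphi -RintegralZl//; last exact: (kernel_integrable kernel_phi).
rewrite -RintegralB//; first by apply: eq_Rintegral => y _; rewrite mulrBl.
- by apply: kernel_mul_integrable => //; exact: kernel_phi.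
- by apply: integrable_scale; exact: (kernel_integrable kernel_phi).
Qed.

Lemma continuous_avg_at0 w x : continuous w -> avg w x r @[r --> 0] --> avg w x 0.
Proof.
move=> cw; rewrite avg0; apply/cvgrPdist_le => e e0.
have K0 : 0 < \int[mu]_y `|phi y| + 1.
  by rewrite ltr_wpDl// Rintegral_ge0.
have := cw x; move/cvgrPdist_le => /(_ (e / (\int[mu]_y `|phi y| + 1))).
rewrite divr_gt0// => /(_ isT) /nbhs_ballP[d /= d0 dw].
near=> r.
rewrite distrC avg_sub// (_ : (fun y => _) =
  (fun y => (fun z => w z - w x) (x + r *: y) * phi y))//.
apply: (@le_trans _ _ (e / (\int[mu]_y `|phi y| + 1) * \int[mu]_y `|phi y|)); last first.
  rewrite mulrAC ler_pdivrMr// ler_wpM2l ?ltW//.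
  by rewrite ltrDl.
apply: (@kernel_norm_le R N (@phi R N) (fun z => w z - w x) _ x r kernel_phi).
  by apply: continuous_sub => //; exact: cst_continuous.
move=> y y1; rewrite distrC; apply: dw.
rewrite mx_norm_ball /ball_/= opprD addrA subrr add0r normrN normrZ.
apply: (@le_lt_trans _ _ `|r|); first by rewrite ler_piMr.
by near: r; exists d => //= s; rewrite /ball_/= sub0r normrN.
Unshelve. all: by end_near. Qed.

(** With [DLap], the derivative of the average at radius $s$ is $s\int g(x+sy)\psi(y)\,dy$, at most
    [cpsi R N * K * s]. Integrating from 0, where the average is [w x * cphi R N], gives the
    quadratic term. *)
Lemma avg_le w g x (r K : R) : continuous w -> continuous g -> DLap w g -> 0 < r ->
  (forall z, `|z| <= r -> g (x + z) <= K) ->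
  avg w x r <= cphi R N * w x + cpsi R N * K * r ^+ 2 / 2.
Proof.
move=> cw cg wg r0 gK.
pose h s := avg w x s - cpsi R N * K * s ^+ 2 / 2.
have dh (s : R) : 0 < s -> is_derive s (1 : R) h
    (s * \int[mu]_y (g (x + s *: y) * psi y) - cpsi R N * K * s).
  move=> s0; have h1 := is_derive_avg x cw s0.
  have h2 : is_derive s (1 : R) (fun s : R => cpsi R N * K * s ^+ 2 / 2) (cpsi R N * K * s).
    rewrite (_ : (fun s : R => _) = (fun t : R => cpsi R N * K / 2 * (t * t))); last first.
      by apply/funext => t /=; rewrite expr2; field.
    have h2 := is_derive_mul (is_derive_cst (cpsi R N * K / 2) s (1 : R))
      (is_derive_mul (is_derive_id s (1 : R)) (is_derive_id s (1 : R))).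
    by apply: (is_derive_eq h2) => /=; field.
  apply: (is_derive_eq (is_derive_sub h1 h2)).
  by rewrite wg// expr2 !mulrA mulVf ?gt_eqF// mul1r.
have h0r : h r <= h 0.
  apply: (@ler0_derive1_nincr _ h 0 r) => //; last exact: ltW.
  - by move=> s; rewrite in_itv/= => /andP[s0 _]; case: (dh s s0).
  - move=> s; rewrite in_itv/= => /andP[s0 sr]; rewrite derive1E; have := dh s s0 => ?.
    rewrite derive_val subr_le0 mulrC; apply: ler_wpM2r; first exact: ltW.
    rewrite mulrC; apply: (@kernel_le R N (@psi R N) g K x s kernel_psi psi_ge0 cg).
    move=> y y1; apply: gK; rewrite normrZ gtr0_norm// -[leRHS]mulr1 ler_pM// ltW//.
  - apply: continuous_in_subspaceT => s /set_mem/=; rewrite in_itv/= => /andP[s0 sr].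
    move: s0; rewrite le_eqVlt => /predU1P[<-|s0]; last first.
      apply: differentiable_continuous; apply/derivable1_diffP.
      by case: (dh s s0).
    apply: cvgB; first exact: continuous_avg_at0.
    apply: cvgM; last exact: cvg_cst.
    apply: cvgM; first exact: cvg_cst.
    exact: exprn_continuous.
move: h0r; rewrite /h avg0 expr0n/= !(mulr0, mul0r) subr0 lerBlDr.
by rewrite mulrC.
Qed.

Lemma DLap_scale (c : R) w g : continuous w -> continuous g -> DLap w g ->
  DLap (fun x => c * w x) (fun x => c * g x).
Proof.
move=> cw cg wg x r r0.
rewrite (kernel_scale _ _ _ kernel_lpsi cw) (kernel_scale _ _ _ kernel_psi cg).
by rewrite wg// mulrCA.
Qed.

Lemma DLap_add w g w' g' : continuous w -> continuous g -> continuous w' ->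
  continuous g' -> DLap w g -> DLap w' g' ->
  DLap (fun x => w x + w' x) (fun x => g x + g' x).
Proof.
move=> cw cg cw' cg' wg wg' x r r0.
rewrite (kernel_add _ _ kernel_lpsi cw cw') (kernel_add _ _ kernel_psi cg cg').
by rewrite mulrDr wg// wg'.
Qed.

Lemma DLap_sub w g w' g' : continuous w -> continuous g -> continuous w' ->
  continuous g' -> DLap w g -> DLap w' g' ->
  DLap (fun x => w x - w' x) (fun x => g x - g' x).
Proof.
move=> cw cg cw' cg' wg wg'.
rewrite (_ : (fun x => w x - _) = (fun x => w x + -1 * w' x)); last first.
  by apply/funext => x; rewrite mulN1r.
rewrite (_ : (fun x => g x - _) = (fun x => g x + -1 * g' x)); last first.
  by apply/funext => x; rewrite mulN1r.
apply: DLap_add => //; last exact: DLap_scale.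
- by apply: continuous_mul => //; exact: cst_continuous.
- by apply: continuous_mul => //; exact: cst_continuous.
Qed.

Lemma DLap_affine w g (b : 'rV[R]_N) (a : R) : 0 < a -> continuous g -> DLap w g ->
  DLap (fun x => w (b + a *: x)) (fun x => a ^+ 2 * g (b + a *: x)).
Proof.
move=> a0 cg wg x r r0; have := wg (b + a *: x) (a * r) (mulr_gt0 a0 r0).
have E (y : 'rV[R]_N) : b + a *: (x + r *: y) = b + a *: x + (a * r) *: y.
  by rewrite scalerDr addrA scalerA.
have -> : \int[mu]_y (w (b + a *: (x + r *: y)) * lpsi y) =
    \int[mu]_y (w (b + a *: x + (a * r) *: y) * lpsi y).
  by apply: eq_Rintegral => y _; rewrite E.
move=> ->; rewrite (kernel_scale (w := fun z => g (b + a *: z)) _ _ _ kernel_psi); last first.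
  exact: continuous_comp_line.
rewrite exprMn mulrA [r ^+ 2 * _]mulrC; congr (_ * _).
by apply: eq_Rintegral => y _; rewrite E.
Qed.

Lemma avg_opp w x (r : R) : continuous w -> avg (fun z => -1 * w z) x r = - avg w x r.
Proof.
by move=> cw; rewrite /avg (kernel_scale _ _ _ kernel_phi cw) mulN1r.
Qed.

Lemma avg_ge w g x (r K : R) : continuous w -> continuous g -> DLap w g -> 0 < r ->
  (forall z, `|z| <= r -> K <= g (x + z)) ->
  cphi R N * w x + cpsi R N * K * r ^+ 2 / 2 <= avg w x r.
Proof.
move=> cw cg wg r0 Kg.
have := @avg_le (fun z => -1 * w z) (fun z => -1 * g z) x r (- K).
rewrite avg_opp// => h; have := h _ _ (DLap_scale (-1) cw cg wg) r0 _.
rewrite !mulN1r !(mulrN, mulNr) -opprD lerN2; apply.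
- by apply: continuous_mul => //; exact: cst_continuous.
- by apply: continuous_mul => //; exact: cst_continuous.
- by move=> z zr; rewrite mulN1r lerN2 Kg.
Qed.

Lemma continuous_ball_le w x (e : R) : continuous w -> 0 < e ->
  exists2 d, 0 < d & forall z, `|z| <= d -> `|w (x + z) - w x| <= e.
Proof.
move=> cw e0; have := cw x; move/cvgrPdist_le => /(_ e e0) /nbhs_ballP[d /= d0 dw].
exists (d / 2); first by rewrite divr_gt0.
move=> z zd; rewrite distrC; apply: dw; rewrite mx_norm_ball /ball_/=.
by rewrite opprD addrA subrr add0r normrN; clra.
Qed.

(** If [g x] were positive, [avg_ge] on a small ball would put the average of [w] strictly above
    [cphi R N * w x], whereas a local maximum keeps it below. *)
Lemma max_principle w g x : continuous w -> continuous g -> DLap w g ->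
  (\forall z \near x, w z <= w x) -> g x <= 0.
Proof.
move=> cw cg wg /nbhs_ballP[d /= d0 dw]; rewrite leNgt; apply/negP => g0.
have [e e0 ge] := continuous_ball_le x cg (divr_gt0 g0 (ltr0n _ 2)).
pose r := Num.min e (d / 2).
have r0 : 0 < r by rewrite lt_min e0 divr_gt0.
have := @avg_ge w g x r (g x / 2) cw cg wg r0.
have lb : forall z, `|z| <= r -> g x / 2 <= g (x + z).
  move=> z; rewrite le_min => /andP[ze _]; have := ge _ ze.
  by rewrite ler_norml => /andP[]; clra.
have h : avg w x r <= w x * cphi R N.
  apply: (@kernel_le R N (@phi R N) w (w x) x r kernel_phi phi_ge0 cw).
  move=> y y1; apply: dw; rewrite mx_norm_ball /ball_/= opprD addrA subrr add0r normrN normrZ.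
  rewrite gtr0_norm//; apply: (@le_lt_trans _ _ r); first by rewrite ler_piMr// ltW.
  by rewrite gt_min; apply/orP; right; clra.
move=> /(_ lb); rewrite leNgt => /negP; apply.
apply: (le_lt_trans h); rewrite mulrC ltrDl.
by rewrite divr_gt0// mulr_gt0 ?exprn_gt0// mulr_gt0 ?cpsi_gt0// divr_gt0.
Qed.

End mean_value.

(** * Interior Lipschitz estimates and first derivatives *)

Section kernel_lipschitz.
Context {R : realType} {N : nat}.
Local Notation mu := (lebesgue_row R N).
Implicit Types (x y z v : 'rV[R]_N) (k w g : 'rV[R]_N -> R).

Lemma norm_dot_le x y : `|dot x y| <= N%:R * (`|x| * `|y|).
Proof.
rewrite /dot (le_trans (ler_norm_sum _ _ _))//.
have -> : N%:R * (`|x| * `|y|) = \sum_(i < N) `|x| * `|y|.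
  by rewrite sumr_const card_ord mulr_natl.
by apply: ler_sum => i _; rewrite normrM ler_pM// coord_le_norm.
Qed.

Lemma is_derive_dot x v : is_derive x v (fun z : 'rV[R]_N => dot z z) (2 * dot x v).
Proof.
have hc (i : 'I_N) : is_derive x v (fun z : 'rV[R]_N => z ord0 i) (v ord0 i).
  apply: cvg_is_derive; apply: (@cvg_near_cst _ _ _ _ (0 : R)^').
  near=> h; have h0 : h != 0 by near: h; exact: nbhs_dnbhs_neq.
  by rewrite !mxE addrK [_ *: _]mulKf.
have h (j : 'I_N) : is_derive x v
    (fun y : 'rV[R]_N => y ord0 j * y ord0 j) (v ord0 j * x ord0 j + x ord0 j * v ord0 j).
  exact: is_derive_mul.
have := @is_derive_sum _ _ _ _ _ x v _ h.
rewrite (_ : \sum_(j < N) _ = fun z => dot z z); last first.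
  by apply/funext => y; rewrite fct_sumE.
move=> H; apply: (is_derive_eq H); rewrite /dot mulr_sumr; apply: eq_bigr => j _; ring.
Unshelve. all: by end_near. Qed.

Lemma flatdot_lipschitz (p : {poly R}) : exists2 L, 0 <= L & forall y y' : 'rV[R]_N,
  `|flatexp p (1 - dot y y) - flatexp p (1 - dot y' y')| <= L * `|y - y'|.
Proof.
have cd : continuous (fun y : 'rV[R]_N => flatexp (dflatexp p) (1 - dot y y)).
  exact: (class_C_continuous (class_C_flatdot 0 _)).
have [M M0 dM] := continuous_cube_bounded 1 cd.
exists (M * (2 * N%:R)); first by rewrite !mulr_ge0.
move=> y y'; rewrite distrC [`|y - y'|]distrC.
set v := y' - y.
pose G (t : R) := flatexp p (1 - dot (y + t *: v) (y + t *: v)).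
pose dG (t : R) := flatexp (dflatexp p) (1 - dot (y + t *: v) (y + t *: v)) *
  (- (2 * dot (y + t *: v) v)).
have Gd (t : R) : is_derive t (1 : R) G (dG t).
  apply/(is_derive_line (fun z => flatexp p (1 - dot z z))).
  apply: (is_derive_comp_dir (g := fun z : 'rV[R]_N => 1 - dot z z)).
    exact: is_derive_flatexp.
  rewrite -[X in is_derive _ _ _ X]add0r.
  by apply: is_derive_sub; exact: is_derive_dot.
have [|c _ E] := @MVT _ G dG 0 1 ltr01 (fun t _ => Gd t).
  apply: continuous_subspaceT => t; apply: differentiable_continuous; apply/derivable1_diffP.
  by case: (Gd t).
have G1 : G 1 = flatexp p (1 - dot y' y') by rewrite /G scale1r /v [y + _]addrC subrK.
have G0 : G 0 = flatexp p (1 - dot y y) by rewrite /G scale0r addr0.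
rewrite -G1 -G0 E subr0 mulr1 /dG; set z := y + c *: v.
have [z1|z1] := leP `|z| 1; last first.
  by rewrite flatdot_supp// mul0r normr0 !mulr_ge0.
rewrite normrM normrN normrM (ger0_norm (ler0n _ 2)) -mulrA ler_pM ?mulr_ge0//; first exact: dM.
rewrite -mulrA ler_wpM2l// (le_trans (norm_dot_le _ _))// ler_wpM2l//.
by rewrite ler_piMl.
Qed.

Lemma psi_lipschitz : exists2 L : R, 0 <= L & forall y y' : 'rV[R]_N,
  `|psi y - psi y'| <= L * `|y - y'|.
Proof. exact: flatdot_lipschitz. Qed.

Lemma phi_lipschitz : exists2 L : R, 0 <= L & forall y y' : 'rV[R]_N,
  `|phi y - phi y'| <= L * `|y - y'|.
Proof.
have [L L0 h] := flatdot_lipschitz (dflatexp 1).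
exists (2 * L); first by rewrite mulr_ge0.
by move=> y y'; rewrite /phi -mulrBr normrM ger0_norm// -mulrA ler_wpM2l.
Qed.

Lemma in_cube (a : R) y : (y \in cube a) = (`|y| <= a).
Proof. by apply/idP/idP; rewrite inE. Qed.

Lemma integrable_indic_cube (a : R) :
  mu.-integrable setT (EFin \o (\1_(cube a) : 'rV[R]_N -> R)).
Proof.
apply: (@integrable_cube_supported _ _ _ a 1).
- by apply: measurable_indic; exact: measurable_cube.
- by move=> y; rewrite indicE; case: (_ \in _); rewrite ?normr1 ?normr0.
- by move=> y ya; rewrite indicE memNset// /cube/= leNgt ya.
Qed.

Lemma Rintegral_indic_cube (a : R) : 0 <= a ->
  \int[mu]_y (\1_(cube a) : 'rV[R]_N -> R) y = (a *+ 2) ^+ N.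
Proof.
move=> a0; rewrite /Rintegral integral_indic//; last exact: measurable_cube.
rewrite (_ : _ `&` _ = cube a) ?setIT//.
exact: (congr1 fine (@lebesgue_row_cube R N a a0)).
Qed.

(** A translation moves the increment from [w] to the Lipschitz kernel, so [w] enters only through
    its supremum. The integrand lives in two unit cubes of measure $2^N$, whence $2^{N+1}$. *)
Lemma kernel_shift_le k w (L A r : R) x x' : kernel1 k ->
  (forall y y', `|k y - k y'| <= L * `|y - y'|) -> continuous w -> 0 < r ->
  (forall z, `|z - x| <= r + `|x - x'| -> `|w z| <= A) ->
  `|\int[mu]_y (w (x + r *: y) * k y) - \int[mu]_y (w (x' + r *: y) * k y)| <=
  A * L * 2 ^+ N.+1 * (`|x - x'| / r).
Proof.
move=> hk kL cw r0 wA; have [ck ks] := hk.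
have A0 : 0 <= A.
  by apply: le_trans (wA x _); rewrite ?subrr ?normr0// addr_ge0// ltW.
set d := r^-1 *: (x - x').
have nd : `|d| = `|x - x'| / r by rewrite normrZ gtr0_norm ?invr_gt0// mulrC.
have rd : r * `|d| = `|x - x'| by rewrite nd mulrC divfK// gt_eqF.
pose f y := w (x + r *: y) * k (d + y).
have cf : continuous f.
  apply: continuous_mul; first exact: continuous_comp_line.
  apply: (@continuousT_comp 'rV[R]_N 'rV[R]_N R (fun y => d + y) k) => //.
  by have := @continuous_line R N d 1; under eq_fun do rewrite scale1r.
have fi : mu.-integrable setT (EFin \o f).
  apply: (@integrable_continuous_supported _ _ _ (1 + `|d|)) => // y yd.
  rewrite /f ks ?mulr0//.
  by have := ler_normD (d + y) (- d); rewrite addrAC subrr add0r normrN; clra.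
have [_ E] := Rintegral_shift (- d) fi.
have -> : \int[mu]_y (w (x' + r *: y) * k y) = \int[mu]_y f y.
  rewrite -E; apply: eq_Rintegral => y _; rewrite /f addNKr.
  congr (w _ * _); rewrite scalerDr addrA; congr (_ + _).
  by rewrite scalerN /d scalerA divff ?gt_eqF// scale1r opprB addrC subrK.
have ki := kernel_mul_integrable x r hk cw.
rewrite -RintegralB//.
have di := integrable_sub ki fi.
apply: (le_trans (le_normr_Rintegral measurableT di)).
have i1 := integrable_indic_cube 1.
have [i2 E2] := Rintegral_shift d i1.
have iB : mu.-integrable setT (EFin \o (fun y => A * L * (`|x - x'| / r) *
    ((\1_(cube 1) : 'rV[R]_N -> R) y + (\1_(cube 1) : 'rV[R]_N -> R) (d + y)))).
  by apply: integrable_scale; exact: integrable_add.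
apply: (@le_trans _ _ (\int[mu]_y (A * L * (`|x - x'| / r) *
    ((\1_(cube 1) : 'rV[R]_N -> R) y + (\1_(cube 1) : 'rV[R]_N -> R) (d + y))))).
  apply: le_Rintegral => //; first exact: (integrable_norm di).
  move=> y _; rewrite /f -mulrBr normrM.
  have L0 : 0 <= L * `|d|.
    by have := kL d 0; rewrite subr0; apply: le_trans.
  have AL0 : 0 <= A * L * (`|x - x'| / r) by rewrite -nd -mulrA mulr_ge0.
  have bnd : `|k y - k (d + y)| <= L * (`|x - x'| / r).
    by have := kL y (d + y); rewrite opprD addrCA subrr addr0 normrN nd.
  have prod : `|y| <= 1 \/ `|d + y| <= 1 ->
      `|w (x + r *: y)| * `|k y - k (d + y)| <= A * L * (`|x - x'| / r).
    move=> yd; rewrite -mulrA ler_pM//; apply: wA.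
    rewrite addrAC subrr add0r normrZ gtr0_norm// -rd.
    case: yd => yd; first by apply: (@le_trans _ _ (r * 1)); [rewrite ler_wpM2l// ltW|rewrite mulr1 lerDl mulr_ge0// ltW].
    have : `|y| <= 1 + `|d|.
      by have := ler_normD (d + y) (- d); rewrite addrAC subrr add0r normrN; clra.
    by rewrite -(ler_pM2l r0) mulrDr mulr1.
  rewrite !indicE !in_cube; have [y1|y1] := leP `|y| 1; have [y2|y2] := leP `|d + y| 1.
  - by apply: (le_trans (prod (or_introl y1))); rewrite ler_peMr// lerDl ler01.
  - by rewrite addr0 mulr1; exact: prod (or_introl y1).
  - by rewrite add0r mulr1; exact: prod (or_intror y2).
  - by rewrite ks// ks// subrr normr0 addr0 !mulr0.
rewrite RintegralZl//; last exact: integrable_add.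
rewrite RintegralD// E2 Rintegral_indic_cube// exprS.
rewrite le_eqVlt; apply/orP; left; apply/eqP.
have -> : (1 *+ 2 : R) = 2 by [].
by move: (2 ^+ N) (_ / r) => p q; ring.
Qed.

End kernel_lipschitz.

Section lipschitz_estimate.
Context {R : realType} {N : nat}.
Local Notation mu := (lebesgue_row R N).
Implicit Types (x y z v : 'rV[R]_N) (w g : 'rV[R]_N -> R).

Lemma avg_continuous_at w x (s : R) : continuous w -> 0 <= s ->
  avg w x r @[r --> s] --> avg w x s.
Proof.
move=> cw; rewrite le_eqVlt => /predU1P[<-|s0]; first exact: continuous_avg_at0.
apply: differentiable_continuous; apply/derivable1_diffP.
by case: (is_derive_avg x cw s0).
Qed.

(** The values of [w] are averages of radius 0. They are compared with averages of radius 1, which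
    are Lipschitz by [kernel_shift_le]. Along the way the derivative in the radius $s$ is $s$ times
    an average of [g], whose increment is of order $|x-x'|/s$: the two powers of $s$ cancel. The
    radius 4 is $1+2+1$: averaging radius, distance of the two points, distance to [x0]. *)
Lemma DLap_lipschitz : exists2 C : R, 0 <= C & forall w g x0 (A B : R),
  continuous w -> continuous g -> DLap w g ->
  (forall z, `|z - x0| <= 4 -> `|w z| <= A) ->
  (forall z, `|z - x0| <= 4 -> `|g z| <= B) ->
  forall x x', `|x - x0| <= 1 -> `|x' - x0| <= 1 ->
  `|w x - w x'| <= C * (A + B) * `|x - x'|.
Proof.
have [L1 L10 lphi] := @phi_lipschitz R N.
have [L2 L20 lpsi'] := @psi_lipschitz R N.
have c0 := @cphi_gt0 R N.
exists ((L1 + L2) * 2 ^+ N.+1 / cphi R N).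
  by rewrite divr_ge0 ?(ltW c0)// mulr_ge0 ?exprn_ge0// addr_ge0.
move=> w g x0 A B cw cg wg wA gB x x' xx0 xx0'.
have A0 : 0 <= A by apply: le_trans (wA x0 _); rewrite ?subrr ?normr0.
have B0 : 0 <= B by apply: le_trans (gB x0 _); rewrite ?subrr ?normr0.
have xx' : `|x - x'| <= 2.
  have := ler_normB (x - x0) (x' - x0); rewrite opprB addrA subrK; clra.
have near4 z (s : R) : s <= 1 -> `|z - x| <= s + `|x - x'| -> `|z - x0| <= 4.
  by move=> s1 zs; have := ler_normD (z - x) (x - x0); rewrite addrA subrK; clra.
pose m (s : R) := avg w x s - avg w x' s.
pose dm (s : R) := s * \int[mu]_y (g (x + s *: y) * psi y) - s * \int[mu]_y (g (x' + s *: y) * psi y).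
have dmP (s : R) : 0 < s -> is_derive s (1 : R) m (dm s).
  move=> s0; have h := is_derive_sub (is_derive_avg x cw s0) (is_derive_avg x' cw s0).
  apply: (is_derive_eq h); rewrite !wg// expr2 !mulrA mulVf ?gt_eqF// mul1r.
  by [].
have dm01 (s : R) : s \in `]0, 1[ -> is_derive s (1 : R) m (dm s).
  by rewrite in_itv/= => /andP[s0 _]; exact: dmP.
have [|c c01 E] := @MVT _ m dm 0 1 ltr01 dm01.
  apply: continuous_in_subspaceT => s /set_mem/=; rewrite in_itv/= => /andP[s0 _].
  rewrite /continuous_at /m; apply: cvgB; exact: avg_continuous_at.
move: c01; rewrite in_itv/= => /andP[c1 c2]; move: E; rewrite subr0 mulr1 => E.
have b1 : `|m 1| <= A * L1 * 2 ^+ N.+1 * `|x - x'|.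
  have := @kernel_shift_le R N _ w L1 A 1 x x' kernel_phi lphi cw ltr01.
  rewrite divr1; apply => z; exact: (fun h => wA _ (near4 z 1 (lexx 1) h)).
have b2 : `|dm c| <= B * L2 * 2 ^+ N.+1 * `|x - x'|.
  rewrite /dm -mulrBr normrM gtr0_norm//.
  have := @kernel_shift_le R N _ g L2 B c x x' kernel_psi lpsi' cg c1.
  move=> h; rewrite mulrC -ler_pdivlMr//.
  have -> : B * L2 * 2 ^+ N.+1 * `|x - x'| / c = B * L2 * 2 ^+ N.+1 * (`|x - x'| / c) by rewrite mulrA.
  apply: h.
  by move=> z zc; apply: gB; apply: (near4 z c _ zc); exact: ltW.
have m0 : m 0 = (w x - w x') * cphi R N by rewrite /m !avg0 mulrBl.
have b3 : `|m 0| <= (A + B) * (L1 + L2) * 2 ^+ N.+1 * `|x - x'|.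
  have -> : m 0 = m 1 - dm c by rewrite -E; ring.
  apply: (le_trans (ler_normB _ _)); apply: (le_trans (lerD b1 b2)).
  rewrite -mulrDl -mulrDl ler_wpM2r// ler_wpM2r ?exprn_ge0//; cnra.
move: b3; rewrite m0 normrM (gtr0_norm c0) -ler_pdivlMr// => b3.
by apply: (le_trans b3); rewrite le_eqVlt; apply/orP; left; apply/eqP; field; rewrite gt_eqF.
Qed.

Lemma kernel_cvg k (wn : nat -> 'rV[R]_N -> R) w x (r C : R) : kernel1 k ->
  (forall n, continuous (wn n)) ->
  (forall n y, `|y| <= 1 -> `|wn n (x + r *: y)| <= C) ->
  (forall z, wn n z @[n --> \oo] --> w z) ->
  \int[mu]_y (wn n (x + r *: y) * k y) @[n --> \oo] -->
  \int[mu]_y (w (x + r *: y) * k y).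
Proof.
move=> hk cw wC wn_w; have [ck ks] := hk.
have ki := integrable_norm (kernel_integrable hk).
have iC : mu.-integrable setT (EFin \o (fun y => C * `|k y|)) by exact: integrable_scale.
have ni n := kernel_mul_integrable x r hk (cw n).
have cv y : (fun n => (wn n (x + r *: y) * k y)%:E) @ \oo --> (w (x + r *: y) * k y)%:E.
  apply: cvg_EFin; first exact: nearW.
  by rewrite /comp/=; apply: cvgM; [exact: wn_w|exact: cvg_cst].
have bd y n : (`|(wn n (x + r *: y) * k y)%:E| <= (C * `|k y|)%:E)%E.
  rewrite lee_fin normrM; have [y1|y1] := leP `|y| 1; first by rewrite ler_wpM2r// wC.
  by rewrite ks// normr0 !mulr0.
have mlim : measurable_fun setT (fun y => (w (x + r *: y) * k y)%:E).
  apply: (emeasurable_fun_cvg (fun n y => (wn n (x + r *: y) * k y)%:E)) => [n|y _].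
    exact: measurable_int (ni n).
  exact: cv.
have [li _ lim] := @dominated_convergence _ _ _ mu setT measurableT
  (fun n y => (wn n (x + r *: y) * k y)%:E) (fun y => (w (x + r *: y) * k y)%:E)
  (EFin \o (fun y => C * `|k y|)) (fun n => measurable_int _ (ni n)) mlim
  (aeW _ (fun y _ => cv y)) iC (aeW _ (fun y n _ => bd y n)).
apply: fine_cvg; rewrite fineK; first exact: lim.
exact: (integrable_fin_num measurableT li).
Qed.

End lipschitz_estimate.

Section quasi_additive.
Context {R : realType}.

(** Up to quadratic errors [f] is additive, so the slopes $f(t)/t$ and $f(s)/s$ differ by $O(s)$
    when $t$ is much smaller than $s$, and the slopes are Cauchy. Applied to increments of
    solutions, this yields partial derivatives without assuming any. *)
Lemma quasi_additive_cvg (f : R -> R) (L A d : R) : 0 < d -> 0 <= L -> 0 <= A ->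
  (forall a b, `|a| <= d -> `|b| <= d -> `|a + b| <= d ->
     `|f (a + b) - f a - f b| <= L * (`|a| * `|b|)) ->
  (forall a, `|a| <= d -> `|f a| <= A * `|a|) ->
  exists l : R, h^-1 * f h @[h --> 0^'] --> l.
Proof.
move=> d0 L0 A0 fadd fA.
have f0 : f 0 = 0.
  have := fA 0; rewrite normr0 mulr0 => /(_ (ltW d0)).
  by rewrite normr_le0 => /eqP.
pose q t := t^-1 * f t.
have mult (t : R) (m : nat) : 0 < t -> m%:R * t <= d ->
    `|f (m%:R * t) - m%:R * f t| <= L * (t * t) * (m%:R * m%:R).
  move=> t0; elim: m => [|m IH]; first by rewrite !mul0r f0 subr0 normr0 mulr0.
  rewrite -natr1 mulrDl mul1r => mtd.
  have mt0 : 0 <= m%:R * t by rewrite mulr_ge0// ltW.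
  have m0 : 0 <= m%:R :> R by [].
  have mtd' : m%:R * t <= d by clra.
  have td : t <= d by clra.
  have t0' := ltW t0.
  have := fadd (m%:R * t) t; rewrite (ger0_norm mt0) (ger0_norm t0') (ger0_norm (addr_ge0 mt0 t0')) => h.
  have {}h := h mtd' td mtd.
  have := IH mtd'; move: h; rewrite !ler_norml => /andP[h1 h2] /andP[h3 h4].
  have h5 : 0 <= L * (t * t) by rewrite mulr_ge0// mulr_ge0// ltW.
  have h6 : 0 <= L * (t * t) * m%:R by rewrite mulr_ge0.
  have -> : L * (t * t) * ((m%:R + 1) * (m%:R + 1)) =
    L * (t * t) * (m%:R * m%:R) + 2 * (L * (t * t) * m%:R) + L * (t * t) by ring.
  have e1 : L * (m%:R * t * t) = L * (t * t) * m%:R by ring.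
  rewrite e1 in h1 h2; rewrite mulrDl mul1r.
  by apply/andP; split; clra.
have est s t : 0 < t -> t <= s -> s <= d ->
    `|q t - q s| <= L * s + L * t + 2 * A * t / s.
  move=> t0 ts sd; have s0 : 0 < s by clra.
  (* Write $s=nt+\rho$ with $0\le\rho<t$. Replacing $f(nt)$ by $nf(t)$ costs at most $Ls^2$ by
     [mult], and the remainder is controlled by the linear bound [fA]. *)
  set n := Num.truncn (s / t).
  have n1 : n%:R * t <= s.
    by rewrite -ler_pdivlMr// truncn_le// divr_ge0// ltW.
  have n2 : s < n%:R * t + t.
    by rewrite -[X in _ + X]mul1r -mulrDl natr1 -ltr_pdivrMr// truncnS_gt.
  have nd : n%:R * t <= d by clra.
  have nt0 : 0 <= n%:R * t by rewrite mulr_ge0// ltW.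
  have h1 := mult t n t0 nd.
  have := fadd (n%:R * t) (s - n%:R * t).
  have s0' := ltW s0; rewrite (_ : n%:R * t + (s - n%:R * t) = s); last by rewrite addrC subrK.
  rewrite (ger0_norm nt0) (ger0_norm s0') [`|s - _|]ger0_norm ?subr_ge0// => h2.
  have {}h2 := h2 nd ltac:(clra) sd.
  have h3 := fA (s - n%:R * t); rewrite ger0_norm ?subr_ge0// in h3.
  have {}h3 := h3 ltac:(clra).
  have h4 := fA t; rewrite (ger0_norm (ltW t0)) in h4.
  have {}h4 := h4 ltac:(clra).
  have tsp : 0 < t * s by rewrite mulr_gt0.
  have -> : q t - q s = (s * f t - t * f s) / (t * s).
    by rewrite /q; field; rewrite !gt_eqF.
  have -> : L * s + L * t + 2 * A * t / s =
      (L * s * (t * s) + L * t * (t * s) + 2 * A * t * t) / (t * s).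
    by field; rewrite !gt_eqF.
  rewrite normrM normfV (gtr0_norm tsp) ler_pM2r ?invr_gt0//.
  have e1 : L * (t * t) * (n%:R * n%:R) <= L * (s * s).
    rewrite -mulrA ler_wpM2l// (_ : t * t * _ = (n%:R * t) * (n%:R * t)); last by ring.
    by rewrite ler_pM.
  have e2 : L * (n%:R * t * (s - n%:R * t)) <= L * (s * t).
    by rewrite ler_wpM2l// ler_pM// ?subr_ge0//; clra.
  have e3 : A * (s - n%:R * t) <= A * t by rewrite ler_wpM2l//; clra.
  have -> : s * f t - t * f s = (s - n%:R * t) * f t - t * (f (n%:R * t) - n%:R * f t) -
     t * (f s - f (s - n%:R * t) - f (n%:R * t)) - t * f (s - n%:R * t) by ring.
  have k1 : `|(s - n%:R * t) * f t| <= t * (A * t).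
    by rewrite normrM ler_pM// ger0_norm ?subr_ge0//; clra.
  have h2' : `|f s - f (s - n%:R * t) - f (n%:R * t)| <= L * (s * t).
    by rewrite addrAC; apply: le_trans h2 e2.
  have k2 : `|t * (f (n%:R * t) - n%:R * f t)| <= t * (L * (s * s)).
    by rewrite normrM gtr0_norm// ler_pM2l//; exact: le_trans h1 e1.
  have k3 : `|t * (f s - f (s - n%:R * t) - f (n%:R * t))| <= t * (L * (s * t)).
    by rewrite normrM gtr0_norm// ler_pM2l.
  have k4 : `|t * f (s - n%:R * t)| <= t * (A * t).
    by rewrite normrM gtr0_norm// ler_pM2l//; exact: le_trans h3 e3.
  apply: (le_trans (ler_normB _ _)).
  apply: (le_trans (lerD (ler_normB _ _) k4)).
  apply: (le_trans (lerD (lerD (ler_normB _ _) k3) (lexx _))).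
  apply: (le_trans (lerD (lerD (lerD k1 k2) (lexx _)) (lexx _))).
  by rewrite le_eqVlt; apply/orP; left; apply/eqP; ring.
have : cvg (q @ 0^'+).
  apply: cauchy_cvg; apply: cauchy_exP => e e0.
  (* With $s$ fixed and $t\to0$, the bound [est] tends to $Ls$; this $s$ makes it a quarter of
     [e]. *)
  pose s := Num.min d (e / (4 * (L + 1))).
  have s0 : 0 < s by rewrite lt_min d0 divr_gt0// mulr_gt0//; clra.
  have Ls : L * s <= e / 4.
    have : s <= e / (4 * (L + 1)) by rewrite ge_min lexx orbT.
    rewrite ler_pdivlMr; last by clra.
    by move=> h; cnra.
  exists (q s); rewrite /= nbhs_simpl /=; near=> t.
  have t0 : 0 < t by near: t; exact: nbhs_right_gt.
  have ts : t <= s by near: t; exact: nbhs_right_le.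
  have tA : t <= e * s / (4 * (2 * A + 1)).
    by near: t; apply: nbhs_right_le; rewrite divr_gt0 ?mulr_gt0//; clra.
  rewrite /ball/= distrC; apply: (le_lt_trans (est s t t0 ts _)).
    by rewrite ge_min lexx.
  have Lt : L * t <= e / 4 by apply: (le_trans _ Ls); rewrite ler_wpM2l.
  have At : 2 * A * t / s <= e / 4.
    rewrite ler_pdivrMr//; move: tA; rewrite ler_pdivlMr; last by clra.
    by move=> h; cnra.
  clra.
move=> /cvg_ex[l ql]; exists l; apply/cvgrPdist_le => e e0.
have e2 : 0 < e / 2 by clra.
move/cvgrPdist_le : ql => /(_ _ e2)[d1 /= d10 hd1].
near=> h.
have h0 : h != 0 by near: h; exact: nbhs_dnbhs_neq.
have hs : `|h| < Num.min d1 (Num.min d (e / (2 * (L + 1)))).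
  near: h; apply: dnbhs0_lt; rewrite !lt_min d10 d0 divr_gt0//; clra.
move: hs; rewrite !lt_min => /and3P[hd1' hd' hL].
have [hp|hn] := ltP 0 h.
  by apply: (le_trans (hd1 h _ hp)); [rewrite /= sub0r normrN|clra].
have {}hn : 0 < - h by rewrite oppr_gt0 lt_neqAle h0.
have h1 : `|l - q (- h)| <= e / 2 by apply: hd1 => //=; rewrite sub0r normrN normrN.
(* Quasi-additivity for the pair $h,-h$ makes $f(h)+f(-h)$ quadratic in $h$, so slopes on the left
   follow those on the right. *)
have h2 : `|q (- h) - q h| <= L * `|h|.
  have := fadd h (- h); rewrite subrr normr0 normrN f0 sub0r => /(_ (ltW hd') (ltW hd') (ltW d0)) h2.
  rewrite /q invrN mulNr -mulrN -mulrBr normrM normfV mulrC ler_pdivrMr ?normr_gt0//.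
  by rewrite -mulrA addrC.
rewrite (_ : l - _ = (l - q (- h)) + (q (- h) - q h)); last by rewrite /q; ring.
apply: (le_trans (ler_normD _ _)); apply: (le_trans (lerD h1 h2)).
move: hL; rewrite ltr_pdivlMr; last by clra.
by move=> hL; have := normr_ge0 h; cnra.
Unshelve. all: by end_near. Qed.

End quasi_additive.

Section distributional_limits.
Context {R : realType} {N : nat}.
Local Notation mu := (lebesgue_row R N).
Implicit Types (x y z v : 'rV[R]_N) (w g : 'rV[R]_N -> R).

Definition loc_unif (T : Type) (F : set_system T) (wn : T -> 'rV[R]_N -> R) w :=
  forall K d : R, 0 < d -> \forall t \near F, forall x, `|x| <= K -> `|wn t x - w x| <= d.

Lemma DLap_limit (T : Type) (F : set_system T) (FF : ProperFilter F)
    (wn gn : T -> 'rV[R]_N -> R) w g :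
  (\forall t \near F, [/\ continuous (wn t), continuous (gn t) & DLap (wn t) (gn t)]) ->
  continuous w -> continuous g -> loc_unif F wn w -> loc_unif F gn g -> DLap w g.
Proof.
move=> nF cw cg wu gu x r r0; apply/eqP; rewrite -subr_eq0 -normr_le0 leNgt; apply/negP.
set e := `|_| => e0.
set S1 := \int[mu]_y `|lpsi y|; set S2 := \int[mu]_y `|psi y|.
have S10 : 0 <= S1 by exact: Rintegral_ge0.
have S20 : 0 <= S2 by exact: Rintegral_ge0.
have r2 : 0 < r ^+ 2 by rewrite exprn_gt0.
pose d := e / (2 * (S1 + r ^+ 2 * S2 + 1)).
have den : 0 < 2 * (S1 + r ^+ 2 * S2 + 1) by cnra.
have d0 : 0 < d by rewrite divr_gt0.
have := filter_ex (filterI nF (filterI (wu (`|x| + r) d d0) (gu (`|x| + r) d d0))).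
move=> [t [[cwt cgt wgt] [wt gt]]].
have xr y : `|y| <= 1 -> `|x + r *: y| <= `|x| + r.
  move=> y1; apply: (le_trans (ler_normD _ _)); rewrite lerD2l normrZ gtr0_norm//.
  by rewrite ler_piMr// ltW.
have h1 := @kernel_norm_le R N _ _ d x r kernel_lpsi (continuous_sub cwt cw)
  (fun y hy => wt _ (xr y hy)).
have h2 := @kernel_norm_le R N _ _ d x r kernel_psi (continuous_sub cgt cg)
  (fun y hy => gt _ (xr y hy)).
have E k (f f' : 'rV[R]_N -> R) : kernel1 k -> continuous f -> continuous f' ->
    \int[mu]_y ((f (x + r *: y) - f' (x + r *: y)) * k y) =
    \int[mu]_y (f (x + r *: y) * k y) - \int[mu]_y (f' (x + r *: y) * k y).
  move=> hk cf cf'; rewrite -RintegralB//; try exact: kernel_mul_integrable.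
  by apply: eq_Rintegral => y _; rewrite mulrBl.
rewrite E// in h1; last exact: kernel_lpsi.
rewrite E// in h2; last exact: kernel_psi.
rewrite wgt// in h1.
have : e <= d * S1 + r ^+ 2 * (d * S2).
  rewrite /e; move: h1 h2; set a := \int[mu]_y (w _ * _); set b := \int[mu]_y (g _ * _).
  set c := \int[mu]_y (gn _ _ * _) => h1 h2.
  rewrite (_ : a - r ^+ 2 * b = - (r ^+ 2 * c - a) + r ^+ 2 * (c - b)); last by ring.
  apply: (le_trans (ler_normD _ _)); rewrite normrN lerD// normrM gtr0_norm//.
  by rewrite ler_pM2l.
rewrite leNgt => /negP; apply.
have -> : d * S1 + r ^+ 2 * (d * S2) = d * (S1 + r ^+ 2 * S2) by ring.
rewrite /d mulrAC ltr_pdivrMr//; cnra.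
Qed.

Lemma class_C2_DLap w : class_C 2 w -> DLap w (laplacian w).
Proof.
move=> w2 x r r0.
have r0' : r != 0 by rewrite gt_eqF.
pose f y := w (r *: (y - - (r^-1 *: x))).
have fE y : w (x + r *: y) = f y.
  by rewrite /f opprK scalerDr scalerA divff// scale1r addrC.
have f2 : class_C 2 f by exact: class_C_affine.
have w1 : class_C 1 w by exact: class_CW.
have dfE i y : partial i (partial i f) y = r ^+ 2 * partial i (partial i w) (x + r *: y).
  rewrite /f partial_affine//.
  have h := class_C_is_derive i (r *: (y - - (r^-1 *: x))) (class_C_partial i w2).
  have h' := is_derive_mul (is_derive_cst r y (delta_mx ord0 i)) (is_derive_affine h).
  rewrite (partialE h') mul0r add0r /= expr2 -mulrA; congr (_ * (_ * partial _ _ _)).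
  by rewrite opprK scalerDr scalerA divff// scale1r addrC.
have cl : continuous (laplacian w).
  have : class_C 0 (laplacian w).
    by apply: class_C_sum => i; do 2 apply: class_C_partial.
  exact: class_C_continuous.
have ip i : mu.-integrable setT (EFin \o (fun y => f y * partial i (partial i psi) y)).
  have p2 : class_C 2 (psi : 'rV[R]_N -> R) by exact: class_C_psi.
  have ct := class_C_continuous (class_C_partial i (class_C_partial i p2)).
  apply: (@integrable_continuous_supported _ _ _ 1).
    by apply: continuous_mul => //; exact: (class_C_continuous f2).
  move=> y y1; rewrite /partial (is_derive_eq0 _ (k := 1)) ?mulr0// => z z1.
  by apply: (is_derive_eq0 _ (k := 1)) => // z' z'1; exact: psi_supp.
have iq i : mu.-integrable setT (EFin \o (fun y => partial i (partial i f) y * psi y)).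
  apply: (@integrable_continuous_supported _ _ _ 1).
    apply: continuous_mul; last exact: continuous_psi.
    exact: (class_C_continuous (class_C_partial i (class_C_partial i f2))).
  by move=> y y1; rewrite psi_supp// mulr0.
have -> : \int[mu]_y (w (x + r *: y) * lpsi y) =
    \int[mu]_y (\sum_i f y * partial i (partial i psi) y).
  by apply: eq_Rintegral => y _; rewrite -laplacian_psi /laplacian mulr_sumr -fE.
have -> : r ^+ 2 * \int[mu]_y (laplacian w (x + r *: y) * psi y) =
    \int[mu]_y (\sum_i partial i (partial i f) y * psi y).
  rewrite -(RintegralZl _ measurableT (kernel_mul_integrable x r kernel_psi cl)).
  apply: eq_Rintegral => y _; rewrite /laplacian mulr_suml mulr_sumr.
  by apply: eq_bigr => i _; rewrite dfE mulrA.
rewrite (Rintegral_sum _ ip).2 (Rintegral_sum _ iq).2; apply: eq_bigr => i _.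
have p1 : class_C 1 (psi : 'rV[R]_N -> R) by exact: class_C_psi.
have p2 := class_C_partial i (class_C_psi 2 : class_C 2 (psi : 'rV[R]_N -> R)).
rewrite (Rintegral_by_parts (k := 1) i (class_CW f2) p2); last first.
  by move=> z z1; apply: (is_derive_eq0 _ (k := 1)) => // z' z'1; exact: psi_supp.
rewrite (Rintegral_by_parts (k := 1) i (class_C_partial i f2) p1) ?opprK//.
by move=> z z1; exact: psi_supp.
Qed.

End distributional_limits.

Lemma cvg_limit_le (R : realType) (T : Type) (F : set_system T) {FF : ProperFilter F}
    (f : T -> R) (l c : R) :
  f t @[t --> F] --> l -> (\forall t \near F, f t <= c) -> l <= c.
Proof.
move=> fl fc; rewrite leNgt; apply/negP => cl.
have [t [h1 h2]] := filter_ex (filterI (cvgr_gt l fl c cl) fc).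
by have := le_lt_trans h2 h1; rewrite ltxx.
Qed.

Section directional.
Context {R : realType} {N : nat}.
Local Notation mu := (lebesgue_row R N).
Implicit Types (x y z v : 'rV[R]_N) (w g f : 'rV[R]_N -> R).
Local Notation e_ i := (delta_mx ord0 i : 'rV[R]_N).

Lemma near_norm_le x (e : R) : 0 < e -> \forall z \near x, `|z - x| <= e.
Proof.
move=> e0; have /cvgrPdist_le/(_ e e0) : z @[z --> x] --> x by exact: cvg_id.
by apply: filterS => z; rewrite distrC.
Qed.

Lemma continuous_ballP w : (forall x (e : R), 0 < e ->
  exists2 d, 0 < d & forall z, `|z - x| <= d -> `|w x - w z| <= e) -> continuous w.
Proof.
move=> h x; apply/(@cvgrPdist_le R R 'rV[R]_N (nbhs x) _ w (w x)) => e e0.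
have [d d0 hd] := h x e e0.
exact: filterS hd (near_norm_le x d0).
Qed.

Lemma norm_basis i : `|e_ i| <= 1.
Proof.
apply/normrv_leP => // j; rewrite mxE eqxx/=.
by case: (_ == _); rewrite ?normr1 ?normr0.
Qed.

Lemma norm_scale_basis i (t : R) : `|t *: e_ i| <= `|t|.
Proof. by rewrite normrZ ler_piMr// norm_basis. Qed.

Lemma mvt_segment (G dG : R -> R) (L : R) :
  (forall t, is_derive t (1 : R) G (dG t)) -> (forall t, 0 <= t <= 1 -> `|dG t| <= L) ->
  `|G 1 - G 0| <= L.
Proof.
move=> Gd dL.
have [|c c01 E] := @MVT _ G dG 0 1 ltr01 (fun t _ => Gd t).
  apply: continuous_subspaceT => t; apply: differentiable_continuous; apply/derivable1_diffP.
  by case: (Gd t).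
rewrite E subr0 mulr1; apply: dL; move: c01; rewrite in_itv/= => /andP[c1 c2].
by rewrite !ltW.
Qed.

Lemma partial_increment f i z (t L : R) : (forall x, derivable f x (e_ i)) ->
  (forall s : R, `|s| <= `|t| -> `|partial i f (z + s *: e_ i)| <= L) ->
  `|f (z + t *: e_ i) - f z| <= L * `|t|.
Proof.
move=> fd fL; pose G (s : R) := f (z + (t * s) *: e_ i).
pose dG (s : R) := partial i f (z + (t * s) *: e_ i) * t.
have h0 (u : R) : is_derive u (1 : R) (fun s => f (z + s *: e_ i)) (partial i f (z + u *: e_ i)).
  by apply/is_derive_line; apply: DeriveDef; [exact: fd|].
have Gd (s : R) : is_derive s (1 : R) G (dG s).
  apply: (is_derive_comp_dir (f := fun s => f (z + s *: e_ i)) (g := fun s : R => t * s)) => //.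
  have h := is_derive_mul (is_derive_cst t s 1) (is_derive_id s (1 : R)).
  by apply: (is_derive_eq h); rewrite /cst mul0r add0r mulr1.
have := @mvt_segment G dG (L * `|t|) Gd.
rewrite /G mulr1 mulr0 scale0r addr0; apply => s /andP[s0 s1].
rewrite /dG normrM ler_wpM2r//; apply: fL.
by rewrite normrM ler_piMr// ger0_norm.
Qed.

Lemma partial_cvg f i x : derivable f x (e_ i) ->
  h^-1 * (f (x + h *: e_ i) - f x) @[h --> 0^'] --> partial i f x.
Proof.
move=> fd.
have fd' : is_derive x (e_ i) f (partial i f x) by exact: DeriveDef.
have := is_derive_cvg fd'.
by under eq_fun do rewrite [_ *: e_ i + x]addrC.
Qed.

Lemma partial_norm_le f i x (L d : R) : 0 < d -> derivable f x (e_ i) ->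
  (forall t : R, `|t| <= d -> `|f (x + t *: e_ i) - f x| <= L * `|t|) ->
  `|partial i f x| <= L.
Proof.
move=> d0 fd fL; have /cvg_norm h := partial_cvg fd.
refine (cvg_limit_le h _).
near=> t; have t0 : t != 0 by near: t; exact: nbhs_dnbhs_neq.
rewrite /= normrM normfV mulrC ler_pdivrMr ?normr_gt0//; apply: fL.
by apply: ltW; near: t; exact: dnbhs0_lt.
Unshelve. all: by end_near. Qed.

Lemma DLap_shift w g (b : 'rV[R]_N) : continuous g -> DLap w g ->
  DLap (fun z => w (z + b)) (fun z => g (z + b)).
Proof.
move=> cg wg; have := DLap_affine b ltr01 cg wg.
have E (f : 'rV[R]_N -> R) : (fun x => f (b + 1 *: x)) = (fun x => f (x + b)).
  by apply/funext => x; rewrite scale1r addrC.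
rewrite E (_ : (fun x => 1 ^+ 2 * _) = (fun z => g (z + b)))//.
by apply/funext => x; rewrite expr1n mul1r scale1r addrC.
Qed.

Lemma continuous_translate w (b : 'rV[R]_N) : continuous w -> continuous (fun z => w (z + b)).
Proof.
move=> cw; have := @continuous_comp_line R N w b 1 cw.
by under eq_fun do rewrite scale1r addrC.
Qed.

Definition locally_lipschitz_dir i g := forall K : R, exists2 L : R, 0 <= L &
  forall z (t : R), `|z| <= K -> `|t| <= 1 -> `|g (z + t *: e_ i) - g z| <= L * `|t|.

(** The increment of [w] along [e_ i] satisfies [DLap] with the increment of [g], and both are
    $O(t)$. A second use of [DLap_lipschitz], now on this increment, gives the bilinear bound that
    quasi-additivity requires. *)
Lemma DLap_increment_lipschitz w g i x : continuous w -> continuous g -> DLap w g ->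
  locally_lipschitz_dir i g -> exists2 L : R, 0 <= L & forall z z' (t : R),
    `|z - x| <= 1 -> `|z' - x| <= 1 -> `|t| <= 1 ->
    `|w (z + t *: e_ i) - w z| <= L * `|t| /\
    `|(w (z + t *: e_ i) - w z) - (w (z' + t *: e_ i) - w z')| <= L * (`|t| * `|z - z'|).
Proof.
move=> cw cg wg gl; have [C C0 hC] := @DLap_lipschitz R N.
have [A A0 wA] := continuous_cube_bounded (`|x| + 8) cw.
have [B B0 gB] := continuous_cube_bounded (`|x| + 8) cg.
have [Lg Lg0 hg] := gl (`|x| + 4).
have nx z : `|z| <= `|z - x| + `|x| by rewrite -[in leLHS](subrK x z); exact: ler_normD.
have step z (t : R) : `|z - x| <= 4 -> `|t| <= 1 -> `|w (z + t *: e_ i) - w z| <= C * (A + B) * `|t|.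
  move=> zx t1; have nt := norm_scale_basis i t.
  have b4 y : `|y - z| <= 4 -> `|y| <= `|x| + 8.
    by move=> yz; have := ler_normD (y - z) (z - x); rewrite addrA subrK; have := nx y; clra.
  have := hC w g z A B cw cg wg (fun y hy => wA y (b4 y hy)) (fun y hy => gB y (b4 y hy)) (z + t *: e_ i) z.
  rewrite [z + _]addrC addrK subrr normr0 => /(_ (le_trans nt t1) ler01) h.
  by apply: (le_trans h); rewrite ler_wpM2l// mulr_ge0// addr_ge0.
have CAB : 0 <= C * (A + B) by rewrite mulr_ge0// addr_ge0.
exists (C * (A + B) + C * (C * (A + B) + Lg)).
  by rewrite addr_ge0// mulr_ge0// addr_ge0.
move=> z z' t zx zx' t1; split.
  apply: (le_trans (step z t _ t1)); first by clra.
  by rewrite ler_wpM2r// lerDl mulr_ge0// addr_ge0.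
have := hC (fun z => w (z + t *: e_ i) - w z) (fun z => g (z + t *: e_ i) - g z) x
  (C * (A + B) * `|t|) (Lg * `|t|).
have cwt := continuous_translate (b := t *: e_ i) cw; have cgt := continuous_translate (b := t *: e_ i) cg.
move=> /(_ (continuous_sub cwt cw) (continuous_sub cgt cg)).
move=> /(_ (DLap_sub cwt cgt cw cg (DLap_shift _ cg wg) wg)).
move=> /(_ (fun y hy => step y t hy t1)) h.
have {}h := h ltac:(move=> y hy; apply: hg => //; have := nx y; clra) z z' zx zx'.
apply: (le_trans h); rewrite -mulrDl mulrA [_ * (`|t| * _)]mulrA ler_wpM2r//.
by rewrite ler_wpM2r// lerDr.
Qed.

(** Existence comes from [quasi_additive_cvg] applied to $t\mapsto w(x+te_i)-w(x)$. Dividing the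
    same bilinear bound by $t$ and passing to the limit makes the derivative locally Lipschitz,
    hence continuous. *)
Lemma partial_exists w g i : continuous w -> continuous g -> DLap w g ->
  locally_lipschitz_dir i g ->
  (forall x, derivable w x (e_ i)) /\ continuous (partial i w).
Proof.
move=> cw cg wg gl.
have dw x : derivable w x (e_ i).
  have [L L0 hL] := DLap_increment_lipschitz x cw cg wg gl.
  pose f (t : R) := w (x + t *: e_ i) - w x.
  have x1 : `|x - x| <= 1 by rewrite subrr normr0.
  have [||l fl] := @quasi_additive_cvg R f L L 1 ltr01 L0 L0.
  - move=> a b a1 b1 ab1.
    have ax : `|(x + a *: e_ i) - x| <= 1.
      by rewrite addrC addKr; exact: le_trans (norm_scale_basis i a) a1.
    have [_] := hL _ _ b ax x1 b1.
    have -> : x + a *: e_ i + b *: e_ i = x + (a + b) *: e_ i by rewrite -addrA -scalerDl.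
    have -> : f (a + b) - f a - f b = w (x + (a + b) *: e_ i) - w (x + a *: e_ i) - (w (x + b *: e_ i) - w x).
      by rewrite /f; ring.
    move=> h; apply: (le_trans h); rewrite ler_wpM2l// mulrC ler_wpM2r//.
    by rewrite addrC addKr norm_scale_basis.
  - by move=> a a1; have [] := hL x x a x1 x1 a1.
  apply/cvg_ex; exists l; move: fl; rewrite /f.
  by under eq_fun do rewrite [x + _]addrC.
split=> //; apply: continuous_ballP => x e e0.
have [L L0 hL] := DLap_increment_lipschitz x cw cg wg gl.
have x1 : `|x - x| <= 1 by rewrite subrr normr0.
have d0 : 0 < Num.min 1 (e / (L + 1)) by rewrite lt_min ltr01 divr_gt0//; clra.
exists (Num.min 1 (e / (L + 1))) => // z; rewrite le_min => /andP[zx zL].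
rewrite distrC.
have h : (h^-1 * (w (z + h *: e_ i) - w z) - h^-1 * (w (x + h *: e_ i) - w x)) @[h --> 0^'] -->
  partial i w z - partial i w x by apply: cvgB; exact: partial_cvg.
have {h}/cvg_norm h := h.
refine (cvg_limit_le h _).
near=> t; have t0 : t != 0 by near: t; exact: nbhs_dnbhs_neq.
have t1 : `|t| <= 1 by apply: ltW; near: t; exact: dnbhs0_lt.
have [_] := hL z x t zx x1 t1.
move=> h2; rewrite /= -mulrBr normrM normfV mulrC ler_pdivrMr ?normr_gt0//.
apply: (le_trans h2); rewrite mulrCA [_ * (L * _)]mulrC ler_wpM2r//.
move: zL; rewrite ler_pdivlMr; last by clra.
by move=> h3; have := normr_ge0 (z - x); cnra.
Unshelve. all: by end_near. Qed.

Lemma continuous_partial_lipschitz g i : (forall x, derivable g x (e_ i)) ->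
  continuous (partial i g) -> locally_lipschitz_dir i g.
Proof.
move=> dg cg K; have [L L0 hL] := continuous_cube_bounded (K + 1) cg.
exists L => // z t zK t1; apply: partial_increment => // s st; apply: hL.
by apply: (le_trans (ler_normD _ _)); have := norm_scale_basis i s; clra.
Qed.

Lemma DLap_partial w g i : continuous w -> continuous g -> DLap w g ->
  (forall x, derivable g x (e_ i)) -> continuous (partial i g) ->
  DLap (partial i w) (partial i g).
Proof.
move=> cw cg wg dg cdg.
have [dw cdw] := partial_exists cw cg wg (continuous_partial_lipschitz dg cdg).
move=> x r r0.
pose h (n : nat) : R := n.+1%:R^-1.
have h0 n : 0 < h n by rewrite invr_gt0.
have h1 n : h n <= 1 by rewrite invf_le1// ler1n.
have hh : h n @[n --> \oo] --> 0 by exact: cvg_harmonic.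
pose D (f : 'rV[R]_N -> R) n z := (h n)^-1 * (f (z + h n *: e_ i) - f z).
have Dc f n : continuous f -> continuous (D f n).
  move=> cf; apply: continuous_mul; first exact: cst_continuous.
  by apply: continuous_sub => //; exact: continuous_translate.
have key f k : kernel1 k -> continuous f -> (forall x, derivable f x (e_ i)) ->
    continuous (partial i f) ->
    \int[mu]_y (D f n (x + r *: y) * k y) @[n --> \oo] -->
    \int[mu]_y (partial i f (x + r *: y) * k y).
  move=> hk cf df cdf; have [L L0 hL] := continuous_partial_lipschitz df cdf (`|x| + r).
  apply: (@kernel_cvg R N k (D f) (partial i f) x r L hk).
  - by move=> n; exact: Dc.
  - move=> n y y1; rewrite /D normrM normfV mulrC ler_pdivrMr ?normr_gt0 ?gt_eqF//.
    apply: hL; last by rewrite gtr0_norm.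
    apply: (le_trans (ler_normD _ _)); rewrite lerD2l normrZ gtr0_norm//.
    by rewrite ler_piMr// ltW.
  - by move=> z; apply: ((cvgr_dnbhsP _ _ _).1 (partial_cvg (df z)) h) => //; split=> // n; rewrite gt_eqF.
have l1 := key _ _ kernel_lpsi cw dw cdw.
have l2 := cvgM (cvg_cst (r ^+ 2)) (key _ _ kernel_psi cg dg cdg).
apply: (@cvg_unique _ (@Rhausdorff R) _ _ _ _ l1).
rewrite (_ : (fun n => _) = (fun n => r ^+ 2 * \int[mu]_y (D g n (x + r *: y) * psi y))); first exact: l2.
apply/funext => n.
have cwn := continuous_translate (b := h n *: e_ i) cw; have cgn := continuous_translate (b := h n *: e_ i) cg.
have := DLap_scale (h n)^-1 (continuous_sub cwn cw) (continuous_sub cgn cg)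
  (DLap_sub cwn cgn cw cg (DLap_shift _ cg wg) wg).
by move=> /(_ x r r0) ->.
Qed.

End directional.

(** * Barriers, decay, and simplicity of ground states *)

Section barriers.
Context {R : realType} {N : nat}.
Local Notation mu := (lebesgue_row R N).
Implicit Types (x y z : 'rV[R]_N) (w g f : 'rV[R]_N -> R).
Local Notation e_ i := (delta_mx ord0 i : 'rV[R]_N).

Lemma cube_max f (k : R) : continuous f -> 0 <= k ->
  exists2 z, `|z| <= k & forall x, `|x| <= k -> f x <= f z.
Proof.
move=> cf k0; have [|z /set_mem zk zm] := @EVT_max_rV R N f (cube k) _ (@cube_compact R N k) (continuous_subspaceT cf).
  by exists 0; rewrite /cube/= normr0.
by exists z => // x xk; apply: zm; rewrite in_cube.
Qed.

Lemma near_row x (P : 'rV[R]_N -> Prop) : (forall z, P z) -> \forall z \near x, P z.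
Proof. by move=> h; apply: filterS (near_norm_le x ltr01) => z _. Qed.

Lemma DLap_sum (I : Type) (s : seq I) (F G : I -> 'rV[R]_N -> R) :
  (forall i, [/\ continuous (F i), continuous (G i) & DLap (F i) (G i)]) ->
  DLap (fun x => \sum_(i <- s) F i x) (fun x => \sum_(i <- s) G i x).
Proof.
move=> h x r r0.
have E (K : I -> 'rV[R]_N -> R) k : kernel1 k -> (forall i, continuous (K i)) ->
    \int[mu]_y ((\sum_(i <- s) K i (x + r *: y)) * k y) =
    \sum_(i <- s) \int[mu]_y (K i (x + r *: y) * k y).
  move=> hk cK; rewrite -(Rintegral_sum _ (fun i => kernel_mul_integrable x r hk (cK i))).2.
  by apply: eq_Rintegral => y _; rewrite mulr_suml.
rewrite (E _ _ kernel_lpsi) ?(E _ _ kernel_psi); try by move=> i; case: (h i).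
by rewrite mulr_sumr; apply: eq_bigr => i _; case: (h i) => _ _; apply.
Qed.

Definition expcoord (c : 'rV[R]_N) (s : R) (i : 'I_N) z : R := expR (s * (z ord0 i - c ord0 i)).

Lemma class_C_expcoord m c s i : class_C m (expcoord c s i).
Proof.
apply: class_C_expR; apply: class_C_mul; first exact: class_C_cst.
by apply: class_C_add; [exact: class_C_coord|exact: class_C_cst].
Qed.

Lemma is_derive_expcoord c s i j z :
  is_derive z (e_ j) (expcoord c s i) (s * (j == i)%:R * expcoord c s i z).
Proof.
have h0 : is_derive z (e_ j) (fun y => y ord0 i - c ord0 i) ((j == i)%:R - 0).
  exact (is_derive_sub (is_derive_coord i j z) (is_derive_cst (c ord0 i) z (e_ j))).
have h1 := is_derive_mul (is_derive_cst s z (e_ j)) h0.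
have h := is_derive_comp_dir (g := fun y : 'rV[R]_N => s * (y ord0 i - c ord0 i)) (is_derive_expR _) h1.
by apply: (is_derive_eq h); rewrite /cst mul0r add0r subr0 mulrC.
Qed.

Lemma DLap_expcoord c s i : s ^+ 2 = 1 -> DLap (expcoord c s i) (expcoord c s i).
Proof.
move=> s1; have := class_C2_DLap (class_C_expcoord 2 c s i).
rewrite (_ : laplacian _ = expcoord c s i)//; apply/funext => z.
have E j : partial j (expcoord c s i) = (fun y => s * (j == i)%:R * expcoord c s i y).
  by apply/funext => y; apply: partialE; exact: is_derive_expcoord.
rewrite /laplacian (bigD1 i)//= big1 ?addr0 => [|j ji].
  rewrite E eqxx mulr1; apply: partialE.
  have h := is_derive_mul (is_derive_cst s z (e_ i)) (is_derive_expcoord c s i i z).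
  apply: (is_derive_eq h); rewrite /cst mul0r add0r eqxx mulr1 mulrA -expr2 s1 mul1r//.
rewrite E (negbTE ji) mulr0 (_ : (fun y => _) = cst 0); first exact: derive_cst.
by apply/funext => y; rewrite mul0r.
Qed.

(** The function $2\sum_i\cosh(z_i-c_i)$, equal to its own Laplacian. It is adapted to the sup norm:
    at least $e^L$ on the boundary of the cube of radius $L$, and $2N$ at the centre. *)
Definition cosh_sum c z : R := \sum_i (expcoord c 1 i z + expcoord c (-1) i z).

Lemma continuous_cosh_sum c : continuous (cosh_sum c).
Proof.
have h : class_C 0 (cosh_sum c).
  by apply: class_C_sum => i; apply: class_C_add; exact: class_C_expcoord.
exact: class_C_continuous h.
Qed.

Lemma DLap_cosh_sum c : DLap (cosh_sum c) (cosh_sum c).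
Proof.
have ce s i := class_C_continuous (class_C_expcoord 0 c s i).
apply: DLap_sum => i.
have c2 : continuous (fun x => expcoord c 1 i x + expcoord c (-1) i x) by exact: continuous_add.
by split => //; apply: DLap_add => //; apply: DLap_expcoord; rewrite ?sqrrN expr1n.
Qed.

Lemma cosh_sum_ge c z (L : R) : 0 < L -> L <= `|z - c| -> expR L <= cosh_sum c z.
Proof.
move=> L0 Lz; have [i hi] : exists i, L <= `|(z - c) ord0 i|.
  have [//|hn] := pselect (exists i, L <= `|(z - c) ord0 i|).
  have : `|z - c| < L.
    by apply/(normrv_ltP _ L0) => i; rewrite ltNge; apply/negP => h; apply: hn; exists i.
  by rewrite ltNge Lz.
have hp s j : 0 <= expcoord c s j z by exact: expR_ge0.
rewrite /cosh_sum (bigD1 i)//=.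
have S0 : 0 <= \sum_(j < N | j != i) (expcoord c 1 j z + expcoord c (-1) j z).
  by apply: sumr_ge0 => j _; rewrite addr_ge0.
suff : expR L <= expcoord c 1 i z + expcoord c (-1) i z by clra.
move: hi; rewrite !mxE /expcoord mul1r mulN1r; set a := _ - _.
have [a0|a0] := leP 0 a.
  by rewrite ger0_norm// => h; rewrite (le_trans (_ : _ <= expR a)) ?ler_expR// lerDl expR_ge0.
by rewrite ltr0_norm// => h; rewrite (le_trans (_ : _ <= expR (- a))) ?ler_expR// lerDr expR_ge0.
Qed.

Lemma cosh_sum_center c : cosh_sum c c = N%:R * 2.
Proof.
rewrite /cosh_sum (eq_bigr (fun=> 2)) ?sumr_const ?card_ord ?mulr_natl// => i _.
by rewrite /expcoord subrr !mulr0 expR0.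
Qed.

Lemma interior_max_principle w g (c z : 'rV[R]_N) (L : R) : continuous w -> continuous g -> DLap w g ->
  `|z - c| < L -> (forall x, `|x - c| <= L -> w x <= w z) -> g z <= 0.
Proof.
move=> cw cg wg zL zm; apply: (max_principle cw cg wg).
have d0 : 0 < L - `|z - c| by rewrite subr_gt0.
apply: filterS (near_norm_le z d0) => x xz; apply: zm.
by have := ler_normD (x - z) (z - c); rewrite addrA subrK; clra.
Qed.

(** Comparison with [k * cosh_sum c], where $k=Me^{-L}$ makes the barrier at least $M$ on the
    boundary of the cube. At an interior positive maximum of the difference, [w <= g] contradicts
    the maximum principle. *)
Lemma decay_barrier w g (c : 'rV[R]_N) (L M : R) : continuous w -> continuous g -> DLap w g ->
  0 < L -> 0 <= M -> (forall z, `|z - c| <= L -> w z <= M) ->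
  (forall z, `|z - c| <= L -> 0 < w z -> w z <= g z) ->
  w c <= M * (N%:R * 2) * expR (- L).
Proof.
move=> cw cg wg L0 M0 wM wgz.
pose k := M * expR (- L); have k0 : 0 <= k by rewrite mulr_ge0 ?expR_ge0.
pose m z := w z - k * cosh_sum c z.
have ckh : continuous (fun z => k * cosh_sum c z).
  by apply: continuous_mul; [exact: cst_continuous|exact: continuous_cosh_sum].
have cm : continuous m by exact: continuous_sub.
have cg' : continuous (fun z => g z - k * cosh_sum c z) by exact: continuous_sub.
have mg : DLap m (fun z => g z - k * cosh_sum c z).
  apply: DLap_sub => //.
  by apply: DLap_scale; [exact: continuous_cosh_sum|exact: continuous_cosh_sum|exact: DLap_cosh_sum].
rewrite leNgt; apply/negP => wc.
have mc : 0 < m c by rewrite /m cosh_sum_center subr_gt0 /k mulrAC.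
have [z zL zm] := cube_max (continuous_translate (b := c) cm) (ltW L0).
have zm' x : `|x - c| <= L -> m x <= m (z + c) by move=> /zm; rewrite subrK.
have mz : 0 < m (z + c) by apply: (lt_le_trans mc); apply: zm'; rewrite subrr normr0 ltW.
have zcL : `|z + c - c| <= L by rewrite addrK.
have wz : w (z + c) <= M by exact: wM.
have kh0 : 0 <= k * cosh_sum c (z + c).
  by rewrite mulr_ge0// sumr_ge0// => i _; rewrite addr_ge0 ?expR_ge0.
have [zl|zl] := ltP `|z + c - c| L.
  have := interior_max_principle cm cg' mg zl zm'.
  by have := wgz _ zcL; move: mz; rewrite /m; clra.
have := cosh_sum_ge L0 zl; move=> h.
have : M <= k * cosh_sum c (z + c).
  by rewrite /k -mulrA ler_peMr// expRN mulrC ler_pdivlMr ?expR_gt0// mul1r.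
by move: mz; rewrite /m; clra.
Qed.

Definition gauss (A B : R) z : R := expR (- (A * dot z z + B)).

Lemma class_C_gauss m A B : class_C m (gauss A B).
Proof.
apply: class_C_expR; rewrite (_ : (fun x => _) = fun x : 'rV[R]_N => -1 * (A * dot x x + B)).
  apply: class_C_mul; first exact: class_C_cst.
  apply: class_C_add; last exact: class_C_cst.
  by apply: class_C_mul; [exact: class_C_cst|exact: class_C_dot].
by apply/funext => x; rewrite mulN1r.
Qed.

Lemma is_derive_gauss A B i z :
  is_derive z (e_ i) (gauss A B) (-2 * A * z ord0 i * gauss A B z).
Proof.
have h0 := is_derive_add (is_derive_mul (is_derive_cst A z (e_ i)) (partial_dot i z)) (is_derive_cst B z (e_ i)).
have h1 := is_derive_mul (is_derive_cst (-1 : R) z (e_ i)) h0.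
have h := is_derive_comp_dir (g := fun y : 'rV[R]_N => -1 * (A * dot y y + B)) (is_derive_expR _) h1.
have -> : gauss A B = fun y => expR (-1 * (A * dot y y + B)) by apply/funext => y; rewrite mulN1r.
by apply: (is_derive_eq h); rewrite /cst; ring.
Qed.

Lemma laplacian_gauss A B z :
  laplacian (gauss A B) z = (4 * A ^+ 2 * dot z z - 2 * N%:R * A) * gauss A B z.
Proof.
have E i y : partial i (gauss A B) y = -2 * A * y ord0 i * gauss A B y.
  exact: partialE (is_derive_gauss A B i y).
have E2 i : partial i (partial i (gauss A B)) z = (4 * A ^+ 2 * (z ord0 i * z ord0 i) - 2 * A) * gauss A B z.
  have -> : partial i (gauss A B) = (fun y => (-2 * A * y ord0 i) * gauss A B y) by apply/funext => y; rewrite E.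
  apply: partialE.
  have h0 := is_derive_mul (is_derive_cst (-2 * A) z (e_ i)) (is_derive_coord i i z).
  have h := is_derive_mul h0 (is_derive_gauss A B i z).
  by apply: (is_derive_eq h); rewrite /cst eqxx/=; ring.
rewrite /laplacian (eq_bigr _ (fun i _ => E2 i)) -mulr_suml; congr (_ * _).
rewrite big_split/= -mulr_sumr sumr_const card_ord /dot -mulr_natl; ring.
Qed.

Lemma DLap_gauss A B :
  DLap (gauss A B) (fun z => (4 * A ^+ 2 * dot z z - 2 * N%:R * A) * gauss A B z).
Proof.
have := class_C2_DLap (class_C_gauss 2 A B).
by have -> := funext (laplacian_gauss A B).
Qed.

Lemma continuous_gauss A B : continuous (gauss A B).
Proof. exact: class_C_continuous (class_C_gauss 0 A B). Qed.

Lemma continuous_dot : continuous (fun z : 'rV[R]_N => dot z z).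
Proof. exact: class_C_continuous (class_C_dot 0). Qed.

Lemma continuous_gauss_potential A : continuous (fun z : 'rV[R]_N => 4 * A ^+ 2 * dot z z - 2 * N%:R * A).
Proof.
apply: continuous_sub; last exact: cst_continuous.
by apply: continuous_mul; [exact: cst_continuous|exact: continuous_dot].
Qed.

Lemma gauss_small A B (d : R) : 0 < A -> 0 < d ->
  exists2 k : R, 0 <= k & forall x, k < `|x| -> gauss A B x < d.
Proof.
move=> A0 d0; pose k2 := Num.max 0 ((- ln d - B) / A).
exists (k2 + 1); first by rewrite addr_ge0// le_max lexx.
move=> x xk; rewrite /gauss -[X in _ < X]lnK ?posrE// ltr_expR.
have h : (- ln d - B) / A < dot x x.
  apply: (le_lt_trans (_ : _ <= k2)); first by rewrite le_max lexx orbT.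
  have k20 : 0 <= k2 by rewrite le_max lexx.
  have := sqr_norm_le_dot x; cnra.
by move: h; rewrite ltr_pdivrMr// mulrC; clra.
Qed.

(** The last hypothesis makes the Gaussian a strict subsolution wherever it exceeds [w]. A positive
    value of the difference would lead to a positive global maximum, which exists because the
    Gaussian vanishes at infinity and [w] is nonnegative. *)
Lemma gaussian_lower w g (A B rho : R) : continuous w -> continuous g -> DLap w g -> 0 < A ->
  (forall x, 0 <= w x) -> (forall x, dot x x <= rho -> gauss A B x <= w x) ->
  (forall x, rho < dot x x -> w x < gauss A B x ->
     g x < (4 * A ^+ 2 * dot x x - 2 * N%:R * A) * gauss A B x) ->
  forall x, gauss A B x <= w x.
Proof.
move=> cw cg wg A0 w0 wr gl x1; rewrite leNgt; apply/negP => wx1.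
pose h := gauss A B; pose m x := h x - w x.
have ch : continuous h by exact: continuous_gauss.
have cm : continuous m by exact: continuous_sub.
have m1 : 0 < m x1 by rewrite subr_gt0.
have [k k0 hk] := gauss_small B A0 m1.
have kx : 0 <= k + `|x1| by rewrite addr_ge0.
have [z zk zm] := cube_max cm kx.
have zx1 : m x1 <= m z by apply: zm; rewrite lerDr.
have zmax x : m x <= m z.
  have [/zm//|xk] := leP `|x| (k + `|x1|).
  apply: le_trans zx1; have /hk : k < `|x| by apply: le_lt_trans xk; rewrite lerDl.
  by move=> hx; have := w0 x; rewrite /m/h; move: hx; rewrite /m/h; clra.
have cL : continuous (fun z => (4 * A ^+ 2 * dot z z - 2 * N%:R * A) * h z).
  by apply: continuous_mul => //; exact: continuous_gauss_potential.
have mg := DLap_sub ch cL cw cg (DLap_gauss A B) wg.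
have mz := max_principle cm (continuous_sub cL cg) mg (near_row z zmax).
have mz0 : 0 < m z by exact: lt_le_trans zx1.
have wz : w z < gauss A B z by move: mz0; rewrite subr_gt0.
have rz : rho < dot z z by rewrite ltNge; apply/negP => /wr; rewrite leNgt wz.
by have := gl z rz wz; move: mz; rewrite /h; clra.
Qed.

Lemma DLap_unique w g g' : continuous w -> continuous g -> continuous g' ->
  DLap w g -> DLap w g' -> g = g'.
Proof.
move=> cw cg cg' wg wg'.
have key f f' : continuous f -> continuous f' -> DLap w f -> DLap w f' -> forall x, f x <= f' x.
  move=> cf cf' wf wf' x; rewrite -subr_le0.
  apply: (max_principle (w := fun x => w x - w x) (g := fun x => f x - f' x)).
  - exact: continuous_sub.
  - exact: continuous_sub.
  - exact: DLap_sub.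
  - by apply: near_row => z; rewrite !subrr.
by apply/funext => x; apply/eqP; rewrite eq_le !key.
Qed.

Definition vanishing w := forall d : R, 0 < d -> exists2 k : R, 0 <= k & forall x, k < `|x| -> `|w x| <= d.

(** Slide [s * U] down onto [G]: the difference is nonnegative and vanishes somewhere, so it is
    identically 0 by a strong maximum principle. Positivity of [q] at infinity serves the sliding;
    its quadratic growth admits Gaussian barriers in the second half. *)
Lemma ground_state (G U q : 'rV[R]_N -> R) (C k : R) : continuous G -> continuous U -> continuous q ->
  (forall x, 0 < U x) -> vanishing G -> vanishing U ->
  DLap G (fun x => q x * G x) -> DLap U (fun x => q x * U x) ->
  0 <= k -> (forall x, k < `|x| -> 0 < q x) -> (forall x, q x <= C * (1 + dot x x)) ->
  exists s : R, forall x, G x = s * U x.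
Proof.
move=> cG cU cq U0 Gv Uv GG UU k0 qk qC.
have cqG : continuous (fun x => q x * G x) by exact: continuous_mul.
have cqU : continuous (fun x => q x * U x) by exact: continuous_mul.
have cGU : continuous (fun x => G x / U x).
  apply: continuous_mul; first by [].
  by move=> x; exact: (cvgV (lt0r_neq0 (U0 x)) (cU x)).
have [x0 x0k x0m] := cube_max cGU k0.
(* The largest ratio on the cube: [s * U - G] is nonnegative there and vanishes at [x0]. *)
pose s := G x0 / U x0; exists s.
pose H x := s * U x - G x.
have csU : continuous (fun x => s * U x) by apply: continuous_mul => //; exact: cst_continuous.
have csqU : continuous (fun x => s * (q x * U x)) by apply: continuous_mul => //; exact: cst_continuous.
have cH : continuous H by exact: continuous_sub.
have HH0 : DLap H (fun x => s * (q x * U x) - q x * G x).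
  apply: DLap_sub => //; exact: DLap_scale.
have E : (fun x => s * (q x * U x) - q x * G x) = (fun x => q x * H x).
  by apply/funext => x; rewrite /H; ring.
have cqH : continuous (fun x => q x * H x) by exact: continuous_mul.
have HH : DLap H (fun x => q x * H x) by rewrite -E.
have Hin x : `|x| <= k -> 0 <= H x.
  by move=> xk; rewrite /H subr_ge0 -ler_pdivrMr//; exact: x0m.
(* A negative value would give a negative global minimum, because [G] and [U] vanish at infinity. It
   would lie outside the cube, where [q] is positive, against the maximum principle. *)
have H0 x : 0 <= H x.
  rewrite leNgt; apply/negP => Hx.
  have d0 : 0 < - H x / (2 * (`|s| + 1)) by rewrite divr_gt0 ?oppr_gt0 ?mulr_gt0 ?ltr_wpDl.
  have d1 : 0 < - H x / 4 by rewrite divr_gt0// oppr_gt0.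
  have [k1 k10 hk1] := Uv _ d0; have [k2 k20 hk2] := Gv _ d1.
  have cNH : continuous (fun x => -1 * H x) by apply: continuous_mul => //; exact: cst_continuous.
  have [|z zk zm] := @cube_max _ (k1 + k2 + `|x|) cNH; first by rewrite !addr_ge0.
  have zx : H z <= H x.
    by have := zm x; rewrite !mulN1r lerN2; apply; rewrite lerDr addr_ge0.
  have zmax y : -1 * H y <= -1 * H z.
    have [/zm//|yk] := leP `|y| (k1 + k2 + `|x|).
    rewrite !mulN1r lerN2; apply: (le_trans zx); rewrite /H.
    have nx := normr_ge0 x.
    have /hk1 : k1 < `|y| by clra.
    have /hk2 : k2 < `|y| by clra.
    have s0 : 0 < 2 * (`|s| + 1) by rewrite mulr_gt0// ltr_wpDl.
    have Uy := U0 y; rewrite (ger0_norm (ltW Uy)) => g1; rewrite ler_pdivlMr// => u1.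
    have s1 : - (`|s| * U y) <= s * U y.
      by rewrite -mulNr ler_wpM2r ?(ltW Uy)// lerNl -normrN ler_norm.
    have g2 := le_trans (ler_norm _) g1.
    have u2 : U y * (2 * (`|s| + 1)) = 2 * (`|s| * U y) + 2 * U y by ring.
    rewrite u2 in u1; rewrite -/(H x); clra.
  have zk' : k < `|z|.
    by rewrite ltNge; apply/negP => /Hin; move: zx Hx; clra.
  have cNq : continuous (fun x => -1 * (q x * H x)) by apply: continuous_mul => //; exact: cst_continuous.
  have := max_principle cNH cNq (DLap_scale (-1) cH cqH HH) (near_row z zmax).
  by have := qk _ zk'; cnra.
have Hx0 : H x0 = 0 by rewrite /H /s divfK ?subrr// gt_eqF.
move=> x; apply/eqP; rewrite eq_sym -subr_eq0 -[_ - _]/(H x) eq_le H0 andbT leNgt; apply/negP => Hx.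
(* If [H x] is positive, a narrow Gaussian centred at [x] stays below [H] everywhere, in particular
   at [x0], where [H] is 0. *)
pose Hs y := H (y + x).
have cHs : continuous Hs by exact: continuous_translate.
have hd0 : 0 < H x / 2 by rewrite divr_gt0.
have [d d0 hd] := continuous_ball_le x cH hd0.
have Hsd y : `|y| <= d -> H x / 2 <= Hs y.
  by rewrite /Hs [y + x]addrC => /hd; rewrite ler_norml => /andP[h1 h2]; clra.
pose B := Num.max 0 (- ln (H x / 2)).
have C0 : 0 <= `|C| * (2 + 2 * dot x x) by rewrite mulr_ge0// addr_ge0// mulr_ge0// dot_ge0.
pose C1 := `|C| * (2 + 2 * dot x x).
(* This size of [A] gives $4A^2|y|^2-2NA > C_1(1+|y|^2)$ as soon as $|y|>d$, and the right-hand side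
   bounds the translated potential. On the ball $|y|\le d$ the choice of [B] keeps the Gaussian
   below [H x / 2]. *)
pose A := (C1 + C1 + 2 * N%:R + 1) / (d ^+ 2) + C1 + 1.
have d20 : 0 < d ^+ 2 by rewrite exprn_gt0.
have N0 : 0 <= N%:R :> R by [].
have C10 : 0 <= C1 by [].
have D0 : 0 <= (C1 + C1 + 2 * N%:R + 1) / d ^+ 2.
  by rewrite divr_ge0 ?(ltW d20)//; clra.
have A1 : C1 + 1 <= A by rewrite /A; clra.
have A0 : 0 < A by clra.
have Ad : C1 + C1 + 2 * N%:R + 1 <= A * d ^+ 2.
  have -> : A * d ^+ 2 = (C1 + C1 + 2 * N%:R + 1) + (C1 + 1) * d ^+ 2.
    by rewrite /A; field; rewrite gt_eqF.
  by rewrite lerDl mulr_ge0 ?(ltW d20)//; clra.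
have := @gaussian_lower Hs (fun y => q (y + x) * H (y + x)) A B (d ^+ 2) cHs
  (continuous_translate (b := x) cqH) (DLap_shift x cqH HH) A0 (fun y => H0 _).
have small y : dot y y <= d ^+ 2 -> gauss A B y <= Hs y.
  move=> yd; apply: le_trans (Hsd y _); last first.
    rewrite -(ler_pXn2r (ltn0Sn 1)) ?nnegrE ?(ltW d0)//; exact: le_trans (sqr_norm_le_dot y) yd.
  rewrite /gauss -[leRHS]lnK ?posrE// ler_expR lerNl.
  have : - ln (H x / 2) <= B by rewrite le_max lexx orbT.
  have : 0 <= A * dot y y by rewrite mulr_ge0 ?dot_ge0 ?(ltW A0).
  clra.
move=> /(_ small) h.
have {}h : forall y, gauss A B y <= Hs y.
  apply: h => y yd Hy.
  have dxy : dot (y + x) (y + x) <= 2 * dot y y + 2 * dot x x.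
    rewrite /dot !mulr_sumr -big_split/= ler_sum// => i _; rewrite !mxE.
    have := sqr_ge0 (y ord0 i - x ord0 i); cnra.
  have q1 : q (y + x) <= C1 * (1 + dot y y).
    apply: (le_trans (qC _)); apply: (le_trans (_ : _ <= `|C| * (1 + dot (y + x) (y + x)))).
      by rewrite ler_wpM2r ?ler_norm// addr_ge0 ?dot_ge0.
    rewrite /C1 -mulrA ler_wpM2l//; have := dot_ge0 y; have := dot_ge0 x; cnra.
  have g0 : 0 < gauss A B y by exact: expR_gt0.
  have step : q (y + x) * H (y + x) <= C1 * (1 + dot y y) * gauss A B y.
    apply: (le_trans (_ : _ <= C1 * (1 + dot y y) * H (y + x))).
      by rewrite ler_wpM2r.
    by rewrite ler_wpM2l ?(ltW Hy)// mulr_ge0// addr_ge0 ?dot_ge0.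
  apply: (le_lt_trans step); rewrite ltr_pM2r//.
  have dy := dot_ge0 y.
  have t1 : A * d ^+ 2 <= A * dot y y by rewrite ler_pM2l// ltW.
  have t2 : A * (A * d ^+ 2) <= A * (A * dot y y) by rewrite ler_pM2l.
  have t3 : (C1 + 1) * dot y y <= A * dot y y by rewrite ler_wpM2r.
  have t4 : A * dot y y * 1 <= A * dot y y * A.
    by rewrite ler_wpM2l ?mulr_ge0 ?(ltW A0)//; clra.
  have t5 : A * (2 * N%:R + 1) <= A * (A * d ^+ 2) by rewrite ler_pM2l//; clra.
  have -> : 4 * A ^+ 2 * dot y y = 4 * (A * (A * dot y y)) by ring.
  have t6 : A * dot y y * A = A * (A * dot y y) by ring.
  cnra.
have := h (x0 - x); rewrite /Hs subrK Hx0.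
by rewrite leNgt expR_gt0.
Qed.

End barriers.

(** * Second derivatives and exponential decay *)

Section regularity.
Context {R : realType} {N : nat}.
Local Notation mu := (lebesgue_row R N).
Implicit Types (x y z : 'rV[R]_N) (w g f : 'rV[R]_N -> R).
Local Notation e_ i := (delta_mx ord0 i : 'rV[R]_N).

Lemma locally_lipschitz_add i f g : locally_lipschitz_dir i f -> locally_lipschitz_dir i g ->
  locally_lipschitz_dir i (fun x => f x + g x).
Proof.
move=> fl gl K; have [L1 L10 h1] := fl K; have [L2 L20 h2] := gl K.
exists (L1 + L2) => [|z t zK t1]; first exact: addr_ge0.
have := h1 z t zK t1; have := h2 z t zK t1.
rewrite mulrDl (_ : f _ + g _ - _ = (f (z + t *: e_ i) - f z) + (g (z + t *: e_ i) - g z)); last by ring.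
by move=> a b; apply: (le_trans (ler_normD _ _)); clra.
Qed.

Lemma locally_lipschitz_mul i f g : continuous f -> continuous g ->
  locally_lipschitz_dir i f -> locally_lipschitz_dir i g ->
  locally_lipschitz_dir i (fun x => f x * g x).
Proof.
move=> cf cg fl gl K; have [L1 L10 h1] := fl K; have [L2 L20 h2] := gl K.
have [M1 M10 m1] := continuous_cube_bounded (K + 1) cf.
have [M2 M20 m2] := continuous_cube_bounded K cg.
exists (L1 * M2 + M1 * L2) => [|z t zK t1]; first by rewrite addr_ge0// mulr_ge0.
have zt : `|z + t *: e_ i| <= K + 1.
  by apply: (le_trans (ler_normD _ _)); have := norm_scale_basis i t; clra.
have -> : f (z + t *: e_ i) * g (z + t *: e_ i) - f z * g z =
  (f (z + t *: e_ i) - f z) * g z + f (z + t *: e_ i) * (g (z + t *: e_ i) - g z) by ring.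
apply: (le_trans (ler_normD _ _)); rewrite !normrM mulrDl lerD//.
  by rewrite mulrAC ler_pM// ?h1// m2.
by rewrite -mulrA ler_pM// ?h2// m1.
Qed.

Lemma locally_lipschitz_cst i (c : R) : locally_lipschitz_dir i (fun _ : 'rV[R]_N => c).
Proof. by move=> K; exists 0 => // z t _ _; rewrite subrr normr0 mul0r. Qed.

Lemma locally_lipschitz_C1 i f : class_C 1 f -> locally_lipschitz_dir i f.
Proof.
move=> f1; apply: continuous_partial_lipschitz; last exact: (class_C_continuous (class_C_partial i f1)).
by move=> x; case: (class_C_is_derive i x f1).
Qed.

Lemma DLap_locally_lipschitz i w g : continuous w -> continuous g -> DLap w g ->
  locally_lipschitz_dir i w.
Proof.
move=> cw cg wg K; have [C C0 hC] := @DLap_lipschitz R N.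
have [A A0 wA] := continuous_cube_bounded (K + 4) cw.
have [B B0 gB] := continuous_cube_bounded (K + 4) cg.
exists (C * (A + B)) => [|z t zK t1]; first by rewrite mulr_ge0// addr_ge0.
have nt := norm_scale_basis i t.
have b4 y : `|y - z| <= 4 -> `|y| <= K + 4.
  by move=> yz; have := ler_normD (y - z) z; rewrite subrK; clra.
have := hC w g z A B cw cg wg (fun y hy => wA y (b4 y hy)) (fun y hy => gB y (b4 y hy)) (z + t *: e_ i) z.
rewrite [z + _]addrC addrK subrr normr0 => /(_ (le_trans nt t1) ler01) h.
by apply: (le_trans h); rewrite ler_wpM2l// mulr_ge0// addr_ge0.
Qed.

Lemma ln_sqr_lipschitz (m a b : R) : 0 < m -> m <= a -> m <= b ->
  `|ln (a ^+ 2) - ln (b ^+ 2)| <= 2 / m * `|a - b|.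
Proof.
move=> m0; have key c d : m <= c -> m <= d -> ln (c ^+ 2) - ln (d ^+ 2) <= 2 / m * `|c - d|.
  move=> mc md; have c0 : 0 < c by clra.
  have d0 : 0 < d by clra.
  rewrite -ln_div ?posrE ?exprn_gt0// -expr_div_n lnXn ?divr_gt0// mulr2n.
  have h : ln (c / d) <= (c - d) / d.
    have -> : c / d = 1 + (c - d) / d by field; rewrite gt_eqF.
    by apply: le_ln1Dx; rewrite ltr_pdivlMr// mulN1r; clra.
  have h2 : (c - d) / d <= `|c - d| / m.
    apply: (le_trans (_ : _ <= `|c - d| / d)).
      by rewrite ler_wpM2r ?invr_ge0 ?(ltW d0)// ler_norm.
    by rewrite ler_wpM2l// lef_pV2 ?posrE.
  have -> : 2 / m * `|c - d| = `|c - d| / m + `|c - d| / m by ring.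
  clra.
move=> ma mb; rewrite ler_norml; apply/andP; split; last exact: key.
by rewrite lerNl opprB distrC; exact: key.
Qed.

Lemma continuous_cube_gt0 f (K : R) : continuous f -> (forall x, 0 < f x) ->
  exists2 m, 0 < m & forall x, `|x| <= K -> m <= f x.
Proof.
move=> cf f0; have [K0|K0] := leP 0 K; last first.
  by exists 1 => // x xK; have := le_lt_trans (le_trans (normr_ge0 x) xK) K0; rewrite ltxx.
have cNf : continuous (fun x => -1 * f x) by apply: continuous_mul => //; exact: cst_continuous.
have [z _ zm] := cube_max cNf K0; exists (f z) => // x xK.
by have := zm x xK; rewrite !mulN1r lerN2.
Qed.

Lemma locally_lipschitz_ln_sqr i w : continuous w -> (forall x, 0 < w x) ->
  locally_lipschitz_dir i w -> locally_lipschitz_dir i (fun x => ln (w x ^+ 2)).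
Proof.
move=> cw w0 wl K; have [L L0 hL] := wl K.
have [m m0 hm] := continuous_cube_gt0 (K + 1) cw w0.
exists (2 / m * L) => [|z t zK t1]; first by rewrite mulr_ge0// divr_ge0// ltW.
have zt : `|z + t *: e_ i| <= K + 1.
  by apply: (le_trans (ler_normD _ _)); have := norm_scale_basis i t; clra.
have zK1 : `|z| <= K + 1 by clra.
apply: (le_trans (ln_sqr_lipschitz m0 (hm _ zt) (hm _ zK1))).
rewrite (_ : 2 / m * L * `|t| = 2 / m * (L * `|t|)); last by rewrite mulrA.
apply: ler_wpM2l; first by rewrite divr_ge0// ltW.
exact: hL.
Qed.

Lemma DLap_class_C1 w g : continuous w -> continuous g -> DLap w g ->
  (forall i, locally_lipschitz_dir i g) -> class_C 1 w.
Proof.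
move=> cw cg wg gl; split=> // i; have [dw cdw] := partial_exists cw cg wg (gl i).
by split.
Qed.

(** The partial derivatives of [w] satisfy [DLap] with those of [g], so the first-order result
    applies to each of them. The classical Laplacian is then identified by [DLap_unique]. *)
Lemma DLap_class_C2 w g : continuous w -> DLap w g -> class_C 1 g ->
  (forall i j, locally_lipschitz_dir j (partial i g)) -> class_C 2 w /\ laplacian w = g.
Proof.
move=> cw wg g1 gl; have cg := class_C_continuous g1.
have dg i : forall x, derivable g x (e_ i) by move=> x; case: (class_C_is_derive i x g1).
have cdg i := class_C_continuous (class_C_partial i g1).
have w1 := DLap_class_C1 cw cg wg (fun i => locally_lipschitz_C1 i g1).
have w2 : class_C 2 w.
  split=> // i; split; first by move=> x; case: (class_C_is_derive i x w1).
  apply: (@DLap_class_C1 _ (partial i g)) => //.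
    exact: (class_C_continuous (class_C_partial i w1)).
  exact: (DLap_partial cw cg wg (dg i)).
split=> //; apply: (DLap_unique cw _ cg (class_C2_DLap w2) wg).
have : class_C 0 (laplacian w) by apply: class_C_sum => i; do 2 apply: class_C_partial.
exact: class_C_continuous.
Qed.

(** The commutator $[\Delta,x_i]=2\partial_i$ cancels the term $-2\partial_i$ of the linearised
    equation; this is why $\partial_i+x_i$ is the operator used on the profiles. *)
Lemma laplacian_coord_mul i w : class_C 2 w ->
  laplacian (fun x => x ord0 i * w x) = (fun x => x ord0 i * laplacian w x + 2 * partial i w x).
Proof.
move=> w2; have w1 := class_CW w2.
have E j : partial j (fun x => x ord0 i * w x) = (fun x => (j == i)%:R * w x + x ord0 i * partial j w x).
  apply/funext => x; apply: partialE.
  exact: is_derive_mul (is_derive_coord i j x) (class_C_is_derive j x w1).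
have E2 j x : partial j (partial j (fun x => x ord0 i * w x)) x =
    (j == i)%:R * (2 * partial j w x) + x ord0 i * partial j (partial j w) x.
  rewrite E; apply: partialE.
  have h1 := is_derive_mul (is_derive_cst ((j == i)%:R : R) x (e_ j)) (class_C_is_derive j x w1).
  have h2 := is_derive_mul (is_derive_coord i j x) (class_C_is_derive j x (class_C_partial j w2)).
  by apply: (is_derive_eq (is_derive_add h1 h2)); rewrite /cst; ring.
apply/funext => x.
have S : laplacian (fun x => x ord0 i * w x) x =
    \sum_j ((j == i)%:R * (2 * partial j w x)) + \sum_j (x ord0 i * partial j (partial j w) x).
  by rewrite -big_split; apply: eq_bigr => j _; exact: E2.
rewrite S addrC /laplacian mulr_sumr; congr (_ + _).
rewrite (bigD1 i)//= eqxx mul1r big1 ?addr0// => j /negbTE ->.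
by rewrite mul0r.
Qed.

Lemma DLap_coord_mul i w g : class_C 2 w -> laplacian w = g ->
  DLap (fun x => x ord0 i * w x) (fun x => x ord0 i * g x + 2 * partial i w x).
Proof.
move=> w2 wg; rewrite -wg -laplacian_coord_mul//; apply: class_C2_DLap.
exact (class_C_mul (class_C_coord 2 i) w2).
Qed.

Lemma const_of_partial0 f : (forall i x, is_derive x (e_ i) f 0) -> forall x, f x = f 0.
Proof.
move=> df; have step i z (t : R) : f (z + t *: e_ i) = f z.
  have := @partial_increment R N f i z t 0.
  rewrite mul0r => h; apply/eqP; rewrite -subr_eq0 -normr_le0; apply: h.
    by move=> x; case: (df i x).
  by move=> s _; rewrite (partialE (df i _)) normr0.
move=> x; rewrite [in LHS](row_sum_delta x).
elim/big_rec : _ => // i y _ IH.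
by rewrite addrC step.
Qed.

Lemma poly_le_expR (c : R) (m : nat) : 0 < c ->
  exists2 K : R, 0 <= K & forall t : R, 0 <= t -> (1 + t) ^+ m <= K * expR (c * t).
Proof.
move=> c0; have [K K0 hK] := horner_le_expR ((1 + c^-1 *: 'X) ^+ m : {poly R}).
exists K => // t t0; have ct : 0 <= c * t by rewrite mulr_ge0// ltW.
have := hK _ ct; rewrite horner_exp hornerD hornerZ hornerX hornerC mulrA mulVf ?gt_eqF// mul1r.
by rewrite ger0_norm// exprn_ge0// addr_ge0.
Qed.

Definition exp_decay (c : R) w := exists2 C : R, 0 <= C & forall x, `|w x| <= C * expR (- (c * `|x|)).

Lemma exp_decay_vanishing (c : R) w : 0 < c -> exp_decay c w -> vanishing w.
Proof.
move=> c0 [C C0 hC] d d0.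
exists (Num.max 0 (ln ((C + 1) / d) / c)); first by rewrite le_max lexx.
move=> x; rewrite gt_max ltr_pdivrMr// => /andP[_ h].
apply: (le_trans (hC x)).
have q0 : 0 < (C + 1) / d by rewrite divr_gt0//; clra.
have : expR (- (c * `|x|)) <= expR (- ln ((C + 1) / d)) by rewrite ler_expR lerN2 [leRHS]mulrC ltW.
rewrite (expRN (ln _)) lnK ?posrE// invf_div => h2.
apply: (le_trans (ler_wpM2l C0 h2)); rewrite mulrA ler_pdivrMr; last by clra.
by rewrite mulrC ler_wpM2l ?(ltW d0)//; clra.
Qed.

Lemma exp_decay_mul (c K : R) (m : nat) p w : 0 < c -> 0 <= K ->
  (forall x, `|p x| <= K * (1 + `|x|) ^+ m) -> exp_decay c w ->
  exp_decay (c / 2) (fun x => p x * w x).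
Proof.
move=> c0 K0 pK [C C0 hC]; have [K1 K10 hK1] := @poly_le_expR (c / 2) m (divr_gt0 c0 (ltr0n _ 2)).
exists (K * K1 * C) => [|x]; first by rewrite !mulr_ge0.
rewrite normrM; apply: (le_trans (ler_pM _ _ (pK x) (hC x))) => //.
have h := hK1 _ (normr_ge0 x).
apply: (le_trans (_ : _ <= K * (K1 * expR (c / 2 * `|x|)) * (C * expR (- (c * `|x|))))).
  by rewrite ler_wpM2r ?mulr_ge0 ?expR_ge0// ler_wpM2l.
have -> : expR (- (c / 2 * `|x|)) = expR (c / 2 * `|x|) * expR (- (c * `|x|)).
  by rewrite -expRD; congr expR; field.
by rewrite le_eqVlt; apply/orP; left; apply/eqP; ring.
Qed.

Lemma exp_decay_add (c : R) f g : exp_decay c f -> exp_decay c g -> exp_decay c (fun x => f x + g x).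
Proof.
move=> [C C0 hC] [D D0 hD]; exists (C + D) => [|x]; first exact: addr_ge0.
by apply: (le_trans (ler_normD _ _)); rewrite mulrDl lerD.
Qed.

Lemma exp_decay_le (c c' : R) f : c' <= c -> exp_decay c f -> exp_decay c' f.
Proof.
move=> cc [C C0 hC]; exists C => // x; apply: (le_trans (hC x)).
by rewrite ler_wpM2l// ler_expR lerN2 ler_wpM2r.
Qed.

Lemma norm_partial_le : exists2 C : R, 0 <= C & forall i w g x (A B : R),
  continuous w -> continuous g -> DLap w g -> derivable w x (e_ i) ->
  (forall z, `|z - x| <= 4 -> `|w z| <= A) -> (forall z, `|z - x| <= 4 -> `|g z| <= B) ->
  `|partial i w x| <= C * (A + B).
Proof.
have [C C0 hC] := @DLap_lipschitz R N; exists C => // i w g x A B cw cg wg dw wA gB.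
apply: (partial_norm_le ltr01 dw) => t t1.
have nt := norm_scale_basis i t.
have := hC w g x A B cw cg wg wA gB (x + t *: e_ i) x.
rewrite [x + _]addrC addrK subrr normr0 => /(_ (le_trans nt t1) ler01) h.
apply: (le_trans h); rewrite ler_wpM2l// mulr_ge0// addr_ge0//.
  by apply: le_trans (wA x _); rewrite ?subrr ?normr0.
by apply: le_trans (gB x _); rewrite ?subrr ?normr0.
Qed.

Lemma exp_decay_partial (c : R) i w g : 0 < c -> continuous w -> continuous g -> DLap w g ->
  (forall x, derivable w x (e_ i)) -> exp_decay c w -> exp_decay c g -> exp_decay c (partial i w).
Proof.
move=> c0 cw cg wg dw [A A0 wA] [B B0 gB]; have [C C0 hC] := norm_partial_le.
exists (C * ((A + B) * expR (c * 4))) => [|x].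
  by rewrite !mulr_ge0 ?expR_ge0// addr_ge0.
have key z : `|z - x| <= 4 -> expR (- (c * `|z|)) <= expR (c * 4) * expR (- (c * `|x|)).
  move=> zx; rewrite -expRD ler_expR.
  have : `|x| <= `|z| + 4 by have := ler_normB z (z - x); rewrite opprB addrC subrK; clra.
  by move=> h; cnra.
have := hC i w g x (A * (expR (c * 4) * expR (- (c * `|x|)))) (B * (expR (c * 4) * expR (- (c * `|x|)))) cw cg wg (dw x).
move=> h; have {}h := h (fun z hz => le_trans (wA z) (ler_wpM2l A0 (key z hz)))
  (fun z hz => le_trans (gB z) (ler_wpM2l B0 (key z hz))).
by apply: (le_trans h); rewrite -mulrDl !mulrA.
Qed.

(** [decay_barrier] is applied about each [x] on the cube of radius $|x|/2$, which avoids [cube k]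
    once $|x|>2k$. For smaller [x] the term [M * expR k] suffices. *)
Lemma decay_outside w g (M k : R) : continuous w -> continuous g -> DLap w g -> 0 <= M -> 0 <= k ->
  (forall x, w x <= M) -> (forall x, k < `|x| -> 0 < w x -> w x <= g x) ->
  exists2 C : R, 0 <= C & forall x, w x <= C * expR (- (2^-1 * `|x|)).
Proof.
move=> cw cg wg M0 k0 wM wk; exists (M * (N%:R * 2) + M * expR k).
  by rewrite addr_ge0// mulr_ge0 ?expR_ge0// mulr_ge0.
move=> x; have e0 := expR_gt0 (- (2^-1 * `|x|)).
have a0 : 0 <= M * (N%:R * 2) by rewrite mulr_ge0// mulr_ge0.
have [xk|xk] := ltP (2 * k) `|x|; last first.
  apply: (le_trans (wM x)); rewrite mulrDl.
  have : M <= M * expR k * expR (- (2^-1 * `|x|)).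
    by rewrite -mulrA -expRD ler_peMr//; apply: le_trans (expR_ge1Dx _); clra.
  by have := mulr_ge0 a0 (ltW e0); clra.
have L0 : 0 < 2^-1 * `|x| by clra.
have := decay_barrier cw cg wg L0 M0 (fun z _ => wM z).
move=> /(_ x) h; apply: (le_trans (h _)).
  move=> z zx; apply: wk.
  by have := ler_normB z (z - x); rewrite opprB addrC subrK; clra.
by rewrite ler_wpM2r ?(ltW e0)// lerDl mulr_ge0// expR_ge0.
Qed.

End regularity.

(** * Classification of the limit profiles *)

Section profiles.
Context {R : realType} {N : nat}.
Local Notation mu := (lebesgue_row R N).
Implicit Types (x y z : 'rV[R]_N) (w g f : 'rV[R]_N -> R).
Local Notation e_ i := (delta_mx ord0 i : 'rV[R]_N).

Definition log_solution (Q w : 'rV[R]_N -> R) :=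
  [/\ continuous w, (forall x, 0 < w x) & DLap w (fun x => (Q x - ln (w x ^+ 2)) * w x)].

Lemma continuous_potential (Q w : 'rV[R]_N -> R) : continuous Q -> continuous w -> (forall x, 0 < w x) ->
  continuous (fun x => (Q x - ln (w x ^+ 2)) * w x).
Proof.
move=> cQ cw w0; apply: continuous_mul; last exact: cw.
by apply: continuous_sub; [exact: cQ|exact: continuous_ln_sqr].
Qed.

Lemma is_derive_ln_sqr w x v (d : R) : 0 < w x -> is_derive x v w d ->
  is_derive x v (fun z => ln (w z ^+ 2)) (2 * d / w x).
Proof.
move=> w0 wd; have h1 := is_derive_expn 2 wd.
have w2 : 0 < w x ^+ 2 by rewrite exprn_gt0.
have h := is_derive_comp_dir (g := fun z => w z ^+ 2) (is_derive1_ln w2) h1.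
by apply: (is_derive_eq h); rewrite expr1; field; rewrite gt_eqF.
Qed.

Lemma log_solution_class_C1 (Q w : 'rV[R]_N -> R) : class_C 1 Q -> log_solution Q w -> class_C 1 w.
Proof.
move=> Q1 [cw w0 wg]; have cQ := class_C_continuous Q1.
have cg := continuous_potential cQ cw w0.
apply: (DLap_class_C1 cw cg wg) => i.
have wl := DLap_locally_lipschitz i cw cg wg.
have cl := continuous_ln_sqr cw w0.
apply: locally_lipschitz_mul => //; first exact: continuous_sub.
rewrite (_ : (fun x => _) = fun x => Q x + (-1) * ln (w x ^+ 2)); last first.
  by apply/funext => x; rewrite mulN1r.
apply: locally_lipschitz_add; first exact: locally_lipschitz_C1.
apply: locally_lipschitz_mul => //; first exact: cst_continuous.
  exact: locally_lipschitz_cst.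
exact: locally_lipschitz_ln_sqr.
Qed.

Lemma is_derive_potential (Q w : 'rV[R]_N -> R) i x : class_C 1 Q -> class_C 1 w -> (forall x, 0 < w x) ->
  is_derive x (e_ i) (fun x => (Q x - ln (w x ^+ 2)) * w x)
    (partial i Q x * w x + (Q x - ln (w x ^+ 2) - 2) * partial i w x).
Proof.
move=> Q1 w1 w0; have dw := class_C_is_derive i x w1.
have h := is_derive_mul (is_derive_sub (class_C_is_derive i x Q1) (is_derive_ln_sqr (w0 x) dw)) dw.
by apply: (is_derive_eq h); field; rewrite gt_eqF.
Qed.

Lemma partial_potential (Q w : 'rV[R]_N -> R) i : class_C 1 Q -> class_C 1 w -> (forall x, 0 < w x) ->
  partial i (fun x => (Q x - ln (w x ^+ 2)) * w x) =
    (fun x => partial i Q x * w x + (Q x - ln (w x ^+ 2) - 2) * partial i w x).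
Proof. by move=> Q1 w1 w0; apply/funext => x; apply: partialE; exact: is_derive_potential. Qed.

Lemma class_C1_potential (Q w : 'rV[R]_N -> R) : class_C 1 Q -> class_C 1 w -> (forall x, 0 < w x) ->
  class_C 1 (fun x => (Q x - ln (w x ^+ 2)) * w x).
Proof.
move=> Q1 w1 w0; have cQ := class_C_continuous Q1; have cw := class_C_continuous w1.
apply: (class_CS (df := fun i x => partial i Q x * w x + (Q x - ln (w x ^+ 2) - 2) * partial i w x)).
- exact: continuous_potential.
- by move=> i x; exact: is_derive_potential.
- move=> i; split => //; apply: continuous_add; apply: continuous_mul => //.
  + exact: (class_C_continuous (class_C_partial i Q1)).
  + apply: continuous_sub; last exact: cst_continuous.
    by apply: continuous_sub => //; exact: continuous_ln_sqr.
  + exact: (class_C_continuous (class_C_partial i w1)).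
Qed.

Lemma log_solution_partial (Q w : 'rV[R]_N -> R) i : class_C 1 Q -> log_solution Q w ->
  DLap (partial i w) (fun x => partial i Q x * w x + (Q x - ln (w x ^+ 2) - 2) * partial i w x).
Proof.
move=> Q1 Qw; have w1 := log_solution_class_C1 Q1 Qw; have [cw w0 wg] := Qw.
have g1 := class_C1_potential Q1 w1 w0.
rewrite -partial_potential//; apply: (DLap_partial cw (class_C_continuous g1) wg).
  by move=> x; case: (class_C_is_derive i x g1).
exact: (class_C_continuous (class_C_partial i g1)).
Qed.

Lemma vanishing_bounded w : continuous w -> vanishing w -> exists2 M : R, 0 <= M & forall x, `|w x| <= M.
Proof.
move=> cw wv; have [k k0 hk] := wv 1 ltr01; have [M M0 hM] := continuous_cube_bounded k cw.
exists (M + 1) => [|x]; first by rewrite addr_ge0.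
by have [/hM|/hk] := leP `|x| k; clra.
Qed.

Lemma dot0r x : dot x 0 = 0.
Proof. by rewrite /dot big1// => i _; rewrite mxE mulr0. Qed.

Lemma dot_le_poly x : 1 + dot x x <= (1 + N%:R) * (1 + `|x|) ^+ 2.
Proof.
have := dot_le_sqr_norm x; have := normr_ge0 x; have : 0 <= N%:R :> R by [].
by move=> n0 x0 h; rewrite expr2; cnra.
Qed.

Lemma coord_le_poly i x : `|x ord0 i| <= 1 * (1 + `|x|) ^+ 1.
Proof. by rewrite mul1r expr1; have := coord_le_norm x i; clra. Qed.

Lemma gauss_mul_inv x : gauss 2^-1 0 x * expR (2^-1 * dot x x) = 1.
Proof. by rewrite /gauss -expRD addr0 addNr expR0. Qed.

Lemma is_derive_dotl (c : 'rV[R]_N) i x : is_derive x (e_ i) (fun z => dot c z) (c ord0 i).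
Proof.
have h (j : 'I_N) : is_derive x (e_ i) (fun z : 'rV[R]_N => c ord0 j * z ord0 j) (c ord0 j * (i == j)%:R).
  have := is_derive_mul (is_derive_cst (c ord0 j) x (e_ i)) (is_derive_coord j i x).
  by move=> h; apply: (is_derive_eq h); rewrite mul0r add0r.
have hs : is_derive x (e_ i) (\sum_j (fun z : 'rV[R]_N => c ord0 j * z ord0 j)) (\sum_j c ord0 j * (i == j)%:R).
  exact: is_derive_sum.
have -> : (fun z => dot c z) = \sum_j (fun z : 'rV[R]_N => c ord0 j * z ord0 j).
  by apply/funext => z; rewrite fct_sumE.
apply: (is_derive_eq hs); rewrite (bigD1 i)//= eqxx mulr1 big1 ?addr0// => j ji.
by rewrite eq_sym (negbTE ji) mulr0.
Qed.

Lemma is_derive_inv_gauss i x :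
  is_derive x (e_ i) (fun z => expR (2^-1 * dot z z)) (x ord0 i * expR (2^-1 * dot x x)).
Proof.
have h1 := is_derive_mul (is_derive_cst (2^-1 : R) x (e_ i)) (partial_dot i x).
have h := is_derive_comp_dir (g := fun y : 'rV[R]_N => 2^-1 * dot y y) (is_derive_expR _) h1.
by apply: (is_derive_eq h); rewrite /cst; field.
Qed.

(* The hypothesis says that [f exp(|x|^2/2) - c.x] has zero gradient. *)
Lemma gaussian_integration f (c : 'rV[R]_N) : class_C 1 f ->
  (forall i x, partial i f x + x ord0 i * f x = c ord0 i * gauss 2^-1 0 x) ->
  exists c0 : R, forall x, f x = (dot c x + c0) * gauss 2^-1 0 x.
Proof.
move=> f1 hf; pose F x := f x * expR (2^-1 * dot x x) - dot c x.
have dF i x : is_derive x (e_ i) F 0.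
  have h := is_derive_sub (is_derive_mul (class_C_is_derive i x f1) (is_derive_inv_gauss i x)) (is_derive_dotl c i x).
  apply: (is_derive_eq h).
  have := hf i x => /(congr1 (fun t => t * expR (2^-1 * dot x x))).
  rewrite -[c ord0 i * _ * _]mulrA gauss_mul_inv mulr1 => <-; ring.
exists (F 0) => x; rewrite -(const_of_partial0 dF x) /F [dot c x + _]addrC subrK.
by rewrite -mulrA [expR _ * _]mulrC gauss_mul_inv mulr1.
Qed.

Lemma gauss_gt0 (A B : R) x : 0 < gauss A B x. Proof. exact: expR_gt0. Qed.

(** With $q=V_0-\ln U^2$, the functions $G_i=\partial_iU+x_iU$ solve $\Delta G_i=qG_i$, the equation
    of [U] itself, and decay. By [ground_state], $G_i=s_iU$, so $\ln U$ has gradient $s-x$ and [U]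
    is a Gaussian centred at $s$. The Gaussian lower bound is what makes [q] at most quadratic. *)
Lemma profile (V0 A B : R) (U : 'rV[R]_N -> R) : log_solution (fun=> V0) U -> 0 < A ->
  (forall x, gauss A B x <= U x) -> vanishing U ->
  exists a, forall x, U x = gauss 2^-1 (- (V0 + N%:R) / 2) (x - a).
Proof.
move=> QU A0 UG Uv; have [cU U0 UU] := QU.
have cst1 : class_C 1 (fun _ : 'rV[R]_N => V0) by exact: class_C_cst.
have U1 := log_solution_class_C1 cst1 QU.
pose q x := V0 - ln (U x ^+ 2).
have cl := continuous_ln_sqr cU U0.
have cq : continuous q by apply: continuous_sub => //; exact: cst_continuous.
have cqU : continuous (fun x => q x * U x) by exact: continuous_mul.
have UqU : DLap U (fun x => q x * U x) by exact: UU.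
have [M M0 UM] := vanishing_bounded cU Uv.
have lnU x : ln (U x ^+ 2) = 2 * ln (U x) by rewrite lnXn// mulr_natl.
(* Below the level $e^{(V_0-1)/2}$ one has $q\ge1$. *)
have [k k0 hk] := Uv (expR ((V0 - 1) / 2)) (expR_gt0 _).
have q1 x : k < `|x| -> 1 <= q x.
  move=> /hk; rewrite gtr0_norm// -[X in X <= _](lnK (U0 x : U x \is Num.pos)) ler_expR /q lnU; clra.
have qup x : q x <= V0 + 2 * (A * dot x x + B).
  have := UG x; rewrite /gauss -[X in _ <= X](lnK (U0 x : U x \is Num.pos)) ler_expR /q lnU; clra.
have qlo x : V0 - 2 * ln (M + 1) <= q x.
  have h1 : ln (U x) <= ln (M + 1).
    rewrite ler_ln ?posrE//; last by clra.
    by have := ler_norm (U x); have := UM x; clra.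
  by rewrite /q lnU; clra.
pose K := `|V0| + 2 * `|ln (M + 1)| + 2 * `|B| + 2 * A.
have K0 : 0 <= K by rewrite /K; have := normr_ge0 V0; have := normr_ge0 B; have := normr_ge0 (ln (M + 1)); clra.
have qK x : `|q x| <= K * (1 + dot x x).
  have := qup x; have := qlo x; have := dot_ge0 x.
  rewrite ler_norml /K; have := ler_norm V0; have := ler_norm (- V0); have := ler_norm B; have := normr_ge0 B.
  have := ler_norm (ln (M + 1)); have := normr_ge0 V0; have := normr_ge0 (ln (M + 1)); rewrite normrN.
  by move=> *; apply/andP; split; cnra.
have qp x : `|q x| <= (K * (1 + N%:R)) * (1 + `|x|) ^+ 2.
  by apply: (le_trans (qK x)); rewrite -mulrA ler_wpM2l// dot_le_poly.
have ed : exp_decay 2^-1 U.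
  have [|C C0 hC] := decay_outside cU cqU UqU M0 k0 (fun x => le_trans (ler_norm _) (UM x)).
    by move=> x /q1 h _; rewrite ler_peMl// ltW.
  by exists C => // x; rewrite gtr0_norm.
have h2 : 0 < 2^-1 :> R by rewrite invr_gt0.
have h4 : 0 < 2^-1 / 2 :> R by rewrite divr_gt0.
have KN : 0 <= K * (1 + N%:R) by rewrite mulr_ge0// addr_ge0.
have edq : exp_decay (2^-1 / 2) (fun x => q x * U x) by exact: (exp_decay_mul h2 KN qp ed).
have gU : partial^~ (fun x => (V0 - ln (U x ^+ 2)) * U x) = fun i => fun x => (q x - 2) * partial i U x.
  apply/funext => i; rewrite (partial_potential i cst1 U1 U0); apply/funext => x.
  by rewrite (partialE (is_derive_cst V0 x (e_ i))) mul0r add0r.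
have dU i x : derivable U x (e_ i) by case: (class_C_is_derive i x U1).
have cdU i := class_C_continuous (class_C_partial i U1).
have g1 := class_C1_potential cst1 U1 U0.
have dUU i : DLap (partial i U) (fun x => (q x - 2) * partial i U x).
  have := log_solution_partial i cst1 QU; rewrite -partial_potential//.
  by rewrite (congr1 (fun h => h i) gU).
have cq2 : continuous (fun x => q x - 2) by apply: continuous_sub => //; exact: cst_continuous.
have cqd i : continuous (fun x => (q x - 2) * partial i U x) by exact: continuous_mul.
have [U2 lapU] : class_C 2 U /\ laplacian U = (fun x => q x * U x).
  apply: DLap_class_C2 => // i j; rewrite (congr1 (fun h => h i) gU).
  apply: locally_lipschitz_mul => //; last exact: (DLap_locally_lipschitz j (cdU i) (cqd i) (dUU i)).
  rewrite (_ : (fun x => _) = fun x => (-1) * ln (U x ^+ 2) + (V0 - 2)); last first.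
    by apply/funext => x; rewrite /q; ring.
  apply: locally_lipschitz_add; last exact: locally_lipschitz_cst.
  apply: locally_lipschitz_mul => //; [exact: cst_continuous|exact: locally_lipschitz_cst|].
  apply: locally_lipschitz_ln_sqr => //; exact: (DLap_locally_lipschitz j cU cqU UqU).
pose G i x := partial i U x + x ord0 i * U x.
have cx i : continuous (fun x : 'rV[R]_N => x ord0 i) by exact: coord_continuous.
have cxU i : continuous (fun x => x ord0 i * U x) by exact: continuous_mul.
have cG i : continuous (G i) by exact: continuous_add.
have cxg i : continuous (fun x => x ord0 i * (q x * U x) + 2 * partial i U x).
  apply: continuous_add; apply: continuous_mul => //; exact: cst_continuous.
have GG i : DLap (G i) (fun x => q x * G i x).
  have := DLap_add (cdU i) (cqd i) (cxU i) (cxg i) (dUU i) (DLap_coord_mul i U2 lapU).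
  rewrite (_ : (fun x => _ + (_ + _)) = (fun x => q x * G i x))//.
  by apply/funext => x; rewrite /G; ring.
have Gv i : vanishing (G i).
  apply: (exp_decay_vanishing h4); apply: exp_decay_add.
    by apply: (exp_decay_partial h4 cU cqU UqU) => //; apply: exp_decay_le ed; clra.
  exact: (exp_decay_mul h2 ler01 (coord_le_poly i) ed).
have /choice[s hs] i : exists s : R, forall x, G i x = s * U x.
  apply: (ground_state (cG i) cU cq U0 (Gv i) Uv (GG i) UqU k0) => [x /q1|x]; first by clra.
  by apply: le_trans (qK x); exact: ler_norm.
pose a : 'rV[R]_N := \row_i s i; exists a.
pose F x := U x * expR (2^-1 * dot x x + - dot a x).
have dF i x : is_derive x (e_ i) F 0.
  have h0 := is_derive_mul (is_derive_cst (2^-1 : R) x (e_ i)) (partial_dot i x).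
  have h00 := is_derive_sub h0 (is_derive_dotl a i x).
  have h1 := is_derive_comp_dir (g := fun y : 'rV[R]_N => 2^-1 * dot y y - dot a y) (is_derive_expR _) h00.
  have h := is_derive_mul (class_C_is_derive i x U1) h1.
  apply: (is_derive_eq h); rewrite /cst [a ord0 i]mxE.
  have -> : partial i U x = s i * U x - x ord0 i * U x by rewrite -hs /G addrK.
  by field.
pose c := ln (U 0).
have Ux x : U x = expR (c - 2^-1 * dot x x + dot a x).
  have := const_of_partial0 dF x; rewrite /F.
  rewrite !dot0r mulr0 oppr0 addr0 expR0 mulr1 -(lnK (U0 0 : U 0 \is Num.pos)) -/c => h.
  by rewrite -addrA expRD -h -mulrA -expRD (_ : _ + _ = 0) ?expR0 ?mulr1//; ring.
have dd x : dot (x - a) (x - a) = dot x x - 2 * dot a x + dot a a.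
  rewrite /dot mulr_sumr -sumrB -big_split/=; apply: eq_bigr => i _; rewrite !mxE; ring.
pose c' := c + 2^-1 * dot a a.
have Ug x : U x = gauss 2^-1 (- c') (x - a).
  by rewrite Ux /gauss dd /c'; congr expR; field.
have cgp : continuous (fun z : 'rV[R]_N => (4 * 2^-1 ^+ 2 * dot z z - 2 * N%:R * 2^-1) * gauss 2^-1 (- c') z).
  by apply: continuous_mul; [exact: continuous_gauss_potential|exact: continuous_gauss].
have {}UUg := DLap_shift (- a) cgp (DLap_gauss 2^-1 (- c')).
rewrite (_ : (fun z => gauss _ _ (z + - a)) = U) in UUg; last by apply/funext => x; rewrite Ug.
have cgs := continuous_translate (b := - a) cgp.
(* The two expressions of the Laplacian at the centre [a] read $V_0-2c'=-N$, which fixes the height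
   of the Gaussian. *)
have /(congr1 (fun h => h a)) := DLap_unique cU cqU cgs UqU UUg.
rewrite /= subrr dot0r.
have Ua : U a = gauss 2^-1 (- c') (0 : 'rV[R]_N) by rewrite (Ug a) subrr.
rewrite -Ua; move=> /(mulIf (lt0r_neq0 (U0 a))) E x.
have la : ln (U a) = c'.
  by rewrite Ua /gauss expRK dot0r mulr0 add0r opprK.
have -> : - (V0 + N%:R) / 2 = - c' by move: E; rewrite /q lnU la; clra.
exact: Ug.
Qed.

(** The lowering operators $\partial_i+x_i$ of the harmonic oscillator map [f] to solutions of
    $\Delta G=(|x|^2-N)G$, whose bounded-decaying solutions are multiples of $e^{-|x|^2/2}$ by
    [ground_state]. Hence [f] times the inverse Gaussian is affine. *)
Lemma linear_profile f (M : R) : continuous f -> (forall x, `|f x| <= M) ->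
  DLap f (fun x => (dot x x - N%:R - 2) * f x) ->
  exists b, forall x, f x = dot b x * gauss 2^-1 0 x.
Proof.
move=> cf fM ff; have M0 : 0 <= M by apply: le_trans (fM 0).
pose q x : R := dot x x - N%:R.
have cd := @continuous_dot R N.
have q1 : class_C 1 (fun x => q x - 2).
  rewrite (_ : (fun x => _) = fun x => dot x x + (- N%:R - 2)); last by apply/funext => x; rewrite /q; ring.
  by apply: class_C_add; [exact: class_C_dot|exact: class_C_cst].
have q2 : class_C 1 q.
  rewrite (_ : q = fun x => dot x x + (- N%:R)); last by apply/funext => x; rewrite /q; ring.
  by apply: class_C_add; [exact: class_C_dot|exact: class_C_cst].
have cq2 := class_C_continuous q1; have cq := class_C_continuous q2.
have cg : continuous (fun x => (q x - 2) * f x) by exact: continuous_mul.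
have fl i := DLap_locally_lipschitz i cf cg ff.
have f1 : class_C 1 f.
  apply: (DLap_class_C1 cf cg ff) => i.
  by apply: locally_lipschitz_mul => //; exact: locally_lipschitz_C1.
have g1 : class_C 1 (fun x => (q x - 2) * f x) by exact: class_C_mul.
have dgE i : partial i (fun x => (q x - 2) * f x) = fun x => 2 * x ord0 i * f x + (q x - 2) * partial i f x.
  apply/funext => x; apply: partialE.
  have h0 := is_derive_sub (is_derive_sub (partial_dot i x) (is_derive_cst (N%:R : R) x (e_ i))) (is_derive_cst (2 : R) x (e_ i)).
  have h := is_derive_mul h0 (class_C_is_derive i x f1).
  by apply: (is_derive_eq h); rewrite !subr0.
have df i x : derivable f x (e_ i) by case: (class_C_is_derive i x f1).
have cdf i := class_C_continuous (class_C_partial i f1).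
have cdg i := class_C_continuous (class_C_partial i g1).
have dff i : DLap (partial i f) (partial i (fun x => (q x - 2) * f x)).
  by apply: (DLap_partial cf cg ff) => // x; case: (class_C_is_derive i x g1).
have [f2 lapf] : class_C 2 f /\ laplacian f = (fun x => (q x - 2) * f x).
  apply: DLap_class_C2 => // i j; rewrite dgE.
  apply: locally_lipschitz_add; apply: locally_lipschitz_mul => //.
  - by apply: continuous_mul; [exact: cst_continuous|exact: coord_continuous].
  - by apply: locally_lipschitz_C1; apply: class_C_mul; [exact: class_C_cst|exact: class_C_coord].
  - exact: locally_lipschitz_C1.
  - exact: (DLap_locally_lipschitz j (cdf i) (cdg i) (dff i)).
have n0 : 0 <= N%:R :> R by [].
pose k : R := N%:R + 3.
have k0 : 0 <= k by rewrite /k; clra.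
have qk x : k < `|x| -> 1 <= q x - 2.
  by move=> xk; have := sqr_norm_le_dot x; rewrite /q /k in xk *; cnra.
have ed : exp_decay 2^-1 f.
  have [|C C0 hC] := decay_outside cf cg ff M0 k0 (fun x => le_trans (ler_norm _) (fM x)).
    by move=> x /qk h fx; rewrite ler_peMl// ltW.
  have cNf : continuous (fun x => -1 * f x) by apply: continuous_mul => //; exact: cst_continuous.
  have cNg : continuous (fun x => -1 * ((q x - 2) * f x)) by apply: continuous_mul => //; exact: cst_continuous.
  have NfM x : -1 * f x <= M by rewrite mulN1r; apply: le_trans (fM x); rewrite -normrN ler_norm.
  have [|D D0 hD] := decay_outside cNf cNg (DLap_scale (-1) cf cg ff) M0 k0 NfM.
    by move=> x /qk h fx; cnra.
  exists (C + D) => [|x]; first exact: addr_ge0.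
  have e0 := expR_ge0 (- (2^-1 * `|x|)).
  have := hC x; have := hD x; rewrite mulN1r mulrDl ler_norml => h3 h4.
  have := mulr_ge0 C0 e0; have := mulr_ge0 D0 e0.
  by move=> h5 h6; apply/andP; split; clra.
have h2 : 0 < 2^-1 :> R by rewrite invr_gt0.
have h4 : 0 < 2^-1 / 2 :> R by rewrite divr_gt0.
have qp x : `|q x - 2| <= ((N%:R + 3) * (1 + N%:R)) * (1 + `|x|) ^+ 2.
  apply: (le_trans (_ : _ <= (N%:R + 3) * (1 + dot x x))).
    by rewrite ler_norml /q; have := dot_ge0 x => d0; apply/andP; split; cnra.
  by rewrite -mulrA ler_wpM2l ?dot_le_poly//; clra.
have KN : 0 <= (N%:R + 3) * (1 + N%:R) :> R by rewrite mulr_ge0//; clra.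
have edq : exp_decay (2^-1 / 2) (fun x => (q x - 2) * f x) by exact: (exp_decay_mul h2 KN qp ed).
pose E x : R := gauss 2^-1 0 x.
have EqE : DLap E (fun x => q x * E x).
  have := @DLap_gauss R N 2^-1 0; rewrite (_ : (fun z => _) = (fun x => q x * E x))//.
  by apply/funext => x; rewrite /q /E; congr (_ * _); field.
have cE : continuous E by exact: continuous_gauss.
have Ev : vanishing E.
  move=> d d0; have [k1 k10 hk1] := @gauss_small R N 2^-1 0 d h2 d0; exists k1 => // x /hk1 h.
  by rewrite ger0_norm ?(ltW h)// expR_ge0.
pose G i x := partial i f x + x ord0 i * f x.
have cxf i : continuous (fun x => x ord0 i * f x) by apply: continuous_mul => //; exact: coord_continuous.
have cG i : continuous (G i) by exact: continuous_add.
have cxg i : continuous (fun x => x ord0 i * ((q x - 2) * f x) + 2 * partial i f x).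
  apply: continuous_add; apply: continuous_mul => //; [exact: coord_continuous|exact: cst_continuous].
have GG i : DLap (G i) (fun x => q x * G i x).
  have := DLap_add (cdf i) (cdg i) (cxf i) (cxg i) (dff i) (DLap_coord_mul i f2 lapf).
  rewrite (_ : (fun x => _ + (_ + _)) = (fun x => q x * G i x))//.
  by apply/funext => x; rewrite dgE /G; ring.
have Gv i : vanishing (G i).
  apply: (exp_decay_vanishing h4); apply: exp_decay_add.
    by apply: (exp_decay_partial h4 cf cg ff) => //; apply: exp_decay_le ed; clra.
  exact: (exp_decay_mul h2 ler01 (coord_le_poly i) ed).
have /choice[s hs] i : exists s : R, forall x, G i x = s * E x.
  apply: (@ground_state _ _ (G i) E q 1 k (cG i) cE cq _ (Gv i) Ev (GG i) EqE k0) => [x|x /qk|x].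
  - exact: gauss_gt0.
  - by clra.
  - by rewrite /q mul1r; clra.
pose b : 'rV[R]_N := \row_i s i.
have [c0 hc0] : exists c0 : R, forall x, f x = (dot b x + c0) * gauss 2^-1 0 x.
  by apply: gaussian_integration => // i x; rewrite [b ord0 i]mxE -hs.
(* The constant part belongs to the ground state, whose potential is [q] instead of [q - 2].
   Comparing both Laplacians of [f] at the origin, where the linear part contributes nothing, gives
   $(q(0)-2)c_0=q(0)c_0$. *)
exists b => x; rewrite hc0; suff -> : c0 = 0 by rewrite addr0.
have E2 : class_C 2 E by exact: class_C_gauss.
have cqE : continuous (fun x => q x * E x) by exact: continuous_mul.
have lapE : laplacian E = fun x => q x * E x.
  apply: (DLap_unique cE _ cqE (class_C2_DLap E2) EqE).
  have : class_C 0 (laplacian E) by apply: class_C_sum => i; do 2 apply: class_C_partial.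
  exact: class_C_continuous.
have dE i y : partial i E y = - y ord0 i * E y.
  by rewrite (partialE (is_derive_gauss 2^-1 0 i y)); rewrite /E; congr (_ * _); field.
have bE i : [/\ continuous (fun y => b ord0 i * (y ord0 i * E y)),
     continuous (fun y => b ord0 i * (y ord0 i * (q y * E y) + 2 * partial i E y)) &
     DLap (fun y => b ord0 i * (y ord0 i * E y)) (fun y => b ord0 i * (y ord0 i * (q y * E y) + 2 * partial i E y))].
  have c1 : continuous (fun y => y ord0 i * E y) by apply: continuous_mul => //; exact: coord_continuous.
  have c2 : continuous (fun y => y ord0 i * (q y * E y) + 2 * partial i E y).
    apply: continuous_add; apply: continuous_mul => //; [exact: coord_continuous|exact: cst_continuous|].
    exact: (class_C_continuous (class_C_partial i (class_CW E2))).
  split; try (by apply: continuous_mul => //; exact: cst_continuous).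
  exact: DLap_scale (DLap_coord_mul i E2 lapE).
have S := DLap_sum (index_enum 'I_N) bE.
have cS1 : continuous (fun y => \sum_i b ord0 i * (y ord0 i * E y)).
  have : class_C 0 (fun y => \sum_i b ord0 i * (y ord0 i * E y)).
    by apply: class_C_sum => i; split=> //; case: (bE i).
  exact: class_C_continuous.
have cS2 : continuous (fun y => \sum_i b ord0 i * (y ord0 i * (q y * E y) + 2 * partial i E y)).
  have : class_C 0 (fun y => \sum_i b ord0 i * (y ord0 i * (q y * E y) + 2 * partial i E y)).
    by apply: class_C_sum => i; split=> //; case: (bE i).
  exact: class_C_continuous.
have cc1 : continuous (fun y => c0 * E y) by apply: continuous_mul => //; exact: cst_continuous.
have cc2 : continuous (fun y => c0 * (q y * E y)) by apply: continuous_mul => //; exact: cst_continuous.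
have T := DLap_add cS1 cS2 cc1 cc2 S (DLap_scale c0 cE cqE EqE).
rewrite (_ : (fun y => _ + c0 * E y) = f) in T; last first.
  apply/funext => y; rewrite hc0 /E mulrDl; congr (_ + _).
  by rewrite /dot mulr_suml; apply: eq_bigr => i _; rewrite mulrA.
have /(congr1 (fun h => h 0)) := DLap_unique cf cg (continuous_add cS2 cc2) ff T.
have z0 := @dot0r 0; have z1 := dot0r b.
rewrite /= hc0 z1 add0r big1 => [|i _]; last by rewrite dE !mxE oppr0 !mul0r mulr0 addr0 mulr0.
have E0 : E 0 = 1 by rewrite /E /gauss z0 mulr0 addr0 oppr0 expR0.
by rewrite -/(E 0) E0 /q z0; clra.
Qed.

End profiles.

(** * The equation tested against compactly supported functions of class C^1 *)

Section weak_form.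
Context {R : realType} {N : nat}.
Local Notation mu := (lebesgue_row R N).
Implicit Types (x y z : 'rV[R]_N) (u w g f h eta chi : 'rV[R]_N -> R).
Local Notation e_ i := (delta_mx ord0 i : 'rV[R]_N).

Lemma Lfun2_continuous_supported f (k : R) : continuous f -> (forall x, k < `|x| -> f x = 0) ->
  f \in Lfun mu 2%:E.
Proof.
move=> cf fk; have [M M0 fM] := continuous_cube_bounded k cf.
apply: (@Lfun2_cube_supported _ _ _ k M) => //; first exact: continuous_measurable_row.
by move=> x; have [/fM//|/fk ->] := leP `|x| k; rewrite normr0.
Qed.

Lemma partial_supp f i (k : R) x : (forall x, k < `|x| -> f x = 0) -> k < `|x| -> partial i f x = 0.
Proof. by move=> fk xk; exact: is_derive_eq0 xk. Qed.

Lemma H1_class_C1 f (k : R) : class_C 1 f -> (forall x, k < `|x| -> f x = 0) ->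
  H1 f /\ is_weak_gradient f (grad f).
Proof.
move=> f1 fk; suff wg : is_weak_gradient f (grad f).
  split=> //; split; last by exists (grad f).
  exact: (Lfun2_continuous_supported (class_C_continuous f1) fk).
move=> i; split.
  rewrite (_ : (fun x => _) = partial i f); last by apply/funext => x; rewrite mxE.
  apply: (@Lfun2_continuous_supported _ k); first exact: (class_C_continuous (class_C_partial i f1)).
  by move=> x; exact: partial_supp.
move=> h ht; have [k' k0' hk] := test_function_supp ht.
rewrite (Rintegral_by_parts _ f1 (ht.1 1%N) hk).
by congr (- _); apply: eq_Rintegral => x _; rewrite mxE.
Qed.

Lemma weak_gradient_class_C1 f (k : R) i : class_C 1 f -> (forall x, k < `|x| -> f x = 0) ->
  ae_eq mu setT (EFin \o (fun x => weak_gradient f x ord0 i - partial i f x)) (cst 0%E).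
Proof.
move=> f1 fk; have [fH fg] := H1_class_C1 f1 fk; have [w2 wE] := weak_gradientP fH i.
have [g2 gE] := fg i.
have E : (fun x => grad f x ord0 i) = partial i f by apply/funext => x; rewrite mxE.
rewrite E in g2.
apply: Lfun2_orthogonal_test; first exact: Lfun2_sub.
move=> h ht; have h2 := Lfun2_test ht.
rewrite (_ : (fun x => _) = (fun x => weak_gradient f x ord0 i * h x - partial i f x * h x)); last first.
  by apply/funext => x; rewrite mulrBl.
rewrite RintegralB//; try exact: Lfun2_mul_integrable.
have := wE _ ht; have := gE _ ht.
have -> : \int[mu]_x (grad f x ord0 i * h x) = \int[mu]_x (partial i f x * h x).
  by apply: eq_Rintegral => x _; rewrite mxE.
by move=> -> /eqP; rewrite eqr_opp => /eqP ->; rewrite subrr.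
Qed.

Lemma psi_gt0 x : dot x x < 1 -> 0 < psi x.
Proof. by move=> h; rewrite /psi /flatexp subr_gt0 h hornerC mul1r expR_gt0. Qed.

(** Since [u] need not have compact support, a smooth cutoff [th], positive where [f] lives, is
    multiplied in. The products with [th] agree almost everywhere, and [th] is then cancelled on the
    support of [f]. *)
Lemma weak_gradient_local u i f (k : R) : H1 u -> class_C 1 u -> continuous f -> 0 <= k ->
  (forall x, k < `|x| -> f x = 0) ->
  \int[mu]_x (weak_gradient u x ord0 i * f x) = \int[mu]_x (partial i u x * f x).
Proof.
move=> uH u1 cf k0 fk; have [w2 wE] := weak_gradientP uH i.
set w := fun x => weak_gradient u x ord0 i in w2 wE *.
have n0 : 0 <= N%:R :> R by [].
(* Then $Nk^2<r^2$, so the cube of radius [k] lies inside the Euclidean ball of radius [r], where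
   the dilated [psi] is positive. *)
pose r : R := k * (N%:R + 1) + 1.
have r0 : 0 < r by rewrite /r; cnra.
pose th x := psi (r^-1 *: (x - 0)) : R.
have thC m : class_C m th by apply: class_C_affine; exact: class_C_psi.
have cth := class_C_continuous (thC 0).
have th_supp x : r < `|x| -> th x = 0.
  move=> xr; apply: psi_supp; rewrite subr0 normrZ gtr0_norm ?invr_gt0// mulrC.
  by rewrite ltr_pdivlMr// mul1r.
have th_gt0 x : `|x| <= k -> 0 < th x.
  move=> xk; apply: psi_gt0; apply: (le_lt_trans (dot_le_sqr_norm _)).
  rewrite subr0 normrZ gtr0_norm ?invr_gt0// exprMn mulrCA exprVn mulrC ltr_pdivrMr ?exprn_gt0// mul1r.
  apply: (le_lt_trans (_ : _ <= N%:R * k ^+ 2)); first by rewrite ler_wpM2l// ler_pXn2r ?nnegrE.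
  by rewrite /r; cnra.
have [M M0 thM] := continuous_cube_bounded r cth.
have thM' x : `|th x| <= M by have [/thM//|/th_supp ->] := leP `|x| r; rewrite normr0.
have mw : measurable_fun setT w := Lfun2_measurable w2.
have mth : measurable_fun setT th := continuous_measurable_row cth.
have wth2 : (fun x => w x * th x) \in Lfun mu 2%:E.
  apply: Lfun2P; first exact: measurable_funM.
  apply: (@le_integrable _ _ _ _ _ measurableT _ (EFin \o (fun x => M ^+ 2 * (w x * w x)))).
  - by apply/measurable_EFinP; apply: measurable_funX; exact: measurable_funM.
  - move=> x _; rewrite /= lee_fin exprMn normrM !normrX mulrC [leRHS]normrM normrX (ger0_norm M0).
    by rewrite -expr2 normrX ler_wpM2r ?exprn_ge0// ler_pXn2r ?nnegrE.
  - by apply: integrable_scale; exact: Lfun2_mul_integrable.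
have cdu := class_C_continuous (class_C_partial i u1).
have duth2 : (fun x => partial i u x * th x) \in Lfun mu 2%:E.
  apply: (@Lfun2_continuous_supported _ r); first exact: continuous_mul.
  by move=> x /th_supp ->; rewrite mulr0.
have ae0 : ae_eq mu setT (EFin \o (fun x => w x * th x - partial i u x * th x)) (cst 0%E).
  apply: Lfun2_orthogonal_test; first exact: Lfun2_sub.
  move=> h ht; have h2 := Lfun2_test ht.
  have tht : test_function (fun x => th x * h x).
    apply: (@test_functionP _ _ _ r) => [m|x /th_supp ->]; last by rewrite mul0r.
    by apply: class_C_mul => //; exact: ht.1.
  rewrite (_ : (fun x => _) = (fun x => w x * th x * h x - partial i u x * th x * h x)); last first.
    by apply/funext => x; rewrite mulrBl.
  rewrite RintegralB//; try exact: Lfun2_mul_integrable.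
  have := wE _ tht; rewrite (Rintegral_by_parts (k := r) i u1 (tht.1 1%N)); last by move=> x /th_supp ->; rewrite mul0r.
  move=> /eqP; rewrite eqr_opp => /eqP e.
  have -> : \int[mu]_x (w x * th x * h x) = \int[mu]_x (w x * (th x * h x)).
    by apply: eq_Rintegral => x _; rewrite mulrA.
  have -> : \int[mu]_x (partial i u x * th x * h x) = \int[mu]_x (partial i u x * (th x * h x)).
    by apply: eq_Rintegral => x _; rewrite mulrA.
  by rewrite e subrr.
rewrite /Rintegral; congr fine; apply: ae_eq_integral => //.
- apply/measurable_EFinP; apply: measurable_funM => //; exact: continuous_measurable_row.
- apply/measurable_EFinP; apply: measurable_funM; exact: continuous_measurable_row.
- apply: filterS ae0 => x /= h _; congr EFin.
  have [xk|xk] := leP `|x| k; last by rewrite fk// !mulr0.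
  have := h I; move=> [] /eqP; rewrite -mulrBl mulf_eq0 (gt_eqF (th_gt0 x xk)) orbF subr_eq0 => /eqP e.
  by rewrite -e.
Qed.

(** The integral identities below use products of a cutoff and a solution as test functions. These
    are neither dilated bumps, as in [DLap], nor known to be smooth. *)
Definition weak_form u g := forall eta (k : R), class_C 1 eta -> (forall x, k < `|x| -> eta x = 0) ->
  \sum_i \int[mu]_x (partial i u x * partial i eta x) = - \int[mu]_x (g x * eta x).

Lemma weak_solution_weak_form (V u : 'rV[R]_N -> R) (eps : R) : 0 < eps -> continuous V ->
  positive_solution V eps u -> class_C 1 u ->
  weak_form u (fun x => (V x - ln (u x ^+ 2)) * u x / eps ^+ 2).
Proof.
move=> e0 cV [cu u0 [uH uw]] u1 eta k et ek.
wlog k0 : k ek / 0 <= k => [wl|].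
  apply: (wl (Num.max k 0)); last by rewrite le_max lexx orbT.
  by move=> x; rewrite gt_max => /andP[/ek].
have [etH etg] := H1_class_C1 et ek; have [iu E] := uw _ etH.
have cet := class_C_continuous et; have cl := continuous_ln_sqr cu u0.
have cdet i := class_C_continuous (class_C_partial i et).
have i1 : mu.-integrable setT (EFin \o (fun x => V x * u x * eta x)).
  apply: (@integrable_continuous_supported _ _ _ k) => [|x /ek ->]; last by rewrite mulr0.
  by apply: continuous_mul => //; exact: continuous_mul.
have ug := weak_gradientP uH; have ew := weak_gradientP etH.
have det2 i : partial i eta \in Lfun mu 2%:E.
  by apply: (@Lfun2_continuous_supported _ k) => // x; exact: partial_supp.
have ip i : mu.-integrable setT (EFin \o (fun x => weak_gradient u x ord0 i * weak_gradient eta x ord0 i)).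
  by apply: Lfun2_mul_integrable; [case: (ug i)|case: (ew i)].
have D : \int[mu]_x dot (weak_gradient u x) (weak_gradient eta x) =
    \sum_i \int[mu]_x (partial i u x * partial i eta x).
  rewrite (Rintegral_sum _ ip).2; apply: eq_bigr => i _.
  have [g2 _] := ug i; have [w2 _] := ew i.
  transitivity (\int[mu]_x (weak_gradient u x ord0 i * partial i eta x)); last first.
    by apply: (@weak_gradient_local u i _ k uH u1 (cdet i) k0) => x; exact: partial_supp.
  have ae0 := weak_gradient_class_C1 i et ek.
  rewrite /Rintegral; congr fine; apply: ae_eq_integral => //.
  - by apply/measurable_EFinP; apply: measurable_funM; exact: Lfun2_measurable.
  - by apply/measurable_EFinP; apply: measurable_funM; exact: Lfun2_measurable.
  - apply: filterS ae0 => x /= h _; congr EFin; congr (_ * _).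
    by have := h I; move=> [] /eqP; rewrite subr_eq0 => /eqP.
rewrite D in E.
have -> : \sum_i \int[mu]_x (partial i u x * partial i eta x) =
    (\int[mu]_x (u x * eta x * ln (u x ^+ 2)) - \int[mu]_x (V x * u x * eta x)) / eps ^+ 2.
  by rewrite -E; field; rewrite gt_eqF.
rewrite -RintegralB// -RintegralZr//; last exact: integrable_sub.
rewrite -mulN1r -RintegralZl//.
  by apply: eq_Rintegral => x _; ring.
apply: (@integrable_continuous_supported _ _ _ k) => [|x /ek ->]; last by rewrite mulr0.
apply: continuous_mul => //; apply: continuous_mul; last exact: cst_continuous.
exact: continuous_potential.
Qed.

Lemma is_derive_translate f (b x v : 'rV[R]_N) (d : R) : is_derive (x + b) v f d ->
  is_derive x v (fun z => f (z + b)) d.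
Proof.
move=> fd; have fd' : is_derive (1 *: (x - - b)) v f d by rewrite scale1r opprK.
have := is_derive_affine fd'; rewrite mul1r.
by rewrite (_ : (fun z => f (1 *: (z - - b))) = (fun z => f (z + b)))//; apply/funext => z; rewrite scale1r opprK.
Qed.

Lemma partial_translate f (b : 'rV[R]_N) i : class_C 1 f ->
  partial i (fun z => f (z + b)) = fun z => partial i f (z + b).
Proof.
by move=> f1; apply/funext => x; apply: partialE; exact: (is_derive_translate (class_C_is_derive i (x + b) f1)).
Qed.

Lemma class_C_translate m f (b : 'rV[R]_N) : class_C m f -> class_C m (fun z => f (z + b)).
Proof.
move=> fm; have := class_C_affine 1 (- b) fm.
by rewrite (_ : (fun z => f (1 *: (z - - b))) = (fun z => f (z + b)))//; apply/funext => z; rewrite scale1r opprK.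
Qed.

Lemma Rintegral_translate f (b : 'rV[R]_N) (k : R) : continuous f -> (forall x, k < `|x| -> f x = 0) ->
  \int[mu]_x f (x + b) = \int[mu]_x f x.
Proof.
move=> cf fk; have [_ <-] := Rintegral_shift b (integrable_continuous_supported cf fk).
by apply: eq_Rintegral => x _; rewrite addrC.
Qed.

Lemma weak_form_translate u g (b : 'rV[R]_N) : class_C 1 u -> continuous g -> weak_form u g ->
  weak_form (fun z => u (z + b)) (fun z => g (z + b)).
Proof.
move=> u1 cg ug eta k et ek.
have ekb x : k + `|b| < `|x| -> eta (x + (- b)) = 0.
  by move=> xk; apply: ek; have := ler_normD (x - b) b; rewrite subrK; clra.
have cet := class_C_continuous et.
have := ug (fun z => eta (z + (- b))) _ (class_C_translate (- b) et) ekb.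
have -> : \int[mu]_x (g x * eta (x - b)) = \int[mu]_x (g (x + b) * eta x).
  rewrite -(Rintegral_translate b (k := k + `|b|) (f := fun x => g x * eta (x - b))).
  - by apply: eq_Rintegral => x _; rewrite addrK.
  - by apply: continuous_mul => //; exact: (continuous_translate (b := - b)).
  - by move=> x /ekb ->; rewrite mulr0.
move=> <-; apply: eq_bigr => i _; rewrite (partial_translate b i u1) (partial_translate (- b) i et).
rewrite -(Rintegral_translate b (k := k + `|b|) (f := fun x => partial i u x * partial i eta (x - b))).
- by apply: eq_Rintegral => x _; rewrite addrK.
- apply: continuous_mul; first exact: (class_C_continuous (class_C_partial i u1)).
  exact: (continuous_translate (b := - b) (class_C_continuous (class_C_partial i et))).
- move=> x xk; rewrite [partial i eta _](partial_supp i (k := k)) ?mulr0//.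
  by have := ler_normD (x - b) b; rewrite subrK; clra.
Qed.

Lemma weak_form_affine u g (b : 'rV[R]_N) (a : R) : 0 < a -> class_C 1 u -> continuous g -> weak_form u g ->
  weak_form (fun z => u (b + a *: z)) (fun z => a ^+ 2 * g (b + a *: z)).
Proof.
move=> a0 u1 cg ug eta k et ek.
have a0' : a != 0 by rewrite gt_eqF.
have aN : a^-1 ^+ N != 0 by rewrite expf_neq0// invr_eq0.
pose et' z := eta (a^-1 *: (z - b)).
have et'1 : class_C 1 et' by exact: class_C_affine.
have supp z : a * k + `|b| < `|z| -> k < `|a^-1 *: (z - b)|.
  move=> zk; rewrite normrZ gtr0_norm ?invr_gt0// mulrC ltr_pdivlMr//.
  by have := ler_normD (z - b) b; rewrite subrK mulrC; clra.
have et'k z : a * k + `|b| < `|z| -> et' z = 0 by move=> /supp/ek.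
have cet := class_C_continuous et; have cet' := class_C_continuous et'1.
have := ug et' _ et'1 et'k.
have back x : a^-1 *: (b + a *: x - b) = x by rewrite addrAC subrr add0r scalerA mulVf// scale1r.
have I1 f : continuous f -> \int[mu]_x (f (b + a *: x) * eta x) = a^-1 ^+ N * \int[mu]_x (f x * et' x).
  move=> cf; have ci : mu.-integrable setT (EFin \o (fun x => f x * et' x)).
    apply: (integrable_continuous_supported (k := a * k + `|b|)); first exact: continuous_mul.
    by move=> x /et'k ->; rewrite mulr0.
  have [_ <-] := Rintegral_affine b a0 ci.
  by apply: eq_Rintegral => x _; rewrite /et' back.
have dv i x : is_derive x (e_ i) (fun z => u (b + a *: z)) (a * partial i u (b + a *: x)).
  have := is_derive_affine (f := u) (a := a) (b := - (a^-1 *: b)) (x := x) (v := e_ i) (d := partial i u (b + a *: x)).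
  have E z : a *: (z - - (a^-1 *: b)) = b + a *: z.
    by rewrite opprK scalerDr scalerA divff// scale1r addrC.
  rewrite E (_ : (fun z => u _) = (fun z => u (b + a *: z))); last by apply/funext => z; rewrite E.
  by apply; exact: (class_C_is_derive i _ u1).
move=> UG.
have -> : \int[mu]_x (a ^+ 2 * g (b + a *: x) * eta x) = a ^+ 2 * (a^-1 ^+ N * \int[mu]_x (g x * et' x)).
  rewrite -I1// -RintegralZl//; first by apply: eq_Rintegral => x _; rewrite mulrA.
  apply: (integrable_continuous_supported (k := k)); last by move=> x /ek ->; rewrite mulr0.
  by apply: continuous_mul => //; exact: continuous_comp_line.
rewrite -[\int[mu]_x _]opprK -UG mulrN mulrN opprK !mulr_sumr; apply: eq_bigr => i _.
have cdu := class_C_continuous (class_C_partial i u1).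
have cde := class_C_continuous (class_C_partial i et'1).
have ci : mu.-integrable setT (EFin \o (fun x => partial i u x * partial i et' x)).
  apply: (integrable_continuous_supported (k := a * k + `|b|)); first exact: continuous_mul.
  by move=> x xk; rewrite (partial_supp i et'k xk) mulr0.
have [ci' <-] := Rintegral_affine b a0 ci.
rewrite -RintegralZl//; apply: eq_Rintegral => x _.
rewrite (partialE (dv i x)) /et' partial_affine// back expr2.
by field.
Qed.

End weak_form.

(** * Green and Pohozaev identities with a cutoff *)

Section pohozaev.
Context {R : realType} {N : nat}.
Local Notation mu := (lebesgue_row R N).
Implicit Types (x y z : 'rV[R]_N) (u w g f h eta chi : 'rV[R]_N -> R).
Local Notation e_ i := (delta_mx ord0 i : 'rV[R]_N).

Lemma Rintegral_cvg_supported (wn : nat -> 'rV[R]_N -> R) w f (k C : R) : 0 < k -> continuous f ->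
  (forall x, k < `|x| -> f x = 0) -> (forall n, continuous (wn n)) -> continuous w ->
  (forall n x, `|x| <= k -> `|wn n x| <= C) -> (forall x, wn n x @[n --> \oo] --> w x) ->
  \int[mu]_x (wn n x * f x) @[n --> \oo] --> \int[mu]_x (w x * f x).
Proof.
move=> k0 cf fk cwn cw wC ww.
have kf : kernel1 (fun y => f (0 + k *: y)).
  split; first exact: continuous_comp_line.
  by move=> y y1; apply: fk; rewrite add0r normrZ gtr0_norm// ltr_pMr.
have kN : k^-1 ^+ N != 0 by rewrite expf_neq0// invr_eq0 gt_eqF.
have E h : continuous h -> \int[mu]_x (h x * f x) =
    (k^-1 ^+ N)^-1 * \int[mu]_y (h (0 + k *: y) * f (0 + k *: y)).
  move=> ch; have ci : mu.-integrable setT (EFin \o (fun x => h x * f x)).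
    apply: (integrable_continuous_supported (k := k)); first exact: continuous_mul.
    by move=> x /fk ->; rewrite mulr0.
  by have [_ ->] := Rintegral_affine 0 k0 ci; rewrite mulrA mulVf// mul1r.
have L := @kernel_cvg R N _ wn w 0 k C kf cwn _ ww.
rewrite E// (_ : (fun n => _) = (fun n => (k^-1 ^+ N)^-1 * \int[mu]_y (wn n (0 + k *: y) * f (0 + k *: y)))); last first.
  by apply/funext => n; rewrite E.
apply: cvgM; first exact: cvg_cst.
apply: L => n y y1; apply: wC.
by rewrite add0r normrZ gtr0_norm// ler_piMr// ltW.
Qed.

Lemma increment_cvg f i chi (k : R) : 0 < k -> class_C 1 f -> continuous chi ->
  (forall x, k < `|x| -> chi x = 0) ->
  \int[mu]_x ((n.+1%:R^-1)^-1 * (f (x + n.+1%:R^-1 *: e_ i) - f x) * chi x) @[n --> \oo] -->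
  \int[mu]_x (partial i f x * chi x).
Proof.
move=> k0 f1 cchi chik; have cf := class_C_continuous f1.
have cdf := class_C_continuous (class_C_partial i f1).
have df x : derivable f x (e_ i) by case: (class_C_is_derive i x f1).
have [L L0 hL] := continuous_partial_lipschitz df cdf k.
pose t (n : nat) : R := n.+1%:R^-1.
have t0 n : 0 < t n by rewrite invr_gt0.
have t1 n : t n <= 1 by rewrite invf_le1// ler1n.
apply: (@Rintegral_cvg_supported _ _ chi k L k0 cchi chik) => //.
- move=> n; apply: continuous_mul; first exact: cst_continuous.
  by apply: continuous_sub => //; exact: continuous_translate.
- move=> n x xk; rewrite -/(t n) normrM normfV mulrC ler_pdivrMr ?normr_gt0 ?gt_eqF//.
  by apply: hL => //; rewrite gtr0_norm.
- move=> x; apply: ((cvgr_dnbhsP _ _ _).1 (partial_cvg (df x)) t); split=> [n|]; first by rewrite gt_eqF.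
  exact: cvg_harmonic.
Qed.

(** The commutator $\Delta(\chi u)-\chi\Delta u = 2\nabla\chi\cdot\nabla u+u\Delta\chi$, written
    without second derivatives of [u]. *)
Definition cutoff_flux chi u x : R := \sum_i (2 * partial i chi x * partial i u x + u x * partial i (partial i chi) x).

Lemma Rintegral_supp_add f g (k : R) : continuous f -> continuous g ->
  (forall x, k < `|x| -> f x = 0) -> (forall x, k < `|x| -> g x = 0) ->
  \int[mu]_x (f x + g x) = \int[mu]_x f x + \int[mu]_x g x.
Proof.
by move=> cf cg fk gk; rewrite RintegralD//; apply: (integrable_continuous_supported (k := k)).
Qed.

Lemma Rintegral_supp_sub f g (k : R) : continuous f -> continuous g ->
  (forall x, k < `|x| -> f x = 0) -> (forall x, k < `|x| -> g x = 0) ->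
  \int[mu]_x (f x - g x) = \int[mu]_x f x - \int[mu]_x g x.
Proof.
by move=> cf cg fk gk; rewrite RintegralB//; apply: (integrable_continuous_supported (k := k)).
Qed.

Lemma continuous_cutoff_flux chi u : class_C 2 chi -> class_C 1 u -> continuous (cutoff_flux chi u).
Proof.
move=> chi2 u1.
have : class_C 0 (cutoff_flux chi u).
  apply: class_C_sum => i; split => //; apply: continuous_add; apply: continuous_mul.
  - apply: continuous_mul; first exact: cst_continuous.
    exact: (class_C_continuous (class_C_partial i chi2)).
  - exact: (class_C_continuous (class_C_partial i u1)).
  - exact: (class_C_continuous u1).
  - exact: (class_C_continuous (class_C_partial i (class_C_partial i chi2))).
exact: class_C_continuous.
Qed.

Lemma cutoff_flux_supp chi u (k : R) x : (forall x, k < `|x| -> chi x = 0) -> k < `|x| ->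
  cutoff_flux chi u x = 0.
Proof.
move=> chik xk; rewrite /cutoff_flux big1// => i _.
have d1 y : k < `|y| -> partial i chi y = 0 by exact: partial_supp.
by rewrite d1// (partial_supp i d1)// !mulr0 mul0r addr0.
Qed.

(** Each equation is tested with [chi] times the other solution, so the terms $\chi\nabla
    u\cdot\nabla w$ cancel. A last integration by parts removes the derivative from [w], so that
    difference quotients can be inserted for it. *)
Lemma green u g w h chi (k : R) : class_C 1 u -> class_C 1 w -> continuous g -> continuous h ->
  weak_form u g -> weak_form w h -> class_C 2 chi -> (forall x, k < `|x| -> chi x = 0) ->
  \int[mu]_x (h x * (chi x * u x)) - \int[mu]_x (g x * (chi x * w x)) =
  \int[mu]_x (w x * cutoff_flux chi u x).
Proof.
move=> u1 w1 cg ch ug wh chi2 chik; have chi1 := class_CW chi2.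
have cu := class_C_continuous u1; have cw := class_C_continuous w1.
have cchi := class_C_continuous chi1.
have cdu i := class_C_continuous (class_C_partial i u1).
have cdw i := class_C_continuous (class_C_partial i w1).
have cdc i := class_C_continuous (class_C_partial i chi1).
have cddc i := class_C_continuous (class_C_partial i (class_C_partial i chi2)).
have dck i x : k < `|x| -> partial i chi x = 0 by exact: partial_supp.
have ddck i x : k < `|x| -> partial i (partial i chi) x = 0 by exact: (partial_supp i (dck i)).
have s1 f x : k < `|x| -> chi x * f x = 0 by move=> /chik ->; rewrite mul0r.
have E f i x : class_C 1 f -> partial i (fun x => chi x * f x) x = partial i chi x * f x + chi x * partial i f x.
  move=> f1; apply: partialE; exact: is_derive_mul (class_C_is_derive i x chi1) (class_C_is_derive i x f1).
have e1 := ug (fun x => chi x * w x) k (class_C_mul chi1 w1) (s1 w).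
have e2 := wh (fun x => chi x * u x) k (class_C_mul chi1 u1) (s1 u).
have -> : \int[mu]_x (h x * (chi x * u x)) - \int[mu]_x (g x * (chi x * w x)) =
    - (- \int[mu]_x (h x * (chi x * u x))) - \int[mu]_x (g x * (chi x * w x)) by rewrite opprK.
rewrite -e2 addrC -e1 -sumrB.
have cf i : continuous (fun x => w x * (2 * partial i chi x * partial i u x + u x * partial i (partial i chi) x)).
  apply: continuous_mul => //; apply: continuous_add; apply: continuous_mul => //.
  by apply: continuous_mul => //; exact: cst_continuous.
have fi i : mu.-integrable setT (EFin \o (fun x => w x * (2 * partial i chi x * partial i u x + u x * partial i (partial i chi) x))).
  by apply: (integrable_continuous_supported (k := k)) => // x xk; rewrite dck// ddck// !(mulr0, mul0r, addr0).
have -> : \int[mu]_x (w x * cutoff_flux chi u x) =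
    \int[mu]_x (\sum_i w x * (2 * partial i chi x * partial i u x + u x * partial i (partial i chi) x)).
  by apply: eq_Rintegral => x _; rewrite /cutoff_flux mulr_sumr.
rewrite (Rintegral_sum _ fi).2; apply: eq_bigr => i _.
have c1 : continuous (fun x => partial i u x * partial i (fun x => chi x * w x) x).
  by apply: continuous_mul => //; exact: (class_C_continuous (class_C_partial i (class_C_mul chi1 w1))).
have c2 : continuous (fun x => partial i w x * partial i (fun x => chi x * u x) x).
  by apply: continuous_mul => //; exact: (class_C_continuous (class_C_partial i (class_C_mul chi1 u1))).
rewrite -(Rintegral_supp_sub (k := k) c1 c2); last 2 first.
- by move=> x xk; rewrite (partial_supp i (s1 w) xk) mulr0.
- by move=> x xk; rewrite (partial_supp i (s1 u) xk) mulr0.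
have -> : \int[mu]_x (partial i u x * partial i (fun x => chi x * w x) x - partial i w x * partial i (fun x => chi x * u x) x) =
    \int[mu]_x (w x * (partial i chi x * partial i u x) - partial i w x * (partial i chi x * u x)).
  by apply: eq_Rintegral => x _; rewrite !E//; ring.
have d1 : class_C 1 (fun x => partial i chi x * u x) := class_C_mul (class_C_partial i chi2) u1.
have d1k x : k < `|x| -> partial i chi x * u x = 0 by move=> /dck ->; rewrite mul0r.
have cd1 := class_C_continuous d1; have cdd1 := class_C_continuous (class_C_partial i d1).
rewrite (Rintegral_supp_sub (k := k)); last 4 first.
- exact: (continuous_mul cw (continuous_mul (cdc i) (cdu i))).
- exact: continuous_mul.
- by move=> x xk; rewrite dck// mul0r mulr0.
- by move=> x xk; rewrite d1k// mulr0.
have := Rintegral_by_parts i w1 d1 d1k => P.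
rewrite -[\int[mu]_x (partial i w x * _)]opprK -P opprK.
rewrite -(Rintegral_supp_add (k := k)); last 4 first.
- exact: (continuous_mul cw (continuous_mul (cdc i) (cdu i))).
- exact: continuous_mul.
- by move=> x xk; rewrite dck// mul0r mulr0.
- by move=> x xk; rewrite (partial_supp i d1k xk) mulr0.
apply: eq_Rintegral => x _.
rewrite (partialE (is_derive_mul (class_C_is_derive i x (class_C_partial i chi2)) (class_C_is_derive i x u1))).
by ring.
Qed.

(** Green's identity is applied to [u] and its translate along [e_ j], then divided by the step. The
    limit replaces differentiating the equation, which would require second derivatives of [u]. *)
Lemma pohozaev_aux u g chi (k : R) j : 0 < k -> class_C 1 u -> class_C 1 g -> weak_form u g ->
  class_C 2 chi -> (forall x, k < `|x| -> chi x = 0) ->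
  \int[mu]_x (partial j g x * (chi x * u x)) - \int[mu]_x (partial j u x * (g x * chi x)) =
  \int[mu]_x (partial j u x * cutoff_flux chi u x).
Proof.
move=> k0 u1 g1 ug chi2 chik.
have cu := class_C_continuous u1; have cg := class_C_continuous g1.
have cchi := class_C_continuous chi2.
have cP := continuous_cutoff_flux chi2 u1.
have ccu : continuous (fun x => chi x * u x) by exact: continuous_mul.
have cgc : continuous (fun x => g x * chi x) by exact: continuous_mul.
have sP x : k < `|x| -> cutoff_flux chi u x = 0 by exact: cutoff_flux_supp.
have s1 x : k < `|x| -> chi x * u x = 0 by move=> /chik ->; rewrite mul0r.
have s2 x : k < `|x| -> g x * chi x = 0 by move=> /chik ->; rewrite mulr0.
have l1 := increment_cvg (i := j) k0 g1 ccu s1.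
have l2 := increment_cvg (i := j) k0 u1 cgc s2.
have l3 := increment_cvg (i := j) k0 u1 cP sP.
have l12 := cvgB l1 l2.
have {}l12 := l12 ltac:(typeclasses eauto).
apply: (@cvg_unique _ (@Rhausdorff R) _ _ _ _ l12).
move: l3; rewrite (_ : (fun n => _) = (fun n => \int[mu]_x (n.+1%:R^-1^-1 * (g (x + n.+1%:R^-1 *: e_ j) - g x) * (chi x * u x)) -
  \int[mu]_x (n.+1%:R^-1^-1 * (u (x + n.+1%:R^-1 *: e_ j) - u x) * (g x * chi x)))) //.
apply/funext => n; set t : R := n.+1%:R^-1.
have ut1 := class_C_translate (t *: e_ j) u1.
have gt1 := class_C_translate (t *: e_ j) g1.
have cut := class_C_continuous ut1; have cgt := class_C_continuous gt1.
have ugt := weak_form_translate (t *: e_ j) u1 cg ug.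
have G1 := green u1 ut1 cg cgt ug ugt chi2 chik.
(* The pairing of [u] with itself vanishes, so it can be subtracted to form the difference quotient
   of the right-hand side. *)
have G0 := green u1 u1 cg cg ug ug chi2 chik.
rewrite subrr in G0.
have I f h : continuous f -> continuous h -> (forall x, k < `|x| -> h x = 0) ->
    \int[mu]_x (t^-1 * (f (x + t *: e_ j) - f x) * h x) =
    t^-1 * (\int[mu]_x (f (x + t *: e_ j) * h x) - \int[mu]_x (f x * h x)).
  move=> cf ch hk; have cft := continuous_translate (b := t *: e_ j) cf.
  rewrite -(Rintegral_supp_sub (k := k)); last 4 first.
  - exact: continuous_mul.
  - exact: continuous_mul.
  - by move=> x /hk ->; rewrite mulr0.
  - by move=> x /hk ->; rewrite mulr0.
  rewrite -RintegralZl//; first by apply: eq_Rintegral => x _; ring.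
  apply: (integrable_continuous_supported (k := k)); last by move=> x /hk ->; rewrite !mulr0 subr0.
  by apply: continuous_sub; exact: continuous_mul.
rewrite !I// -G1 -G0 subr0 -mulrBr; congr (_ * _).
have -> : \int[mu]_x (g x * (chi x * u (x + t *: e_ j))) = \int[mu]_x (u (x + t *: e_ j) * (g x * chi x)).
  by apply: eq_Rintegral => x _; ring.
have -> : \int[mu]_x (g x * (chi x * u x)) = \int[mu]_x (u x * (g x * chi x)).
  by apply: eq_Rintegral => x _; ring.
by ring.
Qed.

(** For $g=(Q-\ln v^2)v$ one has $v\,\partial_jg-g\,\partial_jv=\partial_jQ\,v^2-2v\,\partial_jv$:
    the logarithms cancel, and the last term is a derivative of $v^2$. Only the potential term is
    left without a derivative of the cutoff. *)
Lemma pohozaev (Q v chi : 'rV[R]_N -> R) (k : R) j : 0 < k -> class_C 1 Q -> class_C 1 v ->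
  (forall x, 0 < v x) -> weak_form v (fun x => (Q x - ln (v x ^+ 2)) * v x) ->
  class_C 2 chi -> (forall x, k < `|x| -> chi x = 0) ->
  \int[mu]_x (chi x * partial j Q x * v x ^+ 2) =
  - (\int[mu]_x (v x ^+ 2 * partial j chi x)) + \int[mu]_x (partial j v x * cutoff_flux chi v x).
Proof.
move=> k0 Q1 v1 v0 vg chi2 chik; have chi1 := class_CW chi2.
have g1 := class_C1_potential Q1 v1 v0; have cg := class_C_continuous g1.
have cv := class_C_continuous v1; have cdv := class_C_continuous (class_C_partial j v1).
have cdQ := class_C_continuous (class_C_partial j Q1).
have cdg := class_C_continuous (class_C_partial j g1).
have cchi := class_C_continuous chi2.
rewrite -(pohozaev_aux j k0 v1 g1 vg chi2 chik).
have v2 : class_C 1 (fun x => v x * v x) by exact: class_C_mul.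
have P := Rintegral_by_parts j v2 chi1 chik.
have -> : \int[mu]_x (v x ^+ 2 * partial j chi x) = \int[mu]_x (v x * v x * partial j chi x).
  by apply: eq_Rintegral => x _; rewrite expr2.
rewrite P opprK.
have -> : \int[mu]_x (partial j (fun x => v x * v x) x * chi x) = \int[mu]_x (2 * v x * partial j v x * chi x).
  apply: eq_Rintegral => x _; congr (_ * _); apply: partialE.
  have := is_derive_mul (class_C_is_derive j x v1) (class_C_is_derive j x v1).
  by move=> h; apply: (is_derive_eq h); ring.
rewrite -(Rintegral_supp_sub (k := k)); last 4 first.
- by apply: continuous_mul => //; exact: continuous_mul.
- by apply: continuous_mul => //; exact: continuous_mul.
- by move=> x /chik ->; rewrite !(mulr0, mul0r).
- by move=> x /chik ->; rewrite !(mulr0, mul0r).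
rewrite -(Rintegral_supp_add (k := k)).
- by apply: eq_Rintegral => x _; rewrite (partial_potential j Q1 v1 v0); ring.
- by do ![apply: continuous_mul => //]; exact: cst_continuous.
- by apply: continuous_sub; apply: continuous_mul => //; exact: continuous_mul.
- by move=> x /chik ->; rewrite !(mulr0, mul0r).
- by move=> x /chik ->; rewrite !(mulr0, mul0r) subr0.
Qed.

End pohozaev.

(** * Integrals of decaying functions against a quartic cutoff *)

Section polynomial_decay.
Context {R : realType} {N : nat}.
Local Notation mu := (lebesgue_row R N).
Implicit Types (x y z : 'rV[R]_N) (f : 'rV[R]_N -> R).

(* Dyadic induction on the integral over the cube of radius 2^n. *)
Lemma Rintegral_poly_decay : (0 < N)%N -> exists2 C : R, 0 <= C & forall f (k B : R), continuous f ->
  0 <= B -> (forall x, k < `|x| -> f x = 0) ->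
  (forall x, `|x| <= k -> `|f x| * (1 + `|x|) ^+ (2 * N) <= B) -> `|\int[mu]_x f x| <= C * B.
Proof.
move=> N0; exists (2 ^+ N + 2 * 4 ^+ N) => [|f k B cf B0 fk fB].
  by rewrite addr_ge0// mulr_ge0.
have fB' x : `|f x| * (1 + `|x|) ^+ (2 * N) <= B.
  by have [/fB //|/fk ->] := leP `|x| k; rewrite normr0 mul0r.
have fleB x : `|f x| <= B.
  by apply: le_trans (fB' x); rewrite ler_peMr// exprn_ege1// lerDl.
pose F (n : nat) x := `|f x| * \1_(cube (2 ^+ n)) x.
have mf : measurable_fun setT (fun x => `|f x|).
  by apply: continuous_measurable_row; apply: continuousT_comp cf _; exact: norm_continuous.
have iF n : mu.-integrable setT (EFin \o F n).
  apply: (@integrable_cube_supported _ _ _ (2 ^+ n) B).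
  - apply: measurable_funM => //; apply: measurable_indic; exact: measurable_cube.
  - move=> x; rewrite /F normrM normr_id indicE; case: (_ \in _); rewrite ?normr1 ?normr0 ?mulr1 ?mulr0//.
  - by move=> x xK; rewrite /F indicE memNset ?mulr0// /cube/= leNgt xK.
have p20 n : 0 <= 2 ^+ n :> R by rewrite exprn_ge0.
have iC (c a : R) : mu.-integrable setT (EFin \o (fun x => c * (\1_(cube a) : 'rV[R]_N -> R) x)).
  by apply: integrable_scale; exact: integrable_indic_cube.
have IC (c a : R) : 0 <= a -> \int[mu]_x (c * (\1_(cube a) : 'rV[R]_N -> R) x) = c * (a *+ 2) ^+ N.
  move=> a0; rewrite RintegralZl//; last exact: integrable_indic_cube.
  by rewrite Rintegral_indic_cube.
have bound n : \int[mu]_x F n x <= B * 2 ^+ N + B * (2 * 4 ^+ N) * (1 - (2 ^+ n)^-1).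
  elim: n => [|n IH].
    rewrite expr0 invr1 subrr mulr0 addr0.
    apply: (le_trans (_ : _ <= \int[mu]_x (B * (\1_(cube 1) : 'rV[R]_N -> R) x))).
      apply: le_Rintegral => //.
      by move=> x _; rewrite /F expr0 ler_wpM2r.
    by rewrite IC// mulr2n.
  pose c := B * ((2 ^+ n)^-1 ^+ (2 * N)).
  have step : \int[mu]_x F n.+1 x <= \int[mu]_x (F n x + c * (\1_(cube (2 ^+ n.+1)) : 'rV[R]_N -> R) x).
    apply: le_Rintegral => //; first exact: integrable_add.
    move=> x _; rewrite /F !indicE !in_cube.
    have c0 : 0 <= c by rewrite mulr_ge0// exprn_ge0// invr_ge0.
    case: (leP `|x| (2 ^+ n.+1)) => [x1|x1]; rewrite ?mulr1 ?mulr0 ?addr0; last first.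
      by rewrite mulr_ge0.
    case: (leP `|x| (2 ^+ n)) => [x2|x2]; rewrite ?mulr1 ?mulr0 ?add0r ?lerDl//.
    rewrite /c exprVn ler_pdivlMr ?exprn_gt0//; apply: le_trans (fB' x).
    by rewrite ler_wpM2l// lerXn2r ?nnegrE ?addr_ge0//; clra.
  apply: (le_trans step); rewrite RintegralD//.
  rewrite IC//.
  (* On the shell between radii $2^n$ and $2^{n+1}$ the function is at most $c=B2^{-2Nn}$, and the
     larger cube has measure $2^{(n+2)N}$. The product $B4^N2^{-nN}$ is at most $B4^N2^{-n}$ because
     $N>0$, and the shells sum geometrically. *)
  have e : c * (2 ^+ n.+1 *+ 2) ^+ N <= B * (4 ^+ N) * (2 ^+ n)^-1.
    rewrite /c -mulrA -mulrA ler_wpM2l//.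
    have -> : (2 ^+ n.+1 *+ 2 : R) = 2 ^+ n * 4 by rewrite exprS mulrnAl -mulr_natl -mulr_natl; ring.
    rewrite exprMn mulnC exprM mulrA [4 ^+ N * _]mulrC ler_wpM2r ?exprn_ge0//.
    have -> : (2 ^+ n)^-1 ^+ N ^+ 2 * (2 ^+ n) ^+ N = ((2 ^+ n)^-1 ^+ N : R).
      by rewrite expr2 -mulrA -exprMn mulVf ?expr1n ?mulr1// expf_neq0.
    have q0 : 0 <= (2 ^+ n : R)^-1 by rewrite invr_ge0.
    rewrite -[leRHS]expr1; apply: ler_wiXn2l => //.
    by rewrite invf_le1 ?exprn_gt0// exprn_ege1// ler1n.
  have -> : (2 ^+ n.+1 : R)^-1 = (2 ^+ n)^-1 / 2 by rewrite exprS invfM mulrC.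
  have b0 : 0 <= B * (4 ^+ N) * (2 ^+ n)^-1 by rewrite !mulr_ge0// invr_ge0.
  by move: IH e b0; rewrite -!mulrA; cnra.
pose n := (Num.truncn `|k|).+1.
have kn : k <= 2 ^+ n.
  apply: (le_trans (ler_norm k)); apply: (le_trans (ltW (truncnS_gt _))).
  by rewrite -natrX ler_nat ltnW// ltn_expl.
apply: (le_trans (le_normr_Rintegral measurableT (integrable_continuous_supported cf fk))).
have -> : \int[mu]_x `|f x| = \int[mu]_x F n x.
  apply: eq_Rintegral => x _; rewrite /F indicE in_cube.
  case: (leP `|x| (2 ^+ n)) => [|xn]; rewrite ?mulr1//.
  by rewrite fk ?normr0 ?mul0r//; exact: le_lt_trans kn xn.
apply: (le_trans (bound n)).
have : 0 <= (2 ^+ n : R)^-1 by rewrite invr_ge0.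
have : 0 <= B * (2 * 4 ^+ N) by rewrite mulr_ge0// mulr_ge0.
move=> h1 h2; rewrite (_ : (2 ^+ N + 2 * 4 ^+ N) * B = B * 2 ^+ N + B * (2 * 4 ^+ N)); last by ring.
by rewrite lerD2l ler_piMr//; clra.
Qed.

End polynomial_decay.

Section cutoff.
Context {R : realType} {N : nat}.
Local Notation mu := (lebesgue_row R N).
Implicit Types (x y z : 'rV[R]_N) (f w v : 'rV[R]_N -> R).
Local Notation e_ i := (delta_mx ord0 i : 'rV[R]_N).

Definition flat4 (p : {poly R}) x : R := flatexp p (1 - dot x x ^+ 2).

(* The gradient vanishes to third order at the origin, so that the flux of a
   decaying function through the cutoff is O(s^4). *)
Definition bump4 (s : R) x : R := flat4 1 (s *: (x - 0)).

Lemma class_C_flat4 m (p : {poly R}) : class_C m (flat4 p).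
Proof.
apply: class_C_flatexp.
rewrite (_ : (fun x => _) = fun x : 'rV[R]_N => -1 * (dot x x * dot x x) + 1); last first.
  by apply/funext => x; ring.
apply: class_C_add; last exact: class_C_cst.
apply: class_C_mul; first exact: class_C_cst.
by apply: class_C_mul; exact: class_C_dot.
Qed.

Lemma flat4_supp (p : {poly R}) x : 1 < `|x| -> flat4 p x = 0.
Proof.
move=> x1; apply: flatexp_le0; rewrite subr_le0 exprn_ege1//.
by apply: le_trans (sqr_norm_le_dot x); rewrite exprn_ege1// ltW.
Qed.

Lemma is_derive_flat4 (p : {poly R}) i x :
  is_derive x (e_ i) (flat4 p) (flat4 (dflatexp p) x * (-4 * (dot x x * x ord0 i))).
Proof.
have h1 := is_derive_sub (is_derive_cst (1 : R) x (e_ i)) (is_derive_expn 2 (partial_dot i x)).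
have h := is_derive_comp_dir (g := fun z : 'rV[R]_N => 1 - dot z z ^+ 2) (is_derive_flatexp p _) h1.
by apply: (is_derive_eq h); rewrite expr1 /flat4; ring.
Qed.

Lemma flat4_bounds : exists2 C : R, 0 <= C & forall x i,
  `|partial i (flat4 1) x| <= C * `|x| ^+ 3 /\ `|partial i (partial i (flat4 1)) x| <= C * `|x| ^+ 2.
Proof.
have [K1 K10 h1] := continuous_cube_bounded 1 (class_C_continuous (class_C_flat4 0 (dflatexp 1))).
have [K2 K20 h2] := continuous_cube_bounded 1 (class_C_continuous (class_C_flat4 0 (dflatexp (dflatexp 1)))).
have n0 : 0 <= N%:R :> R by [].
exists (K1 * (4 * N%:R + 8) + K2 * (16 * N%:R ^+ 2)).
  by rewrite addr_ge0// mulr_ge0// ?addr_ge0// mulr_ge0// exprn_ge0.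
move=> x i.
have E1 y : partial i (flat4 1) y = flat4 (dflatexp 1) y * (-4 * (dot y y * y ord0 i)).
  exact: partialE (is_derive_flat4 1 i y).
have E2 : partial i (partial i (flat4 1)) x =
    flat4 (dflatexp (dflatexp 1)) x * (16 * (dot x x * x ord0 i) ^+ 2) -
    flat4 (dflatexp 1) x * (8 * x ord0 i ^+ 2 + 4 * dot x x).
  rewrite (funext E1); apply: partialE.
  have e1 := is_derive_mul (is_derive_cst (-4 : R) x (e_ i)) (is_derive_mul (partial_dot i x) (is_derive_coord i i x)).
  have h := is_derive_mul (is_derive_flat4 (dflatexp 1) i x) e1.
  by apply: (is_derive_eq h); rewrite /cst eqxx/=; ring.
have [x1|x1] := leP `|x| 1; last first.
  by rewrite E2 E1 !flat4_supp// !mul0r subrr normr0; split; rewrite mulr_ge0 ?exprn_ge0// addr_ge0// mulr_ge0// ?addr_ge0// mulr_ge0// exprn_ge0.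
have d0 := dot_ge0 x; have dN := dot_le_sqr_norm x.
have ci := coord_le_norm x i; have x0 := normr_ge0 x.
have f1 := h1 x x1; have f2 := h2 x x1.
have dx : `|dot x x * x ord0 i| <= N%:R * `|x| ^+ 3.
  by rewrite normrM (ger0_norm d0) exprSr mulrA ler_pM.
have x2 : `|x ord0 i ^+ 2| <= `|x| ^+ 2 by rewrite normrX lerXn2r ?nnegrE.
split.
  rewrite E1 normrM normrM normrN (ger0_norm (ler0n _ 4)).
  apply: (le_trans (_ : _ <= K1 * (4 * (N%:R * `|x| ^+ 3)))).
    by rewrite ler_pM// ?mulr_ge0// ler_wpM2l.
  have -> : K1 * (4 * (N%:R * `|x| ^+ 3)) = K1 * (4 * N%:R) * `|x| ^+ 3 by ring.
  rewrite ler_wpM2r ?exprn_ge0//.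
  have : 0 <= K1 * 8 by rewrite mulr_ge0.
  have : 0 <= K2 * (16 * N%:R ^+ 2) by rewrite mulr_ge0// mulr_ge0// exprn_ge0.
  by rewrite mulrDr; clra.
rewrite E2; apply: (le_trans (ler_normB _ _)).
have k1 : `|flat4 (dflatexp (dflatexp 1)) x * (16 * (dot x x * x ord0 i) ^+ 2)| <= K2 * (16 * (N%:R ^+ 2 * `|x| ^+ 2)).
  rewrite normrM ler_pM// normrM (ger0_norm (ler0n _ 16)) ler_wpM2l// normrX.
  have h3 : `|dot x x * x ord0 i| <= N%:R * `|x|.
    apply: (le_trans dx); rewrite ler_wpM2l// -[leRHS]expr1; apply: ler_wiXn2l => //.
  by rewrite -exprMn lerXn2r ?nnegrE// mulr_ge0.
have k2 : `|flat4 (dflatexp 1) x * (8 * x ord0 i ^+ 2 + 4 * dot x x)| <= K1 * (8 * `|x| ^+ 2 + 4 * (N%:R * `|x| ^+ 2)).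
  rewrite normrM ler_pM// ger0_norm; last by rewrite addr_ge0// mulr_ge0// sqr_ge0.
  rewrite lerD// ler_wpM2l//; exact: le_trans (ler_norm _) x2.
by apply: (le_trans (lerD k1 k2)); rewrite le_eqVlt; apply/orP; left; apply/eqP; ring.
Qed.

Lemma class_C_bump4 m (s : R) : class_C m (bump4 s).
Proof. by apply: class_C_affine; exact: class_C_flat4. Qed.

Lemma bump4_supp (s : R) x : 0 < s -> s^-1 < `|x| -> bump4 s x = 0.
Proof.
move=> s0 xs; apply: flat4_supp.
by rewrite subr0 normrZ gtr0_norm// -ltr_pdivrMl// mulr1.
Qed.

Lemma bump4_ge0 (s : R) x : 0 <= bump4 s x.
Proof. by rewrite /bump4 /flat4 /flatexp; case: ifP => // _; rewrite hornerC mul1r expR_ge0. Qed.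

Lemma bump4_le1 (s : R) x : bump4 s x <= 1.
Proof.
rewrite /bump4 /flat4 /flatexp; case: ifP => // h; rewrite hornerC mul1r -[leRHS](@expR0 R) ler_expR.
by rewrite oppr_le0 invr_ge0 ltW.
Qed.

Lemma bump4_bounds : exists2 C : R, 0 <= C & forall (s : R) x i, 0 < s ->
  `|partial i (bump4 s) x| <= C * s ^+ 4 * (1 + `|x|) ^+ 3 /\
  `|partial i (partial i (bump4 s)) x| <= C * s ^+ 4 * (1 + `|x|) ^+ 3.
Proof.
have [C C0 h] := flat4_bounds; exists C => // s x i s0.
have c1 : class_C 1 (flat4 1) by exact: class_C_flat4.
have E : partial i (bump4 s) = (fun z => s * partial i (flat4 1) (s *: (z - 0))) by exact: partial_affine.
have E2 : partial i (partial i (bump4 s)) x = s ^+ 2 * partial i (partial i (flat4 1)) (s *: (x - 0)).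
  rewrite E; apply: partialE.
  have d := class_C_is_derive i (s *: (x - 0)) (class_C_partial i (class_C_flat4 2 1)).
  have h' := is_derive_mul (is_derive_cst s x (e_ i)) (is_derive_affine d).
  by apply: (is_derive_eq h'); rewrite /cst mul0r add0r expr2 mulrA.
have [h1 h2] := h (s *: (x - 0)) i.
rewrite subr0 normrZ (gtr0_norm s0) in h1 h2.
have x0 := normr_ge0 x.
have x01 : `|x| <= 1 + `|x| by rewrite lerDr.
have p1 : 0 <= 1 + `|x| by rewrite addr_ge0.
have x3 : `|x| ^+ 3 <= (1 + `|x|) ^+ 3 by rewrite lerXn2r ?nnegrE.
have x2 : `|x| ^+ 2 <= (1 + `|x|) ^+ 3.
  apply: (le_trans (_ : _ <= (1 + `|x|) ^+ 2)); first by rewrite lerXn2r ?nnegrE.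
  have p2 : 1 <= 1 + `|x| by rewrite lerDl.
  by apply: ler_weXn2l.
have s4 : 0 <= C * s ^+ 4 by rewrite mulr_ge0// exprn_ge0// ltW.
split.
  rewrite E subr0 normrM (gtr0_norm s0).
  apply: (le_trans (ler_wpM2l (ltW s0) h1)); apply: (le_trans _ (ler_wpM2l s4 x3)).
  by rewrite le_eqVlt; apply/orP; left; apply/eqP; ring.
rewrite E2 subr0 normrM [`|s ^+ 2|]gtr0_norm ?exprn_gt0//.
have s2 : 0 <= s ^+ 2 by rewrite exprn_ge0// ltW.
apply: (le_trans (ler_wpM2l s2 h2)); apply: (le_trans _ (ler_wpM2l s4 x2)).
by rewrite le_eqVlt; apply/orP; left; apply/eqP; ring.
Qed.

Lemma bump4_mass : (0 < N)%N -> exists2 C : R, 0 <= C & forall (s B : R) (w : 'rV[R]_N -> R), 0 < s -> continuous w -> 0 <= B ->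
  (forall x, `|x| <= s^-1 -> `|w x| * (1 + `|x|) ^+ (2 * N) <= B) ->
  `|\int[mu]_x (bump4 s x * w x)| <= C * B.
Proof.
move=> N0; have [C C0 h] := @Rintegral_poly_decay R N N0; exists C => // s B w s0 cw B0 wB.
apply: (h _ s^-1) => //.
- by apply: continuous_mul => //; exact: (class_C_continuous (class_C_bump4 0 s)).
- by move=> x /(bump4_supp s0) ->; rewrite mul0r.
- move=> x /wB; apply: le_trans; rewrite normrM -mulrA ler_piMl//.
  by rewrite ger0_norm ?bump4_ge0 ?bump4_le1.
Qed.

Lemma bump4_gradient_mass : (0 < N)%N -> exists2 C : R, 0 <= C & forall (s B : R) (w : 'rV[R]_N -> R) j, 0 < s -> continuous w -> 0 <= B ->
  (forall x, `|x| <= s^-1 -> `|w x| * (1 + `|x|) ^+ (2 * N + 3) <= B) ->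
  `|\int[mu]_x (w x * partial j (bump4 s) x)| <= C * s ^+ 4 * B.
Proof.
move=> N0; have [C C0 h] := @Rintegral_poly_decay R N N0; have [D D0 hD] := bump4_bounds.
exists (C * D); first exact: mulr_ge0.
move=> s B w j s0 cw B0 wB.
have s4 : 0 <= s ^+ 4 by rewrite exprn_ge0// ltW.
rewrite (_ : C * D * s ^+ 4 * B = C * (D * s ^+ 4 * B)); last by ring.
apply: (h _ s^-1) => //.
- apply: continuous_mul => //.
  exact: (class_C_continuous (class_C_partial j (class_C_bump4 1 s))).
- by rewrite mulr_ge0// mulr_ge0.
- by move=> x xs; rewrite (partial_supp j (fun y => bump4_supp s0) xs) mulr0.
- move=> x xs; have [h1 _] := hD s x j s0; have := wB x xs; rewrite exprD normrM => h2.
  have p0 : 0 <= (1 + `|x|) ^+ (2 * N) by rewrite exprn_ge0// addr_ge0.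
  apply: (le_trans (_ : _ <= `|w x| * (D * s ^+ 4 * (1 + `|x|) ^+ 3) * (1 + `|x|) ^+ (2 * N))).
    by rewrite ler_wpM2r// ler_wpM2l.
  apply: (le_trans _ (ler_wpM2l (mulr_ge0 D0 s4) h2)).
  by rewrite le_eqVlt; apply/orP; left; apply/eqP; ring.
Qed.

(** The exponent of the weight is $2N$ for integrability, by [Rintegral_poly_decay], plus 3 for the
    growth of the cutoff derivatives. *)
Lemma bump4_flux_mass : (0 < N)%N -> exists2 C : R, 0 <= C & forall (s B : R) (b v : 'rV[R]_N -> R), 0 < s -> continuous b -> class_C 1 v -> 0 <= B ->
  (forall x i, `|x| <= s^-1 -> `|b x| * (`|v x| + `|partial i v x|) * (1 + `|x|) ^+ (2 * N + 3) <= B) ->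
  `|\int[mu]_x (b x * cutoff_flux (bump4 s) v x)| <= C * s ^+ 4 * B.
Proof.
move=> N0; have [C C0 h] := @Rintegral_poly_decay R N N0; have [D D0 hD] := bump4_bounds.
exists (C * (D * (N%:R * 2))); first by rewrite !mulr_ge0.
move=> s B b v s0 cb v1 B0 bB.
have s4 : 0 <= s ^+ 4 by rewrite exprn_ge0// ltW.
rewrite (_ : C * (D * (N%:R * 2)) * s ^+ 4 * B = C * (D * s ^+ 4 * (N%:R * 2 * B))); last by ring.
apply: (h _ s^-1) => //.
- by apply: continuous_mul => //; apply: continuous_cutoff_flux => //; exact: class_C_bump4.
- apply: mulr_ge0; first exact: mulr_ge0.
  by apply: mulr_ge0 => //; exact: mulr_ge0.
- by move=> x xs; rewrite (cutoff_flux_supp _ (fun y => bump4_supp s0) xs) mulr0.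
- move=> x xs; rewrite normrM.
  have p0 : 0 <= (1 + `|x|) ^+ (2 * N) by rewrite exprn_ge0// addr_ge0.
  have Ds : 0 <= D * s ^+ 4 by exact: mulr_ge0.
  have q0 : 0 <= (1 + `|x|) ^+ 3 by rewrite exprn_ge0// addr_ge0.
  have t i : `|2 * partial i (bump4 s) x * partial i v x + v x * partial i (partial i (bump4 s)) x| <=
      D * s ^+ 4 * (2 * ((`|v x| + `|partial i v x|) * (1 + `|x|) ^+ 3)).
    have [h1 h2] := hD s x i s0; apply: (le_trans (ler_normD _ _)).
    rewrite !normrM (ger0_norm (ler0n _ 2)).
    have a1 := ler_wpM2r (normr_ge0 (partial i v x)) h1.
    have a2 := ler_wpM2l (normr_ge0 (v x)) h2.
    have b1 : 0 <= D * s ^+ 4 * (1 + `|x|) ^+ 3 * `|v x|.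
      by apply: mulr_ge0 => //; exact: mulr_ge0.
    have -> : D * s ^+ 4 * (2 * ((`|v x| + `|partial i v x|) * (1 + `|x|) ^+ 3)) =
      2 * (D * s ^+ 4 * (1 + `|x|) ^+ 3 * `|v x|) + 2 * (D * s ^+ 4 * (1 + `|x|) ^+ 3 * `|partial i v x|) by ring.
    rewrite -mulrA; clra.
  have sumb : `|b x| * `|cutoff_flux (bump4 s) v x| * (1 + `|x|) ^+ (2 * N) <=
      \sum_(i < N) D * s ^+ 4 * (2 * B).
    rewrite /cutoff_flux; apply: (le_trans (ler_wpM2r p0 (ler_wpM2l (normr_ge0 _) (ler_norm_sum _ _ _)))).
    rewrite mulr_sumr mulr_suml; apply: ler_sum => i _.
    apply: (le_trans (ler_wpM2r p0 (ler_wpM2l (normr_ge0 _) (t i)))).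
    have := ler_wpM2l Ds (ler_wpM2l (ler0n R 2) (bB x i xs)); rewrite exprD.
    by apply: le_trans; rewrite le_eqVlt; apply/orP; left; apply/eqP; ring.
  apply: (le_trans sumb); rewrite sumr_const card_ord -mulr_natl.
  by rewrite le_eqVlt; apply/orP; left; apply/eqP; ring.
Qed.

Lemma bump4_at0 (K : R) : exists2 s0 : R, 0 < s0 & forall s x, 0 < s -> s <= s0 -> `|x| <= K -> expR (-2) <= bump4 s x.
Proof.
have n0 : 0 <= N%:R :> R by [].
(* Then $|sx|\le 1/(2(N+1))$ in sup norm, so the fourth power of the Euclidean norm of $sx$ is at
   most $1/2$ and the exponent in [bump4] is at least $-2$. *)
pose s0 : R := ((`|K| + 1) * (2 * (N%:R + 1)))^-1.
have k0 : 0 <= `|K| by [].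
have d0 : 0 < (`|K| + 1) * (2 * (N%:R + 1)) by rewrite mulr_gt0//; clra.
exists s0 => [|s x s_gt0 ss0 xK]; first by rewrite invr_gt0.
have h : `|s *: (x - 0)| <= (2 * (N%:R + 1))^-1.
  rewrite subr0 normrZ gtr0_norm//.
  apply: (le_trans (_ : _ <= s0 * (`|K| + 1))).
    by rewrite ler_pM ?(ltW s_gt0)//; have := ler_norm K; clra.
  by rewrite /s0 invfM mulrAC mulVf ?mul1r// gt_eqF//; clra.
have dh : dot (s *: (x - 0)) (s *: (x - 0)) ^+ 2 <= 2^-1.
  have := dot_le_sqr_norm (s *: (x - 0)); have := dot_ge0 (s *: (x - 0)).
  set d := dot _ _; set a := `|_| in h *; move=> dge dle.
  have a0 : 0 <= a by exact: normr_ge0.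
  have h1 : a * (2 * (N%:R + 1)) <= 1.
    by rewrite -ler_pdivlMr ?div1r//; clra.
  have h2 : a <= 2^-1 by cnra.
  have h3 : N%:R * a <= 2^-1 by cnra.
  have h4 : d <= 4^-1 by apply: (le_trans dle); rewrite expr2; cnra.
  by rewrite expr2; cnra.
rewrite /bump4 /flat4 /flatexp ifT; last by clra.
rewrite hornerC mul1r ler_expR lerN2 -[leRHS]invrK lef_pV2 ?posrE//; clra.
Qed.

End cutoff.

(** * Bounds on solutions that do not depend on the parameter *)

Section uniform_bounds.
Context {R : realType} {N : nat}.
Local Notation mu := (lebesgue_row R N).
Implicit Types (x y z : 'rV[R]_N) (u v Q V : 'rV[R]_N -> R).
Local Notation e_ i := (delta_mx ord0 i : 'rV[R]_N).

Lemma cond_V1_bounds V : cond_V1 V -> exists2 L : R, 0 <= L & forall x, 0 <= V x <= L.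
Proof.
move=> [_ i0 _ soo].
have V0 x : 0 <= V x.
  have : (ereal_inf (range (EFin \o V)) <= (V x)%:E)%E by apply: ereal_inf_lbound; exists x.
  by move=> /(lt_le_trans i0); rewrite lte_fin => /ltW.
have Vs x : ((V x)%:E <= ereal_sup (range (EFin \o V)))%E by apply: ereal_sup_ubound; exists x.
move: soo Vs; case: (ereal_sup _) => [s _ Vs|//|_ Vs]; last by have := Vs 0; rewrite leeNy_eq.
exists s => [|x]; first by have := Vs 0; rewrite lee_fin; exact: le_trans.
by rewrite V0/= -lee_fin.
Qed.

Lemma ln_sqr (s : R) : 0 < s -> ln (s ^+ 2) = 2 * ln s.
Proof. by move=> s0; rewrite lnXn// mulr_natl. Qed.

Lemma ln_le_sub1 (s : R) : 0 < s -> ln s <= s - 1.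
Proof. by move=> s0; have := @le_ln1Dx R (s - 1); rewrite [1 + _]addrC subrK; apply; clra. Qed.

Lemma entropy_bound (M s : R) : 1 <= M -> 0 < s -> s <= M -> `|ln (s ^+ 2) * s| <= 2 + 2 * M ^+ 2.
Proof.
move=> M1 s0 sM; rewrite ln_sqr// normrM (gtr0_norm s0) normrM (ger0_norm (ler0n _ 2)).
have M20 : 0 <= M ^+ 2 by rewrite exprn_ge0//; clra.
have l1 := ln_le_sub1 s0.
have si0 : 0 < s^-1 by rewrite invr_gt0.
have l2 : - ln s <= s^-1 - 1.
  by rewrite -lnV ?posrE//; exact: ln_le_sub1.
have : `|ln s| * s <= 1 + M ^+ 2.
  have [l0|l0] := leP 0 (ln s).
    by rewrite ger0_norm//; cnra.
  rewrite ltr0_norm//; have h : - ln s * s <= (s^-1 - 1) * s by rewrite ler_wpM2r// ltW.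
  have : (s^-1 - 1) * s = 1 - s by rewrite mulrBl mulVf ?gt_eqF// mul1r.
  clra.
by cnra.
Qed.

Lemma log_solution_scaled V u (p : 'rV[R]_N) (eps : R) : 0 < eps -> continuous V -> positive_solution V eps u ->
  log_solution (fun x => V (p + eps *: x)) (fun x => u (p + eps *: x)).
Proof.
move=> e0 cV su; have [cu u0 _] := su.
have D := weak_solution_DLap e0 cV su.
have cg : continuous (fun x => (V x - ln (u x ^+ 2)) * u x / eps ^+ 2).
  by apply: continuous_mul; [exact: continuous_potential|exact: cst_continuous].
split; [exact: continuous_comp_line|by move=> x; exact: u0|].
have := DLap_affine p e0 cg D.
rewrite (_ : (fun x => eps ^+ 2 * _) = (fun x => (V (p + eps *: x) - ln (u (p + eps *: x) ^+ 2)) * u (p + eps *: x)))//.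
by apply/funext => x; field; rewrite gt_eqF.
Qed.

Lemma phi_sqr_mass (v : 'rV[R]_N -> R) (r : R) : 0 < r -> continuous v -> mu.-integrable setT (EFin \o (fun x => v x ^+ 2)) ->
  forall P : R, (forall y, phi y <= P) ->
  \int[mu]_y (v (0 + r *: y) ^+ 2 * phi y) <= P * (r^-1 ^+ N * \int[mu]_x v x ^+ 2).
Proof.
move=> r0 cv vi P phiP; have [vi' <-] := @Rintegral_affine R N (fun x => v x ^+ 2) r 0 r0 vi.
rewrite -RintegralZl//; apply: le_Rintegral => //.
- apply: (@kernel_mul_integrable R N phi (fun x => v x ^+ 2) 0 r kernel_phi).
  by move=> x; apply: (@continuous_comp _ _ _ v (fun t => t ^+ 2)); [exact: cv|exact: exprn_continuous].
- exact: integrable_scale.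
- by move=> y _; rewrite mulrC ler_wpM2r ?sqr_ge0.
Qed.

(** At a maximum of height $m$, the rescaled solution has Laplacian at least $-2m\ln m$, so its
    average remains comparable to $m$ up to a radius of order $(\ln m)^{-1/2}$. The rescaled mass
    there is of order $m^2(\ln m)^{-N/2}$ and bounded by [C], which bounds $m$. *)
Lemma sup_bound_at_max (C : R) : (0 < N)%N -> 0 <= C -> exists2 M : R, 1 <= M & forall V (eps : R) u x0,
  0 < eps -> continuous V -> (forall x, 0 <= V x) -> positive_solution V eps u ->
  \int[mu]_x (u x ^+ 2) <= C * eps ^+ N -> (forall x, u x <= u x0) -> u x0 <= M.
Proof.
move=> N0 C0; have c0 := @cphi_gt0 R N; have p0 := @cpsi_gt0 R N.
have [P P0 phiP] := kernel_bounded (@kernel_phi R N).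
have [K K0 hK] := @poly_le_expR R 1 N ltr01.
(* With $r^2=a/\ln m$ the error term in [avg_ge] is exactly half of [cphi R N * m]. *)
pose a : R := cphi R N / (2 * cpsi R N).
have a0 : 0 < a by rewrite divr_gt0// mulr_gt0.
pose D : R := (4 * (P * C) / cphi R N) ^+ 2 * a^-1 ^+ N.
have D0 : 0 <= D.
  by rewrite mulr_ge0// exprn_ge0// ?invr_ge0 ?(ltW a0)// divr_ge0 ?(ltW c0)// !mulr_ge0.
exists (1 + D * K) => [|V eps u x0 e0 cV V0 su uC umax]; first by rewrite lerDl mulr_ge0.
have [//|m1] := leP (u x0) 1; first by move=> h; rewrite (le_trans h)// lerDl mulr_ge0.
have [cu u0 [uH _]] := su.
have Lv := log_solution_scaled x0 e0 cV su; have [cv v0 DL] := Lv.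
pose v x := u (x0 + eps *: x).
set m := u x0 in m1 *.
have vm x : v x <= m by exact: umax.
pose l := ln m; have l0 : 0 < l by rewrite ln_gt0.
have m0 : 0 < m by clra.
have r20 : 0 < a / l by rewrite divr_gt0.
pose r := Num.sqrt (a / l); have r0 : 0 < r by rewrite sqrtr_gt0.
have rr : r ^+ 2 = a / l by rewrite sqr_sqrtr// ltW.
have cVs : continuous (fun x => V (x0 + eps *: x)) by exact: continuous_comp_line.
have cg := continuous_potential cVs cv v0.
have gK z : `|z| <= r -> - (2 * (m * l)) <= (fun x => (V (x0 + eps *: x) - ln (v x ^+ 2)) * v x) (0 + z).
  move=> _; rewrite add0r /=; set t := v z.
  have t0 : 0 < t by exact: v0.
  have tm : t <= m by exact: vm.
  rewrite ln_sqr// mulrBl.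
  have Vt : 0 <= V (x0 + eps *: z) * t by rewrite mulr_ge0// ltW.
  have lt : ln t <= l by rewrite ler_ln ?posrE.
  have : ln t * t <= m * l.
    have [h|h] := leP 0 (ln t); first by rewrite mulrC ler_pM// ltW.
    by apply: (@le_trans _ _ 0); [rewrite nmulr_rle0// ltW|rewrite mulr_ge0// ltW].
  by rewrite -mulrA; clra.
have := avg_ge (x := 0) cv cg DL r0 gK.
rewrite scaler0 addr0 rr -/m => h1.
have h2 : cphi R N * m / 2 <= avg v 0 r.
  apply: le_trans h1; rewrite le_eqVlt; apply/orP; left; apply/eqP.
  by rewrite /a; field; rewrite !gt_eqF.
have i2 : mu.-integrable setT (EFin \o (fun x => u x ^+ 2)).
  have := Lfun2_mul_integrable uH.1 uH.1.
  by rewrite (_ : (fun x => u x * u x) = (fun x => u x ^+ 2))//; apply/funext => x; rewrite expr2.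
have [vi vE] := Rintegral_affine x0 e0 i2.
have cv2 : continuous (fun x => v x ^+ 2).
  by move=> x; apply: (@continuous_comp _ _ _ v (fun t => t ^+ 2)); [exact: cv|exact: exprn_continuous].
(* Pointwise $t\le m/4+t^2/m$, which trades the average of [v] for its mass and leaves a quarter of
   [cphi R N * m] to spare. *)
have h3 : avg v 0 r <= m / 4 * cphi R N + m^-1 * \int[mu]_y (v (0 + r *: y) ^+ 2 * phi y).
  rewrite /avg /cphi -RintegralZl//; last exact: (kernel_integrable kernel_phi).
  have kv := kernel_mul_integrable 0 r (@kernel_phi R N) cv2.
  rewrite -RintegralZl// -RintegralD//; last 2 first.
  - by apply: integrable_scale; exact: (kernel_integrable kernel_phi).
  - exact: integrable_scale.
  apply: le_Rintegral => //.
  - exact: (kernel_mul_integrable 0 r (@kernel_phi R N) cv).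
  - apply: integrable_add; apply: integrable_scale => //; exact: (kernel_integrable kernel_phi).
  - move=> y _; rewrite mulrA -mulrDl ler_wpM2r ?phi_ge0//.
    set t := v _; have -> : m / 4 + m^-1 * t ^+ 2 = (m ^+ 2 / 4 + t ^+ 2) / m by field; rewrite gt_eqF.
    rewrite ler_pdivlMr//; have := sqr_ge0 (m / 2 - t); cnra.
have h4 := phi_sqr_mass r0 cv vi (fun y => le_trans (ler_norm _) (phiP y)).
have rN : 0 <= r^-1 ^+ N by rewrite exprn_ge0// invr_ge0 ltW.
have h5 : \int[mu]_x (v x ^+ 2) <= C.
  rewrite /v vE exprVn mulrC ler_pdivrMr ?exprn_gt0//.
have h6 : m * m * cphi R N / 4 <= P * C * r^-1 ^+ N.
  have h7 : \int[mu]_y (v (0 + r *: y) ^+ 2 * phi y) <= P * C * r^-1 ^+ N.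
    apply: (le_trans h4); rewrite -mulrA ler_wpM2l// mulrC ler_wpM2r//.
  have h8 := ler_wpM2l (ltW (_ : 0 < m^-1)) h7.
  have h9 : cphi R N * m / 4 <= m^-1 * (P * C * r^-1 ^+ N).
    by apply: le_trans (h8 _); rewrite ?invr_gt0//; clra.
  move: h9; rewrite [leRHS]mulrC ler_pdivlMr// => h9; apply: le_trans h9.
  by rewrite le_eqVlt; apply/orP; left; apply/eqP; ring.
(* Squaring removes the square root in $r$: $r^{-2N}=(\ln m/a)^N$. Since $(\ln m)^N\le Km$, the cube
   of $m$ is bounded. *)
have m4 : m ^+ 4 <= D * l ^+ N.
  have s1 : m * m <= 4 * (P * C) / cphi R N * r^-1 ^+ N.
    rewrite mulrAC ler_pdivlMr//; move: h6; rewrite ler_pdivrMr// => h6.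
    by apply: (le_trans h6); rewrite le_eqVlt; apply/orP; left; apply/eqP; ring.
  have mm : 0 <= m * m by rewrite mulr_ge0// ltW.
  have := ler_pM mm mm s1 s1.
  have -> : m * m * (m * m) = m ^+ 4 by ring.
  have rNN : r^-1 ^+ N * r^-1 ^+ N = a^-1 ^+ N * l ^+ N.
    by rewrite -exprMn -invfM -expr2 rr invf_div exprMn mulrC.
  set c := 4 * (P * C) / cphi R N; set rN' := r^-1 ^+ N in rNN *.
  have -> : c * rN' * (c * rN') = c ^+ 2 * (rN' * rN') by ring.
  by move=> h; apply: (le_trans h); rewrite rNN /D -/c mulrA.
have lK : l ^+ N <= K * m.
  have := hK l (ltW l0); rewrite mul1r lnK ?posrE// => h; apply: le_trans h.
  by rewrite lerXn2r ?nnegrE ?addr_ge0 ?(ltW l0)// lerDr.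
have m3 : m ^+ 3 <= D * K.
  have : m ^+ 4 <= D * (K * m) by apply: (le_trans m4); rewrite ler_wpM2l.
  by rewrite exprSr mulrA ler_pM2r.
have : m <= m ^+ 3 by rewrite -[leLHS]expr1 ler_weXn2l// ltW.
clra.
Qed.

Lemma global_max u (k : R) : continuous u -> (forall x, k < `|x| -> u x <= 1) ->
  (forall x, u x <= 1) \/ exists x0, forall x, u x <= u x0.
Proof.
move=> cu uk; have k0 : 0 <= Num.max k 0 by rewrite le_max lexx orbT.
have [x0 _ hx0] := cube_max cu k0.
have out x : Num.max k 0 < `|x| -> u x <= 1 by rewrite gt_max => /andP[/uk].
have [h|h] := leP (u x0) 1; [left|right; exists x0] => x.
  by have [/hx0 h'|/out//] := leP `|x| (Num.max k 0); exact: le_trans h' h.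
by have [/hx0//|/out h'] := leP `|x| (Num.max k 0); rewrite (le_trans h')// ltW.
Qed.

Lemma log_solution_rhs_bound Q v (L M : R) : (forall x, 0 <= Q x <= L) -> 1 <= M -> (forall x, 0 < v x) -> (forall x, v x <= M) ->
  forall x, `|(Q x - ln (v x ^+ 2)) * v x| <= L * M + (2 + 2 * M ^+ 2).
Proof.
move=> QL M1 v0 vM x; rewrite mulrBl (le_trans (ler_normB _ _))// lerD//; last exact: entropy_bound.
by have /andP[q0 qL] := QL x; rewrite normrM !ger0_norm ?(ltW (v0 x))// ler_pM// ltW.
Qed.

Lemma log_solution_lipschitz (L M : R) : 0 <= L -> 1 <= M -> exists2 C : R, 0 <= C & forall Q v, continuous Q ->
  (forall x, 0 <= Q x <= L) -> log_solution Q v -> (forall x, v x <= M) ->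
  forall x x', `|x - x'| <= 1 -> `|v x - v x'| <= C * `|x - x'|.
Proof.
move=> L0 M1; have [C C0 hC] := @DLap_lipschitz R N.
have G0 : 0 <= L * M + (2 + 2 * M ^+ 2).
  by rewrite addr_ge0 ?mulr_ge0//; [clra|rewrite addr_ge0// mulr_ge0// exprn_ge0//; clra].
exists (C * (M + (L * M + (2 + 2 * M ^+ 2)))); first by rewrite mulr_ge0// addr_ge0//; clra.
move=> Q v cQ QL [cv v0 vD] vM x x' xx'.
apply: (hC v _ x' M _ cv (continuous_potential cQ cv v0) vD) => //; last by rewrite subrr normr0.
  by move=> z _; rewrite gtr0_norm.
by move=> z _; exact: log_solution_rhs_bound.
Qed.

(** The derivative of $s\mapsto(q-2\ln s)s$ is $q-2-2\ln s$, nonnegative for $\ln s\le-1$. The proof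
    uses $\ln(h/s)\le h/s-1$ instead of differentiating. *)
Lemma entropy_increasing (q s h : R) : 0 <= q -> 0 < s -> s < h -> ln h <= -1 ->
  (q - ln (s ^+ 2)) * s <= (q - ln (h ^+ 2)) * h.
Proof.
move=> q0 s0 sh lh; have h0 : 0 < h by clra.
rewrite !ln_sqr//.
have l1 : ln h - ln s <= (h - s) / s.
  rewrite -ln_div ?posrE//.
  have -> : h / s = 1 + (h - s) / s by field; rewrite gt_eqF.
  by apply: le_ln1Dx; rewrite ltr_pdivlMr//; clra.
have l2 : s * (ln h - ln s) <= h - s.
  by apply: (le_trans (ler_wpM2l (ltW s0) l1)); rewrite mulrCA divff ?mulr1// gt_eqF.
have l3 : (h - s) * ln h <= (h - s) * -1 by rewrite ler_wpM2l// subr_ge0 ltW.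
have : h * ln h - s * ln s = (h - s) * ln h + s * (ln h - ln s) by ring.
have : q * s <= q * h by rewrite ler_wpM2l// ltW.
by clra.
Qed.

Lemma entropy_strictly_increasing (q s h : R) : 0 <= q -> 0 < s -> s < h -> ln h <= -2 ->
  (q - ln (s ^+ 2)) * s < (q - ln (h ^+ 2)) * h.
Proof.
move=> q0 s0 sh lh; have h0 : 0 < h by clra.
rewrite !ln_sqr//.
have l1 : ln h - ln s <= (h - s) / s.
  rewrite -ln_div ?posrE//.
  have -> : h / s = 1 + (h - s) / s by field; rewrite gt_eqF.
  by apply: le_ln1Dx; rewrite ltr_pdivlMr//; clra.
have l2 : s * (ln h - ln s) <= h - s.
  by apply: (le_trans (ler_wpM2l (ltW s0) l1)); rewrite mulrCA divff ?mulr1// gt_eqF.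
have l3 : (h - s) * ln h <= (h - s) * -2 by rewrite ler_wpM2l// subr_ge0 ltW.
have : h * ln h - s * ln s = (h - s) * ln h + s * (ln h - ln s) by ring.
have : q * s <= q * h by rewrite ler_wpM2l// ltW.
by clra.
Qed.

(** The uniform Lipschitz bound keeps [v] above $1/2\ge e^{-1}$ near 0, where the Gaussian
    [gauss A 1] lies below $e^{-1}$. Farther out, if [v] is below the Gaussian, [entropy_increasing]
    bounds its Laplacian by $(L+2A|x|^2+2)$ times the Gaussian, which a large [A] beats with
    $4A^2|x|^2-2NA$. *)
Lemma log_solution_gaussian_lower (L M : R) : 0 <= L -> 1 <= M -> exists2 A : R, 0 < A & forall Q v, continuous Q ->
  (forall x, 0 <= Q x <= L) -> log_solution Q v -> (forall x, v x <= M) -> 1 <= v 0 ->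
  forall x, gauss A 1 x <= v x.
Proof.
move=> L0 M1; have [C C0 hC] := log_solution_lipschitz L0 M1.
pose d : R := (2 * (C + 1))^-1.
have d0 : 0 < d by rewrite invr_gt0 mulr_gt0//; clra.
have dC : C * d <= 2^-1.
  by rewrite /d invfM mulrA mulrAC ler_piMl ?invr_ge0// ler_pdivrMr ?mul1r; clra.
have d1 : d <= 1 by rewrite /d invf_le1 ?mulr_gt0//; clra.
have n0 : 0 <= N%:R :> R by [].
have d20 : 0 < d ^+ 2 by rewrite exprn_gt0.
(* On $|x|\ge d$ this gives $A|x|^2\ge L+3+2N$, which covers all lower-order terms. *)
pose A : R := 1 + (L + 3 + 2 * N%:R) / d ^+ 2.
have A1 : 1 <= A by rewrite /A lerDl divr_ge0 ?(ltW d20)//; clra.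
have Ad : L + 3 + 2 * N%:R <= A * d ^+ 2.
  have -> : A * d ^+ 2 = d ^+ 2 + (L + 3 + 2 * N%:R) by rewrite /A; field; rewrite gt_eqF.
  by rewrite lerDr ltW.
exists A => [|Q v cQ QL Qv vM v1]; first by clra.
have [cv v0 vD] := Qv.
have A0 : 0 < A by clra.
have e1 : expR (-1 : R) <= 2^-1.
  by rewrite expRN lef_pV2 ?posrE ?expR_gt0//; have := @expR_ge1Dx R 1; clra.
apply: (gaussian_lower (rho := d ^+ 2) cv (continuous_potential cQ cv v0) vD A0).
- by move=> x; exact/ltW/v0.
- move=> x xd.
  have xd' : `|x| <= d.
    by rewrite -(ler_pXn2r (ltn0Sn 1)) ?nnegrE ?(ltW d0)//; exact: le_trans (sqr_norm_le_dot x) xd.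
  have := hC Q v cQ QL Qv vM 0 x; rewrite sub0r normrN => /(_ (le_trans xd' d1)).
  have : C * `|x| <= C * d by rewrite ler_wpM2l.
  rewrite ler_norml => h1 /andP[_ h2].
  have : gauss A 1 x <= 2^-1.
    apply: le_trans e1; rewrite /gauss ler_expR lerN2 lerDr mulr_ge0 ?dot_ge0// ltW//.
  clra.
- move=> x xd vg; set h := gauss A 1 x in vg *.
  have h0 : 0 < h by exact: gauss_gt0.
  have lh : ln h = - (A * dot x x + 1) by rewrite /h /gauss expRK.
  have Ad0 : 0 <= A * dot x x by rewrite mulr_ge0 ?dot_ge0// ltW.
  have /andP[q0 qL] := QL x.
  apply: (le_lt_trans (entropy_increasing q0 (v0 x) vg _)); first by rewrite lh; clra.
  rewrite ltr_pM2r// ln_sqr// lh.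
  have t1 : A * d ^+ 2 <= A * dot x x by rewrite ler_pM2l// ltW.
  have t2 : A * (A * d ^+ 2) <= A * (A * dot x x) by rewrite ler_pM2l.
  have t3 : A * (L + 3 + 2 * N%:R) <= A * (A * d ^+ 2) by rewrite ler_pM2l.
  have t4 : 1 * (A * dot x x) <= A * (A * dot x x) by rewrite ler_wpM2r.
  have t5 : 1 * (L + 3) <= A * (L + 3) by rewrite ler_wpM2r//; clra.
  have -> : 4 * A ^+ 2 * dot x x = 4 * (A * (A * dot x x)) by ring.
  have -> : 2 * N%:R * A = A * (2 * N%:R) by ring.
  have e : A * (L + 3 + 2 * N%:R) = A * (L + 3) + A * (2 * N%:R) by ring.
  have : 0 <= A * (2 * N%:R) by rewrite mulr_ge0// ?mulr_ge0// ltW.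
  clra.
Qed.

End uniform_bounds.

(** * Rescaled solutions near a peak *)

Section tame_solutions.
Context {R : realType} {N : nat}.
Local Notation mu := (lebesgue_row R N).
Implicit Types (x y z : 'rV[R]_N) (u v Q V : 'rV[R]_N -> R).
Local Notation e_ i := (delta_mx ord0 i : 'rV[R]_N).

(** What is retained of a solution rescaled about a point, with constants meant to be uniform in the
    parameter. Decay is required only for $|x|\le T$, a window of order $c/\varepsilon$, since
    further out the solution may have other peaks. *)
Record tame (L M A B K T : R) (Q v : 'rV[R]_N -> R) : Prop := Tame {
  tame_C1 : class_C 1 Q;
  tame_sol : log_solution Q v;
  tame_weak : weak_form v (fun x => (Q x - ln (v x ^+ 2)) * v x);
  tame_Q : forall x, 0 <= Q x <= L;
  tame_upper : forall x, v x <= M;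
  tame_lower : forall x, gauss A B x <= v x;
  tame_decay : forall x, `|x| <= T -> v x <= K * expR (- (2^-1 * `|x|)) }.

Lemma tame_ln_bound (M A B : R) : 1 <= M -> 0 <= A -> exists2 C : R, 0 <= C & forall v,
  (forall x, v x <= M) -> (forall x, gauss A B x <= v x) -> forall x, `|ln (v x ^+ 2)| <= C * (1 + `|x|) ^+ 2.
Proof.
move=> M1 A0; have n0 : 0 <= N%:R :> R by [].
have lM : 0 <= ln M by rewrite ln_ge0.
pose C0 := 2 * (A + `|B| + ln M).
have C00 : 0 <= C0 by rewrite mulr_ge0// !addr_ge0.
exists (C0 * (1 + N%:R)) => [|v vM vG x]; first by rewrite mulr_ge0// addr_ge0.
have v0 : 0 < v x := lt_le_trans (gauss_gt0 A B x) (vG x).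
apply: (le_trans (_ : _ <= C0 * (1 + dot x x))); last by rewrite -mulrA ler_wpM2l// dot_le_poly.
have h1 : ln (v x) <= ln M by rewrite ler_ln ?posrE//; clra.
have h2 : - (A * dot x x + B) <= ln (v x).
  by rewrite -[leLHS](expRK (_ : R)) ler_ln ?posrE ?expR_gt0//; exact: vG.
have d0 := dot_ge0 x; have := ler_norm B; have Bn := normr_ge0 B => hB.
rewrite ln_sqr// normrM (ger0_norm (ler0n _ 2)) /C0 -mulrA ler_wpM2l// ler_norml.
have p1 : 0 <= A * dot x x by exact: mulr_ge0.
have p2 : 0 <= `|B| * dot x x by exact: mulr_ge0.
have p3 : 0 <= ln M * dot x x by exact: mulr_ge0.
by rewrite mulrDr !mulrDl mulr1; apply/andP; split; clra.
Qed.

(** Half of the exponential rate absorbs the quadratic growth of $\ln v^2$, the other half the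
    polynomial weight. The window shrinks by 4 because [norm_partial_le] looks at a neighbourhood of
    that radius. *)
Lemma tame_pointwise (L M A B K : R) (m : nat) : 0 <= L -> 1 <= M -> 0 <= A -> 0 <= K ->
  exists2 D : R, 0 <= D & forall T Q v, tame L M A B K T Q v -> forall x i, `|x| <= T - 4 ->
  (v x + `|partial i v x|) * (1 + `|x|) ^+ m <= D.
Proof.
move=> L0 M1 A0 K0; have [C C0 hC] := @tame_ln_bound M A B M1 A0.
have [P P0 hP] := @norm_partial_le R N.
have h4 : 0 < 4^-1 :> R by rewrite invr_gt0.
have [K2 K20 hK2] := @poly_le_expR R 4^-1 2 h4.
have [Km Km0 hKm] := @poly_le_expR R 4^-1 m h4.
pose E := K * expR 2 + (L + C) * K2 * K * expR 2.
have E0 : 0 <= E by rewrite addr_ge0 ?mulr_ge0 ?expR_ge0// addr_ge0.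
exists ((K + P * E) * Km) => [|T Q v tv x i xT].
  by rewrite mulr_ge0// addr_ge0// mulr_ge0.
have [Q1 Qv _ QL vM vG vK] := tv; have [cv v0 vD] := Qv.
have cg := continuous_potential (class_C_continuous Q1) cv v0.
have v1 := log_solution_class_C1 Q1 Qv.
set q := expR (- (4^-1 * `|x|)).
have q0 : 0 < q by exact: expR_gt0.
have x0 := normr_ge0 x.
have tri z : `|z - x| <= 4 -> `|z| <= T /\ `|x| <= `|z| + 4.
  move=> zx; have := ler_normD (z - x) x; rewrite subrK => a1.
  by have := ler_normB z (z - x); rewrite opprB addrC subrK => a2; split; clra.
have vx : v x <= K * q.
  apply: (le_trans (vK x _)); first by clra.
  by rewrite ler_wpM2l// ler_expR; clra.
have vz z : `|z - x| <= 4 -> `|v z| <= K * expR 2 * q.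
  move=> zx; have [zT xz] := tri z zx; rewrite gtr0_norm//; apply: (le_trans (vK z zT)).
  by rewrite -mulrA ler_wpM2l// -expRD ler_expR; clra.
have gz z : `|z - x| <= 4 -> `|(Q z - ln (v z ^+ 2)) * v z| <= (L + C) * K2 * K * expR 2 * q.
  move=> zx; have [zT xz] := tri z zx; rewrite normrM (gtr0_norm (v0 z)).
  have z0 := normr_ge0 z.
  have b1 : `|Q z - ln (v z ^+ 2)| <= (L + C) * (1 + `|z|) ^+ 2.
    apply: (le_trans (ler_normB _ _)); rewrite mulrDl lerD//; last exact: hC.
    have /andP[h1 h2] := QL z; rewrite ger0_norm// (le_trans h2)// ler_peMr// exprn_ege1//; clra.
  have b2 : `|Q z - ln (v z ^+ 2)| <= (L + C) * (K2 * expR (4^-1 * `|z|)).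
    by apply: (le_trans b1); rewrite ler_wpM2l ?addr_ge0// hK2.
  apply: (le_trans (ler_pM _ _ b2 (vK z zT))) => //; first exact/ltW/v0.
  have -> : (L + C) * (K2 * expR (4^-1 * `|z|)) * (K * expR (- (2^-1 * `|z|))) =
    (L + C) * K2 * K * (expR (4^-1 * `|z|) * expR (- (2^-1 * `|z|))) by ring.
  rewrite -[leRHS]mulrA ler_wpM2l; [|by rewrite !mulr_ge0// addr_ge0|] => //.
  by rewrite -!expRD ler_expR; clra.
have dv : derivable v x (e_ i) by case: (class_C_is_derive i x v1).
have := hP i v _ x _ _ cv cg vD dv vz gz.
rewrite -mulrDl -/E => pv.
have s1 : v x + `|partial i v x| <= (K + P * E) * q by rewrite mulrDl -mulrA lerD.
apply: (le_trans (ler_pM _ _ s1 (hKm _ x0))).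
- by rewrite addr_ge0// ltW.
- by rewrite exprn_ge0// addr_ge0.
rewrite /q; have -> : (K + P * E) * expR (- (4^-1 * `|x|)) * (Km * expR (4^-1 * `|x|)) =
  (K + P * E) * Km * (expR (- (4^-1 * `|x|)) * expR (4^-1 * `|x|)) by ring.
by rewrite -expRD addNr expR0 mulr1.
Qed.

Lemma dot_translate_le x d : dot (x + d) (x + d) <= 2 * dot x x + 2 * dot d d.
Proof.
rewrite /dot !mulr_sumr -big_split/= ler_sum// => i _; rewrite !mxE.
by have := sqr_ge0 (x ord0 i - d ord0 i); cnra.
Qed.

(** The rate [A] doubles because $|x+d|^2\le2|x|^2+2|d|^2$; [B], [K] and [T] absorb the bounded
    shift. *)
Lemma tame_translate (L M A B K T D : R) Q v d : 0 <= A -> 0 <= K -> `|d| <= D ->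
  tame L M A B K T Q v ->
  tame L M (2 * A) (B + 2 * A * (N%:R * D ^+ 2)) (K * expR (2^-1 * D)) (T - D)
    (fun x => Q (x + d)) (fun x => v (x + d)).
Proof.
move=> A0 K0 dD [Q1 Qv wv QL vM vG vK]; have [cv v0 vD] := Qv.
have cg := continuous_potential (class_C_continuous Q1) cv v0.
have v1 := log_solution_class_C1 Q1 Qv.
split.
- exact: class_C_translate.
- split; [exact: continuous_translate|by move=> x|].
  exact: (DLap_shift d cg vD).
- exact: (weak_form_translate d v1 cg wv).
- by move=> x.
- by move=> x.
- move=> x; apply: le_trans (vG _); rewrite /gauss ler_expR lerN2.
  have D0 : 0 <= D by apply: le_trans dD.
  have h1 := dot_translate_le x d.
  have h2 : dot d d <= N%:R * D ^+ 2.
    by apply: (le_trans (dot_le_sqr_norm d)); rewrite ler_wpM2l// lerXn2r ?nnegrE.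
  have := ler_wpM2l A0 h1; have := ler_wpM2l A0 h2; clra.
- move=> x xT; have := ler_normD x d; have := ler_normB (x + d) d; rewrite addrK => t1 t2.
  apply: (le_trans (vK _ _)); first by clra.
  by rewrite -mulrA ler_wpM2l// -expRD ler_expR; clra.
Qed.

End tame_solutions.

Section peaks.
Context {R : realType} {N : nat}.
Local Notation mu := (lebesgue_row R N).
Implicit Types (x y z : 'rV[R]_N) (u v Q V : 'rV[R]_N -> R).

Lemma finite_lower_bound (k : nat) (f : 'I_k -> R) : (forall i, 0 < f i) ->
  exists2 c : R, 0 < c & forall i, c <= f i.
Proof.
move=> f0; pose S := \sum_i (f i)^-1.
have S0 : 0 <= S by apply: sumr_ge0 => i _; rewrite invr_ge0 ltW.
exists (S + 1)^-1 => [|i]; first by rewrite invr_gt0; clra.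
rewrite -[leRHS]invrK lef_pV2 ?posrE ?invr_gt0//; last by clra.
rewrite /S (bigD1 i)//= -addrA lerDl addr_ge0// sumr_ge0// => j _.
by rewrite invr_ge0 ltW.
Qed.

Lemma enorm_ge x : `|x| <= enorm x.
Proof.
rewrite /enorm -[leLHS]ger0_norm// -sqrtr_sqr ler_sqrt ?dot_ge0//.
exact: sqr_norm_le_dot.
Qed.

Lemma energy_mass (eps C : R) u : H1 u ->
  \int[mu]_x (eps ^+ 2 * enorm (weak_gradient u x) ^+ 2 + u x ^+ 2) <= C ->
  \int[mu]_x (u x ^+ 2) <= C.
Proof.
move=> uH; apply: le_trans.
have i2 : mu.-integrable setT (EFin \o (fun x => u x ^+ 2)).
  have := Lfun2_mul_integrable uH.1 uH.1.
  by rewrite (_ : (fun x => u x * u x) = (fun x => u x ^+ 2))//; apply/funext => x; rewrite expr2.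
have ig : mu.-integrable setT (EFin \o (fun x => enorm (weak_gradient u x) ^+ 2)).
  have h i := Lfun2_mul_integrable (weak_gradientP uH i).1 (weak_gradientP uH i).1.
  have [hs _] := Rintegral_sum (index_enum 'I_N) h.
  rewrite (_ : (fun x => enorm _ ^+ 2) = (fun x => \sum_i weak_gradient u x ord0 i * weak_gradient u x ord0 i))//.
  by apply/funext => x; rewrite sqr_sqrtr ?dot_ge0.
apply: le_Rintegral => //; first by apply: integrable_add => //; exact: integrable_scale.
by move=> x _; rewrite lerDr mulr_ge0// sqr_ge0.
Qed.

(** At a local maximum the maximum principle gives $V-\ln u^2\le0$, so $u\ge e^{V/2}\ge1$. *)
Lemma peak_value V (eps : R) u y : 0 < eps -> continuous V -> (forall x, 0 <= V x) ->
  positive_solution V eps u -> local_max u y -> 1 <= u y.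
Proof.
move=> e0 cV V0 su um; have [cu u0 _] := su.
have cg : continuous (fun x => (V x - ln (u x ^+ 2)) * u x / eps ^+ 2).
  by apply: continuous_mul; [exact: continuous_potential|exact: cst_continuous].
have := max_principle cu cg (weak_solution_DLap e0 cV su) um.
rewrite pmulr_lle0 ?invr_gt0 ?exprn_gt0// pmulr_lle0// ln_sqr// => h.
rewrite -[leLHS](@expR0 R) -[leRHS](lnK (u0 y : u y \is Num.pos)) ler_expR.
by have := V0 y; clra.
Qed.

(** The sup bound comes from the energy bound at a global maximum, the Gaussian bound from
    [peak_value], and the exponential bound from [decay_barrier] on cubes that stay away from all
    peaks. *)
Lemma peak_tame V (k : nat) (xi : 'I_k -> 'rV[R]_N) (u : R -> 'rV[R]_N -> R) : (0 < N)%N ->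
  class_C 1 V -> cond_V1 V -> injective xi -> peak_solution V xi u ->
  exists (y : 'I_k -> R -> 'rV[R]_N) (L M A K c r : R),
  [/\ [/\ 0 <= L, 1 <= M, 0 < A, 0 <= K & 0 < c], forall j, y j eps @[eps --> 0^'+] --> xi j &
   \forall eps \near 0^'+, [/\ positive_solution V eps (u eps),
     forall j, tame L M A 1 K (c / eps) (fun x => V (y j eps + eps *: x)) (fun x => u eps (y j eps + eps *: x)),
     forall x, (forall j, r * eps <= `|x - y j eps|) -> u eps x <= expR (-2) &
     forall tau : R, 0 < tau -> exists k : R, forall x, k < `|x| -> u eps x <= tau]].
Proof.
move=> N0 V1 cV1 xi_inj [eps0 e00 [hpos [y [ymax yxi ytau]] [C C0 hC]]].
have cV := class_C_continuous V1.
have [L L0 VL] := cond_V1_bounds cV1.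
have V0 x : 0 <= V x by have /andP[] := VL x.
have vanish eps tau : 0 < eps < eps0 -> 0 < tau -> exists k : R, forall x, k < `|x| -> u eps x <= tau.
  move=> he tau0; have [r r1 hr] := ytau tau tau0.
  exists (r * eps + \sum_j `|y j eps|) => x xk; apply: (le_trans (ler_norm _)); apply: hr => // j.
  apply: le_trans (enorm_ge _).
  have : `|y j eps| <= \sum_j `|y j eps| by rewrite (bigD1 j)//= lerDl sumr_ge0.
  by have := ler_normD (x - y j eps) (y j eps); rewrite subrK; clra.
have [M M1 hM] := sup_bound_at_max N0 (ltW C0).
have uM eps x : 0 < eps < eps0 -> u eps x <= M.
  move=> he; have /andP[ep _] := he; have su := hpos _ he; have [cu _ [uH _]] := su.
  have [kk hkk] := vanish eps 1 he ltr01.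
  have [h|[x0 hx0]] := global_max cu hkk; first exact: le_trans (h x) M1.
  apply: (le_trans (hx0 x)); apply: (hM V eps _ x0 ep cV V0 su _ hx0).
  exact: (energy_mass uH (hC _ he)).
have [A A0 hA] := @log_solution_gaussian_lower R N L M L0 M1.
(* Below the level $e^{-2}$ the coefficient $V-\ln u^2$ is at least 4, more than the decay barrier
   asks. It is also the level of [entropy_strictly_increasing], used again when comparing two
   solutions. *)
have [r r1 hr] := ytau (expR (-2)) (expR_gt0 _).
have dpos (p : 'I_k * 'I_k) : 0 < (if p.1 == p.2 then 1 else `|xi p.1 - xi p.2|).
  by case: eqVneq => // pp; rewrite normr_gt0 subr_eq0 (inj_eq xi_inj).
have [c0 c00 hc0] : exists2 c : R, 0 < c & forall i j, i != j -> c <= `|xi i - xi j|.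
  have f0 (i : 'I_#|{: 'I_k * 'I_k}|) := dpos (enum_val i).
  have [c c0 hc] := finite_lower_bound f0; exists c => // i j ij.
  by have := hc (enum_rank (i, j)); rewrite enum_rankK/= (negbTE ij).
(* Two concentration points are at distance at least $5c$. The displacement of the two peaks costs
   $2c$ and a point of the barrier cube is within $2c$ of its own peak, so it remains $c\ge
   r\varepsilon$ away from any other one. *)
pose c := c0 / 5; have cpos : 0 < c by rewrite divr_gt0.
(* The first term is the constant of [decay_barrier]; the second covers $|x|\le2r$, where only the
   sup bound is available. *)
pose K := M * (N%:R * 2) + M * expR r.
have M0 : 0 <= M by clra.
have K0 : 0 <= K by rewrite addr_ge0// mulr_ge0 ?expR_ge0// mulr_ge0.
exists y, L, M, A, K, c, r; split=> //.
have near_y : \forall eps \near 0^'+, forall j, `|y j eps - xi j| <= c.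
  apply: filter_forall => j; have := yxi j => /cvgrPdist_le/(_ _ cpos).
  by apply: filterS => e; rewrite distrC.
have near_r : \forall eps \near (0 : R)^'+, r * eps <= c.
  near=> e; rewrite -ler_pdivlMl; last by clra.
  by near: e; apply: nbhs_right_le; rewrite mulr_gt0// invr_gt0; clra.
near=> eps.
have ep : 0 < eps by near: eps; exact: nbhs_right_gt.
have he : 0 < eps < eps0 by rewrite ep/=; near: eps; exact: nbhs_right_lt.
have hy : forall j, `|y j eps - xi j| <= c by near: eps.
have hre : r * eps <= c by near: eps.
have su := hpos _ he; have [cu u0 _] := su.
have out x : (forall j, r * eps <= `|x - y j eps|) -> u eps x <= expR (-2).
  move=> h; apply: (le_trans (ler_norm _)); apply: hr => // j.
  exact: le_trans (h j) (enorm_ge _).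
split=> //; last by move=> tau tau0; exact: vanish.
move=> j; set Q := fun x => _; set v := fun x => _.
have Q1 : class_C 1 Q.
  have := class_C_affine eps (- (eps^-1 *: y j eps)) V1.
  rewrite (_ : (fun z => _) = Q)//; apply/funext => z; rewrite /Q opprK scalerDr scalerA divff ?gt_eqF//.
  by rewrite scale1r addrC.
have Qv : log_solution Q v by exact: log_solution_scaled.
have [cv v0 vD] := Qv.
have cg := continuous_potential (class_C_continuous Q1) cv v0.
have QL x : 0 <= Q x <= L by exact: VL.
have vM x : v x <= M by exact: uM.
have u1 : class_C 1 (u eps).
  have v1 := class_C_affine eps^-1 (y j eps) (log_solution_class_C1 Q1 Qv).
  rewrite (_ : u eps = fun z => v (eps^-1 *: (z - y j eps)))//; apply/funext => z.
  by rewrite /v scalerA divff ?gt_eqF// scale1r addrC subrK.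
have cgu : continuous (fun x => (V x - ln (u eps x ^+ 2)) * u eps x / eps ^+ 2).
  by apply: continuous_mul; [exact: continuous_potential|exact: cst_continuous].
split=> //.
- have := weak_form_affine (y j eps) ep u1 cgu (weak_solution_weak_form ep cV su u1).
  rewrite (_ : (fun z => eps ^+ 2 * _) = (fun x => (Q x - ln (v x ^+ 2)) * v x))//.
  by apply/funext => x; rewrite /Q /v; field; rewrite gt_eqF.
- apply: (hA Q v (class_C_continuous Q1) QL Qv vM).
  by rewrite /v scaler0 addr0; apply: (peak_value ep cV V0 su); exact: ymax.
- move=> x xc; have e0 := expR_gt0 (- (2^-1 * `|x|)).
  have a0 : 0 <= M * (N%:R * 2) by rewrite mulr_ge0// mulr_ge0.
  have [xr|xr] := ltP (2 * r) `|x|; last first.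
    apply: (le_trans (vM x)); rewrite mulrDl.
    have : M <= M * expR r * expR (- (2^-1 * `|x|)).
      by rewrite -mulrA -expRD ler_peMr//; apply: le_trans (expR_ge1Dx _); clra.
    by have := mulr_ge0 a0 (ltW e0); clra.
  have L0' : 0 < 2^-1 * `|x| by clra.
  apply: (le_trans (decay_barrier cv cg vD L0' M0 (fun z _ => vM z) _)); last first.
    by rewrite ler_wpM2r ?(ltW e0)// lerDl mulr_ge0// expR_ge0.
  move=> z zx _.
  have z1 : r <= `|z| by have := ler_normB z (z - x); rewrite opprB addrC subrK; clra.
  have z2 : `|z| * eps <= 2 * c.
    have : `|x| * eps <= c by rewrite -ler_pdivlMr.
    have : `|z| <= 3 / 2 * `|x| by have := ler_normD (z - x) x; rewrite subrK; clra.
    by move=> h1 h2; cnra.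
  have vz : v z <= expR (-2).
    apply: out => i; have [->|ij] := eqVneq i j.
      by rewrite addrC addKr normrZ gtr0_norm// mulrC ler_pM2l.
    have h1 := hc0 i j ij; have h2 := hy i; have h3 := hy j.
    have h4 : `|eps *: z| <= 2 * c by rewrite normrZ gtr0_norm// mulrC.
    have E : xi i - xi j = - (y j eps + eps *: z - y i eps) + eps *: z + (y j eps - xi j) - (y i eps - xi i).
      by apply/rowP => q; rewrite !mxE; ring.
    have := h1; rewrite E => h5.
    have := ler_normB (- (y j eps + eps *: z - y i eps) + eps *: z + (y j eps - xi j)) (y i eps - xi i).
    have := ler_normD (- (y j eps + eps *: z - y i eps) + eps *: z) (y j eps - xi j).
    have := ler_normD (- (y j eps + eps *: z - y i eps)) (eps *: z).
    rewrite normrN /c in h2 h3 h4 hre *; clra.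
  have lv : ln (v z) <= -2.
    by rewrite -(expRK (-2)) ler_ln ?posrE ?expR_gt0.
  rewrite ler_peMl ?(ltW (v0 z))// ln_sqr//.
  by have /andP[q0 _] := QL z; clra.
Unshelve. all: by end_near. Qed.

End peaks.

(** * Compactness along ultrafilters *)

Section ultrafilters.

Lemma ultra_map (T U : Type) (f : T -> U) (F : set_system T) : UltraFilter F -> UltraFilter (f @ F).
Proof.
move=> FU; have PF : ProperFilter F by exact: ultra_proper.
split; first exact: fmap_proper_filter.
move=> G PG sG; apply/seteqP; split=> [B GB|]; last exact: sG.
have [//|h] := in_ultra_setVsetC (f @^-1` B) FU.
have : G (B `&` ~` B) by apply: filterI => //; exact: sG.
by rewrite setICr => /filter_not_empty.
Qed.

Lemma ultra_compact_cvg (T : Type) (X : topologicalType) (A : set X) (f : T -> X) (F : set_system T) :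
  UltraFilter F -> compact A -> (\forall t \near F, A (f t)) -> exists2 p, A p & f t @[t --> F] --> p.
Proof.
move=> FU; rewrite compact_ultra => cA FA.
by have [p [Ap fp]] := cA _ (ultra_map f FU) FA; exists p.
Qed.

End ultrafilters.

Section continuous_convergence.
Context {R : realType} {N : nat} {T : Type}.
Variable F : set_system T.
Hypothesis FU : UltraFilter F.
Implicit Types (x y z : 'rV[R]_N) (w g : 'rV[R]_N -> R) (wn gn : T -> 'rV[R]_N -> R).

Let PF : ProperFilter F. Proof. exact: ultra_proper. Qed.

Lemma ultra_real_cvg (f : T -> R) (M : R) : (\forall t \near F, `|f t| <= M) ->
  exists l : R, f t @[t --> F] --> l.
Proof.
move=> fM; have [||p _ fp] := @ultra_compact_cvg T R `[- M, M]%classic f F FU; last by exists p.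
- exact: segment_compact.
- by apply: filterS fM => t; rewrite /= in_itv/= -ler_norml.
Qed.

Lemma ultra_row_cvg (z : T -> 'rV[R]_N) (M : R) : (\forall t \near F, `|z t| <= M) ->
  exists2 p, `|p| <= M & z t @[t --> F] --> p.
Proof. by move=> zM; have [p Ap zp] := ultra_compact_cvg FU (@cube_compact R N M) zM; exists p. Qed.

(** Continuous convergence: moving arguments are allowed. Products, logarithms and changes of centre
    then reduce to limits of real functions, and local uniformity is recovered by
    [ccvg_loc_unif]. *)
Definition ccvg wn w := forall (z : T -> 'rV[R]_N) x, z t @[t --> F] --> x -> wn t (z t) @[t --> F] --> w x.

Lemma ccvg_at wn w x : ccvg wn w -> wn t x @[t --> F] --> w x.
Proof. by move=> h; apply: (h (fun=> x)); exact: cvg_cst. Qed.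

(** If uniformity failed, the ultrafilter would contain the set of bad parameters. Points witnessing
    the failure converge by compactness, and continuous convergence at their limit is
    contradicted. *)
Lemma ccvg_loc_unif wn w : continuous w -> ccvg wn w -> loc_unif F wn w.
Proof.
move=> cw ww K d d0.
have [//|bad] := in_ultra_setVsetC [set t | forall x, `|x| <= K -> `|wn t x - w x| <= d] FU.
have /choice[z hz] t : exists z : 'rV[R]_N,
    (~ forall x, `|x| <= K -> `|wn t x - w x| <= d) -> `|z| <= K /\ d < `|wn t z - w z|.
  have [h|h] := pselect (forall x, `|x| <= K -> `|wn t x - w x| <= d); first by exists 0.
  have [z hz] : exists z, `|z| <= K /\ d < `|wn t z - w z|.
    apply: contrapT => hn; apply: h => x xK; rewrite leNgt; apply/negP => dx.
    by apply: hn; exists x.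
  by exists z.
have zK : \forall t \near F, `|z t| <= K by apply: filterS bad => t /hz[].
have [x xK zx] := ultra_row_cvg zK.
have l1 : `|wn t (z t) - w (z t)| @[t --> F] --> `|w x - w x|.
  apply: cvg_norm; apply: cvgB; first exact: ww.
  exact: (cvg_comp _ _ zx (cw x)).
exfalso; rewrite subrr normr0 in l1.
have [t [h1 h2]] := filter_ex (filterI (cvgr_lt 0 l1 d d0) bad).
by have [_ h3] := hz t h2; have := lt_trans h3 h1; rewrite ltxx.
Qed.

(** Along an ultrafilter bounded values converge at every point simultaneously, so no diagonal
    extraction occurs. Equicontinuity then upgrades pointwise to continuous convergence. *)
Lemma ascoli wn :
  (forall K : R, exists2 L : R, 0 <= L & \forall t \near F, (forall x, `|x| <= K -> `|wn t x| <= L) /\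
     (forall x y, `|x| <= K -> `|y| <= K -> `|x - y| <= 1 -> `|wn t x - wn t y| <= L * `|x - y|)) ->
  exists2 w, continuous w & ccvg wn w.
Proof.
move=> H.
have /choice[w hw] x : exists l : R, wn t x @[t --> F] --> l.
  have [L L0 hL] := H `|x|; apply: (@ultra_real_cvg _ L).
  by apply: filterS hL => t [h _]; exact: h.
have wlip K : exists2 L : R, 0 <= L & forall x y, `|x| <= K -> `|y| <= K -> `|x - y| <= 1 ->
    `|w x - w y| <= L * `|x - y|.
  have [L L0 hL] := H K; exists L => // x y xK yK xy.
  have l : `|wn t x - wn t y| @[t --> F] --> `|w x - w y| by apply: cvg_norm; apply: cvgB.
  by apply: (cvg_limit_le l); apply: filterS hL => t [_ h]; exact: h.
exists w.
  apply: continuous_ballP => x e e0; have [L L0 hL] := wlip (`|x| + 1).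
  exists (Num.min 1 (e / (L + 1))); first by rewrite lt_min ltr01 divr_gt0//; clra.
  move=> z; rewrite le_min => /andP[z1 z2].
  have zx : `|z| <= `|x| + 1 by have := ler_normD (z - x) x; rewrite subrK; clra.
  have xx : `|x| <= `|x| + 1 by rewrite lerDl.
  apply: (le_trans (hL x z xx zx _)); first by rewrite distrC.
  move: z2; rewrite distrC ler_pdivlMr; last by clra.
  by move=> z2; have := normr_ge0 (x - z); cnra.
move=> z x zx; apply/cvgrPdist_le => e e0.
have [L L0 hL] := H (`|x| + 1).
pose d := Num.min 1 (e / (2 * (L + 1))).
have d0 : 0 < d by rewrite lt_min ltr01 divr_gt0//; clra.
have e2 : 0 < e / 2 by rewrite divr_gt0.
have zd : \forall t \near F, `|z t - x| <= d.
  by have := zx _ (near_norm_le x d0).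
have /cvgrPdist_le/(_ _ e2) wx := hw x.
apply: filterS (filterI (filterI hL zd) wx) => t [[[_ h] h1] h2].
move: h1; rewrite le_min => /andP[z1 z2].
have zK : `|z t| <= `|x| + 1 by have := ler_normD (z t - x) x; rewrite subrK; clra.
have xx : `|x| <= `|x| + 1 by rewrite lerDl.
have h3 := h _ _ zK xx z1.
have h4 : L * `|z t - x| <= e / 2.
  move: z2; rewrite ler_pdivlMr; last by clra.
  by have := normr_ge0 (z t - x); move: (`|z t - x|) => a a0; cnra.
rewrite (_ : w x - _ = (w x - wn t x) - (wn t (z t) - wn t x)); last by ring.
by apply: (le_trans (ler_normB _ _)); clra.
Qed.

(** One power of the weight is given up: beyond radius $K=2B/d$ it provides the smallness, and
    inside that radius local uniform convergence does. This holds on windows [Tn t] that grow with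
    the parameter. *)
Lemma weighted_unif wn w (Tn : T -> R) (m : nat) (B : R) : loc_unif F wn w -> 0 <= B ->
  (\forall t \near F, forall x, `|x| <= Tn t -> `|wn t x| * (1 + `|x|) ^+ m.+1 <= B) ->
  (forall x, `|w x| * (1 + `|x|) ^+ m.+1 <= B) -> forall d : R, 0 < d ->
  \forall t \near F, forall x, `|x| <= Tn t -> `|wn t x - w x| * (1 + `|x|) ^+ m <= d.
Proof.
move=> wu B0 hn hw d d0; pose K := 2 * B / d.
have K0 : 0 <= K by rewrite /K divr_ge0 ?mulr_ge0// ltW.
have P0 : 0 < (1 + K) ^+ m by rewrite exprn_gt0//; clra.
have dP : 0 < d / (1 + K) ^+ m by rewrite divr_gt0.
apply: filterS (filterI hn (wu K _ dP)) => t [h1 h2] x xT.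
have x0 := normr_ge0 x; have p0 : 0 <= (1 + `|x|) ^+ m by rewrite exprn_ge0//; clra.
have [xK|xK] := leP `|x| K.
  apply: (le_trans (ler_wpM2r p0 (h2 x xK))).
  rewrite mulrAC ler_pdivrMr// ler_wpM2l ?(ltW d0)// lerXn2r ?nnegrE//; clra.
have a1 := h1 x xT; have a2 := hw x.
have x1 : 0 < 1 + `|x| by clra.
have : `|wn t x - w x| * (1 + `|x|) ^+ m.+1 <= 2 * B.
  have := ler_wpM2r (exprn_ge0 m.+1 (ltW x1)) (ler_normB (wn t x) (w x)).
  by rewrite mulrDl; clra.
rewrite exprSr mulrA -ler_pdivlMr// => h; apply: (le_trans h).
rewrite ler_pdivrMr//; have : K * d = 2 * B by rewrite /K divfK// gt_eqF.
by cnra.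
Qed.

(** The Gaussian lower bound passes to the limit and keeps it positive, so the logarithms converge
    too and the limit solves the equation with constant potential. Since the windows exhaust the
    space, the limit decays everywhere and [profile] applies. *)
Lemma tame_limit (L M A K V0 : R) (Tn : T -> R) (Qn vn : T -> 'rV[R]_N -> R) : 0 <= L -> 1 <= M -> 0 < A -> 0 <= K ->
  (\forall t \near F, tame L M A 1 K (Tn t) (Qn t) (vn t)) ->
  (forall X : R, \forall t \near F, X <= Tn t) -> ccvg Qn (fun=> V0) ->
  exists a, ccvg vn (fun x => gauss 2^-1 (- (V0 + N%:R) / 2) (x - a)).
Proof.
move=> L0 M1 A0 K0 tn Too QV.
have [C C0 hC] := @log_solution_lipschitz R N L M L0 M1.
have [k|U cU vU] := @ascoli vn.
  exists (M + C); first by clra.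
  apply: filterS tn => t [Q1 Qv _ QL vM vG vK]; split=> [x _|x y _ _ xy].
    have v0 : 0 < vn t x by case: Qv.
    by rewrite gtr0_norm//; have := vM x; clra.
  apply: (le_trans (hC _ _ (class_C_continuous Q1) QL Qv vM x y xy)).
  by rewrite ler_wpM2r//; clra.
have UG x : gauss A 1 x <= U x.
  rewrite -lerN2; have l : - vn t x @[t --> F] --> - U x by apply: cvgN; exact: ccvg_at.
  by apply: (cvg_limit_le l); apply: filterS tn => t [_ _ _ _ _ vG _]; rewrite lerN2.
have U0 x : 0 < U x := lt_le_trans (gauss_gt0 A 1 x) (UG x).
have UK x : U x <= K * expR (- (2^-1 * `|x|)).
  have l := @ccvg_at vn U x vU; apply: (cvg_limit_le l); apply: filterS (filterI tn (Too `|x|)) => t [[_ _ _ _ _ _ vK] xT].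
  exact: vK.
have Uv : vanishing U.
  apply: (@exp_decay_vanishing R N 2^-1); first by rewrite invr_gt0.
  by exists K => // x; rewrite gtr0_norm.
have cst1 : continuous (fun _ : 'rV[R]_N => V0) by exact: cst_continuous.
have cg := continuous_potential cst1 cU U0.
have gU : ccvg (fun t x => (Qn t x - ln (vn t x ^+ 2)) * vn t x) (fun x => (V0 - ln (U x ^+ 2)) * U x).
  move=> z x zx; have vz := vU z x zx; have qz := QV z x zx.
  have v2 : vn t (z t) ^+ 2 @[t --> F] --> U x ^+ 2 by rewrite expr2; apply: cvgM.
  have lz : ln (vn t (z t) ^+ 2) @[t --> F] --> ln (U x ^+ 2).
    by apply: (cvg_comp _ _ v2); apply: continuous_ln; exact: exprn_gt0.
  exact: cvgM (cvgB qz lz) vz.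
have QU : log_solution (fun=> V0) U.
  split=> //; apply: (@DLap_limit R N T F PF vn (fun t x => (Qn t x - ln (vn t x ^+ 2)) * vn t x)) => //.
  - apply: filterS tn => t [Q1 [cv v0 vD] _ _ _ _ _]; split=> //.
    exact: continuous_potential (class_C_continuous Q1) cv v0.
  - exact: ccvg_loc_unif.
  - exact: ccvg_loc_unif.
have [a ha] := profile QU A0 UG Uv; exists a => z x zx.
by rewrite -ha; exact: vU.
Qed.

End continuous_convergence.

(** * Quantitative Pohozaev estimates *)

Section pohozaev_tools.
Context {R : realType} {N : nat}.
Local Notation mu := (lebesgue_row R N).
Implicit Types (x y z : 'rV[R]_N) (f w V : 'rV[R]_N -> R).

Lemma hessian_expansion V (xi : 'rV[R]_N) : grad V xi = 0 -> differentiable (grad V) xi ->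
  forall e : R, 0 < e -> exists2 r : R, 0 < r & forall h j, `|h| <= r ->
    `|partial j V (xi + h) - (h *m hessian V xi) ord0 j| <= e * `|h|.
Proof.
move=> g0 dg e e0.
have /diff_locally/eqaddoP/(_ e e0)/nbhs_ballP[r /= r0 hr] := dg.
exists (r / 2) => [|h j hh]; first by rewrite divr_gt0.
have := hr h; rewrite -ball_normE/= sub0r normrN => /(_ (le_lt_trans hh _)) E.
have {}E : `|grad V (h + xi) - (grad V xi + h *m hessian V xi)| <= e * `|h|.
  have := E ltac:(clra); rewrite /shift/= /hessian /jacobian mul_rV_lin1.
  by rewrite !fctE.
apply: le_trans E; apply: le_trans (coord_le_norm _ j).
have E2 (a b : 'rV[R]_N) : (a - b) ord0 j = a ord0 j - b ord0 j by rewrite !mxE.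
have E3 : grad V (h + xi) ord0 j = partial j V (xi + h) by rewrite mxE addrC.
by rewrite g0 add0r E2 E3.
Qed.

Lemma Rintegral_odd f (k : R) : continuous f -> (forall x, k < `|x| -> f x = 0) -> (forall x, f (- x) = - f x) ->
  \int[mu]_x f x = 0.
Proof.
move=> cf fk fodd; have fi := integrable_continuous_supported cf fk.
have := RintegralN_arg fi.
have -> : \int[mu]_x f (- x) = - \int[mu]_x f x.
  rewrite -mulN1r -RintegralZl//; apply: eq_Rintegral => x _; by rewrite fodd mulN1r.
clra.
Qed.

Lemma bump4_lower (f : 'rV[R]_N -> R) (s a d : R) (x0 : 'rV[R]_N) : 0 < s -> 0 < a -> 0 <= d -> continuous f -> (forall x, 0 <= f x) ->
  (forall x, `|x - x0| <= a -> d <= f x /\ expR (-2) <= bump4 s x) ->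
  expR (-2) * d * (a *+ 2) ^+ N <= \int[mu]_x (bump4 s x * f x).
Proof.
move=> s0 a0 d0 cf f0 hd.
have cb := class_C_continuous (@class_C_bump4 R N 0 s).
have bi : mu.-integrable setT (EFin \o (fun x => bump4 s x * f x)).
  apply: (@integrable_continuous_supported _ _ _ s^-1); first exact: continuous_mul.
  by move=> x /(bump4_supp s0) ->; rewrite mul0r.
have [bi' <-] := Rintegral_shift x0 bi.
rewrite -[X in _ * X <= _](@Rintegral_indic_cube R N a) ?(ltW a0)//.
rewrite -RintegralZl//; last exact: integrable_indic_cube.
apply: le_Rintegral => //; first by apply: integrable_scale; exact: integrable_indic_cube.
move=> x _; rewrite indicE in_cube; case: (leP `|x| a) => xa; last first.
  by rewrite mulr0 mulr_ge0// bump4_ge0.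
have [|h1 h2] := hd (x0 + x); first by rewrite addrC addKr.
by rewrite mulr1 ler_pM// expR_ge0.
Qed.

Lemma bump4_even (s : R) x : bump4 s (- x) = bump4 s x.
Proof.
rewrite /bump4 /flat4 !subr0 scalerN; congr (flatexp _ (1 - _ ^+ 2)).
by rewrite /dot; apply: eq_bigr => i _; rewrite !mxE mulrNN.
Qed.

Lemma gauss_even (A B : R) x : gauss A B (- x) = gauss A B x.
Proof.
rewrite /gauss; congr (expR (- (A * _ + B))).
by rewrite /dot; apply: eq_bigr => i _; rewrite !mxE mulrNN.
Qed.

Lemma mulmx_norm_le (H : 'M[R]_N) : exists2 C : R, 0 <= C & forall x, `|x *m H| <= C * `|x|.
Proof.
pose C := \sum_(i < N) \sum_(j < N) `|H i j|.
have C0 : 0 <= C by apply: sumr_ge0 => i _; apply: sumr_ge0.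
exists C => // x; apply/normrv_leP; first by rewrite mulr_ge0.
move=> j; rewrite mxE (le_trans (ler_norm_sum _ _ _))// /C mulr_suml ler_sum// => i _.
rewrite normrM mulrC ler_pM//; last exact: coord_le_norm.
by rewrite (bigD1 j)//= lerDl sumr_ge0.
Qed.

End pohozaev_tools.

Section pohozaev_estimates.
Context {R : realType} {N : nat}.
Local Notation mu := (lebesgue_row R N).
Implicit Types (x y z : 'rV[R]_N) (f g u v Q V : 'rV[R]_N -> R).
Local Notation e_ i := (delta_mx ord0 i : 'rV[R]_N).

Lemma continuous_sqr f : continuous f -> continuous (fun x => f x ^+ 2).
Proof. by move=> cf; have := continuous_mul cf cf; under eq_fun do rewrite -expr2. Qed.

Definition bump_mean (s : R) f : R := \int[mu]_x (bump4 s x * f x).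

Lemma bump_mean_integrable (s : R) f : 0 < s -> continuous f ->
  mu.-integrable setT (EFin \o (fun x => bump4 s x * f x)).
Proof.
move=> s0 cf; apply: (@integrable_continuous_supported _ _ _ s^-1).
  by apply: continuous_mul => //; exact: (class_C_continuous (class_C_bump4 0 s)).
by move=> x /(bump4_supp s0) ->; rewrite mul0r.
Qed.

Lemma bump_meanD (s : R) f g : 0 < s -> continuous f -> continuous g ->
  bump_mean s (fun x => f x + g x) = bump_mean s f + bump_mean s g.
Proof.
move=> s0 cf cg; rewrite /bump_mean -RintegralD//; try exact: bump_mean_integrable.
by apply: eq_Rintegral => x _; rewrite mulrDr.
Qed.

Lemma bump_meanZ (s c : R) f : 0 < s -> continuous f ->
  bump_mean s (fun x => c * f x) = c * bump_mean s f.
Proof.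
move=> s0 cf; rewrite /bump_mean -RintegralZl//; last exact: bump_mean_integrable.
by apply: eq_Rintegral => x _; ring.
Qed.

Lemma eq_bump_mean (s : R) f g : (forall x, f x = g x) -> bump_mean s f = bump_mean s g.
Proof. by move=> fg; apply: eq_Rintegral => x _; rewrite fg. Qed.

Lemma bump_mean_odd (s : R) f : 0 < s -> continuous f -> (forall x, f (- x) = - f x) -> bump_mean s f = 0.
Proof.
move=> s0 cf fodd; apply: (@Rintegral_odd _ _ _ s^-1).
- by apply: continuous_mul => //; exact: (class_C_continuous (class_C_bump4 0 s)).
- by move=> x /(bump4_supp s0) ->; rewrite mul0r.
- by move=> x; rewrite bump4_even fodd mulrN.
Qed.

(** Each term on the right of [pohozaev] contains a derivative of the cutoff, hence a factor $s^4$.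
    The support of the cutoff must fit in the window where [tame_pointwise] holds. *)
Lemma pohozaev_tame (L M A B K : R) : (0 < N)%N -> 0 <= L -> 1 <= M -> 0 <= A -> 0 <= K ->
  exists2 C : R, 0 <= C & forall (s T : R) Q v j, 0 < s -> s^-1 <= T - 4 -> tame L M A B K T Q v ->
  `|bump_mean s (fun x => partial j Q x * v x ^+ 2)| <= C * s ^+ 4.
Proof.
move=> N0 L0 M1 A0 K0; have [D D0 hD] := @tame_pointwise R N L M A B K (2 * N + 3) L0 M1 A0 K0.
have [C1 C10 h1] := @bump4_gradient_mass R N N0; have [C2 C20 h2] := @bump4_flux_mass R N N0.
exists (C1 * D ^+ 2 + C2 * D ^+ 2) => [|s T Q v j s0 sT tv].
  by rewrite addr_ge0// mulr_ge0// exprn_ge0.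
have [Q1 Qv wv QL vM vG vK] := tv; have [cv v0 vD] := Qv.
have v1 := log_solution_class_C1 Q1 Qv.
have s40 : 0 <= s ^+ 4 by rewrite exprn_ge0// ltW.
have D20 : 0 <= D ^+ 2 by rewrite exprn_ge0.
have si0 : 0 < s^-1 by rewrite invr_gt0.
have P := pohozaev j si0 Q1 v1 v0 wv (class_C_bump4 2 s) (fun x => @bump4_supp R N s x s0).
have -> : bump_mean s (fun x => partial j Q x * v x ^+ 2) = \int[mu]_x (bump4 s x * partial j Q x * v x ^+ 2).
  by apply: eq_Rintegral => x _; rewrite mulrA.
rewrite P; apply: (le_trans (ler_normD _ _)); rewrite normrN.
have pt x i : `|x| <= s^-1 -> [/\ v x * (1 + `|x|) ^+ (2 * N + 3) <= D, `|partial i v x| * (1 + `|x|) ^+ (2 * N + 3) <= D & v x <= D].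
  move=> xs; have := hD T Q v tv x i (le_trans xs sT); rewrite mulrDl => h.
  have p1 : 1 <= (1 + `|x|) ^+ (2 * N + 3) by rewrite exprn_ege1// lerDl.
  have p0 : 0 <= (1 + `|x|) ^+ (2 * N + 3) by apply: le_trans p1.
  have vx := v0 x; have a1 := mulr_ge0 (ltW vx) p0; have a2 := mulr_ge0 (normr_ge0 (partial i v x)) p0.
  have a3 : v x <= v x * (1 + `|x|) ^+ (2 * N + 3) by rewrite ler_peMr// ltW.
  by split; clra.
rewrite mulrDl; apply: lerD; rewrite -mulrA [D ^+ 2 * _]mulrC mulrA.
- apply: h1 => //; first exact: continuous_sqr.
  move=> x xs; have [b1 _ b2] := pt x j xs.
  rewrite ger0_norm ?sqr_ge0// expr2 -mulrA expr2; apply: ler_pM => //; first exact/ltW.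
  by rewrite mulr_ge0 ?(ltW (v0 x))// exprn_ge0// addr_ge0.
- apply: h2 => //; first exact: (class_C_continuous (class_C_partial j v1)).
  move=> x i xs; have [_ b1 _] := pt x j xs.
  have b2 := hD T Q v tv x i (le_trans xs sT).
  have p1 : 1 <= (1 + `|x|) ^+ (2 * N + 3) by rewrite exprn_ege1// lerDl.
  have b3 : `|partial j v x| <= D by apply: le_trans b1; rewrite ler_peMr.
  rewrite (gtr0_norm (v0 x)) -mulrA expr2; apply: ler_pM => //.
  by rewrite mulr_ge0 ?exprn_ge0// ?addr_ge0// ltW.
Qed.

(** Linearisation at [a]. The remainder is the relative entropy $a-b-b\ln(a/b)$; the inequality $\ln
    x\le x-1$ at $a/b$ makes it nonnegative, and at $b/a$ bounds it by $(a-b)^2/a$. *)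
Lemma entropy_diff (q a b : R) : 0 < a -> 0 < b -> exists2 e : R, 0 <= e <= (a - b) ^+ 2 / a &
  (q - ln (a ^+ 2)) * a - (q - ln (b ^+ 2)) * b = (q - ln (a ^+ 2) - 2) * (a - b) + 2 * e.
Proof.
move=> a0 b0; exists (a - b - b * (ln a - ln b)); last by rewrite !ln_sqr//; ring.
have l1 : ln a - ln b <= a / b - 1 by rewrite -ln_div ?posrE//; apply: ln_le_sub1; exact: divr_gt0.
have l2 : ln b - ln a <= b / a - 1 by rewrite -ln_div ?posrE//; apply: ln_le_sub1; exact: divr_gt0.
have k1 := ler_wpM2l (ltW b0) l1; have k2 := ler_wpM2l (ltW b0) l2.
have e1 : b * (a / b - 1) = a - b by field; rewrite gt_eqF.
have e2 : (a - b) ^+ 2 / a = a - b + b * (b / a - 1) by field; rewrite gt_eqF.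
by rewrite e2; apply/andP; split; clra.
Qed.

Lemma entropy_diff_le (q a b C : R) : 0 < a -> 0 < b -> `|q| <= C -> `|ln (a ^+ 2)| <= C -> `|ln (b ^+ 2)| <= C ->
  `|(q - ln (a ^+ 2)) * a - (q - ln (b ^+ 2)) * b| <= (2 * C + 4) * `|a - b|.
Proof.
(* The remainder is divided by the point of linearisation; linearising at the larger of the two
   makes it at most $a-b$. *)
move=> a0 b0 qC; wlog ab : a b a0 b0 / b <= a => [wl|] aC bC.
  have [ab|ab] := leP b a; first exact: wl.
  by rewrite distrC [`|a - b|]distrC; apply: wl => //; exact: ltW.
have [e /andP[e0 e1] ->] := entropy_diff q a0 b0.
have d0 : 0 <= a - b by rewrite subr_ge0.
have e2 : e <= a - b.
  apply: (le_trans e1); rewrite ler_pdivrMr// expr2 ler_wpM2l//; clra.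
apply: (le_trans (ler_normD _ _)); rewrite normrM (ger0_norm d0) normrM (ger0_norm (ler0n _ 2)) (ger0_norm e0).
have h : `|q - ln (a ^+ 2) - 2| <= 2 * C + 2.
  apply: (le_trans (ler_normB _ _)); rewrite (ger0_norm (ler0n _ 2)).
  by have := ler_normB q (ln (a ^+ 2)); clra.
by have := ler_wpM2r d0 h; clra.
Qed.

Lemma tame_diff_rhs (L M A B K : R) : 0 <= L -> 1 <= M -> 0 <= A -> exists2 C : R, 0 <= C & forall T Q v w,
  tame L M A B K T Q v -> tame L M A B K T Q w -> forall x,
  `|(Q x - ln (v x ^+ 2)) * v x - (Q x - ln (w x ^+ 2)) * w x| <= C * (1 + `|x|) ^+ 2 * `|v x - w x|.
Proof.
move=> L0 M1 A0; have [C C0 hC] := @tame_ln_bound R N M A B M1 A0.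
exists (2 * (L + C) + 4) => [|T Q v w [_ [_ v0 _] _ QL vM vG _] [_ [_ w0 _] _ _ wM wG _] x].
  by rewrite addr_ge0// mulr_ge0// addr_ge0.
have p1 : 1 <= (1 + `|x|) ^+ 2 by rewrite exprn_ege1// lerDl.
have b1 : `|Q x| <= (L + C) * (1 + `|x|) ^+ 2.
  have /andP[q0 qL] := QL x; rewrite ger0_norm// (le_trans qL)// (le_trans (_ : _ <= L + C)) ?lerDl//.
  by rewrite ler_peMr// addr_ge0.
have b2 f : (forall x, f x <= M) -> (forall x, gauss A B x <= f x) -> `|ln (f x ^+ 2)| <= (L + C) * (1 + `|x|) ^+ 2.
  move=> fM fG; apply: (le_trans (hC f fM fG x)); rewrite ler_wpM2r ?lerDr//; exact: le_trans p1.
apply: (le_trans (entropy_diff_le (v0 x) (w0 x) b1 (b2 v vM vG) (b2 w wM wG))).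
rewrite ler_wpM2r//; have -> : (2 * (L + C) + 4) * (1 + `|x|) ^+ 2 = 2 * ((L + C) * (1 + `|x|) ^+ 2) + 4 * (1 + `|x|) ^+ 2 by ring.
clra.
Qed.

Lemma tame_diff_gradient (L M A B K : R) : 0 <= L -> 1 <= M -> 0 <= A -> exists2 C : R, 0 <= C & forall T S Q v w,
  tame L M A B K T Q v -> tame L M A B K T Q w -> (forall x, `|v x - w x| <= S) -> forall x i,
  `|partial i v x - partial i w x| <= C * S * (1 + `|x|) ^+ 2.
Proof.
move=> L0 M1 A0; have [C C0 hC] := @tame_diff_rhs L M A B K L0 M1 A0.
have [P P0 hP] := @norm_partial_le R N.
exists (P * (1 + C * 25)) => [|T S Q v w tv tw vw x i].
  by rewrite mulr_ge0// addr_ge0// mulr_ge0.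
have [Q1 Qv _ _ _ _ _] := tv; have [_ Qw _ _ _ _ _] := tw.
have [cv v0 vD] := Qv; have [cw w0 wD] := Qw; have cQ := class_C_continuous Q1.
have v1 := log_solution_class_C1 Q1 Qv; have w1 := log_solution_class_C1 Q1 Qw.
have S0 : 0 <= S by apply: le_trans (vw 0).
have cgv := continuous_potential cQ cv v0; have cgw := continuous_potential cQ cw w0.
have d := is_derive_sub (class_C_is_derive i x v1) (class_C_is_derive i x w1).
have dd : derivable (fun x => v x - w x) x (e_ i) by case: d.
have p1 : 1 <= (1 + `|x|) ^+ 2 by rewrite exprn_ege1// lerDl.
have gz z : `|z - x| <= 4 -> `|(Q z - ln (v z ^+ 2)) * v z - (Q z - ln (w z ^+ 2)) * w z| <= C * 25 * (1 + `|x|) ^+ 2 * S.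
  move=> zx; apply: (le_trans (hC _ _ _ _ tv tw z)).
  have zz : 1 + `|z| <= 5 * (1 + `|x|).
    by have := ler_normD (z - x) x; rewrite subrK; have := normr_ge0 x; clra.
  have z2 : (1 + `|z|) ^+ 2 <= 25 * (1 + `|x|) ^+ 2.
    have -> : 25 * (1 + `|x|) ^+ 2 = (5 * (1 + `|x|)) ^+ 2 by ring.
    by rewrite lerXn2r ?nnegrE ?addr_ge0// mulr_ge0// addr_ge0.
  apply: ler_pM => //; first by rewrite mulr_ge0// exprn_ge0// addr_ge0.
  by rewrite -mulrA ler_wpM2l.
have := hP i _ _ x S _ (continuous_sub cv cw) (continuous_sub cgv cgw) (DLap_sub cv cgv cw cgw vD wD) dd (fun z _ => vw z) gz.
rewrite (partialE d) => h; apply: (le_trans h).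
have -> : P * (1 + C * 25) * S * (1 + `|x|) ^+ 2 = P * (S * (1 + `|x|) ^+ 2 + C * 25 * (1 + `|x|) ^+ 2 * S) by ring.
by rewrite ler_wpM2l// lerD2r ler_peMr.
Qed.

(** The same cutoff gain $s^4$, now linear in the size [S] of the difference. The weight has
    exponent $2N+5$: $2N+3$ for the flux estimates and 2 for the growth allowed in
    [tame_diff_gradient]. *)
Lemma pohozaev_tame_diff (L M A B K : R) : (0 < N)%N -> 0 <= L -> 1 <= M -> 0 <= A -> 0 <= K ->
  exists2 C : R, 0 <= C & forall (s T S : R) Q v w j, 0 < s -> s^-1 <= T - 4 -> tame L M A B K T Q v -> tame L M A B K T Q w ->
  (forall x, `|v x - w x| <= S) ->
  `|bump_mean s (fun x => partial j Q x * (v x ^+ 2 - w x ^+ 2))| <= C * s ^+ 4 * S.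
Proof.
move=> N0 L0 M1 A0 K0; have [D D0 hD] := @tame_pointwise R N L M A B K (2 * N + 5) L0 M1 A0 K0.
have [G G0 hG] := @tame_diff_gradient L M A B K L0 M1 A0.
have [C1 C10 h1] := @bump4_gradient_mass R N N0; have [C2 C20 h2] := @bump4_flux_mass R N N0.
exists (C1 * (2 * D) + C2 * (G * D) + C2 * (D * (1 + G))) => [|s T S Q v w j s0 sT tv tw vw].
  by rewrite !addr_ge0// !mulr_ge0// addr_ge0.
have [Q1 Qv wv QL vM vG vK] := tv; have [cv v0 vD] := Qv.
have [_ Qw ww _ _ _ _] := tw; have [cw w0 wD] := Qw.
have v1 := log_solution_class_C1 Q1 Qv; have w1 := log_solution_class_C1 Q1 Qw.
have s40 : 0 <= s ^+ 4 by rewrite exprn_ge0// ltW.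
have S0 : 0 <= S by apply: le_trans (vw 0).
have si0 : 0 < s^-1 by rewrite invr_gt0.
have supp := fun x => @bump4_supp R N s x s0.
have Pv := pohozaev j si0 Q1 v1 v0 wv (class_C_bump4 2 s) supp.
have Pw := pohozaev j si0 Q1 w1 w0 ww (class_C_bump4 2 s) supp.
have cdQ := class_C_continuous (class_C_partial j Q1).
have cdv := class_C_continuous (class_C_partial j v1); have cdw := class_C_continuous (class_C_partial j w1).
have cb := class_C_continuous (@class_C_bump4 R N 0 s).
have cdb := class_C_continuous (class_C_partial j (@class_C_bump4 R N 1 s)).
have cv2 : continuous (fun x => v x ^+ 2) by exact: continuous_sqr.
have cw2 : continuous (fun x => w x ^+ 2) by exact: continuous_sqr.
have cfv := continuous_cutoff_flux (class_C_bump4 2 s) v1; have cfw := continuous_cutoff_flux (class_C_bump4 2 s) w1.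
have dm1 : class_C 1 (fun x => v x - w x).
  rewrite (_ : (fun x => _) = fun x => v x + -1 * w x); last by apply/funext => x; rewrite mulN1r.
  exact (class_C_add v1 (class_C_mul (class_C_cst 1 (-1)) w1)).
have cfd := continuous_cutoff_flux (class_C_bump4 2 s) dm1.
have pd i x : partial i (fun x => v x - w x) x = partial i v x - partial i w x.
  exact: partialE (is_derive_sub (class_C_is_derive i x v1) (class_C_is_derive i x w1)).
have fluxd x : cutoff_flux (bump4 s) (fun x => v x - w x) x = cutoff_flux (bump4 s) v x - cutoff_flux (bump4 s) w x.
  by rewrite /cutoff_flux -sumrB; apply: eq_bigr => i _; rewrite pd; ring.
have fs f x : s^-1 < `|x| -> cutoff_flux (bump4 s) f x = 0 by exact: cutoff_flux_supp.
(* The flux term is bilinear in the solution and its gradient, so the difference splits into two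
   terms, each with one factor of size [S]. *)
have -> : bump_mean s (fun x => partial j Q x * (v x ^+ 2 - w x ^+ 2)) =
    - (\int[mu]_x ((v x ^+ 2 - w x ^+ 2) * partial j (bump4 s) x)) +
    (\int[mu]_x ((partial j v x - partial j w x) * cutoff_flux (bump4 s) v x) +
     \int[mu]_x (partial j w x * cutoff_flux (bump4 s) (fun x => v x - w x) x)).
  have -> : bump_mean s (fun x => partial j Q x * (v x ^+ 2 - w x ^+ 2)) =
     \int[mu]_x (bump4 s x * partial j Q x * v x ^+ 2) - \int[mu]_x (bump4 s x * partial j Q x * w x ^+ 2).
    rewrite -(Rintegral_supp_sub (k := s^-1)).
    - by apply: eq_Rintegral => x _; ring.
    - exact: (continuous_mul (continuous_mul cb cdQ) cv2).
    - exact: (continuous_mul (continuous_mul cb cdQ) cw2).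
    - by move=> x /supp ->; rewrite !mul0r.
    - by move=> x /supp ->; rewrite !mul0r.
  have E1 : \int[mu]_x ((v x ^+ 2 - w x ^+ 2) * partial j (bump4 s) x) =
      \int[mu]_x (v x ^+ 2 * partial j (bump4 s) x) - \int[mu]_x (w x ^+ 2 * partial j (bump4 s) x).
    rewrite -(Rintegral_supp_sub (k := s^-1)).
    - by apply: eq_Rintegral => x _; ring.
    - exact: continuous_mul.
    - exact: continuous_mul.
    - by move=> x xs; rewrite (partial_supp j supp xs) mulr0.
    - by move=> x xs; rewrite (partial_supp j supp xs) mulr0.
  have E2 : \int[mu]_x ((partial j v x - partial j w x) * cutoff_flux (bump4 s) v x) +
      \int[mu]_x (partial j w x * cutoff_flux (bump4 s) (fun x => v x - w x) x) =
      \int[mu]_x (partial j v x * cutoff_flux (bump4 s) v x) - \int[mu]_x (partial j w x * cutoff_flux (bump4 s) w x).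
    rewrite -(Rintegral_supp_add (k := s^-1)) -?(Rintegral_supp_sub (k := s^-1)).
    - by apply: eq_Rintegral => x _; rewrite fluxd; ring.
    - exact: continuous_mul.
    - exact: continuous_mul.
    - by move=> x xs; rewrite fs ?mulr0.
    - by move=> x xs; rewrite fs ?mulr0.
    - exact: (continuous_mul (continuous_sub cdv cdw) cfv).
    - exact: continuous_mul.
    - by move=> x xs; rewrite fs ?mulr0.
    - by move=> x xs; rewrite fs ?mulr0.
  by rewrite E1 E2 Pv Pw; ring.
have pv x i : `|x| <= s^-1 -> v x * (1 + `|x|) ^+ (2 * N + 5) <= D /\ `|v x| * (1 + `|x|) ^+ (2 * N + 5) + `|partial i v x| * (1 + `|x|) ^+ (2 * N + 5) <= D.
  move=> xs; have := hD T Q v tv x i (le_trans xs sT); rewrite mulrDl (gtr0_norm (v0 x)) => h; split=> //.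
  by apply: le_trans h; rewrite lerDl mulr_ge0// exprn_ge0// addr_ge0.
have pw x i : `|x| <= s^-1 -> w x * (1 + `|x|) ^+ (2 * N + 5) <= D /\ `|partial i w x| * (1 + `|x|) ^+ (2 * N + 5) <= D.
  move=> xs; have := hD T Q w tw x i (le_trans xs sT); rewrite mulrDl => h; split; apply: le_trans h.
    by rewrite lerDl mulr_ge0// exprn_ge0// addr_ge0.
  by rewrite lerDr mulr_ge0 ?(ltW (w0 x))// exprn_ge0// addr_ge0.
have q3 x : 0 <= (1 + `|x|) ^+ (2 * N + 3) by rewrite exprn_ge0// addr_ge0.
have q35 x : (1 + `|x|) ^+ (2 * N + 3) <= (1 + `|x|) ^+ (2 * N + 5).
  by apply: ler_weXn2l; rewrite ?lerDl// leq_add2l.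
have q2 x : (1 + `|x|) ^+ (2 * N + 3) * (1 + `|x|) ^+ 2 = (1 + `|x|) ^+ (2 * N + 5) by rewrite -exprD -addnA.
have r1 : `|\int[mu]_x ((v x ^+ 2 - w x ^+ 2) * partial j (bump4 s) x)| <= C1 * s ^+ 4 * (2 * D * S).
  apply: h1 => //; first exact: continuous_sub; first by rewrite !mulr_ge0.
  move=> x xs; have [b1 _] := pv x j xs; have [b2 _] := pw x j xs.
  have -> : v x ^+ 2 - w x ^+ 2 = (v x - w x) * (v x + w x) by ring.
  rewrite normrM [`|v x + w x|]gtr0_norm ?addr_gt0//.
  have b3 : (v x + w x) * (1 + `|x|) ^+ (2 * N + 3) <= 2 * D.
    have := ler_wpM2l (ltW (v0 x)) (q35 x); have := ler_wpM2l (ltW (w0 x)) (q35 x); rewrite mulrDl; clra.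
  have b4 : 0 <= (v x + w x) * (1 + `|x|) ^+ (2 * N + 3) by rewrite mulr_ge0// addr_ge0// ltW.
  have := ler_pM (normr_ge0 _) b4 (vw x) b3; rewrite mulrA [S * _]mulrC.
  by apply.
have r2 : `|\int[mu]_x ((partial j v x - partial j w x) * cutoff_flux (bump4 s) v x)| <= C2 * s ^+ 4 * (G * D * S).
  apply: h2 => //; first exact: continuous_sub; first by rewrite !mulr_ge0.
  move=> x i xs; have [_ b1] := pv x i xs; have b2 := hG T S Q v w tv tw vw x j.
  rewrite -mulrDl -(q2 x) in b1.
  have := ler_wpM2r (mulr_ge0 (addr_ge0 (normr_ge0 (v x)) (normr_ge0 (partial i v x))) (q3 x)) b2.
  rewrite !mulrA => h; apply: (le_trans h).
  have := ler_wpM2l (mulr_ge0 G0 S0) b1; clra.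
have r3 : `|\int[mu]_x (partial j w x * cutoff_flux (bump4 s) (fun x => v x - w x) x)| <= C2 * s ^+ 4 * (D * (1 + G) * S).
  apply: h2 => //; first by rewrite !mulr_ge0// addr_ge0.
  move=> x i xs; have [_ b1] := pw x j xs; have b2 := hG T S Q v w tv tw vw x i.
  rewrite pd; have p1 : 1 <= (1 + `|x|) ^+ 2 by rewrite exprn_ege1// lerDl.
  have b3 : `|v x - w x| + `|partial i v x - partial i w x| <= (1 + G) * S * (1 + `|x|) ^+ 2.
    have -> : (1 + G) * S * (1 + `|x|) ^+ 2 = S * (1 + `|x|) ^+ 2 + G * S * (1 + `|x|) ^+ 2 by ring.
    by apply: lerD => //; apply: (le_trans (vw x)); rewrite ler_peMr.
  rewrite -(q2 x) in b1.
  have b4 := ler_wpM2l (mulr_ge0 (normr_ge0 (partial j w x)) (q3 x)) b3.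
  have b5 := ler_wpM2l (mulr_ge0 (addr_ge0 (ler01) G0) S0) b1.
  clra.
apply: (le_trans (ler_normD _ _)); rewrite normrN.
have := ler_normD (\int[mu]_x ((partial j v x - partial j w x) * cutoff_flux (bump4 s) v x))
  (\int[mu]_x (partial j w x * cutoff_flux (bump4 s) (fun x => v x - w x) x)).
have -> : (C1 * (2 * D) + C2 * (G * D) + C2 * (D * (1 + G))) * s ^+ 4 * S =
  C1 * s ^+ 4 * (2 * D * S) + C2 * s ^+ 4 * (G * D * S) + C2 * s ^+ 4 * (D * (1 + G) * S) by ring.
clra.
Qed.

End pohozaev_estimates.

Lemma near_right_ratio (R : realType) (F : set_system R) (b X : R) : Filter F -> (0 : R)^'+ `<=` F ->
  0 < b -> \forall t \near F, X <= b / t.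
Proof.
move=> FF F0 b0; have e0 : 0 < b / (`|X| + 1) by rewrite divr_gt0// ltr_wpDl.
have tpos : \forall t \near F, 0 < t by apply: F0; exact: nbhs_right_gt.
have tle : \forall t \near F, t <= b / (`|X| + 1) by apply: F0; exact: nbhs_right_le.
apply: filterS (filterI tpos tle) => t [t0 te].
rewrite ler_pdivlMr//; apply: (le_trans (ler_wpM2r (ltW t0) (ler_norm X))).
move: te; rewrite ler_pdivlMr ?ltr_wpDl// mulrC; have := ltW t0; clra.
Qed.

Lemma cvg_right_id (R : realType) (F : set_system R) : Filter F -> (0 : R)^'+ `<=` F -> t @[t --> F] --> (0 : R).
Proof.
move=> FF F0; apply/cvgrPdist_le => e e0.
have tpos : \forall t \near F, 0 < t by apply: F0; exact: nbhs_right_gt.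
have tle : \forall t \near F, t <= e by apply: F0; exact: nbhs_right_le.
by apply: filterS (filterI tpos tle) => t [t0 te]; rewrite sub0r normrN gtr0_norm.
Qed.

(** * The peaks lie within o(eps) of the concentration points *)

Section centering.
Context {R : realType} {N : nat}.
Local Notation mu := (lebesgue_row R N).
Implicit Types (x y z : 'rV[R]_N) (f g u v Q V : 'rV[R]_N -> R).
Local Notation e_ i := (delta_mx ord0 i : 'rV[R]_N).

Lemma tame_weaken (L M A B K T L' M' A' B' K' T' : R) Q v : L <= L' -> M <= M' -> A <= A' -> B <= B' -> K <= K' ->
  T' <= T -> tame L M A B K T Q v -> tame L' M' A' B' K' T' Q v.
Proof.
move=> LL MM AA BB KK TT [Q1 Qv wv QL vM vG vK]; split=> //.
- by move=> x; have /andP[-> /= QLx] := QL x; exact: le_trans LL.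
- by move=> x; exact: le_trans MM.
- move=> x; apply: le_trans (vG x); rewrite /gauss ler_expR lerN2 lerD// ler_wpM2r//; exact: dot_ge0.
- move=> x xT; apply: (le_trans (vK x (le_trans xT TT))).
  by rewrite ler_wpM2r// expR_ge0.
Qed.

Lemma is_derive_potential_scaled V (p : 'rV[R]_N) (t : R) j x : class_C 1 V -> t != 0 ->
  is_derive x (e_ j) (fun z => V (p + t *: z)) (t * partial j V (p + t *: x)).
Proof.
move=> V1 t0; have E z : t *: (z - - (t^-1 *: p)) = p + t *: z.
  by rewrite opprK scalerDr scalerA divff// scale1r addrC.
have := @is_derive_affine _ _ V t (partial j V (p + t *: x)) (- (t^-1 *: p)) x (e_ j).
rewrite E (_ : (fun z => V (t *: _)) = (fun z => V (p + t *: z))); last by apply/funext => z; rewrite E.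
by apply; exact: (class_C_is_derive j _ V1).
Qed.

Lemma continuous_mulmx_coord (H : 'M[R]_N) j : continuous (fun x : 'rV[R]_N => (x *m H) ord0 j).
Proof.
have : class_C 0 (fun x : 'rV[R]_N => \sum_k x ord0 k * H k j).
  by apply: class_C_sum => k; apply: class_C_mul; [exact: class_C_coord|exact: class_C_cst].
rewrite (_ : (fun x : 'rV[R]_N => \sum_k x ord0 k * H k j) = (fun x => (x *m H) ord0 j)); last first.
  by apply/funext => x; rewrite mxE.
exact: class_C_continuous.
Qed.

Lemma gauss_lower_cube (A B : R) x : 0 <= A -> `|x| <= 1 -> expR (- (A * N%:R + B)) <= gauss A B x.
Proof.
move=> A0 x1; rewrite /gauss ler_expR lerN2 lerD2r ler_wpM2l//.
apply: (le_trans (dot_le_sqr_norm x)); rewrite -[leRHS]mulr1 ler_wpM2l// -[leRHS](expr1n _ 2).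
by rewrite lerXn2r ?nnegrE.
Qed.

(* The Pohozaev identity balances [H (xi - p) / t] against second-order errors. *)
Lemma center_estimate (L M A B K : R) (H : 'M[R]_N) : (0 < N)%N -> 0 <= L -> 1 <= M -> 0 <= A -> 0 <= K ->
  exists2 C : R, 0 <= C & exists2 s0 : R, 0 < s0 & forall (t rho eta T : R) V (xi p : 'rV[R]_N) v (E : 'rV[R]_N -> R),
  0 < t -> 0 < rho -> 0 < eta -> class_C 1 V -> tame L M A B K T (fun x => V (p + t *: x)) v ->
  rho / t <= T - 4 -> t / rho <= s0 ->
  (forall h j, `|h| <= 2 * rho -> `|partial j V (xi + h) - (h *m H) ord0 j| <= eta * `|h|) ->
  `|p - xi| <= rho -> continuous E -> (forall x, E (- x) = E x) ->
  (forall x, `|x| <= rho / t -> `|v x ^+ 2 - E x| * (1 + `|x|) ^+ (2 * N + 1) <= eta) ->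
  t ^+ 2 / rho ^+ 4 <= eta ->
  `|t^-1 *: (xi - p) *m H| <= C * eta * (1 + `|t^-1 *: (xi - p)|).
Proof.
move=> N0 L0 M1 A0 K0.
have [C1 C10 h1] := @bump4_mass R N N0.
have [C2 C20 h2] := @pohozaev_tame R N L M A B K N0 L0 M1 A0 K0.
have [D D0 hD] := @tame_pointwise R N L M A B K (2 * N + 1) L0 M1 A0 K0.
have [CH CH0 hH] := mulmx_norm_le H.
have [s0 s00 hs] := @bump4_at0 R N 1.
pose g0 := expR (- (A * N%:R + B)); have g00 : 0 < g0 by exact: expR_gt0.
pose m0 := expR (-2) * g0 ^+ 2 * (1 *+ 2) ^+ N.
have m00 : 0 < m0 by rewrite mulr_gt0 ?exprn_gt0// mulr_gt0 ?expR_gt0// exprn_gt0.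
have D20 : 0 <= D ^+ 2 by rewrite exprn_ge0.
exists ((C1 * (CH + D ^+ 2) + C2) / m0).
  by rewrite divr_ge0 ?(ltW m00)// addr_ge0// mulr_ge0// addr_ge0.
exists s0 => // t rho eta T V xi p v E t0 rho0 eta0 V1 tv rT ts hV pxi cE Eeven vE tr.
have [Q1 Qv _ QL vM vG vK] := tv; have [cv v0 vD] := Qv.
(* The cutoff of scale $s$ is supported in $|x|\le\rho/t$, that is, within distance $\rho$ of [p] in
   the original variables. *)
pose s := t / rho; have s_gt0 : 0 < s by rewrite divr_gt0.
have sV : s^-1 = rho / t by rewrite /s invf_div.
set d := t^-1 *: (xi - p).
have cv2 := continuous_sqr cv.
have cP j : continuous (fun x => partial j V (p + t *: x)).
  by apply: continuous_comp_line; exact: (class_C_continuous (class_C_partial j V1)).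
have t0' : t != 0 by rewrite gt_eqF.
have dQ j x : partial j (fun x => V (p + t *: x)) x = t * partial j V (p + t *: x).
  exact: partialE (is_derive_potential_scaled p j x V1 t0').
pose h j (z : 'rV[R]_N) := (z *m H) ord0 j.
have ch j : continuous (h j) by exact: continuous_mulmx_coord.
pose I (f : 'rV[R]_N -> R) := bump_mean s f.
(* A lower bound for the cut-off mass, uniform by the Gaussian bound on the unit cube; it is the
   coefficient of the unknown [h j d] below. *)
have Iv : m0 <= I (fun x => v x ^+ 2).
  apply: (@bump4_lower R N _ s 1 (g0 ^+ 2) 0) => //.
  - by rewrite exprn_ge0// ltW.
  - by move=> x; exact: sqr_ge0.
  - move=> x; rewrite subr0 => x1; split; last exact: hs.
    rewrite lerXn2r ?nnegrE ?(ltW g00) ?(ltW (v0 x))//; apply: le_trans (vG x); exact: gauss_lower_cube.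
pose err j x := partial j V (p + t *: x) - h j (t *: (x - d)).
have pd x : p + t *: x = xi + t *: (x - d).
  by rewrite /d scalerBr scalerA divff// scale1r; apply/rowP => i; rewrite !mxE; ring.
have errE j x : `|x| <= rho / t -> `|err j x| <= eta * (t * (`|x| + `|d|)).
  move=> xr; have tx : `|t *: x| <= rho by rewrite normrZ gtr0_norm// mulrC -ler_pdivlMr.
  have td : `|t *: d| <= rho by rewrite /d scalerA divff// scale1r distrC.
  have h3 : `|t *: (x - d)| <= 2 * rho by rewrite scalerBr; apply: (le_trans (ler_normB _ _)); clra.
  rewrite /err pd; apply: (le_trans (hV _ j h3)); rewrite ler_wpM2l ?(ltW eta0)//.
  by rewrite normrZ gtr0_norm// ler_wpM2l ?(ltW t0)// ler_normB.
have cerr j : continuous (err j).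
  apply: continuous_sub => //; have := continuousT_comp (@continuous_affine R N t d) (ch j).
  by [].
have key j : `|h j d| * m0 <= (C1 * (CH + D ^+ 2) + C2) * eta * (1 + `|d|).
  pose f1 x := h j x * (v x ^+ 2 - E x) + t^-1 * (err j x * v x ^+ 2).
  have cf1 : continuous f1.
    apply: continuous_add; first by apply: continuous_mul => //; exact: continuous_sub.
    by apply: continuous_mul; [exact: cst_continuous|exact: continuous_mul].
  have cf2 : continuous (fun x => h j x * E x) by exact: continuous_mul.
  have cf3 : continuous (fun x => partial j (fun x => V (p + t *: x)) x * v x ^+ 2).
    by apply: continuous_mul => //; exact: (class_C_continuous (class_C_partial j Q1)).
  have lin a b : h j (a *: b) = a * h j b by rewrite /h -scalemxAl mxE.
  have linB a b : h j (a - b) = h j a - h j b by rewrite /h mulmxBl !mxE.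
  (* From $h(d)=h(x)-h(x-d)$, with $t\,h(x-d)$ replaced by $\partial_jV(p+tx)$ up to [err]. One
     power of $t$ comes from this scaling and a second one from the chain rule, whence $t^{-2}$. *)
  have E1 : h j d * I (fun x => v x ^+ 2) = I f1 + I (fun x => h j x * E x) +
      - (t ^- 2) * I (fun x => partial j (fun x => V (p + t *: x)) x * v x ^+ 2).
    rewrite /I -!bump_meanZ// -bump_meanD// -bump_meanD//; last 2 first.
    - exact: continuous_add.
    - by apply: continuous_mul => //; exact: cst_continuous.
    apply: eq_bump_mean => x; rewrite dQ /f1 /err lin linB; field; exact: t0'.
  (* The main part of $h(x)v^2$ is odd because the limit profile is even; only its distance to that
     profile contributes. *)
  have I2 : I (fun x => h j x * E x) = 0.
    by apply: bump_mean_odd => // x; rewrite Eeven /h mulNmx mxE mulNr.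
  rewrite I2 addr0 in E1.
  have b1 : `|I f1| <= C1 * ((CH + D ^+ 2) * eta * (1 + `|d|)).
    apply: h1 => //; first by rewrite !mulr_ge0 ?(ltW eta0)// addr_ge0.
    rewrite sV => x xr; have x0 := normr_ge0 x; have d0 := normr_ge0 d.
    have p0 : 0 <= (1 + `|x|) ^+ (2 * N) by rewrite exprn_ge0// addr_ge0.
    have e1 := vE x xr; rewrite exprD expr1 in e1.
    have hx : `|h j x| <= CH * `|x| by apply: le_trans (hH x); exact: coord_le_norm.
    have v1 : v x * (1 + `|x|) ^+ (2 * N + 1) <= D.
      apply: le_trans (hD T _ v tv x j (le_trans xr rT)).
      by rewrite ler_wpM2r ?lerDl// exprn_ge0// addr_ge0.
    have v2 : v x ^+ 2 * (1 + `|x|) ^+ (2 * N + 1) <= D ^+ 2.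
      have q1 : 1 <= (1 + `|x|) ^+ (2 * N + 1) by rewrite exprn_ege1// lerDl.
      have vD' : v x <= D by apply: le_trans v1; rewrite ler_peMr// ltW.
      rewrite expr2 -mulrA expr2; apply: ler_pM => //; first exact: ltW.
      by rewrite mulr_ge0 ?(ltW (v0 x))//; exact: le_trans q1.
    have a1 : `|h j x * (v x ^+ 2 - E x)| * (1 + `|x|) ^+ (2 * N) <= CH * eta.
      rewrite normrM -mulrA; apply: (le_trans (ler_wpM2r _ hx)); first by rewrite mulr_ge0.
      rewrite -mulrA ler_wpM2l//; apply: le_trans e1.
      rewrite mulrCA; apply: ler_wpM2l => //; rewrite [leRHS]mulrC ler_wpM2r//; clra.
    have a2 : `|t^-1 * (err j x * v x ^+ 2)| * (1 + `|x|) ^+ (2 * N) <= D ^+ 2 * eta * (1 + `|d|).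
      rewrite normrM gtr0_norm ?invr_gt0// normrM (ger0_norm (sqr_ge0 _)).
      have vp : 0 <= v x ^+ 2 * (1 + `|x|) ^+ (2 * N) by rewrite mulr_ge0// sqr_ge0.
      apply: (le_trans (_ : _ <= t^-1 * (eta * (t * (`|x| + `|d|))) * (v x ^+ 2 * (1 + `|x|) ^+ (2 * N)))).
        rewrite -!mulrA ler_wpM2l ?invr_ge0 ?(ltW t0)// !mulrA.
        have := ler_wpM2r vp (errE j x xr); rewrite !mulrA; exact.
      have -> : t^-1 * (eta * (t * (`|x| + `|d|))) = eta * (`|x| + `|d|) by field.
      rewrite exprD expr1 mulrA in v2.
      have xd : `|x| + `|d| <= (1 + `|x|) * (1 + `|d|) by cnra.
      have := ler_wpM2l (ltW eta0) (ler_wpM2r vp xd); rewrite !mulrA => k1; apply: (le_trans k1).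
      have := ler_wpM2l (mulr_ge0 (ltW eta0) (addr_ge0 ler01 d0)) v2; clra.
    rewrite /f1; apply: (le_trans (ler_wpM2r p0 (ler_normD _ _))); rewrite mulrDl.
    have a3 : CH * eta <= CH * eta * (1 + `|d|) by rewrite ler_peMr ?lerDl// mulr_ge0// ltW.
    rewrite (_ : (CH + D ^+ 2) * eta * (1 + `|d|) = CH * eta * (1 + `|d|) + D ^+ 2 * eta * (1 + `|d|)); last by ring.
    exact: lerD (le_trans a1 a3) a2.
  (* Here the fourth power in the cutoff estimate is used: $t^{-2}s^4=t^2/\rho^4$ is still small. *)
  have b2 : `|- (t ^- 2) * I (fun x => partial j (fun x => V (p + t *: x)) x * v x ^+ 2)| <= C2 * eta.
    rewrite normrM normrN [`|t ^- 2|]gtr0_norm ?invr_gt0 ?exprn_gt0//.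
    have := h2 s T _ v j s_gt0 _ tv; rewrite sV => /(_ rT) k1.
    apply: (le_trans (ler_wpM2l _ k1)); first by rewrite invr_ge0 exprn_ge0// ltW.
    have -> : t ^- 2 * (C2 * s ^+ 4) = C2 * (t ^+ 2 / rho ^+ 4).
      by rewrite /s; field; rewrite t0' gt_eqF.
    by rewrite ler_wpM2l.
  have b3 : `|h j d| * m0 <= `|h j d * I (fun x => v x ^+ 2)|.
    by rewrite normrM ler_wpM2l// (le_trans Iv)// ler_norm.
  apply: (le_trans b3); rewrite E1; apply: (le_trans (ler_normD _ _)).
  have : C2 * eta <= C2 * eta * (1 + `|d|) by rewrite ler_peMr ?lerDl// mulr_ge0// ltW.
  have -> : (C1 * (CH + D ^+ 2) + C2) * eta * (1 + `|d|) = C1 * ((CH + D ^+ 2) * eta * (1 + `|d|)) + C2 * eta * (1 + `|d|) by ring.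
  clra.
apply/normrv_leP.
  by rewrite mulr_ge0 ?addr_ge0// mulr_ge0 ?(ltW eta0)// divr_ge0 ?(ltW m00)// addr_ge0// mulr_ge0// addr_ge0.
move=> j; have := key j; rewrite -ler_pdivlMr// => k; apply: (le_trans k).
by rewrite le_eqVlt; apply/orP; left; apply/eqP; field; rewrite gt_eqF.
Qed.

Lemma peak_center (L M A K c : R) V (xi : 'rV[R]_N) (F : set_system R) (y : R -> 'rV[R]_N) (u : R -> 'rV[R]_N -> R) :
  (0 < N)%N -> UltraFilter F -> (0 : R)^'+ `<=` F -> 0 <= L -> 1 <= M -> 0 < A -> 0 <= K -> 0 < c ->
  class_C 1 V -> grad V xi = 0 -> differentiable (grad V) xi -> \det (hessian V xi) != 0 ->
  y t @[t --> F] --> xi ->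
  (\forall t \near F, tame L M A 1 K (c / t) (fun x => V (y t + t *: x)) (fun x => u t (y t + t *: x))) ->
  exists A' B' K' c' D : R, [/\ [/\ 0 < A', 0 <= K' & 0 < c'],
    \forall t \near F, tame L M A' B' K' (c' / t) (fun x => V (xi + t *: x)) (fun x => u t (xi + t *: x)),
    ccvg F (fun t x => u t (xi + t *: x)) (gauss 2^-1 (- (V xi + N%:R) / 2)) &
    \forall t \near F, `|y t - xi| <= D * t].
Proof.
move=> N0 FU F0 L0 M1 A0 K0 c0 V1 gV dV detV yxi tn.
have PF : ProperFilter F by exact: ultra_proper.
have cV := class_C_continuous V1.
have tpos : \forall t \near F, 0 < t by apply: F0; exact: nbhs_right_gt.
have tsmall (e : R) : 0 < e -> \forall t \near F, t <= e by move=> e0; apply: F0; exact: nbhs_right_le.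
have t_to0 : t @[t --> F] --> (0 : R) by exact: cvg_right_id.
have Too (b X : R) : 0 < b -> \forall t \near F, X <= b / t by exact: near_right_ratio.
have QV : ccvg F (fun t x => V (y t + t *: x)) (fun=> V xi).
  move=> z x zx; have h : y t + t *: z t @[t --> F] --> xi.
    by rewrite -[X in _ --> X]addr0 -(scale0r x); apply: cvgD => //; apply: cvgZ.
  exact: (cvg_comp (fun t => y t + t *: z t) V h (cV xi)).
have [a va] := tame_limit FU L0 M1 A0 K0 tn (fun X => Too c X c0) QV.
set B0 := - (V xi + N%:R) / 2 in va *.
(* The centre of the limiting Gaussian, in the original variables. *)
pose p t := y t + t *: a.
have pxi : p t @[t --> F] --> xi.
  by rewrite -[X in _ --> X]addr0 -(scale0r a); apply: cvgD => //; apply: cvgZ => //; exact: cvg_cst.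
pose A1 := 2 * A; pose B1 := 1 + 2 * A * (N%:R * `|a| ^+ 2); pose K1 := K * expR (2^-1 * `|a|).
have A10 : 0 < A1 by rewrite mulr_gt0.
have K10 : 0 <= K1 by rewrite mulr_ge0// expR_ge0.
have E1 (f : 'rV[R]_N -> R) t : (fun x => f (y t + t *: (x + a))) = (fun x => f (p t + t *: x)).
  by apply/funext => x; rewrite /p scalerDr [t *: x + _]addrC addrA.
have tn1 : \forall t \near F, tame L M A1 B1 K1 (c / t - `|a|) (fun x => V (p t + t *: x)) (fun x => u t (p t + t *: x)).
  apply: filterS tn => t /(tame_translate (ltW A0) K0 (lexx `|a|)).
  by rewrite !E1.
pose E x := gauss 2^-1 B0 x : R.
have vE : ccvg F (fun t x => u t (p t + t *: x)) E.
  move=> z x zx; have zx' : z t + a @[t --> F] --> x + a by apply: cvgD => //; exact: cvg_cst.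
  have := va _ _ zx'; rewrite addrK (_ : (fun t => u t (y t + t *: (z t + a))) = (fun t => u t (p t + t *: z t)))//.
  by apply/funext => t; rewrite /p scalerDr [t *: z t + _]addrC addrA.
have cE : continuous E by exact: continuous_gauss.
pose H := hessian V xi.
have [C C0 [s0 s00 hC]] := @center_estimate L M A1 B1 K1 H N0 L0 M1 (ltW A10) K10.
have [Ci Ci0 hCi] := mulmx_norm_le (invmx H).
have Hu : H \in unitmx by rewrite unitmxE unitfE.
have [D D0 hD] := @tame_pointwise R N L M A1 B1 K1 (2 * N + 2) L0 M1 (ltW A10) K10.
pose d t := t^-1 *: (xi - p t).
have sq t x : tame L M A1 B1 K1 (c / t - `|a|) (fun x => V (p t + t *: x)) (fun x => u t (p t + t *: x)) ->
    `|x| <= c / t - `|a| - 4 -> `|u t (p t + t *: x) ^+ 2| * (1 + `|x|) ^+ (2 * N + 1).+1 <= D ^+ 2.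
  move=> tv xT; have -> : (2 * N + 1).+1 = (2 * N + 2)%N by rewrite addn1 addn2.
  have q1 : 1 <= (1 + `|x|) ^+ (2 * N + 2) by rewrite exprn_ege1// lerDl.
  have v0 : 0 < u t (p t + t *: x) by have [_ [_ h _] _ _ _ _ _] := tv; exact: h.
  have v1 : u t (p t + t *: x) * (1 + `|x|) ^+ (2 * N + 2) <= D.
    have := hD _ _ _ tv x (Ordinal N0) xT; apply: le_trans.
    by rewrite ler_wpM2r ?lerDl//; exact: le_trans q1.
  have vD : u t (p t + t *: x) <= D by apply: le_trans v1; rewrite ler_peMr// ltW.
  rewrite ger0_norm ?sqr_ge0// expr2 -mulrA expr2; apply: ler_pM => //; first exact: ltW.
  by rewrite mulr_ge0 ?(ltW v0)//; exact: le_trans q1.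
have vE2 : ccvg F (fun t x => u t (p t + t *: x) ^+ 2) (fun x => E x ^+ 2).
  move=> z x zx; have := vE z x zx => h; rewrite expr2; under eq_fun do rewrite expr2.
  exact: cvgM.
have big X : \forall t \near F, X <= c / t - `|a| - 4.
  by apply: filterS (Too c (X + `|a| + 4) c0) => t; clra.
have EB x : `|E x ^+ 2| * (1 + `|x|) ^+ (2 * N + 1).+1 <= D ^+ 2.
  have l0 : u t (p t + t *: x) ^+ 2 @[t --> F] --> E x ^+ 2 by apply: vE2; exact: cvg_cst.
  have l : `|u t (p t + t *: x) ^+ 2| * (1 + `|x|) ^+ (2 * N + 1).+1 @[t --> F] --> `|E x ^+ 2| * (1 + `|x|) ^+ (2 * N + 1).+1.
    by apply: cvgM; [exact: cvg_norm|exact: cvg_cst].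
  by apply: (cvg_limit_le l); apply: filterS (filterI tn1 (big `|x|)) => t [h1 h2]; exact: sq.
have cE2 : continuous (fun x => E x ^+ 2) by exact: continuous_sqr.
have wu (e : R) : 0 < e -> \forall t \near F, forall x, `|x| <= c / t - `|a| - 4 ->
    `|u t (p t + t *: x) ^+ 2 - E x ^+ 2| * (1 + `|x|) ^+ (2 * N + 1) <= e.
  move=> e0; have D20 : 0 <= D ^+ 2 by rewrite exprn_ge0.
  apply: (@weighted_unif R N R F FU _ _ (fun t => c / t - `|a| - 4) (2 * N + 1) (D ^+ 2) (ccvg_loc_unif FU cE2 vE2) D20 _ EB e e0).
  by apply: filterS tn1 => t h x; exact: sq.
have d0 : d t @[t --> F] --> (0 : 'rV[R]_N).
  apply/cvgrPdist_le => e' e'0.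
  (* The estimate will read $|d|\le\frac e2(1+|d|)$; with $e\le1$ the term in $|d|$ is absorbed and
     $|d|\le e$ follows. *)
  pose e : R := Num.min (e' : R) 1; have e0 : 0 < e by rewrite /e lt_min (e'0 : 0 < e' :> R) ltr01.
  pose eta := e / (2 * (Ci * C + 1)).
  have CC : 0 <= Ci * C by exact: mulr_ge0.
  have eta0 : 0 < eta by rewrite divr_gt0//; clra.
  have [r r0 hr] := hessian_expansion gV dV eta0.
  pose rho := Num.min (r / 2) (c / 2).
  have rho0 : 0 < rho by rewrite lt_min !divr_gt0.
  have rho_r2 : rho <= r / 2 by rewrite ge_min lexx.
  have rho_r : 2 * rho <= r by clra.
  have rho_c : rho <= c / 2 by rewrite ge_min lexx orbT.
  have near_p : \forall t \near F, `|p t - xi| <= rho.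
    have /cvgrPdist_le/(_ _ rho0) := pxi; by apply: filterS => t; rewrite distrC.
  have near1 : \forall t \near F, t <= s0 * rho by apply: tsmall; exact: mulr_gt0.
  have near2 : \forall t \near F, t <= Num.min 1 (eta * rho ^+ 4).
    by apply: tsmall; rewrite lt_min ltr01 mulr_gt0// exprn_gt0.
  have c2 : 0 < c / 2 by rewrite divr_gt0.
  apply: filterS (filterI (filterI (filterI tn1 (wu eta eta0)) (filterI near_p near1)) (filterI (filterI near2 tpos) (Too (c / 2) (`|a| + 4) c2))).
  move=> t [[[tv tw] [tp t1]] [[t2 t0] tT]].
  move: t2; rewrite le_min => /andP[t21 t22].
  have rT : rho / t <= c / t - `|a| - 4.
    have : rho / t <= c / 2 / t by rewrite ler_wpM2r// invr_ge0 ltW.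
    have : c / t = c / 2 / t + c / 2 / t by field; rewrite gt_eqF.
    clra.
  have := hC t rho eta _ V xi (p t) _ (fun x => E x ^+ 2) t0 rho0 eta0 V1 tv rT.
  rewrite ler_pdivrMr// => /(_ t1 (fun h j hh => hr h j (le_trans hh rho_r)) tp cE2) => h.
  have {}h : `|d t *m H| <= C * eta * (1 + `|d t|).
    apply: h.
    - by move=> x; rewrite /E gauss_even.
    - by move=> x xr; apply: tw; exact: le_trans rT.
    - rewrite ler_pdivrMr ?exprn_gt0//; apply: le_trans t22.
      by rewrite expr2 ler_piMr// ltW.
  rewrite sub0r normrN; have dd : `|d t| <= Ci * (C * eta * (1 + `|d t|)).
    rewrite -[X in `|X| <= _](mulmxK Hu); apply: (le_trans (hCi _)).
    by rewrite ler_wpM2l.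
  have k1 : Ci * C * eta <= e / 2.
    rewrite /eta mulrA ler_pdivrMr; last by clra.
    by have := ltW e0; cnra.
  have n0 := normr_ge0 (d t).
  have k2 : `|d t| <= e / 2 * (1 + `|d t|).
    apply: (le_trans dd); have -> : Ci * (C * eta * (1 + `|d t|)) = Ci * C * eta * (1 + `|d t|) by ring.
    by rewrite ler_wpM2r// addr_ge0.
  have e1 : e <= 1 by rewrite ge_min lexx orbT.
  have ee : e <= e' by rewrite ge_min lexx.
  apply: le_trans ee; cnra.
have dle1 : \forall t \near F, `|d t| <= 1.
  by have /cvgrPdist_le/(_ _ ltr01) := d0; apply: filterS => t; rewrite sub0r normrN.
have E2 (f : 'rV[R]_N -> R) t : 0 < t -> (fun x => f (p t + t *: (x + d t))) = (fun x => f (xi + t *: x)).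
  move=> t0; apply/funext => x; congr f; rewrite /d scalerDr scalerA divff ?gt_eqF// scale1r.
  by apply/rowP => i; rewrite !mxE; ring.
exists (2 * A1), (B1 + 2 * A1 * (N%:R * 1 ^+ 2)), (K1 * expR (2^-1 * 1)), (c / 2), (1 + `|a|); split.
- by split; rewrite ?mulr_gt0 ?divr_gt0// mulr_ge0// expR_ge0.
- have c2 : 0 < c / 2 by rewrite divr_gt0.
  apply: filterS (filterI (filterI tn1 dle1) (filterI tpos (Too (c / 2) (`|a| + 1) c2))) => t [[tv d1] [t0 tT]].
  have := tame_translate (ltW A10) K10 d1 tv; rewrite (E2 V t t0) (E2 (u t) t t0); apply: tame_weaken => //.
  have : c / t = c / 2 / t + c / 2 / t by field; rewrite gt_eqF.
  clra.
- move=> z x zx; have zx' : z t + d t @[t --> F] --> x.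
    by rewrite -[X in _ --> X]addr0; apply: cvgD.
  have := vE _ _ zx'; apply: cvg_trans; apply: near_eq_cvg; apply: filterS tpos => t t0.
  by have := congr1 (fun f => f (z t)) (E2 (u t) t t0).
- apply: filterS (filterI dle1 tpos) => t [d1 t0].
  have -> : y t - xi = - (t *: d t) - t *: a.
    rewrite /d scalerA divff ?gt_eqF// scale1r /p; apply/rowP => i; rewrite !mxE; ring.
  apply: (le_trans (ler_normB _ _)); rewrite normrN [`|t *: d t|]normrZ [`|t *: a|]normrZ (gtr0_norm t0).
  by rewrite mulrDl mul1r [`|a| * t]mulrC lerD2r ler_piMr// ltW.
Qed.

End centering.

(** * The normalised difference of two solutions *)

Section difference.
Context {R : realType} {N : nat}.
Local Notation mu := (lebesgue_row R N).
Implicit Types (x y z : 'rV[R]_N) (f g u v Q V : 'rV[R]_N -> R).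

Lemma continuous_dotr (b : 'rV[R]_N) : continuous (fun x : 'rV[R]_N => dot b x).
Proof.
have : class_C 0 (fun x : 'rV[R]_N => \sum_k b ord0 k * x ord0 k).
  by apply: class_C_sum => k; apply: class_C_mul; [exact: class_C_cst|exact: class_C_coord].
exact: class_C_continuous.
Qed.

Lemma bump_mean_sum (I : Type) (r : seq I) (s : R) (f : I -> 'rV[R]_N -> R) : 0 < s -> (forall i, continuous (f i)) ->
  bump_mean s (fun x => \sum_(i <- r) f i x) = \sum_(i <- r) bump_mean s (f i).
Proof.
move=> s0 cf; have [_ <-] := Rintegral_sum r (fun i => bump_mean_integrable s0 (cf i)).
by apply: eq_Rintegral => x _; rewrite mulr_sumr.
Qed.

(** The quotient by [S t] is bounded by 1, so [ascoli] provides a limit. The nonlinear remainder is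
    at most $|v-w|^2/v\le S|v-w|/v$; after division by [S t] it vanishes, since [v] and [w] have the
    same positive limit. What survives is the equation of [linear_profile]. *)
Lemma difference_limit (T : Type) (F : set_system T) (L M A B K V0 B0 : R) (Tn S : T -> R) (Q v w : T -> 'rV[R]_N -> R) :
  UltraFilter F -> 0 <= L -> 1 <= M -> 0 <= A ->
  (\forall t \near F, [/\ tame L M A B K (Tn t) (Q t) (v t), tame L M A B K (Tn t) (Q t) (w t), 0 < S t &
     forall x, `|v t x - w t x| <= S t]) ->
  ccvg F Q (fun=> V0) -> B0 = - (V0 + N%:R) / 2 -> ccvg F v (gauss 2^-1 B0) -> ccvg F w (gauss 2^-1 B0) ->
  exists b, ccvg F (fun t x => (S t)^-1 * (v t x - w t x)) (fun x => dot b x * gauss 2^-1 0 x).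
Proof.
move=> FU L0 M1 A0 tn QV B0E vU wU; have PF : ProperFilter F by exact: ultra_proper.
have [C C0 hC] := @DLap_lipschitz R N.
have [D D0 hD] := @tame_diff_rhs R N L M A B K L0 M1 A0.
pose W t x := (S t)^-1 * (v t x - w t x).
pose rhs (q f : 'rV[R]_N -> R) x := (q x - ln (f x ^+ 2)) * f x.
pose g t x := (S t)^-1 * (rhs (Q t) (v t) x - rhs (Q t) (w t) x).
have Wg : \forall t \near F, [/\ continuous (W t), continuous (g t) & DLap (W t) (g t)].
  apply: filterS tn => t [[Q1 [cv v0 vD] _ _ _ _ _] [_ [cw w0 wD] _ _ _ _ _] _ _].
  have cQ := class_C_continuous Q1.
  have cgv := continuous_potential cQ cv v0; have cgw := continuous_potential cQ cw w0.
  split.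
  - by apply: continuous_mul; [exact: cst_continuous|exact: continuous_sub].
  - by apply: continuous_mul; [exact: cst_continuous|exact: continuous_sub].
  - by apply: DLap_scale; [exact: continuous_sub|exact: continuous_sub|exact: DLap_sub].
have W1 : \forall t \near F, forall x, `|W t x| <= 1.
  apply: filterS tn => t [_ _ S0 vw] x; rewrite /W normrM gtr0_norm ?invr_gt0// mulrC.
  by rewrite ler_pdivrMr// mul1r.
have gB : \forall t \near F, forall x, `|g t x| <= D * (1 + `|x|) ^+ 2.
  apply: filterS tn => t [tv tw S0 vw] x; rewrite /g normrM gtr0_norm ?invr_gt0// mulrC ler_pdivrMr//.
  apply: (le_trans (hD _ _ _ _ tv tw x)); rewrite ler_wpM2l//.
  by rewrite mulr_ge0// exprn_ge0// addr_ge0.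
have [k|phi cphi Wphi] := @ascoli R N T F FU W.
  pose Bk := D * (`|k| + 5) ^+ 2.
  have Bk0 : 0 <= Bk by rewrite mulr_ge0// exprn_ge0// addr_ge0.
  exists (1 + C * (1 + Bk)); first by rewrite addr_ge0// mulr_ge0// addr_ge0.
  apply: filterS (filterI (filterI Wg W1) gB) => t [[[cW cg WD] W1t] gBt]; split=> [x _|x y xk _ xy].
    by apply: (le_trans (W1t x)); rewrite lerDl mulr_ge0// addr_ge0.
  apply: (le_trans (hC _ _ x 1 Bk cW cg WD _ _ x y _ _)) => //.
  - move=> z zx; apply: (le_trans (gBt z)); rewrite ler_wpM2l// lerXn2r ?nnegrE ?addr_ge0//.
    have : `|z| <= `|z - x| + `|x| by rewrite -{1}(subrK x z) ler_normD.
    by have := ler_norm k; clra.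
  - by rewrite subrr normr0.
  - by rewrite distrC.
  - by rewrite ler_wpM2r// lerDr.
pose h x := (dot x x - N%:R - 2) * phi x.
have ch : continuous h.
  apply: continuous_mul => //; apply: continuous_sub; last exact: cst_continuous.
  by apply: continuous_sub; [exact: continuous_dot|exact: cst_continuous].
have gh : ccvg F g h.
  move=> z x zx; have vz := vU z x zx; have wz := wU z x zx; have qz := QV z x zx; have Wz := Wphi z x zx.
  have G0 := gauss_gt0 2^-1 B0 x.
  have v2 : v t (z t) ^+ 2 @[t --> F] --> gauss 2^-1 B0 x ^+ 2 by rewrite expr2; apply: cvgM.
  have lz : ln (v t (z t) ^+ 2) @[t --> F] --> ln (gauss 2^-1 B0 x ^+ 2).
    by apply: (cvg_comp _ _ v2); apply: continuous_ln; exact: exprn_gt0.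
  pose m t := Q t (z t) - ln (v t (z t) ^+ 2) - 2.
  have mz : m t @[t --> F] --> dot x x - N%:R - 2.
    (* The height of the Gaussian cancels [V0], so the limiting linearised potential is that of the
       harmonic oscillator. *)
    have -> : dot x x - N%:R - 2 = V0 - ln (gauss 2^-1 B0 x ^+ 2) - 2.
      by rewrite ln_sqr// /gauss expRK B0E; field.
    by apply: cvgB; [exact: cvgB|exact: cvg_cst].
  pose r t := 2 * (`|v t (z t) - w t (z t)| / v t (z t)).
  have rz : r t @[t --> F] --> 0.
    rewrite -(mulr0 2); apply: cvgM; first exact: cvg_cst.
    rewrite -(mul0r (gauss 2^-1 B0 x)^-1); apply: cvgM; last by apply: cvgV => //; rewrite gt_eqF.
    by rewrite -(normr0 R) -(subrr (gauss 2^-1 B0 x)); apply: cvg_norm; apply: cvgB.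
  have ez : g t (z t) - m t * W t (z t) @[t --> F] --> 0.
    apply/cvgr0Pnorm_le => e e0.
    have /cvgr0Pnorm_le/(_ e e0) := rz; move=> re.
    apply: filterS (filterI tn re) => t [[[_ [_ v0 _] _ _ _ _ _] [_ [_ w0 _] _ _ _ _ _] S0 vw] ret].
    have v0z := v0 (z t); have w0z := w0 (z t); have [e1 /andP[e10 e1u] E] := entropy_diff (Q t (z t)) v0z w0z.
    apply: le_trans ret.
    have -> : g t (z t) - m t * W t (z t) = (S t)^-1 * (2 * e1).
      by rewrite /g /rhs E /m /W; ring.
    rewrite normrM gtr0_norm ?invr_gt0// ger0_norm ?mulr_ge0// mulrC ler_pdivrMr//.
    rewrite /r ger0_norm; last by rewrite !mulr_ge0// invr_ge0 ltW.
    rewrite -[leRHS]mulrA ler_pM2l//; apply: (le_trans e1u).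
    rewrite -real_normK ?num_real// expr2 mulrAC; apply: ler_wpM2l => //.
    by rewrite mulr_ge0// invr_ge0 ltW.
  have : g t (z t) - m t * W t (z t) + m t * W t (z t) @[t --> F] --> 0 + h x.
    by apply: cvgD => //; apply: cvgM.
  by rewrite add0r; under eq_fun do rewrite subrK.
have phi1 x : `|phi x| <= 1.
  have l : `|W t x| @[t --> F] --> `|phi x| by apply: cvg_norm; apply: Wphi; exact: cvg_cst.
  by apply: (cvg_limit_le l); apply: filterS W1 => t; exact.
have [b hb] := linear_profile cphi phi1 (DLap_limit PF Wg cphi ch (ccvg_loc_unif FU cphi Wphi) (ccvg_loc_unif FU ch gh)).
by exists b => z x zx; rewrite -hb; exact: Wphi.
Qed.

(** Both solutions are rescaled about [xi], so the gradient of the potential is $t^2xH$ up to a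
    small multiple of $t^2|x|$. Dividing the Pohozaev identity of the difference by $t^2$ leaves
    errors proportional to [eta * S]. *)
Lemma difference_estimate (L M A B K : R) (H : 'M[R]_N) : (0 < N)%N -> 0 <= L -> 1 <= M -> 0 <= A -> 0 <= K ->
  exists2 C : R, 0 <= C & forall (t rho eta T S : R) V (xi : 'rV[R]_N) v w,
  0 < t -> 0 < rho -> 0 < eta -> 0 <= S -> class_C 1 V ->
  tame L M A B K T (fun x => V (xi + t *: x)) v -> tame L M A B K T (fun x => V (xi + t *: x)) w ->
  rho / t <= T - 4 -> (forall h j, `|h| <= rho -> `|partial j V (xi + h) - (h *m H) ord0 j| <= eta * `|h|) ->
  (forall x, `|v x - w x| <= S) -> t ^+ 2 / rho ^+ 4 <= eta ->
  forall j, `|bump_mean (t / rho) (fun x => (x *m H) ord0 j * (v x ^+ 2 - w x ^+ 2))| <= C * eta * S.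
Proof.
move=> N0 L0 M1 A0 K0.
have [C1 C10 h1] := @bump4_mass R N N0.
have [C2 C20 h2] := @pohozaev_tame_diff R N L M A B K N0 L0 M1 A0 K0.
have [D D0 hD] := @tame_pointwise R N L M A B K (2 * N + 1) L0 M1 A0 K0.
exists (C2 + C1 * (2 * D)) => [|t rho eta T S V xi v w t0 rho0 eta0 S0 V1 tv tw rT hV vw tr j].
  by rewrite addr_ge0// !mulr_ge0.
have [Q1 [cv v0 vD] _ _ _ _ _] := tv; have [_ [cw w0 wD] _ _ _ _ _] := tw.
pose s := t / rho; have s_gt0 : 0 < s by rewrite divr_gt0.
have sV : s^-1 = rho / t by rewrite /s invf_div.
have t0' : t != 0 by rewrite gt_eqF.
pose h x : R := (x *m H) ord0 j.
have ch : continuous h by exact: continuous_mulmx_coord.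
pose P x := v x ^+ 2 - w x ^+ 2.
have cP : continuous P by apply: continuous_sub; exact: continuous_sqr.
pose Qj x := partial j (fun z => V (xi + t *: z)) x.
have cQ : continuous Qj by exact: (class_C_continuous (class_C_partial j Q1)).
have dQ x : Qj x = t * partial j V (xi + t *: x) := partialE (is_derive_potential_scaled xi j x V1 t0').
pose err x := partial j V (xi + t *: x) - h (t *: x).
have hZ x : h (t *: x) = t * h x by rewrite /h -scalemxAl mxE.
have errE x : err x = t^-1 * Qj x - t * h x.
  by rewrite /err dQ hZ mulrA mulVf// mul1r.
have cerr : continuous err.
  have -> : err = (fun x => t^-1 * Qj x - t * h x) by apply/funext.
  by apply: continuous_sub; apply: continuous_mul => //; exact: cst_continuous.
have E : bump_mean s (fun x => h x * P x) = t ^- 2 * bump_mean s (fun x => Qj x * P x) +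
    bump_mean s (fun x => - t^-1 * (err x * P x)).
  rewrite -bump_meanZ//; last exact: continuous_mul.
  rewrite -bump_meanD//.
  - by apply: eq_bump_mean => x; rewrite errE; field.
  - by apply: continuous_mul; [exact: cst_continuous|exact: continuous_mul].
  - by apply: continuous_mul; [exact: cst_continuous|exact: continuous_mul].
have b1 : `|t ^- 2 * bump_mean s (fun x => Qj x * P x)| <= C2 * eta * S.
  rewrite normrM [`|t ^- 2|]gtr0_norm ?invr_gt0 ?exprn_gt0//.
  have := h2 s T S _ v w j s_gt0 _ tv tw vw; rewrite sV => /(_ rT) k1.
  apply: (le_trans (ler_wpM2l _ k1)); first by rewrite invr_ge0 exprn_ge0// ltW.
  have -> : t ^- 2 * (C2 * s ^+ 4 * S) = C2 * (t ^+ 2 / rho ^+ 4) * S.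
    by rewrite /s; field; rewrite t0' gt_eqF.
  by rewrite ler_wpM2r// ler_wpM2l.
have b2 : `|bump_mean s (fun x => - t^-1 * (err x * P x))| <= C1 * (eta * (S * (2 * D))).
  apply: h1 => //.
  - by apply: continuous_mul; [exact: cst_continuous|exact: continuous_mul].
  - by rewrite !mulr_ge0// ltW.
  rewrite sV => x xr; have x0 := normr_ge0 x.
  have p0 : 0 <= (1 + `|x|) ^+ (2 * N) by rewrite exprn_ge0// addr_ge0.
  have tx : `|t *: x| <= rho by rewrite normrZ gtr0_norm// mulrC -ler_pdivlMr.
  have e1 : `|t^-1 * err x| <= eta * (1 + `|x|).
    rewrite normrM gtr0_norm ?invr_gt0// mulrC ler_pdivrMr//; apply: (le_trans (hV _ j tx)).
    rewrite -mulrA ler_wpM2l ?(ltW eta0)// normrZ gtr0_norm// mulrC ler_wpM2r ?(ltW t0)//; clra.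
  have xT := le_trans xr rT.
  have q0 : 0 <= (1 + `|x|) ^+ (2 * N + 1) by rewrite exprn_ge0// addr_ge0.
  have v1 : v x * (1 + `|x|) ^+ (2 * N + 1) <= D.
    by apply: le_trans (hD T _ v tv x j xT); rewrite ler_wpM2r// lerDl.
  have w1 : w x * (1 + `|x|) ^+ (2 * N + 1) <= D.
    by apply: le_trans (hD T _ w tw x j xT); rewrite ler_wpM2r// lerDl.
  have e2 : `|P x| <= S * (v x + w x).
    have -> : P x = (v x - w x) * (v x + w x) by rewrite /P; ring.
    by rewrite normrM [`|v x + w x|]gtr0_norm ?addr_gt0// ler_wpM2r// addr_ge0// ltW.
  have -> : - t^-1 * (err x * P x) = - (t^-1 * err x * P x) by ring.
  rewrite normrN normrM; apply: (le_trans (ler_wpM2r p0 (ler_pM (normr_ge0 _) (normr_ge0 _) e1 e2))).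
  have -> : eta * (1 + `|x|) * (S * (v x + w x)) * (1 + `|x|) ^+ (2 * N) =
     eta * (S * (v x * (1 + `|x|) ^+ (2 * N + 1) + w x * (1 + `|x|) ^+ (2 * N + 1))).
    by rewrite exprD expr1; ring.
  rewrite ler_wpM2l ?(ltW eta0)// ler_wpM2l//.
  apply: (le_trans (lerD v1 w1)); clra.
rewrite -/s -/h E; apply: (le_trans (ler_normD _ _)); apply: (le_trans (lerD b1 b2)).
rewrite le_eqVlt; apply/orP; left; apply/eqP; ring.
Qed.

End difference.

(** Otherwise the ultrafilter contains the complement for every [i], hence their finite
    intersection, which contradicts the hypothesis. *)
Lemma ultra_exists (T : Type) (I : finType) (F : set_system T) (P : I -> T -> Prop) : UltraFilter F ->
  (\forall t \near F, exists i, P i t) -> exists i, \forall t \near F, P i t.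
Proof.
move=> FU hP; have PF : ProperFilter F by exact: ultra_proper.
apply: contrapT => nP; have h i : \forall t \near F, ~ P i t.
  have [Pi|//] := @in_ultra_setVsetC T F (P i) FU.
  by exfalso; apply: nP; exists i.
have e : F ((fun t => exists i, P i t) `&` (fun t => forall i, ~ P i t)).
  by apply: filterI => //; exact: filter_forall.
apply: (filter_not_empty F).
by apply: filterS e => t [[i Pi] /(_ i)].
Qed.

(** * Comparison of the two families *)

Section uniqueness.
Context {R : realType} {N : nat}.
Local Notation mu := (lebesgue_row R N).
Implicit Types (x y z : 'rV[R]_N) (f g u v Q V : 'rV[R]_N -> R).

(** At a maximum of $u-v$ with $u>v$, the maximum principle orders the right-hand sides as $g_u\le
    g_v$. Strict monotonicity below the level $e^{-2}$ gives the opposite order. *)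
Lemma max_difference_large V (eps : R) u v z : 0 < eps -> continuous V -> (forall x, 0 <= V x) ->
  positive_solution V eps u -> positive_solution V eps v -> v z < u z -> (forall x, u x - v x <= u z - v z) ->
  expR (-2) < u z.
Proof.
move=> e0 cV V0 su sv vu zmax; have [cu u0 _] := su; have [cv v0 _] := sv.
have cg w : positive_solution V eps w -> continuous (fun x => (V x - ln (w x ^+ 2)) * w x / eps ^+ 2).
  by move=> [cw w0 _]; apply: continuous_mul; [exact: continuous_potential|exact: cst_continuous].
have znear : \forall x \near z, u x - v x <= u z - v z.
  by apply: filterS (near_norm_le z ltr01) => x _.
have := max_principle (continuous_sub cu cv) (continuous_sub (cg _ su) (cg _ sv))
  (DLap_sub cu (cg _ su) cv (cg _ sv) (weak_solution_DLap e0 cV su) (weak_solution_DLap e0 cV sv)) znear.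
rewrite -mulrBl pmulr_lle0 ?invr_gt0 ?exprn_gt0// => h; rewrite ltNge; apply/negP => uz.
have lu : ln (u z) <= -2 by rewrite -[leRHS]expRK ler_ln ?posrE ?expR_gt0.
have := entropy_strictly_increasing (V0 z) (v0 z) vu lu; clra.
Qed.

(** The maximum of $|u-v|$ is attained because both solutions vanish at infinity;
    [max_difference_large] is applied to whichever solution is larger there. This ties the maximum
    to a peak of that solution. *)
Lemma max_difference V (eps : R) u v : 0 < eps -> continuous V -> (forall x, 0 <= V x) ->
  positive_solution V eps u -> positive_solution V eps v ->
  (forall tau : R, 0 < tau -> exists k : R, forall x, k < `|x| -> u x <= tau) ->
  (forall tau : R, 0 < tau -> exists k : R, forall x, k < `|x| -> v x <= tau) ->
  ~ (forall x, u x = v x) ->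
  exists z, [/\ 0 < `|u z - v z|, forall x, `|u x - v x| <= `|u z - v z| & expR (-2) < u z \/ expR (-2) < v z].
Proof.
move=> e0 cV V0 su sv hu hv nuv; have [cu u0 _] := su; have [cv v0 _] := sv.
have [x0 ux0] : exists x0, u x0 <> v x0 by apply: contrapT => h; apply: nuv => x; apply: contrapT => h'; apply: h; exists x.
have d0 : 0 < `|u x0 - v x0| by rewrite normr_gt0 subr_eq0; apply/eqP.
have [k1 hk1] := hu _ d0; have [k2 hk2] := hv _ d0.
pose k := Num.max `|x0| (Num.max k1 k2).
have k0 : 0 <= k by rewrite le_max normr_ge0.
have cd : continuous (fun x : 'rV[R]_N => `|u x - v x| : R).
  have cuv : continuous (fun x => u x - v x) by exact: continuous_sub.
  exact: (continuousT_comp cuv (@norm_continuous R R^o)).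
have [z zk zmax] := cube_max cd k0.
have zx0 : `|u x0 - v x0| <= `|u z - v z| by apply: zmax; rewrite le_max lexx.
have zM x : `|u x - v x| <= `|u z - v z|.
  have [xk|kx] := leP `|x| k; first exact: zmax.
  apply: le_trans zx0; move: kx; rewrite gt_max => /andP[_]; rewrite gt_max => /andP[h1 h2].
  have := hk1 x h1; have := hk2 x h2; have := u0 x; have := v0 x.
  by rewrite ler_norml; clra.
exists z; split=> //; first exact: lt_le_trans zx0.
have [vu|uv] := ltP (v z) (u z).
  left; apply: (max_difference_large e0 cV V0 su sv vu) => x.
  by rewrite -[leRHS]gtr0_norm ?subr_gt0//; apply: le_trans (zM x); exact: ler_norm.
right; have uv' : u z < v z.
  rewrite lt_neqAle uv andbT; apply/eqP => uvz; move: zx0; rewrite uvz subrr normr0.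
  by rewrite leNgt d0.
apply: (max_difference_large e0 cV V0 sv su uv') => x.
rewrite -[leRHS]gtr0_norm ?subr_gt0// [leRHS]distrC; apply: le_trans (zM x).
by rewrite distrC ler_norm.
Qed.

(* If the solutions differed, the normalised difference would converge to [dot b x * gauss 2^-1 0 x]
   with b <> 0, while the Pohozaev identity forces the mean of its product with [dot b x] to vanish. *)
Lemma no_concentrated_difference (F : set_system R) (L M A B K c r B0 : R) V (xi : 'rV[R]_N) (u v : R -> 'rV[R]_N -> R)
  (X : R -> 'rV[R]_N) : (0 < N)%N -> UltraFilter F -> (0 : R)^'+ `<=` F -> 0 <= L -> 1 <= M -> 0 <= A -> 0 <= K -> 0 < c ->
  class_C 1 V -> grad V xi = 0 -> differentiable (grad V) xi -> \det (hessian V xi) != 0 ->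
  B0 = - (V xi + N%:R) / 2 ->
  ccvg F (fun t x => u t (xi + t *: x)) (gauss 2^-1 B0) -> ccvg F (fun t x => v t (xi + t *: x)) (gauss 2^-1 B0) ->
  (\forall t \near F, tame L M A B K (c / t) (fun x => V (xi + t *: x)) (fun x => u t (xi + t *: x))) ->
  (\forall t \near F, tame L M A B K (c / t) (fun x => V (xi + t *: x)) (fun x => v t (xi + t *: x))) ->
  (\forall t \near F, [/\ 0 < `|u t (X t) - v t (X t)|, forall x, `|u t x - v t x| <= `|u t (X t) - v t (X t)| &
     `|X t - xi| <= r * t]) -> False.
Proof.
move=> N0 FU F0 L0 M1 A0 K0 c0 V1 gV dV detV B0E uU vU tu tv hX.
have PF : ProperFilter F by exact: ultra_proper.
have cV := class_C_continuous V1.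
have tpos : \forall t \near F, 0 < t by apply: F0; exact: nbhs_right_gt.
have tsmall (e : R) : 0 < e -> \forall t \near F, t <= e by move=> e0; apply: F0; exact: nbhs_right_le.
have t_to0 : t @[t --> F] --> (0 : R) by exact: cvg_right_id.
have Too (b Y : R) : 0 < b -> \forall t \near F, Y <= b / t by exact: near_right_ratio.
have QV : ccvg F (fun t x => V (xi + t *: x)) (fun=> V xi).
  move=> z x zx; have h : xi + t *: z t @[t --> F] --> xi.
    by rewrite -[X in _ --> X]addr0 -(scale0r x); apply: cvgD; [exact: cvg_cst|apply: cvgZ].
  exact: (cvg_comp (fun t => xi + t *: z t) V h (cV xi)).
pose S t := `|u t (X t) - v t (X t)|.
pose u' t x := u t (xi + t *: x); pose v' t x := v t (xi + t *: x).
pose W t x := (S t)^-1 * (u' t x - v' t x).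
have tn : \forall t \near F, [/\ tame L M A B K (c / t) (fun x => V (xi + t *: x)) (u' t),
    tame L M A B K (c / t) (fun x => V (xi + t *: x)) (v' t), 0 < S t & forall x, `|u' t x - v' t x| <= S t].
  by apply: filterS (filterI (filterI tu tv) hX) => t [[tut tvt] [S0 SM _]]; split=> // x; exact: SM.
have [b hb] := difference_limit FU L0 M1 A0 tn QV B0E uU vU.
(* At the rescaled maximum points the normalised difference has absolute value 1, and these points
   stay bounded. At their limit [dot b] cannot vanish. *)
have bne0 : exists x0, dot b x0 != 0.
  have [X0 _ hX0] : exists2 p, `|p| <= r & t^-1 *: (X t - xi) @[t --> F] --> p.
    apply: ultra_row_cvg; apply: filterS (filterI tpos hX) => t [t0 [_ _ Xr]].
    by rewrite normrZ gtr0_norm ?invr_gt0// mulrC ler_pdivrMr.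
  exists X0; apply/eqP => bX0.
  have l : `|(S t)^-1 * (u' t (t^-1 *: (X t - xi)) - v' t (t^-1 *: (X t - xi)))| @[t --> F] --> `|dot b X0 * gauss 2^-1 0 X0|.
    by apply: cvg_norm; exact: (hb _ _ hX0).
  have : - `|dot b X0 * gauss 2^-1 0 X0| <= -1 :> R.
    apply: (cvg_limit_le (cvgN l)); apply: filterS (filterI tpos hX) => t [t0 [S0 _ _]].
    have XE : xi + t *: (t^-1 *: (X t - xi)) = X t by rewrite scalerA divff ?gt_eqF// scale1r addrC subrK.
    rewrite /u' /v' XE.
    rewrite normrM gtr0_norm ?invr_gt0// -/(S t) mulVf//.
    by rewrite gt_eqF.
  by rewrite bX0 mul0r normr0; clra.
have [x0 bx0] := bne0.
pose H := hessian V xi.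
have Hu : H \in unitmx by rewrite unitmxE unitfE.
(* The vector $H^{-1}b$: it recombines the $N$ estimates on $(xH)_j$ into one on $b\cdot x$. This is
   where nondegeneracy is used. *)
pose cc : 'rV[R]_N := (invmx H *m b^T)^T.
have ccE x : \sum_j cc ord0 j * (x *m H) ord0 j = dot b x.
  have -> : \sum_j cc ord0 j * (x *m H) ord0 j = ((x *m H) *m cc^T) ord0 ord0.
    by rewrite mxE; apply: eq_bigr => j _; rewrite !mxE mulrC.
  rewrite /cc trmxK -mulmxA mulKVmx// mxE /dot; apply: eq_bigr => j _; by rewrite !mxE mulrC.
have [C1 C10 h1] := @bump4_mass R N N0.
have [C2 C20 h2] := @difference_estimate R N L M A B K H N0 L0 M1 A0 K0.
have [D D0 hD] := @tame_pointwise R N L M A B K (2 * N + 2) L0 M1 A0 K0.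
(* Since $u^2-v^2=(u-v)(u+v)$, this is $b\cdot x\,(u^2-v^2)/S$, the quantity controlled by
   [difference_estimate]. Its limit [f0] is nonnegative and positive at [x0]. *)
pose f t x := dot b x * (W t x * (u' t x + v' t x)).
pose f0 x := dot b x * (dot b x * gauss 2^-1 0 x * (gauss 2^-1 B0 x + gauss 2^-1 B0 x)).
have cb := @continuous_dotr R N b.
have cG (B' : R) : continuous (gauss 2^-1 B' : 'rV[R]_N -> R) by exact: continuous_gauss.
have cf0 : continuous f0.
  by apply: continuous_mul => //; apply: continuous_mul; [exact: continuous_mul|exact: continuous_add].
have f00 x : 0 <= f0 x.
  rewrite /f0 !mulrA -expr2 mulr_ge0//; last by rewrite addr_ge0// ltW// gauss_gt0.
  by rewrite mulr_ge0 ?sqr_ge0// ltW// gauss_gt0.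
have f0x0 : 0 < f0 x0.
  rewrite /f0 !mulrA -expr2 mulr_gt0 ?addr_gt0 ?gauss_gt0// mulr_gt0 ?gauss_gt0//.
  by rewrite exprn_even_gt0.
have ff0 : ccvg F f f0.
  move=> z x zx; have bz : dot b (z t) @[t --> F] --> dot b x by exact: (cvg_comp _ _ zx (cb x)).
  by apply: cvgM => //; apply: cvgM; [exact: hb|apply: cvgD; [exact: uU|exact: vU]].
have fB t x : [/\ tame L M A B K (c / t) (fun x => V (xi + t *: x)) (u' t),
    tame L M A B K (c / t) (fun x => V (xi + t *: x)) (v' t), 0 < S t & forall x, `|u' t x - v' t x| <= S t] ->
    `|x| <= c / t - 4 -> `|f t x| * (1 + `|x|) ^+ (2 * N).+1 <= N%:R * `|b| * (2 * D).
  move=> [tut tvt S0 SM] xT.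
  have [_ [_ u0 _] _ _ _ _ _] := tut; have [_ [_ v0 _] _ _ _ _ _] := tvt.
  have q0 : 0 <= (1 + `|x|) ^+ (2 * N + 2) by rewrite exprn_ge0// addr_ge0.
  have u1 : u' t x * (1 + `|x|) ^+ (2 * N + 2) <= D.
    by apply: le_trans (hD _ _ _ tut x (Ordinal N0) xT); rewrite ler_wpM2r// lerDl.
  have v1 : v' t x * (1 + `|x|) ^+ (2 * N + 2) <= D.
    by apply: le_trans (hD _ _ _ tvt x (Ordinal N0) xT); rewrite ler_wpM2r// lerDl.
  have uv0 : 0 <= u' t x + v' t x by rewrite addr_ge0// ltW// ?u0 ?v0.
  have W1 : `|W t x| <= 1 by rewrite /W normrM gtr0_norm ?invr_gt0// mulrC ler_pdivrMr// mul1r.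
  have b1 : `|dot b x| <= N%:R * `|b| * (1 + `|x|).
    apply: (le_trans (norm_dot_le b x)); rewrite mulrA ler_wpM2l ?mulr_ge0//; clra.
  have b2 : `|W t x * (u' t x + v' t x)| <= u' t x + v' t x.
    by rewrite normrM [`|_ + _|]ger0_norm// ler_piMl.
  have p0 : 0 <= (1 + `|x|) ^+ (2 * N).+1 by rewrite exprn_ge0// addr_ge0.
  (* Of the $2N+2$ powers in the decay of [u'] and [v'], one pays for the linear factor and one is
     reserved for [weighted_unif]. *)
  rewrite /f normrM; apply: (le_trans (ler_wpM2r p0 (ler_pM (normr_ge0 _) (normr_ge0 _) b1 b2))).
  have -> : N%:R * `|b| * (1 + `|x|) * (u' t x + v' t x) * (1 + `|x|) ^+ (2 * N).+1 =
    N%:R * `|b| * (u' t x * (1 + `|x|) ^+ (2 * N + 2) + v' t x * (1 + `|x|) ^+ (2 * N + 2)).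
    by rewrite addn2 !exprS; ring.
  rewrite ler_wpM2l ?mulr_ge0//; apply: (le_trans (lerD u1 v1)); clra.
have big Y : \forall t \near F, Y <= c / t - 4.
  by apply: filterS (Too c (Y + 4) c0) => t; clra.
have BB0 : 0 <= N%:R * `|b| * (2 * D) by rewrite !mulr_ge0.
have f0B x : `|f0 x| * (1 + `|x|) ^+ (2 * N).+1 <= N%:R * `|b| * (2 * D).
  have l : `|f t x| * (1 + `|x|) ^+ (2 * N).+1 @[t --> F] --> `|f0 x| * (1 + `|x|) ^+ (2 * N).+1.
    by apply: cvgM; [apply: cvg_norm; apply: ff0; exact: cvg_cst|exact: cvg_cst].
  by apply: (cvg_limit_le l); apply: filterS (filterI tn (big `|x|)) => t [k1 k2]; exact: fB.
have wu (e : R) : 0 < e -> \forall t \near F, forall x, `|x| <= c / t - 4 -> `|f t x - f0 x| * (1 + `|x|) ^+ (2 * N) <= e.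
  move=> e0; apply: (@weighted_unif R N R F FU _ _ (fun t => c / t - 4) (2 * N) _ (ccvg_loc_unif FU cf0 ff0) BB0 _ f0B e e0).
  by apply: filterS tn => t h x; exact: fB.
have [a a0 ha] : exists2 a : R, 0 < a & forall x, `|x - x0| <= a -> f0 x0 / 2 <= f0 x.
  have e0 : 0 < f0 x0 / 2 by rewrite divr_gt0.
  have /(@cvgrPdist_le R R 'rV[R]_N (nbhs x0))/(_ _ e0)/nbhs_closedballP[a ha] := cf0 x0.
  exists a%:num => // x xa; have := ha x; rewrite /= closed_ballE//= /closed_ball_ /= distrC => /(_ xa).
  rewrite ler_norml; clra.
have [s0 s00 hs] := @bump4_at0 R N (`|x0| + a).
pose m0 := expR (-2) * (f0 x0 / 2) * (a *+ 2) ^+ N.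
have m00 : 0 < m0 by rewrite mulr_gt0 ?exprn_gt0 ?pmulrn_rgt0// mulr_gt0 ?expR_gt0// divr_gt0.
pose C3 := (\sum_j `|cc ord0 j|) * C2 + C1.
have C30 : 0 <= C3 by rewrite addr_ge0// mulr_ge0// sumr_ge0.
(* [C3 * eta] will bound the mean of [f0], while [m0] bounds it from below; this choice makes the
   upper bound at most half of the lower one. *)
pose eta := m0 / (2 * (C3 + 1)).
have eta0 : 0 < eta by rewrite divr_gt0//; clra.
have [rho rho0 hrho] := hessian_expansion gV dV eta0.
pose rh := Num.min rho (c / 2).
have rh0 : 0 < rh by rewrite lt_min rho0 divr_gt0.
have c2 : 0 < c / 2 by rewrite divr_gt0.
have near1 : \forall t \near F, t <= s0 * rh by apply: tsmall; exact: mulr_gt0.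
have near2 : \forall t \near F, t <= Num.min 1 (eta * rh ^+ 4).
  by apply: tsmall; rewrite lt_min ltr01 mulr_gt0// exprn_gt0.
apply: (filter_not_empty F).
apply: filterS (filterI (filterI tn (wu eta eta0)) (filterI (filterI near1 near2) (filterI tpos (Too (c / 2) 4 c2)))).
move=> t [[tnt wt] [[t1 t2] [t0 tT]]]; have [tut tvt S0 SM] := tnt.
move: t2; rewrite le_min => /andP[t21 t22].
have rT : rh / t <= c / t - 4.
  have k1 : rh / t <= c / 2 / t by rewrite ler_wpM2r ?invr_ge0 ?(ltW t0)// ge_min lexx orbT.
  have -> : c / t = c / 2 / t + c / 2 / t by field; rewrite gt_eqF.
  clra.
have [Q1 [cu u0 _] _ _ _ _ _] := tut; have [_ [cv v0 _] _ _ _ _ _] := tvt.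
pose s := t / rh; have s_gt0 : 0 < s by rewrite divr_gt0.
have sV : s^-1 = rh / t by rewrite /s invf_div.
have tr : t ^+ 2 / rh ^+ 4 <= eta.
  rewrite ler_pdivrMr ?exprn_gt0//; apply: le_trans t22.
  by rewrite expr2 ler_piMr// ltW.
have hV k j : `|k| <= rh -> `|partial j V (xi + k) - (k *m H) ord0 j| <= eta * `|k|.
  by move=> kr; apply: hrho; apply: (le_trans kr); rewrite ge_min lexx.
have e2 := h2 t rh eta (c / t) (S t) V xi _ _ t0 rh0 eta0 (ltW S0) V1 tut tvt rT hV SM tr.
have cP : continuous (fun x => u' t x ^+ 2 - v' t x ^+ 2) by apply: continuous_sub; exact: continuous_sqr.
have cj j : continuous (fun x => (x *m H) ord0 j * (u' t x ^+ 2 - v' t x ^+ 2)).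
  by apply: continuous_mul => //; exact: continuous_mulmx_coord.
have cf : continuous (f t).
  apply: continuous_mul => //; apply: continuous_mul; last exact: continuous_add.
  by apply: continuous_mul; [exact: cst_continuous|exact: continuous_sub].
have fE : bump_mean s (f t) = \sum_j (S t)^-1 * cc ord0 j * bump_mean s (fun x => (x *m H) ord0 j * (u' t x ^+ 2 - v' t x ^+ 2)).
  under eq_bigr => j _ do rewrite -bump_meanZ//.
  rewrite -bump_mean_sum//; last by move=> j; apply: continuous_mul => //; exact: cst_continuous.
  apply: eq_bump_mean => x; rewrite /f -ccE mulr_suml; apply: eq_bigr => j _; rewrite /W; ring.
have b1 : `|bump_mean s (f t)| <= (\sum_j `|cc ord0 j|) * C2 * eta.
  rewrite fE; apply: (le_trans (ler_norm_sum _ _ _)); rewrite -mulrA mulr_suml; apply: ler_sum => j _.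
  rewrite !normrM [`|(S t)^-1|]gtr0_norm ?invr_gt0// -mulrA mulrC ler_pdivrMr// -mulrA ler_wpM2l//.
have b2 : `|bump_mean s (fun x => f t x - f0 x)| <= C1 * eta.
  apply: h1 => //; [exact: continuous_sub|exact: ltW|].
  by rewrite sV => x xr; apply: wt; exact: le_trans rT.
have b3 : m0 <= bump_mean s f0.
  apply: (@bump4_lower R N _ s a (f0 x0 / 2) x0) => //; first by rewrite divr_ge0// ltW.
  move=> x xa; split; first exact: ha.
  apply: hs => //; first by rewrite /s ler_pdivrMr.
  by rewrite -(subrK x0 x); apply: (le_trans (ler_normD _ _)); rewrite addrC lerD2l.
have E : bump_mean s f0 = bump_mean s (f t) + (- 1) * bump_mean s (fun x => f t x - f0 x).
  rewrite -bump_meanZ//; last exact: continuous_sub.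
  rewrite -bump_meanD//; last by apply: continuous_mul; [exact: cst_continuous|exact: continuous_sub].
  by apply: eq_bump_mean => x; ring.
have k1 := ler_norm (bump_mean s (f t)).
have k2 : - bump_mean s (fun x => f t x - f0 x) <= `|bump_mean s (fun x => f t x - f0 x)| by rewrite -normrN ler_norm.
have k3 : m0 <= C3 * eta.
  by apply: (le_trans b3); rewrite E /C3 mulrDl; clra.
have : C3 * eta <= m0 / 2.
  rewrite /eta mulrA ler_pdivrMr; last by clra.
  have := ltW m00; cnra.
clra.
Qed.

End uniqueness.

Unset Implicit Arguments.

Theorem theorem1p2 (R : realType) (N k : nat) (hN : (3 <= N)%N)
  (hk : (1 <= k)%N) (V : 'rV[R]_N -> R) (xi : 'I_k -> 'rV[R]_N)
  (VC1 : class_C 1 V) (V1 : cond_V1 V) (V2 : cond_V2 V xi)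
  (u1 u2 : R -> 'rV[R]_N -> R)
  (hu1 : peak_solution V xi u1) (hu2 : peak_solution V xi u2) :
  \forall eps \near 0^'+, forall x, u1 eps x = u2 eps x.
Proof.
have N0 : (0 < N)%N by exact: leq_trans hN.
have [xi_inj Vxi] := V2.
have cV := class_C_continuous VC1; have [L0 L00 VL] := cond_V1_bounds V1.
have V0 x : 0 <= V x by have /andP[] := VL x.
have [y1 [La [Ma [Aa [Ka [ca [ra [[La0 Ma1 Aa0 Ka0 ca0] y1xi n1]]]]]]]] := peak_tame N0 VC1 V1 xi_inj hu1.
have [y2 [Lb [Mb [Ab [Kb [cb [rb [[Lb0 Mb1 Ab0 Kb0 cb0] y2xi n2]]]]]]]] := peak_tame N0 VC1 V1 xi_inj hu2.
apply: contrapT => nP.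
(* The filter of small parameters for which the two solutions differ; it is proper precisely because
   the conclusion is assumed to fail. *)
pose G := within (fun eps => ~ (forall x, u1 eps x = u2 eps x)) (0 : R)^'+.
have GP : ProperFilter G.
  apply: Build_ProperFilter_ex => P; rewrite /G /within /= => GP; apply: contrapT => nx; apply: nP.
  move: GP; apply: filterS => eps h; apply: contrapT => /h Pe; apply: nx; by exists eps.
have [F [FU GF]] := ultraFilterLemma GP.
have PF : ProperFilter F by exact: ultra_proper.
have F0 : (0 : R)^'+ `<=` F by move=> P hP; apply: GF; rewrite /G /within /=; apply: filterS hP.
have bad : \forall t \near F, ~ (forall x, u1 t x = u2 t x).
  by apply: GF; rewrite /G /within /=; apply: filterS (@filterT _ (0 : R)^'+ _).
have tpos : \forall t \near F, 0 < t by apply: F0; exact: nbhs_right_gt.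
have m1 := F0 _ n1; have m2 := F0 _ n2.
(* Only one of the two solutions is known to exceed $e^{-2}$ at the maximum point, so the nearby
   peak may belong to either family; the Boolean records which. *)
pose y (l : bool) := if l then y1 else y2; pose r := Num.max ra rb.
pose P (lj : bool * 'I_k) t := exists z, [/\ 0 < `|u1 t z - u2 t z|,
    forall x, `|u1 t x - u2 t x| <= `|u1 t z - u2 t z| & `|z - y lj.1 lj.2 t| <= r * t].
(* There are finitely many pairs of a family and a peak, so a single pair serves along the whole
   ultrafilter. *)
have pick : exists lj, \forall t \near F, P lj t.
  apply: (@ultra_exists R _ F P FU); apply: filterS (filterI (filterI m1 m2) (filterI tpos bad)).
  move=> t [[[s1 _ far1 van1] [s2 _ far2 van2]] [t0 nt]].
  have [z [z0 zM zb]] := max_difference t0 cV V0 s1 s2 van1 van2 nt.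
  have close (yy : 'I_k -> R -> 'rV[R]_N) (rr : R) (u : 'rV[R]_N -> R) : (forall x, (forall j, rr * t <= `|x - yy j t|) -> u x <= expR (-2)) ->
      rr <= r -> expR (-2) < u z -> exists j, `|z - yy j t| <= r * t.
    move=> far rrr uz; apply: contrapT => nj; move: uz; rewrite ltNge => /negP; apply; apply: far => j.
    rewrite leNgt; apply/negP => h; apply: nj; exists j; apply: ltW; apply: (lt_le_trans h).
    by rewrite ler_wpM2r// ltW.
  have [zb1|zb2] := zb.
    have [|j hj] := close y1 ra _ far1 _ zb1; first by rewrite le_max lexx.
    by exists (true, j), z.
  have [|j hj] := close y2 rb _ far2 _ zb2; first by rewrite le_max lexx orbT.
  by exists (false, j), z.
have [[l j] hlj] := pick.
pose X t := xget 0 [set z | [/\ 0 < `|u1 t z - u2 t z|,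
    forall x, `|u1 t x - u2 t x| <= `|u1 t z - u2 t z| & `|z - y l j t| <= r * t]].
have hX : \forall t \near F, [/\ 0 < `|u1 t (X t) - u2 t (X t)|,
    forall x, `|u1 t x - u2 t x| <= `|u1 t (X t) - u2 t (X t)| & `|X t - y l j t| <= r * t].
  by apply: filterS hlj => t ht; exact: (xgetPex 0 ht).
have [gV dV detV] := Vxi j.
have y1F : y1 j t @[t --> F] --> xi j by move=> O /y1xi; exact: F0.
have y2F : y2 j t @[t --> F] --> xi j by move=> O /y2xi; exact: F0.
have t1 : \forall t \near F, tame La Ma Aa 1 Ka (ca / t) (fun x => V (y1 j t + t *: x)) (fun x => u1 t (y1 j t + t *: x)).
  by apply: filterS m1 => t [_ h _ _]; exact: h.
have t2 : \forall t \near F, tame Lb Mb Ab 1 Kb (cb / t) (fun x => V (y2 j t + t *: x)) (fun x => u2 t (y2 j t + t *: x)).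
  by apply: filterS m2 => t [_ h _ _]; exact: h.
(* Both families are recentred at [xi j], even though the maximum point is known to be close to a
   peak of one of them only. *)
have [A1 [B1 [K1 [c1 [D1 [[A10 K10 c10] tm1 lim1 near1]]]]]] :=
  peak_center N0 FU F0 La0 Ma1 Aa0 Ka0 ca0 VC1 gV dV detV y1F t1.
have [A2 [B2 [K2 [c2 [D2 [[A20 K20 c20] tm2 lim2 near2]]]]]] :=
  peak_center N0 FU F0 Lb0 Mb1 Ab0 Kb0 cb0 VC1 gV dV detV y2F t2.
pose c := Num.min c1 c2; have c0 : 0 < c by rewrite lt_min c10.
(* The two families come with different constants; [tame_weaken] brings them to common ones. The
   radius adds the distance from the maximum point to the peak and from the peak to [xi j]. *)
apply: (@no_concentrated_difference R N F (Num.max La Lb) (Num.max Ma Mb) (Num.max A1 A2) (Num.max B1 B2) (Num.max K1 K2)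
  c (r + Num.max D1 D2) _ V (xi j) u1 u2 X N0 FU F0 _ _ _ _ c0 VC1 gV dV detV erefl lim1 lim2).
- by rewrite le_max La0.
- by rewrite le_max Ma1.
- by rewrite le_max (ltW A10).
- by rewrite le_max K10.
- apply: filterS (filterI tm1 tpos) => t [h t0]; move: h; apply: tame_weaken; rewrite ?le_max ?lexx//.
  by rewrite ler_wpM2r ?invr_ge0 ?(ltW t0)// ge_min lexx.
- apply: filterS (filterI tm2 tpos) => t [h t0]; move: h; apply: tame_weaken; rewrite ?le_max ?lexx ?orbT//.
  by rewrite ler_wpM2r ?invr_ge0 ?(ltW t0)// ge_min lexx orbT.
- apply: filterS (filterI (filterI hX tpos) (filterI near1 near2)) => t [[[X0 XM Xr] t0] [k1 k2]]; split=> //.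
  have yl : `|y l j t - xi j| <= Num.max D1 D2 * t.
    rewrite /y; case: (l).
      by apply: (le_trans k1); rewrite ler_wpM2r ?(ltW t0)// le_max lexx.
    by apply: (le_trans k2); rewrite ler_wpM2r ?(ltW t0)// le_max lexx orbT.
  rewrite -(subrK (y l j t) (X t)) -addrA mulrDl; apply: (le_trans (ler_normD _ _)).
  exact: lerD.
Qed.
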